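(* Fix $\beta>0$, $\gamma\in(0,1)$ and any $\epsilon>0$. Then: $$\lim_{\delta\downarrow0}\ \limsup_{N\to\infty}\ \mathbf P\big(|\mathsf{DT}^*(\delta)|>\epsilon\kappa_N\big)=0;$$ $$\lim_{N\to\infty}\ \mathbf P\big(|\mathsf T(\delta)\setminus\mathsf{IT}(\delta)|>\epsilon\kappa_N\big)=0\quad\text{for all }\delta\in(0,1);$$ $$\lim_{r\to\infty}\ \limsup_{N\to\infty}\ \mathbf P\big(|\mathsf{WT}^*(\delta,r)|>\epsilon\kappa_N\big)=0\quad\text{for all }\delta\in(0,1).$$
   Context: Constants: $g=2/\pi$, $\alpha=\sqrt{2\pi}$. For $N\ge3$, $\mathsf V_N=(-N,N)^2\cap\mathbb Z^2$, and $h=(h_x)_{x\in\mathsf V_N}$ is the DGFF: the centered Gaussian field with $\mathrm{Cov}(h_x,h_y)=\mathbf E_x\sum_{n=0}^{\tau-1}\mathbf 1_{\{S_n=y\}}$, $(S_n)$ discrete-time simple random walk on $\mathbb Z^2$ started at $x$ and $\tau$ its exit time from $\mathsf V_N$; put $h_x=0$ for $x\in\mathbb Z^2\setminus\mathsf V_N$. Set $\tau_x=e^{\beta h_x}$, $\widehat t_N=N^{2\sqrt g\beta}(\log N)^{-\frac{3+2\gamma}{2\alpha}\beta}$, $\widehat\tau_x=\tau_x/\widehat t_N$, $\kappa_N=(\log N)^\gamma$, $r_N=\exp\{(\log\log N)^{100(2+\gamma)}\}$, $\mathsf B_r=\{y\in\mathbb Z^2:\|y\|_\infty\le r\}$. For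 $I\subset[0,\infty)$: $\mathsf T(I)=\{x\in\mathsf V_N:\widehat\tau_x\in I\}$, and for $\delta>0$: $\mathsf T(\delta)=\mathsf T([\delta,\infty))$. Define $\mathsf{IT}(\delta)=\{x\in\mathsf T(\delta): x+y\notin\mathsf T(\delta)\ \forall y\in\mathsf B_{N/r_N}\setminus\mathsf B_{r_N}\}$; $\mathsf{IT}^*(\delta)=\{x\in\mathsf{IT}(\delta):\widehat\tau_x=\max_{y\in\mathsf B_{r_N}}\widehat\tau_{x+y}\}$; $\mathsf{NT}^*(\delta)=\{x\in\mathsf{IT}^*(\delta):\widehat\tau_x\in[\delta,\delta^{-1}]\}$; $\mathsf{DT}^*(\delta)=\mathsf{IT}^*(\delta)\setminus\mathsf{NT}^*(\delta)$ (those with $\widehat\tau_x>\delta^{-1}$); $\mathsf{WT}^*(\delta,r)=\{x\in\mathsf{NT}^*(\delta):\max_{y\in\mathsf B_{r_N}\setminus\mathsf B_r}\widehat\tau_{x+y}\ge\delta\}$. $|\cdot|$ denotes cardinality. *)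

(* Defs.v *)
From mathcomp Require Export all_boot all_order all_algebra.
From mathcomp Require Export finmap.
From mathcomp Require Export all_classical all_reals all_analysis.
Export Order.TTheory GRing.Theory Num.Theory.
Export numFieldNormedType.Exports.

Set Implicit Arguments.
Unset Strict Implicit.
Unset Printing Implicit Defensive.

Local Open Scope classical_set_scope.
Local Open Scope ring_scope.

Notation Z2 := (int * int)%type.

Section Lattice.
Variable R : realType.

Definition VN (N : nat) : set Z2 :=
  [set x | (- N%:Z < x.1 < N%:Z) && (- N%:Z < x.2 < N%:Z)].

Definition BB (r : R) : set Z2 :=
  [set y | (Num.max `|y.1| `|y.2|)%:~R <= r].

(* [fset_set A] is empty when [A] is infinite; below, cardinalities are only
   taken of subsets of [VN N]. *)
Definition card_of (A : set Z2) : nat := #|` fset_set A|.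

(* Maximum of the nonnegative function [f] over a finite set; by convention it
   is 0 over the empty set. *)
Definition max_over (A : set Z2) (f : Z2 -> R) : R :=
  \big[Num.max/0]_(y <- fset_set A) f y.

End Lattice.

Section RandomWalk.
Context (R : realType) (d : measure_display) (Omega : measurableType d).

Definition srw_trans (z z' : Z2) : R :=
  if `|z'.1 - z.1| + `|z'.2 - z.2| == 1 then 4^-1 else 0.

Definition simple_random_walk (P : probability Omega R) (x : Z2)
    (S : nat -> Omega -> Z2) : Prop :=
  (forall n z, measurable [set w | S n w = z]) /\
  (forall (n : nat) (p : nat -> Z2),
     P [set w | forall k, (k <= n)%N -> S k w = p k] =
     ((p 0%N == x)%:R * \prod_(k < n) srw_trans (p k) (p k.+1))%:E).

(* Equal to [+oo] if the walk never leaves [V]. *)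
Definition exit_time (V : set Z2) (S : nat -> Omega -> Z2) (w : Omega) : \bar R :=
  ereal_inf [set n%:R%:E | n in [set n : nat | ~ V (S n w)]].

Definition green (P : probability Omega R) (S : nat -> Omega -> Z2)
    (V : set Z2) (y : Z2) : \bar R :=
  (\int[P]_w \sum_(0 <= n <oo | n%:R%:E < exit_time V S w)
     (\1_[set y] (S n w))%:E)%E.

End RandomWalk.

Section Gaussian.
Context (R : realType) (d : measure_display) (Omega : measurableType d).
Variable P : probability Omega R.

(* The library's [normal_prob m 0] is not the Dirac mass at [m]. *)
Definition gaussian_law (m s : R) (A : set R) : \bar R :=
  if s == 0 then \d_m A else normal_prob m s A.

Definition gaussian_field (V : set Z2) (h : Z2 -> {RV P >-> R}) : Prop :=
  forall a : Z2 -> R, exists m s : R, forall A : set R, measurable A ->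
    P [set w | A (\sum_(x <- fset_set V) a x * h x w)] = gaussian_law m s A.

(* [PS x] is the law, on an auxiliary probability space, under which [S] is the
   walk started at [x]. *)
Definition dgff (dS : measure_display) (OmegaS : measurableType dS)
    (PS : Z2 -> probability OmegaS R) (S : nat -> OmegaS -> Z2)
    (N : nat) (h : Z2 -> {RV P >-> R}) : Prop :=
  [/\ gaussian_field (VN N) h,
      forall x, VN N x -> ('E_P[h x] = 0)%E,
      forall x y, VN N x -> VN N y ->
        covariance P (h x) (h y) = green (PS x) S (VN N) y
    & forall x, ~ VN N x -> forall w, h x w = 0].

End Gaussian.

Section Traps.
Context (R : realType) (beta gamma : R) (N : nat).

Definition gconst : R := 2 / pi.
Definition alpha : R := Num.sqrt (2 * pi).

Definition logN : R := ln N%:R.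

Definition that : R :=
  N%:R `^ (2 * Num.sqrt gconst * beta) *
  logN `^ (- ((3 + 2 * gamma) / (2 * alpha) * beta)).

Definition kappa : R := logN `^ gamma.

Definition rN : R := expR (ln logN `^ (100 * (2 + gamma))).

(* A realization of the field. *)
Variable phi : Z2 -> R.

Definition tauhat (x : Z2) : R := expR (beta * phi x) / that.

Definition TI (I : set R) : set Z2 := [set x | VN N x /\ I (tauhat x)].

Definition T (delta : R) : set Z2 := TI `[delta, +oo[.

Definition IT (delta : R) : set Z2 :=
  [set x | T delta x /\
    forall y, (BB (N%:R / rN) `\` BB rN) y -> ~ T delta (x + y)].

Definition ITs (delta : R) : set Z2 :=
  [set x | IT delta x /\
    tauhat x = max_over (BB rN) (fun y => tauhat (x + y))].

Definition NTs (delta : R) : set Z2 :=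
  [set x | ITs delta x /\ delta <= tauhat x <= delta^-1].

Definition DTs (delta : R) : set Z2 := ITs delta `\` NTs delta.

Definition WTs (delta r : R) : set Z2 :=
  [set x | NTs delta x /\
    delta <= max_over (BB rN `\` BB r) (fun y => tauhat (x + y))].

End Traps.

(* Main.v *)
Require Import Defs.
From mathcomp Require Import measurable_realfun ring lra zify.

Set Implicit Arguments.
Unset Strict Implicit.
Unset Printing Implicit Defensive.

Local Open Scope classical_set_scope.
Local Open Scope ring_scope.

(** Only upper bounds on probabilities are needed.  The field [eta = alpha * h]
    has covariance [4 ln (N / |x - y|) + O(1)].  By Kahane's inequality, up to
    a constant factor [E (1 - exp (- sum_i w_i e^(X_i)))] is at most its value
    for a branching random walk on a dyadic tree of depth [n ~ log_2 N]; after
    a change of measure the recursion over the levels of the tree is dominated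
    by a one-dimensional walk with a barrier, which yields the factors
    [k^(-3/2)] of each block of [k] levels.

    To bound a cardinality by [epsilon * kappa], thin the points (or the blocks
    of size [2^kb]) with probability [kappa^-1]: if the count exceeds
    [epsilon * kappa], a thinned set still contains a counted point with
    probability at least [hit_const epsilon].  A counted point for statements 2
    and 3 has a partner at distance about [2^k], both being high; then the mean
    of [eta] over a segment of length [2^k] is either exceptionally high
    (functional [phi1]) or low compared to both points (functional [phi2]).
    Each case costs [k^(-3/2)] up to logarithms, and the sum over the relevant
    scales [k] is small. *)

(** Kahane's inequality is obtained for products of small two-point averaging operators. They
    commute and are monotone, so one round of each side is compared by a second-order Taylor
    expansion; the field enters only as the limit of fair coin flips along explicit vectors. The
    tree uses biased coins: weighting by [e^(-y)] turns them into symmetric steps [meps], and the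
    loss of [mth] per step, a factor 4 per level, exactly pays for the four children. What remains
    is [W_(j+1) <= average of W_j] on a line under a cap [4 e^z], settled by reflection. Field and
    tree agree only up to constants: independent noise raises the covariances (price: a factor 2),
    and Jensen removes the excess variance (price: a constant in the weights). Points get weight 2,
    above the critical 1, so that sums behave like maxima; subtracting a full segment mean from a
    pair would leave exactly 1, and the small [kap] restores decay. The threshold lies about
    [3/2 ln ln N + u] below [n v1], with [e^u = kappa]: thinning and the ballot factor [n^(-3/2)]
    compensate this, and scale [k] contributes about [(n / (k (n - k)))^(3/2)] up to logarithms. *)

Ltac nneg :=
  repeat first
    [ lazymatch goal with
      | |- is_true (0 <= _ + _) => apply: addr_ge0
      | |- is_true (0 <= _ * _) => apply: mulr_ge0
      | |- is_true (0 <= _^-1) => rewrite invr_ge0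
      | |- is_true (0 <= expR _) => exact: expR_ge0
      | |- is_true (0 <= Num.sqrt _) => exact: sqrtr_ge0
      | |- is_true (0 <= _%:R) => exact: ler0n
      | |- is_true (0 <= _ ^+ _) => first [exact: sqr_ge0 | apply: exprn_ge0]
      end
    | done | assumption | apply: ltW; assumption | apply: mulr_ge0 ].

(** * Simple random walk on the integers and its version killed at 0 *)

Section Walk1D.

Variable R : realType.

Implicit Types (n m : nat) (u r : int).

Fixpoint srw1 n u : R :=
  if n is n'.+1 then (srw1 n' (u - 1) + srw1 n' (u + 1)) / 2 else (u == 0)%:R.

Lemma srw1_ge0 n u : 0 <= srw1 n u.
Proof. by elim: n u => [|n IH] u /=; [exact: ler0n | rewrite divr_ge0// addr_ge0]. Qed.

Lemma srw1N n u : srw1 n (- u) = srw1 n u.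
Proof.
elim: n u => [|n IH] u /=; first by rewrite oppr_eq0.
by rewrite -opprD IH -[- u + 1]opprK opprD opprK IH addrC.
Qed.

(** The quotient of neighbouring binomial coefficients, freed of denominators so that it also holds
    outside the range of the walk. *)
Lemma srw1_ratio n r :
  (n%:R + r%:~R + 2) * srw1 n (r + 2) = (n%:R - r%:~R) * srw1 n r.
Proof.
elim: n r => [|n IH] r /=.
  rewrite add0r sub0r; case: (eqVneq r 0) => [->|r0].
    by rewrite !add0r oppr0 mul0r mulr0.
  rewrite mulr0; case: eqVneq => [r2|_]; last by rewrite mulr0.
  suff -> : r = - 2 by rewrite mulr1 rmorphN /=; ring.
  by apply/eqP; rewrite -addr_eq0 r2.
have /= H1 := IH (r + 1); have /= H2 := IH (r - 1).
rewrite !intrD -!addrA /= in H1 H2.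
have e1 : (r + (1 + 2) = r + 2 + 1 :> int) by ring.
have e2 : (r + (- 1 + 2) = r + 1 :> int) by ring.
have e3 : (r + 2 - 1 = r + 1 :> int) by ring.
rewrite e1 in H1; rewrite e2 in H2; rewrite e3 -natr1.
lra.
Qed.

Lemma srw1_succ n r : n.+1%:R * srw1 n (r + 1) = (n.+1%:R - r%:~R) * srw1 n.+1 r.
Proof.
have /= H2 := srw1_ratio n (r - 1).
have e2 : (r - 1 + 2 = r + 1 :> int) by ring.
rewrite e2 intrD in H2; rewrite /= -natr1; lra.
Qed.

Lemma srw1_center n : srw1 n.*2.+2 0 = (n.*2.+1%:R / n.*2.+2%:R) * srw1 n.*2 0.
Proof.
have := srw1_succ n.*2.+1 0; have := srw1_succ n.*2 (- 1).
have h : n.*2.+2%:R != 0 :> R by rewrite pnatr_eq0.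
rewrite addNr add0r srw1N subr0 => H1 /(mulfI h) <-.
by rewrite mulrAC H1 rmorphN /= opprK natr1 mulrAC divff// mul1r.
Qed.

Lemma srw1_odd_center n : srw1 n.*2.+1 1 = srw1 n.*2.+2 0.
Proof.
have := srw1_succ n.*2.+1 0; have h : n.*2.+2%:R != 0 :> R by rewrite pnatr_eq0.
by rewrite add0r subr0 => /(mulfI h).
Qed.

Lemma srw1_step n (r : nat) :
  srw1 n r%:Z - srw1 n (r%:Z + 2) = (2 * r%:R + 2) / (n%:R + r%:R + 2) * srw1 n r%:Z.
Proof.
have h : (n%:R + r%:R + 2 : R) != 0 by rewrite -!natrD pnatr_eq0 addn2.
rewrite mulrAC; apply: (canRL (mulfK h)).
by have := srw1_ratio n r%:Z; rewrite -pmulrn; lra.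
Qed.

Lemma srw1_decr n (r : nat) : srw1 n (r%:Z + 2) <= srw1 n r%:Z.
Proof.
rewrite -subr_ge0 srw1_step mulr_ge0 ?srw1_ge0// divr_ge0.
Qed.

(** The left side is nonincreasing in [n], because [(2n+1) (2n+3) <= (2n+2)^2]. *)
Lemma srw1_center_sq n : srw1 n.*2 0 ^+ 2 * n.*2.+1%:R <= 1.
Proof.
elim: n => [|n IH]; first by rewrite /= mulr1 expr1n.
rewrite doubleS srw1_center exprMn.
apply: le_trans IH; rewrite mulrAC [leRHS]mulrC ler_wpM2r ?sqr_ge0//.
rewrite expr_div_n mulrAC ler_pdivrMr ?exprn_gt0 ?ltr0n//.
have -> : n.*2.+3%:R = n.*2.+1%:R + 2 :> R by rewrite -natrD addn2.
have -> : n.*2.+2%:R = n.*2.+1%:R + 1 :> R by rewrite natr1.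
have : 0 <= n.*2.+1%:R :> R by rewrite ler0n.
move: (n.*2.+1%:R : R) => x x0; nra.
Qed.

Lemma srw1_le_parity n (r : nat) : srw1 n r%:Z <= srw1 n (odd r : nat)%:Z.
Proof.
have [k] := ubnP r; elim: k r => // k IH [|[|r]] //= hr.
rewrite negbK -addn2 PoszD; apply: le_trans (srw1_decr _ _) _.
by apply: IH; lia.
Qed.

Lemma srw1_parity n (b : bool) : odd n != b -> srw1 n (b : nat)%:Z = 0.
Proof.
suff H k (u : int) : odd (k + `|u|) -> srw1 k u = 0.
  by move=> h; apply: H; case: b h; rewrite /= ?addn0 ?addn1 /= ; case: (odd n).
elim: k u => [|k IH] u; first by move=> /=; case: (eqVneq u 0) => // ->.
by move=> h /=; rewrite !IH ?addr0 ?mul0r//; lia.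
Qed.

Lemma srw1_sq_le n u : srw1 n u ^+ 2 * n.+1%:R <= 1.
Proof.
have [r ->] : exists r : nat, srw1 n u = srw1 n r%:Z.
  by case: u => r; [exists r | exists r.+1; rewrite NegzE srw1N].
apply: (@le_trans _ _ (srw1 n (odd r : nat)%:Z ^+ 2 * n.+1%:R)).
  by rewrite ler_wpM2r// lerXn2r ?nnegrE ?srw1_ge0// srw1_le_parity.
case: (eqVneq (odd n) (odd r)) => [<-|h]; last by rewrite srw1_parity// expr0n mul0r.
case: (boolP (odd n)) => on.
  rewrite -[n in srw1 n]odd_double_half on add1n /= -/(srw1 _.+1 1) srw1_odd_center -doubleS.
  apply: (le_trans _ (srw1_center_sq n./2.+1)); rewrite ler_wpM2l ?sqr_ge0// ler_nat.
  by have := odd_double_half n; rewrite on; lia.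
have e : n = n./2.*2 by have := odd_double_half n; rewrite (negbTE on).
by rewrite e; apply: srw1_center_sq.
Qed.

Lemma srw1_le n u : srw1 n u <= (Num.sqrt n.+1%:R)^-1.
Proof.
rewrite -[leLHS]ger0_norm ?srw1_ge0// -sqrtr_sqr -sqrtrV ?ler0n// ler_wsqrtr//.
by rewrite -[leRHS]mul1r ler_pdivlMr ?ltr0n// srw1_sq_le.
Qed.

(** By reflection, the transition probability from [x] to [y > 0] of the walk killed at 0. *)
Definition srw1_killed n (x y : nat) : R := srw1 n (x%:Z - y%:Z) - srw1 n (x%:Z + y%:Z).

Lemma srw1_killedC n x y : srw1_killed n x y = srw1_killed n y x.
Proof. by rewrite /srw1_killed -(opprB y%:Z) srw1N [_ + y%:Z]addrC. Qed.

Lemma srw1_killedS n x y :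
  srw1_killed n.+1 x.+1 y = (srw1_killed n x y + srw1_killed n x.+2 y) / 2.
Proof.
rewrite /srw1_killed /=.
have -> : (x.+1%:Z - y%:Z - 1 = x%:Z - y%:Z :> int) by lia.
have -> : (x.+1%:Z - y%:Z + 1 = x.+2%:Z - y%:Z :> int) by lia.
have -> : (x.+1%:Z + y%:Z - 1 = x%:Z + y%:Z :> int) by lia.
have -> : (x.+1%:Z + y%:Z + 1 = x.+2%:Z + y%:Z :> int) by lia.
by lra.
Qed.

Lemma srw1_killed_init x y : (0 < y)%N -> srw1_killed 0 x y = (x == y)%:R.
Proof.
move=> y0; rewrite /srw1_killed /=.
have -> : (x%:Z + y%:Z == 0) = false by lia.
by rewrite subr0 subr_eq0 eqz_nat.
Qed.

(* Telescoping in steps of 2 from x - y to x + y; each step costs a factor r / n. *)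
Lemma srw1_killed_bounds n x y :
  0 <= srw1_killed n x y <= 4 * x%:R * y%:R / (n.+1%:R * Num.sqrt n.+1%:R).
Proof.
wlog xy : x y / (y <= x)%N.
  move=> H; case/orP: (leq_total y x) => h; first exact: H.
  by rewrite (srw1_killedC n x) [4 * _ * _]mulrAC; exact: H.
pose f k := srw1 n (x - y + k.*2)%N%:Z.
have -> : srw1_killed n x y = \sum_(0 <= k < y) (f k - f k.+1).
  under eq_bigr do rewrite -opprB.
  rewrite sumrN telescope_sumr// opprB /srw1_killed /f addn0.
  by congr (srw1 _ _ - srw1 _ _); lia.
have fE k : f k - f k.+1 = (2 * (x - y + k.*2)%N%:R + 2) / (n%:R + (x - y + k.*2)%N%:R + 2) * f k.
  rewrite -srw1_step /f doubleS; congr (_ - srw1 _ _); lia.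
apply/andP; split.
  apply: sumr_ge0 => k _; rewrite fE mulr_ge0 ?srw1_ge0// divr_ge0// -?natrM -?natrD ?ler0n//.
apply: (@le_trans _ _ (\sum_(0 <= k < y) (4 * x%:R / (n.+1%:R * Num.sqrt n.+1%:R)))); last first.
  by rewrite sumr_const_nat subn0 -[leLHS]mulr_natr mulrAC.
rewrite !big_nat; apply: ler_sum => k /= ky; rewrite fE invfM mulrA.
apply: ler_pM; rewrite ?srw1_ge0 ?srw1_le//.
apply: ler_pM; rewrite ?invr_ge0 -?natrM -?natrD ?ler0n// ?ler_nat.
  lia.
by rewrite lef_pV2 ?posrE ?ltr0n// ?ler_nat; lia.
Qed.

End Walk1D.

(** * Wallis integrals and the return probability with its constant *)

Section Wallis.

Variable R : realType.

Lemma mean_value (f df : R -> R) (a b : R) : a <= b ->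
  (forall x : R, is_derive x 1 f (df x)) ->
  exists2 c, a <= c <= b & f b - f a = df c * (b - a).
Proof.
move=> ab fd; have [c cab ->] : exists2 c, c \in `[a, b] & f b - f a = df c * (b - a).
  apply: MVT_segment => // x; apply: continuous_subspaceT => {}x.
  by apply/differentiable_continuous/derivable1_diffP; case: (fd x).
by exists c.
Qed.

(** The primitive of [cos^n] that vanishes at 0, by the usual reduction formula. *)
Fixpoint cos_primitive (n : nat) (x : R) : R :=
  if n is n'.+1 then
    if n' is n''.+1 then
      (sin x * cos x ^+ n' + n'%:R * cos_primitive n'' x) / n%:R
    else sin x
  else x.

Lemma is_derive_cos_primitive n (x : R) :
  is_derive x 1 (cos_primitive n) (cos x ^+ n).
Proof.
suff [] : is_derive x 1 (cos_primitive n) (cos x ^+ n) /\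
          is_derive x 1 (cos_primitive n.+1) (cos x ^+ n.+1) by [].
elim: n => [|n [IH1 IH2]]; first by split; [exact: is_derive_id | exact: is_derive_sin].
split=> //.
have D1 := is_deriveM (is_derive_sin x) (is_deriveX n.+1 (is_derive_cos x)).
have D2 := is_deriveD D1 (is_deriveZ n.+1%:R IH1).
have D3 := is_deriveZ n.+2%:R^-1 D2.
have h : n.+2%:R != 0 :> R by rewrite pnatr_eq0.
have -> : cos_primitive n.+2 =
    n.+2%:R^-1 \*: (@sin R * @cos R ^+ n.+1 + n.+1%:R \*: cos_primitive n).
  by apply/funext => y; rewrite !fctE /= [LHS]mulrC.
apply: (is_derive_eq D3); rewrite /GRing.scale /=.
apply: (canLR (mulKf h)).
have -> : (@cos R ^+ n.+1) x = cos x ^+ n.+1 by rewrite fctE.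
have := cos2Dsin2 x; rewrite -!natr1 !exprS expr0 !mulr1 /=; move: (cos x) (sin x) => c s.
move: (c ^+ n) => p H; have ss : s * s = 1 - c * c by lra.
transitivity (p * c * c - (n%:R + 1) * p * (s * s) + (n%:R + 1) * p); first by ring.
by rewrite ss; ring.
Qed.

(** The integral of [cos^n] over [[0, pi/2]], read off from the primitive. *)
Definition wallis n : R := cos_primitive n (pi / 2).

Lemma wallisS n : wallis n.+2 = n.+1%:R / n.+2%:R * wallis n.
Proof. by rewrite /wallis /= cos_pihalf exprS mul0r mulr0 add0r mulrAC. Qed.

Lemma cos_primitive0 n : cos_primitive n 0 = 0.
Proof.
suff [] : cos_primitive n 0 = 0 /\ cos_primitive n.+1 0 = 0 by [].
elim: n => [|n [IH1 IH2]]; first by rewrite /= sin0.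
by split=> //; rewrite [LHS]/= sin0 mul0r IH1 mulr0 addr0 mul0r.
Qed.

(** The difference of the two primitives vanishes at 0 and has derivative [cos^n (cos - 1) <= 0] on
    the interval. *)
Lemma wallis_decr n : wallis n.+1 <= wallis n.
Proof.
have d (x : R) : is_derive x 1 (cos_primitive n.+1 \- cos_primitive n) (cos x ^+ n.+1 - cos x ^+ n).
  by apply: is_deriveB; exact: is_derive_cos_primitive.
have p0 : 0 <= pi / 2 :> R by rewrite divr_ge0// pi_ge0.
have [c /andP[c0 c1]] := mean_value p0 d.
rewrite -[X in X - _ = _]/(wallis n.+1 - wallis n).
rewrite -[X in _ - X = _]/(cos_primitive n.+1 0 - cos_primitive n 0).
rewrite !cos_primitive0 !subr0 => e.
rewrite -subr_le0 e mulr_le0_ge0// subr_le0 exprS ler_piMl ?cos_le1// exprn_ge0//.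
by apply: cos_ge0_pihalf; rewrite c1 andbT (le_trans _ c0)// oppr_le0.
Qed.

Lemma wallis_prod n : n.+1%:R * wallis n.+1 * wallis n = pi / 2.
Proof.
elim: n => [|n IH]; first by rewrite /wallis /= sin_pihalf !mul1r.
rewrite wallisS -IH mulrA.
have h : n.+2%:R != 0 :> R by rewrite pnatr_eq0.
by rewrite [n.+2%:R * _]mulrC divfK// mulrAC.
Qed.

Lemma wallis_srw1 n : wallis n.*2 = srw1 R n.*2 0 * (pi / 2).
Proof.
elim: n => [|n IH]; first by rewrite /wallis /= mul1r.
by rewrite doubleS wallisS IH srw1_center -[RHS]mulrA.
Qed.

(** Monotonicity squeezes the constant product [(n+1) W_n W_(n+1) = pi/2] between squares. The
    constant [pi] must be exact: it decides the coefficient 4 of the logarithm in the covariance. *)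
Lemma srw1_center_wallis n :
  2 / (pi * n.*2.+1%:R) <= srw1 R n.*2 0 ^+ 2 /\
  ((0 < n)%N -> srw1 R n.*2 0 ^+ 2 <= 1 / (pi * n%:R)).
Proof.
have pi0 : 0 < pi :> R := pi_gt0 R.
have W0 k : 0 <= wallis k.*2 by rewrite wallis_srw1 mulr_ge0 ?srw1_ge0// divr_ge0// ltW.
have e : srw1 R n.*2 0 = wallis n.*2 * (2 / pi).
  have F (p t : R) : 0 < p -> t = t * (p / 2) * (2 / p) by move=> ?; field; rewrite gt_eqF.
  by rewrite wallis_srw1; exact: F.
split.
  have H1 := wallis_decr n.*2; have H2 := wallis_prod n.*2.
  have : pi / 2 <= n.*2.+1%:R * wallis n.*2 ^+ 2.
    by rewrite -H2 expr2 mulrA ler_wpM2r// ler_wpM2l// ler0n.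
  move=> H; rewrite e exprMn ler_pdivrMr ?mulr_gt0 ?ltr0n//; move: H.
  move: (pi) pi0 (wallis _ ^+ 2) => p p0 w H.
  have -> : w * (2 / p) ^+ 2 * (p * n.*2.+1%:R) = 4 / p * (n.*2.+1%:R * w).
    by field; rewrite gt_eqF.
  have -> : 2 = 4 / p * (p / 2) by field; rewrite gt_eqF.
  by rewrite ler_wpM2l// divr_ge0// ltW.
case: n e => // n e _; rewrite e exprMn ler_pdivlMr ?mulr_gt0 ?ltr0n//.
have H1 := wallis_decr n.*2.+1; have H2 := wallis_prod n.*2.+1.
have : n.*2.+2%:R * wallis n.*2.+2 ^+ 2 <= pi / 2.
  by rewrite -H2 expr2 mulrA ler_wpM2l// mulr_ge0 ?ler0n// (W0 n.+1).
rewrite -doubleS -[in n.+1.*2%:R]muln2 natrM.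
move: (pi) pi0 (wallis _ ^+ 2) => p p0 w H.
have -> : w * (2 / p) ^+ 2 * (p * n.+1%:R) = 2 / p * (n.+1%:R * 2 * w).
  by field; rewrite gt_eqF.
rewrite [leRHS](_ : _ = 2 / p * (p / 2)); last by field; rewrite gt_eqF.
by rewrite ler_wpM2l// divr_ge0// ltW.
Qed.

End Wallis.

(** * Subsolutions of the heat equation on the integers *)

Section LatticeRecursion.

Variable R : realType.

Implicit Types (t : R).

Lemma sqrt_expR t : Num.sqrt (expR t) = expR (t / 2).
Proof.
have -> : expR t = expR (t / 2) ^+ 2 by rewrite -expRM_natl; congr expR; field.
by rewrite sqrtr_sqr ger0_norm ?expR_ge0.
Qed.

Lemma t32E t : 0 < t -> expR (- (3 / 2 * ln t)) = (t * Num.sqrt t)^-1.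
Proof.
move=> t0; rewrite -{2 3}(lnK (x := t)) ?posrE// sqrt_expR -expRD -expRN.
by congr expR; field.
Qed.

(** With [r = t^(1/8)], [ln r <= r - 1] gives [3/2 ln t + 2 <= 12 r]. Two logarithms thus cost only
    [t^(1/4)], and [t^(-3/2)] degrades to the still integrable [t^(-5/4)]. *)
Lemma log_quartic t : 1 <= t -> (3 / 2 * ln t + 2) ^+ 2 <= 144 * Num.sqrt (Num.sqrt t).
Proof.
move=> t1; have t0 : 0 < t by apply: lt_le_trans t1.
have -> : Num.sqrt (Num.sqrt t) = expR (ln t / 8) ^+ 2.
  by rewrite -{1}(lnK (x := t)) ?posrE// !sqrt_expR -expRM_natl; congr expR; field.
have l0 : 0 <= ln t by exact: ln_ge0.
have := expR_ge1Dx (ln t / 8); move: (expR _) => r h; nra.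
Qed.

Lemma geometric_sum (e : R) n : 0 < e -> \sum_(1 <= k < n) expR (- (k%:R * e)) <= e^-1.
Proof.
move=> e0; case: n => [|n]; first by rewrite big_nil invr_ge0 ltW.
suff H : \sum_(1 <= k < n.+1) expR (- (k%:R * e)) <= (1 - expR (- (n%:R * e))) / e.
  by apply: le_trans H _; rewrite ler_pdivrMr// mulVf ?gt_eqF// gerBl expR_ge0.
elim: n => [|n IH]; first by rewrite big_geq// mul0r oppr0 expR0 subrr mul0r.
rewrite big_nat_recr//=; apply: (le_trans (lerD IH (lexx _))).
rewrite -lerBrDl -mulrBl ler_pdivlMr//.
have -> : - (n%:R * e) = - (n.+1%:R * e) + e by rewrite -natr1; ring.
rewrite expRD; have := expR_ge1Dx e; have := expR_ge0 (- (n.+1%:R * e)).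
by move: (expR _) (expR e) => a b; nra.
Qed.

Variables (w : nat -> int -> R) (e K : R).

Hypothesis w0 : forall j i, 0 <= w j i.

Hypothesis wS : forall j i, w j.+1 i <= (w j (i - 1) + w j (i + 1)) / 2.

Lemma lattice_support (r : nat) :
  (forall i : int, (r%:Z < i)%R -> w 0 i = 0) ->
  forall j (i : int), ((r + j)%:Z < i)%R -> w j i = 0.
Proof.
move=> h; elim=> [|j IH] i hi; first by apply: h; lia.
apply/eqP; rewrite eq_le w0 andbT; apply: le_trans (wS _ _) _.
by rewrite !IH ?addr0 ?mul0r//; lia.
Qed.

(* Maximum principle for the walk killed at the site [- b]. *)
Lemma killed_comparison (b r j0 : nat) (M : R) : 0 <= M ->
  (forall j, w j (- b%:Z) <= M) -> (forall i : int, (r%:Z < i)%R -> w j0 i = 0) ->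
  forall j x, w (j0 + j)%N (x%:Z - b%:Z) <=
    M + \sum_(1 <= y < (r + b).+1) srw1_killed R j x y * w j0 (y%:Z - b%:Z).
Proof.
move=> M0 wM hr; elim=> [|j IH] x.
  rewrite addn0; case: x => [|x].
    rewrite sub0r (le_trans (wM _))// lerDl sumr_ge0// => y _.
    by rewrite mulr_ge0//; case/andP: (srw1_killed_bounds R 0 0 y).
  case: (leqP x.+1 (r + b)) => hx; last first.
    rewrite hr; last by lia.
    by rewrite addr_ge0// sumr_ge0// => y _; rewrite mulr_ge0//; case/andP: (srw1_killed_bounds R 0 x.+1 y).
  rewrite (bigD1_seq x.+1) ?iota_uniq ?mem_index_iota//=.
  rewrite srw1_killed_init// eqxx mul1r addrCA lerDl addr_ge0// sumr_ge0// => y _.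
  by rewrite mulr_ge0//; case/andP: (srw1_killed_bounds R 0 x.+1 y).
rewrite addnS; case: x => [|x].
  rewrite sub0r (le_trans (wM _))// lerDl sumr_ge0// => y _.
  by rewrite mulr_ge0//; case/andP: (srw1_killed_bounds R j.+1 0 y).
apply: le_trans (wS _ _) _.
have -> : (x.+1%:Z - b%:Z - 1 = x%:Z - b%:Z :> int) by lia.
have -> : (x.+1%:Z - b%:Z + 1 = x.+2%:Z - b%:Z :> int) by lia.
rewrite ler_pdivrMr//; apply: le_trans (lerD (IH x) (IH x.+2)) _.
rewrite le_eqVlt; apply/orP; left; apply/eqP.
rewrite addrACA -big_split /= mulrDl mulr_suml; congr (_ + _); first by ring.
by apply: eq_bigr => y _; rewrite srw1_killedS; field.
Qed.

(** Since the killed kernel is at most [4 x y / j^(3/2)], the data at time [j0] enter only through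
    their first moment measured from the killing site. *)
Lemma killed_moment_bound (b r j0 : nat) (M A : R) : 0 <= M ->
  (forall j, w j (- b%:Z) <= M) -> (forall i : int, (r%:Z < i)%R -> w j0 i = 0) ->
  (forall L, \sum_(1 <= y < L) y%:R * w j0 (y%:Z - b%:Z) <= A) ->
  forall j x, w (j0 + j)%N (x%:Z - b%:Z) <=
    M + 4 * x%:R * A / (j.+1%:R * Num.sqrt j.+1%:R).
Proof.
move=> M0 wM hr hA j x; apply: (le_trans (killed_comparison M0 wM hr j x)).
rewrite lerD2l mulrAC; apply: (@le_trans _ _ (4 * x%:R / (j.+1%:R * Num.sqrt j.+1%:R) *
    \sum_(1 <= y < (r + b).+1) y%:R * w j0 (y%:Z - b%:Z))); last first.
  by apply: ler_wpM2l (hA _); rewrite divr_ge0 ?mulr_ge0 ?ler0n.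
rewrite mulr_sumr; apply: ler_sum => y _; rewrite mulrA ler_wpM2r//.
by case/andP: (srw1_killed_bounds R j x y) => _ /le_trans; apply; rewrite mulrAC.
Qed.

(** A discrete Tanaka formula: [k] is harmonic on the positive side and its positive part has a kink
    at 0, so a step can raise the moment only by half of the mass there. *)
Lemma positive_moment_step j L :
  \sum_(0 <= k < L) k%:R * w j.+1 k%:Z <=
  \sum_(0 <= k < L.+1) k%:R * w j k%:Z + w j 0 / 2.
Proof.
case: L => [|L]; first by rewrite big_nil addr_ge0// ?divr_ge0// sumr_ge0// => k _; rewrite mulr_ge0.
rewrite big_nat_recl// mul0r add0r.
apply: (@le_trans _ _ (\sum_(0 <= k < L) k.+1%:R * ((w j k%:Z + w j k.+2%:Z) / 2))).
  apply: ler_sum => k _; rewrite ler_wpM2l//; apply: le_trans (wS _ _) _.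
  have -> : (k.+1%:Z - 1 = k%:Z :> int) by lia.
  by have -> : (k.+1%:Z + 1 = k.+2%:Z :> int) by lia.
have P : \sum_(0 <= k < L) k.+1%:R * ((w j k%:Z + w j k.+2%:Z) / 2) =
   (\sum_(0 <= k < L) k.+1%:R * w j k%:Z + \sum_(0 <= k < L) k.+1%:R * w j k.+2%:Z) / 2.
  by rewrite -big_split mulr_suml; apply: eq_bigr => k _; rewrite /= -mulrDr mulrA.
rewrite P ler_pdivrMr//.
have A1 : \sum_(0 <= k < L) k.+1%:R * w j k%:Z <=
   \sum_(0 <= k < L.+2) k%:R * w j k%:Z + \sum_(0 <= k < L) w j k%:Z.
  rewrite big_nat_recr//= big_nat_recr//=.
  rewrite (_ : \sum_(0 <= k < L) k.+1%:R * w j k%:Z =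
     \sum_(0 <= k < L) k%:R * w j k%:Z + \sum_(0 <= k < L) w j k%:Z); last first.
    by rewrite -big_split; apply: eq_bigr => k _; rewrite /= -natr1 mulrDl mul1r.
  by have := mulr_ge0 (ler0n R L) (w0 j L%:Z); have := mulr_ge0 (ler0n R L.+1) (w0 j L.+1%:Z); lra.
have A2 : \sum_(0 <= k < L) k.+1%:R * w j k.+2%:Z + \sum_(0 <= k < L) w j k%:Z <=
   \sum_(0 <= k < L.+2) k%:R * w j k%:Z + w j 0.
  apply: (@le_trans _ _ (\sum_(0 <= k < L) k.+1%:R * w j k.+2%:Z + \sum_(0 <= k < L.+2) w j k%:Z)).
    by rewrite lerD2l big_nat_recr//= big_nat_recr//= -addrA lerDl addr_ge0.
  rewrite !big_nat_recl//= mul0r add0r mul1r.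
  rewrite [X in _ <= X + _](_ : _ = w j 1 + (\sum_(0 <= k < L) k.+1%:R * w j k.+2%:Z + \sum_(0 <= k < L) w j k.+2%:Z)); last first.
    by rewrite -big_split; congr (_ + _); apply: eq_bigr => k _; rewrite /= -[k.+2%:R]natr1 mulrDl mul1r.
  lra.
lra.
Qed.

Lemma positive_moment_le j L :
  \sum_(0 <= k < L) k%:R * w j k%:Z <=
  \sum_(0 <= k < L + j) k%:R * w 0 k%:Z + (\sum_(0 <= s < j) w s 0) / 2.
Proof.
elim: j L => [|j IH] L; first by rewrite addn0 [X in _ + X / _]big_geq// mul0r addr0.
apply: le_trans (positive_moment_step _ _) _.
apply: le_trans (lerD (IH _) (lexx _)) _.
by rewrite addSnnS big_nat_recr//= mulrDl addrA.
Qed.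

End LatticeRecursion.

(** * The ballot estimate for a capped recursion on the lattice *)

Section LatticeBound.

Variable R : realType.

Lemma nat_multiple (l e : R) : 0 <= l -> 0 < e <= 1 ->
  exists b : nat, l <= b%:R * e <= l + 1.
Proof.
move=> l0 /andP[e0 e1]; exists (Num.truncn (l / e)).+1.
have le0 : 0 <= l / e by rewrite divr_ge0// ltW.
have /andP[h1 h2] := truncn_itv le0; rewrite -natr1; apply/andP; split.
  by rewrite -ler_pdivrMr// natr1 ltW.
by move: h1; rewrite ler_pdivlMr// mulrDl mul1r => h1; lra.
Qed.

(** The cap 12, plus 12 times the bound for the first moment at half time: low sites are estimated
    by the weak bound, high sites by the moment about 0. *)
Definition lattice_const : R :=
  12 + 12 * (4 * (3 * (12 + 104)) * (144 ^+ 2) + 2 * (7 + 3 * (64 * 144))).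

Lemma lattice_const_gt0 : 0 < lattice_const.
Proof. by apply: ltr_wpDr; [nneg | exact: ltr0n]. Qed.

Variables (w : nat -> int -> R) (e K : R).

Hypothesis e01 : 0 < e <= 1.

Hypothesis K1 : 1 <= K.

Hypothesis w0 : forall j i, 0 <= w j i.

Hypothesis wS : forall j i, w j.+1 i <= (w j (i - 1) + w j (i + 1)) / 2.

Hypothesis wcap : forall j i, w j i <= 12 * expR (i%:~R * e).

Hypothesis hS0 : forall L, \sum_(0 <= k < L) w 0 k%:Z <= K / e.

Hypothesis hS1 : forall L, \sum_(0 <= k < L) k%:R * w 0 k%:Z <= K / e ^+ 2.

Variable r : nat.

Hypothesis w_supp : forall i : int, (r%:Z < i)%R -> w 0 i = 0.

Lemma initial_moment (b L : nat) :
  \sum_(1 <= y < L) y%:R * w 0 (y%:Z - b%:Z) <= 13 * K * (1 + b%:R * e) / e ^+ 2.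
Proof.
case/andP: e01 => e0 e1.
have T0 y : 0 <= y%:R * w 0 (y%:Z - b%:Z) by rewrite mulr_ge0.
apply: (@le_trans _ _ (\sum_(0 <= y < b + L) y%:R * w 0 (y%:Z - b%:Z))).
  case: L => [|L]; first by rewrite big_geq// sumr_ge0.
  rewrite [leRHS](big_cat_nat (n := L.+1)) ?leq_addl//= -[leLHS]addr0 lerD ?sumr_ge0//.
  by rewrite [leRHS]big_nat_recl// [leLHS]big_add1 lerDr.
rewrite (big_cat_nat (n := b)) ?leq_addr//=.
have A : \sum_(0 <= y < b) y%:R * w 0 (y%:Z - b%:Z) <= b%:R * 12 / e.
  rewrite big_nat_rev /= add0n.
  apply: (@le_trans _ _ (b%:R * 12 * \sum_(1 <= k < b.+1) expR (- (k%:R * e)))).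
    rewrite big_add1 mulr_sumr !big_nat; apply: ler_sum => k /= kb.
    rewrite -mulrA; apply: ler_pM => //; first by rewrite ler_nat leq_subr.
    apply: le_trans (wcap _ _) _; rewrite ler_wpM2l// ler_expR.
    rewrite -mulNr ler_wpM2r// ?(ltW e0)//.
    have -> : (b - k.+1)%N%:Z - b%:Z = - k.+1%:Z by lia.
    by rewrite rmorphN.
  by apply: ler_wpM2l (geometric_sum _ e0); rewrite mulr_ge0.
have B : \sum_(b <= y < b + L) y%:R * w 0 (y%:Z - b%:Z) <= K / e ^+ 2 + b%:R * (K / e).
  rewrite -{1}[b]add0n big_addn addKn.
  rewrite (eq_bigr (fun k => k%:R * w 0 k%:Z + b%:R * w 0 k%:Z)); last first.
    by move=> k _; rewrite natrD mulrDl; congr (_ * w _ _ + _ * w _ _); lia.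
  by rewrite big_split /= lerD ?hS1// -mulr_sumr ler_wpM2l// hS0.
apply: le_trans (lerD A B) _.
have -> : 13 * K * (1 + b%:R * e) / e ^+ 2 = 13 * K / e ^+ 2 + 13 * K * b%:R / e.
  by field; rewrite gt_eqF.
have b0 : 0 <= b%:R :> R by [].
have -> : b%:R * 12 / e + (K / e ^+ 2 + b%:R * (K / e)) =
   K / e ^+ 2 + (12 + K) * b%:R / e by field; rewrite gt_eqF.
have K1' := K1; apply: lerD; rewrite ler_pM2r ?invr_gt0 ?exprn_gt0//; nra.
Qed.

(** [time j] is the variance accumulated by steps of size [e]. At height [- depth t] the factor
    [e^z] of the cap equals [t^(-3/2)]; this is where the walk gets killed. *)
Let time (j : nat) := j.+1%:R * e ^+ 2.

Let depth (t : R) := 3 / 2 * ln t.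

Let time_gt0 j : 0 < time j.
Proof. by case/andP: e01 => e0 _; rewrite mulr_gt0// exprn_gt0. Qed.

Let time32 j : (j.+1%:R * Num.sqrt j.+1%:R)^-1 = e ^+ 3 / (time j * Num.sqrt (time j)).
Proof.
case/andP: e01 => e0 _; rewrite /time sqrtrM// sqrtr_sqr gtr0_norm//.
have : 0 < Num.sqrt j.+1%:R :> R by rewrite sqrtr_gt0.
have : 0 < j.+1%:R :> R by [].
move: (j.+1%:R : R) (Num.sqrt _) => x y x0 y0.
by field; rewrite !gt_eqF.
Qed.

(** Paths that reach the barrier at [- depth] are paid by the cap, the others by the killed kernel.
    The first moment of the initial data is taken from the barrier, which loses a factor
    [depth + 2]; this factor is removed in [lattice_sharp_bound]. *)
Lemma lattice_weak_bound j (i : int) (Y : R) :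
  1 <= time j -> 0 <= Y -> i%:~R * e <= Y ->
  w j i <= (12 + 52 * K * (Y + depth (time j) + 1) * (depth (time j) + 2)) /
           (time j * Num.sqrt (time j)).
Proof.
case/andP: e01 => e0 e1; move=> t1 Y0 iY.
have l0 : 0 <= depth (time j) by rewrite mulr_ge0// ln_ge0.
have s0 : 0 < time j * Num.sqrt (time j) by rewrite mulr_gt0// sqrtr_gt0.
have [b /andP[b1 b2]] := nat_multiple l0 e01.
have capb : 12 * expR (- (b%:R * e)) <= 12 / (time j * Num.sqrt (time j)).
  by rewrite ler_pM2l// -t32E// ler_expR lerN2.
have [x [ix|ix]] : exists x : nat, i = x%:Z - b%:Z \/ (i < - b%:Z)%R.
  case: (lerP (- b%:Z) i) => h; last by exists 0%N; right.
  exists `|(i + b%:Z)%R|%N; left; clear -h; lia.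
  have M0 : 0 <= 12 * expR (- (b%:R * e)) by rewrite mulr_ge0// expR_ge0.
  have wM j' : w j' (- b%:Z) <= 12 * expR (- (b%:R * e)).
    by apply: le_trans (wcap _ _) _; rewrite rmorphN mulNr.
  have := killed_moment_bound w0 wS M0 wM w_supp (initial_moment b) j x.
  rewrite add0n -ix => /le_trans; apply.
  rewrite [leRHS]mulrDl; apply: lerD => //.
  rewrite time32 mulrA ler_pM2r ?invr_gt0//.
  have -> : 4 * x%:R * (13 * K * (1 + b%:R * e) / e ^+ 2) * e ^+ 3 =
    52 * K * (x%:R * e) * (1 + b%:R * e) by field; rewrite gt_eqF.
  have xe : x%:R * e <= Y + depth (time j) + 1.
    have -> : x%:R = i%:~R + b%:R :> R by rewrite ix intrD rmorphN /= subrK.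
    by rewrite mulrDl; lra.
  have xe0 : 0 <= x%:R * e by rewrite mulr_ge0// ltW.
  have K0 : 0 <= 52 * K by have := K1; lra.
  apply: ler_pM; first by rewrite mulr_ge0.
  - by rewrite addr_ge0// mulr_ge0// ltW.
  - exact: ler_wpM2l.
  - lra.
apply: (@le_trans _ _ (12 / (time j * Num.sqrt (time j)))); last first.
  by rewrite ler_pM2r ?invr_gt0// lerDl !mulr_ge0//; have := K1; lra.
apply: le_trans (wcap _ _) _; apply: le_trans capb; rewrite ler_pM2l// ler_expR.
rewrite -mulNr ler_pM2r// -[- b%:R]/(- b%:~R) -rmorphN /= ler_int; exact: ltW.
Qed.

Lemma lattice_origin_bound s : 1 <= time s ->
  w s 0 <= 64 * 144 * K / Num.sqrt (Num.sqrt (time s)) ^+ 5.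
Proof.
move=> t1; have := @lattice_weak_bound s 0 0 t1 (lexx 0).
rewrite mul0r => /(_ (lexx 0)); rewrite add0r => /le_trans; apply.
have l0 : 0 <= depth (time s) by rewrite mulr_ge0// ln_ge0.
have b0 : 0 < Num.sqrt (Num.sqrt (time s)) by rewrite !sqrtr_gt0.
have := log_quartic t1; rewrite -/(depth _).
have e1 : Num.sqrt (time s) = Num.sqrt (Num.sqrt (time s)) ^+ 2.
  by rewrite [RHS]sqr_sqrtr// sqrtr_ge0.
have e2 : time s = Num.sqrt (Num.sqrt (time s)) ^+ 4.
  by rewrite (exprM _ 2 2) -e1 sqr_sqrtr// ltW.
have -> : time s * Num.sqrt (time s) =
    Num.sqrt (Num.sqrt (time s)) ^+ 4 * Num.sqrt (Num.sqrt (time s)) ^+ 2.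
  by rewrite -e2 -e1.
move: (depth _) l0 => l l0.
move: (Num.sqrt (Num.sqrt (time s))) b0 {e1 e2} => b b0 H.
have -> : 64 * 144 * K / b ^+ 5 = 64 * 144 * K * b / (b ^+ 4 * b ^+ 2).
  by field; rewrite gt_eqF.
rewrite ler_pM2r ?invr_gt0 ?mulr_gt0 ?exprn_gt0//.
apply: (@le_trans _ _ (64 * K * (l + 2) ^+ 2)); last by have := K1; nra.
have K1' := K1; have : 1 <= (l + 2) ^+ 2 by nra.
nra.
Qed.

(** The local time at the origin stays bounded because [t^(-5/4)] is integrable at infinity. *)
Lemma lattice_origin_sum j :
  e ^+ 2 * \sum_(0 <= s < j) w s 0 <= 12 + 5 * (64 * 144 * K).
Proof.
case/andP: e01 => e0 e1; set D := 64 * 144 * K.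
have D0 : 0 <= D by apply: mulr_ge0; [rewrite mulr_ge0 | exact: le_trans K1].
have e20 : 0 < e ^+ 2 by rewrite exprn_gt0.
have e21 : e ^+ 2 <= 1 by rewrite expr_le1// ltW.
pose b k := Num.sqrt (Num.sqrt (k%:R * e ^+ 2)).
have b1 k : 1 <= k%:R * e ^+ 2 -> 1 <= b k.
  by move=> h; rewrite /b -[leLHS]sqrtr1 ler_wsqrtr// -[leLHS]sqrtr1 ler_wsqrtr.
have b4 k : b k ^+ 4 = k%:R * e ^+ 2.
  rewrite /b (exprM _ 2 2) sqr_sqrtr ?sqrtr_ge0// sqr_sqrtr// mulr_ge0// ltW//.
(* Before time 1 only the cap is used; afterwards the majorant is the integral of [t^(-5/4)], which
   is [4 (1 - 1/b)] for [b = t^(1/4)]. *)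
have H : (j%:R * e ^+ 2 < 1 -> e ^+ 2 * \sum_(0 <= s < j) w s 0 <= 12 * (j%:R * e ^+ 2)) /\
   (1 <= j%:R * e ^+ 2 -> e ^+ 2 * \sum_(0 <= s < j) w s 0 <= 12 + D * (1 + 4 * (1 - (b j)^-1))).
  elim: j => [|j [IH1 IH2]].
    rewrite big_geq// !mul0r !mulr0; split=> // h; exfalso; lra.
  rewrite big_nat_recr//= mulrDr.
  have c12 : w j 0 <= 12 by have := wcap j 0; rewrite mul0r expR0 mulr1.
  have w00 := w0 j 0.
  case: (ltrP (j%:R * e ^+ 2) 1) => hj.
    split=> hj1.
      by have := IH1 hj; rewrite -natr1 mulrDl mul1r; nra.
    have := IH1 hj; have := lattice_origin_bound hj1; rewrite -/(b j.+1) -/D.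
    have b1' := b1 _ hj1; have : (b j.+1)^-1 <= 1 by rewrite invf_le1// (lt_le_trans ltr01).
    have : 0 < (b j.+1)^-1 by rewrite invr_gt0 (lt_le_trans ltr01).
    rewrite -exprVn; move: (b j.+1)^-1 => x x0 x1 h1 h2.
    have x5 : x ^+ 5 <= 1 by rewrite expr_le1// ltW.
    have h3 : e ^+ 2 * w j 0 <= D by have := exprn_gt0 5 x0; nra.
    nra.
  split=> hj1; first by move: hj1; rewrite -natr1 mulrDl mul1r; lra.
  have := IH2 hj; have := lattice_origin_bound hj1; rewrite -/(b j.+1) -/D.
  have ba1 := b1 _ hj; have bb1 := b1 _ hj1.
  have Ea := b4 j; have Eb := b4 j.+1.
  have Ed : e ^+ 2 = b j.+1 ^+ 4 - b j ^+ 4 by rewrite Ea Eb -natr1; ring.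
  move: (b j) (b j.+1) ba1 bb1 Ed {Ea Eb b1 b4} => a c a1 c1 Ed h1 h2.
  have a0 : 0 < a by lra. have c0 : 0 < c by lra.
  have ac : a <= c.
    rewrite -(ler_pXn2r (n := 4)) ?nnegrE ?ltW//; lra.
  have K1' : e ^+ 2 / c ^+ 5 <= 4 * (a^-1 - c^-1).
    have -> : 4 * (a^-1 - c^-1) = 4 * (c - a) * c ^+ 4 / (a * c ^+ 5).
      by field; rewrite !gt_eqF.
    have -> : e ^+ 2 / c ^+ 5 = e ^+ 2 * a / (a * c ^+ 5) by field; rewrite !gt_eqF.
    rewrite ler_pM2r ?invr_gt0 ?mulr_gt0 ?exprn_gt0// Ed.
    have -> : c ^+ 4 - a ^+ 4 = (c - a) * (c ^+ 3 + c ^+ 2 * a + c * a ^+ 2 + a ^+ 3) by ring.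
    have -> : 4 * (c - a) * c ^+ 4 = (c - a) * (4 * c ^+ 3 * c) by ring.
    rewrite -[leLHS]mulrA ler_wpM2l ?subr_ge0//.
    have c3 : 0 < c ^+ 3 by rewrite exprn_gt0.
    have h4 : c ^+ 3 + c ^+ 2 * a + c * a ^+ 2 + a ^+ 3 <= 4 * c ^+ 3.
      have q1 : c ^+ 2 * a <= c ^+ 3 by rewrite [c ^+ 3]exprSr ler_wpM2l// sqr_ge0.
      have q2 : c * a ^+ 2 <= c ^+ 3.
        by rewrite [c ^+ 3]exprS ler_wpM2l ?(ltW c0)// lerXn2r ?nnegrE ?(ltW a0) ?(ltW c0)//.
      have q3 : a ^+ 3 <= c ^+ 3 by rewrite lerXn2r ?nnegrE ?(ltW a0) ?(ltW c0)//.
      lra.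
    move: h4; move: (_ + a ^+ 3) => S h4.
    have p1 : 0 <= (4 * c ^+ 3 - S) * a by rewrite mulr_ge0 ?subr_ge0// ltW.
    have p2 : 0 <= c ^+ 3 * (c - a) by rewrite mulr_ge0 ?subr_ge0// ltW.
    by move: (c ^+ 3) p1 p2 => u p1 p2; lra.
  have h3 : e ^+ 2 * w j 0 <= D * (e ^+ 2 / c ^+ 5).
    apply: le_trans (ler_wpM2l (ltW e20) h1) _.
    by rewrite le_eqVlt mulrCA eqxx.
  have := ler_wpM2l D0 K1'; lra.
case: H => H1 H2; case: (ltrP (j%:R * e ^+ 2) 1) => h.
  by have := H1 h; lra.
have := H2 h; have : 0 < (b j)^-1 by rewrite invr_gt0 (lt_le_trans ltr01)// b1.
by move: (b j)^-1 => x x0; nra.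
Qed.

(** The positive moment can grow only through the local time at 0, so it keeps the order [K / e^2]
    of the initial data for all times. *)
Lemma lattice_moment_bound j L :
  \sum_(0 <= k < L) k%:R * w j k%:Z <= (7 + 3 * (64 * 144)) * K / e ^+ 2.
Proof.
case/andP: e01 => e0 e1; have e20 : 0 < e ^+ 2 by rewrite exprn_gt0.
apply: (le_trans (positive_moment_le w0 wS j L)).
rewrite ler_pdivlMr// mulrDl.
have h1 := hS1 (L + j); rewrite ler_pdivlMr// in h1.
have h2 := lattice_origin_sum j; have h3 := K1.
apply: (le_trans (lerD h1 (lexx _))); move: h2.
rewrite [_ / 2 * _]mulrAC [_ * e ^+ 2]mulrC.
by move: (e ^+ 2 * _) => u; lra.
Qed.

(** The weak bound is spent on the first half of the time, where it only has to control the first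
    moment seen from the barrier. The second half, by the killed kernel started from that moment,
    gives [t^(-3/2)] without further logarithms. *)
Lemma lattice_sharp_bound j (i : int) (Y : R) : 2 <= time j -> 0 <= Y ->
  i%:~R * e + depth (time j) <= Y ->
  w j i <= lattice_const * K * (1 + Y) / (time j * Num.sqrt (time j)).
Proof.
case/andP: e01 => e0 e1; have e20 : 0 < e ^+ 2 by rewrite exprn_gt0.
have [A1 A1E] : exists a : R, a = 7 + 3 * (64 * 144) by eexists.
have [A2 A2E] : exists a : R, a = 4 * (3 * (12 + 104)) * (144 ^+ 2) by eexists.
have A10 : 0 <= A1 by rewrite A1E; nneg.
have A20 : 0 <= A2 by rewrite A2E; nneg.
have -> : lattice_const = 12 + 12 * (A2 + 2 * A1) by rewrite A1E A2E.
move=> t2 Y0 iY; set t := time j in t2 iY *.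
have t1 : 1 <= t by apply: le_trans t2; rewrite ler1n.
have l0 : 0 <= depth t by rewrite mulr_ge0// ln_ge0.
have q0 : 0 < t * Num.sqrt t by rewrite mulr_gt0 ?sqrtr_gt0 ?time_gt0.
have [b /andP[b1 b2]] := nat_multiple l0 e01.
have capb : 12 * expR (- (b%:R * e)) <= 12 / (t * Num.sqrt t).
  by rewrite ler_pM2l// -t32E ?time_gt0// ler_expR lerN2.
have K0 : 0 < K by apply: lt_le_trans K1.
case: (ltrP i (- b%:Z)) => ib.
  apply: (@le_trans _ _ (12 / (t * Num.sqrt t))).
    apply: le_trans (wcap _ _) _; apply: le_trans capb; rewrite ler_pM2l// ler_expR.
    rewrite -mulNr ler_pM2r// -[- b%:R]/(- b%:~R) -rmorphN /= ler_int; exact: ltW.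
  rewrite ler_pM2r ?invr_gt0//; have K1' := K1.
  have : 12 * (1 + Y) <= (12 + 12 * (A2 + 2 * A1)) * K * (1 + Y).
    by rewrite ler_wpM2r ?addr_ge0//; nra.
  lra.
have [x ix] : exists x : nat, i = x%:Z - b%:Z.
  by exists `|(i + b%:Z)%R|%N; clear -ib; lia.
pose j0 := j./2; pose j1 := (j - j0)%N.
have jE : (j = j0 + j1)%N by rewrite /j1 subnKC// /j0; clear; lia.
have tj0 : t <= 2 * time j0.
  rewrite /t /time mulrA ler_pM2r// -natrM ler_nat /j0; clear; lia.
have t01 : 1 <= time j0 by lra.
have tj0' : time j0 <= t.
  by rewrite /t /time ler_pM2r// ler_nat /j0; clear; lia.
have d01 : depth (time j0) <= depth t.
  by rewrite ler_pM2l ?divr_gt0// ler_ln// posrE time_gt0.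
have d00 : 0 <= depth (time j0) by rewrite mulr_ge0// ln_ge0.
(* The constant 3 exceeds [2^(3/2)], the price of halving the time. *)
have s3 (u : R) : 0 < u -> t <= 2 * u -> (u * Num.sqrt u)^-1 <= 3 / (t * Num.sqrt t).
  move=> u0 tu; rewrite ler_pdivlMr// mulrC ler_pdivrMr ?mulr_gt0 ?sqrtr_gt0//.
  have st : Num.sqrt t <= 3 / 2 * Num.sqrt u.
    rewrite -(ler_pXn2r (n := 2)) ?nnegrE ?sqrtr_ge0 ?mulr_ge0 ?sqrtr_ge0//.
    by rewrite exprMn !sqr_sqrtr ?ltW ?time_gt0//; lra.
  have -> : 3 * (u * Num.sqrt u) = (2 * u) * (3 / 2 * Num.sqrt u) by field.
  by apply: ler_pM => //; rewrite ?sqrtr_ge0// (le_trans ler01).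
have sup (k : int) : (k <= b%:Z)%R ->
    w j0 k <= 3 * (12 + 104) * K * (depth t + 2) ^+ 2 / (t * Num.sqrt t).
  move=> kb; have := @lattice_weak_bound j0 k (b%:R * e) t01.
  have be0 : 0 <= b%:R * e by rewrite mulr_ge0// ltW.
  have kbe : k%:~R * e <= b%:R * e by rewrite ler_pM2r// -[b%:R]/(b%:~R) ler_int.
  move=> /(_ be0 kbe) /le_trans; apply.
  have q00 : 0 <= (t * Num.sqrt t)^-1 by rewrite invr_ge0 ltW.
  have := s3 _ (time_gt0 j0) tj0; move: (time j0 * _)^-1 (t * _)^-1 q00 => p q q00 pq.
  set d0 := depth (time j0) in d00 d01 *; set d := depth t in l0 b1 b2 d01 *.
  have h : 12 + 52 * K * (b%:R * e + d0 + 1) * (d0 + 2) <= (12 + 104) * K * (d + 2) ^+ 2.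
    have h1 : (b%:R * e + d0 + 1) * (d0 + 2) <= 2 * (d + 2) ^+ 2 by nra.
    have h2 : 52 * K * ((b%:R * e + d0 + 1) * (d0 + 2)) <= 52 * K * (2 * (d + 2) ^+ 2).
      by apply: ler_wpM2l => //; rewrite mulr_ge0// ltW.
    have h3 : 1 <= (d + 2) ^+ 2 by rewrite exprn_ege1// ler_wpDl// ler1n.
    have h4 : 12 <= 12 * K * (d + 2) ^+ 2 by rewrite -mulrA ler_peMr// mulr_ege1.
    have -> : (12 + 104) * K * (d + 2) ^+ 2 = 12 * K * (d + 2) ^+ 2 + 52 * K * (2 * (d + 2) ^+ 2) by ring.
    by rewrite -[52 * K * _ * _]mulrA lerD.
  have h0 : 0 <= 12 + 52 * K * (b%:R * e + d0 + 1) * (d0 + 2).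
    by rewrite addr_ge0// !mulr_ge0// ?addr_ge0// ltW.
  apply: (@le_trans _ _ ((12 + 104) * K * (d + 2) ^+ 2 * (3 * q))).
    apply: (@le_trans _ _ ((12 + 52 * K * (b%:R * e + d0 + 1) * (d0 + 2)) * (3 * q))).
      exact: ler_wpM2l.
    by apply: ler_wpM2r h; rewrite mulr_ge0.
  by rewrite le_eqVlt; apply/orP; left; apply/eqP; ring.
(* Sites with [y <= 2b] fall under the weak bound, whose logarithms to the fourth power are absorbed
   by [sqrt t]; beyond them [y <= 2 (y - b)], so the moment about 0 suffices. *)
have mom L : \sum_(1 <= y < L) y%:R * w j0 (y%:Z - b%:Z) <= (A2 + 2 * A1) * K / e ^+ 2.
  have T0 y : 0 <= y%:R * w j0 (y%:Z - b%:Z) by rewrite mulr_ge0.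
  have b0 : 0 <= b%:R :> R by [].
  apply: (@le_trans _ _ (\sum_(1 <= y < b.*2.+1 + L) y%:R * w j0 (y%:Z - b%:Z))).
    case: L => [|L]; first by rewrite big_geq// sumr_ge0.
    rewrite [leRHS](big_cat_nat (n := L.+1)) ?leq_addl//= -[leLHS]addr0 lerD ?sumr_ge0//.
  rewrite (big_cat_nat (n := b.*2.+1)) ?leq_addr//= mulrDl mulrDl; apply: lerD.
    apply: (@le_trans _ _ (\sum_(1 <= y < b.*2.+1) (b.*2%:R *
        (3 * (12 + 104) * K * (depth t + 2) ^+ 2 / (t * Num.sqrt t))))).
      rewrite !big_nat; apply: ler_sum => y /andP[_ yb].
      apply: ler_pM => //; first by rewrite ler_nat.
      by apply: sup; clear -yb; lia.
    rewrite sumr_const_nat subn1 /= -[leLHS]mulr_natr -muln2 natrM ler_pdivlMr//.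
    have be2 : (b%:R * e) ^+ 2 <= (depth t + 2) ^+ 2.
      by rewrite lerXn2r ?nnegrE ?mulr_ge0 ?addr_ge0 ?(ltW e0)//; lra.
    have L4 : (depth t + 2) ^+ 2 * (depth t + 2) ^+ 2 <= 144 ^+ 2 * Num.sqrt t.
      have h := log_quartic t1; rewrite -/(depth t) in h.
      have -> : 144 ^+ 2 * Num.sqrt t = (144 * Num.sqrt (Num.sqrt t)) * (144 * Num.sqrt (Num.sqrt t)).
        by rewrite -expr2 exprMn sqr_sqrtr// sqrtr_ge0.
      by apply: ler_pM; rewrite ?sqr_ge0.
    have -> : b%:R * 2 * (3 * (12 + 104) * K * (depth t + 2) ^+ 2 / (t * Num.sqrt t)) *
        (b%:R * 2) * e ^+ 2 = 4 * (3 * (12 + 104)) * K / (t * Num.sqrt t) *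
        ((b%:R * e) ^+ 2 * (depth t + 2) ^+ 2).
      by field; rewrite !gt_eqF ?sqrtr_gt0 ?time_gt0.
    apply: (@le_trans _ _ (4 * (3 * (12 + 104)) * K / (t * Num.sqrt t) * (144 ^+ 2 * Num.sqrt t))).
      apply: ler_wpM2l; first by nneg.
      by apply: le_trans L4; rewrite ler_wpM2r ?sqr_ge0.
    have -> : 4 * (3 * (12 + 104)) * K / (t * Num.sqrt t) * (144 ^+ 2 * Num.sqrt t) =
       A2 * K / t by rewrite A2E; field; rewrite !gt_eqF ?sqrtr_gt0 ?time_gt0.
    by rewrite ler_pdivrMr ?time_gt0// ler_peMr// mulr_ge0// ltW.
  rewrite -{1}[b.*2.+1]add0n big_addn addKn.
  apply: (@le_trans _ _ (2 * \sum_(0 <= k < b.+1 + L) k%:R * w j0 k%:Z)).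
    rewrite [X in _ <= 2 * X](big_cat_nat (n := b.+1)) ?leq_addr//= mulrDr -[leLHS]add0r lerD//.
      by rewrite mulr_ge0 ?sumr_ge0// => k _; rewrite mulr_ge0.
    rewrite -{1}[b.+1]add0n [X in _ <= 2 * X]big_addn addKn mulr_sumr; apply: ler_sum => k _.
    have -> : ((k + b.*2.+1)%N%:Z - b%:Z = (k + b.+1)%N%:Z :> int) by clear; lia.
    by rewrite mulrA ler_wpM2r// -natrM ler_nat; clear; lia.
  rewrite -!mulrA ler_wpM2l// mulrA A1E.
  exact: (lattice_moment_bound j0).
have M0 : 0 <= 12 * expR (- (b%:R * e)) by rewrite mulr_ge0// expR_ge0.
have wM j' : w j' (- b%:Z) <= 12 * expR (- (b%:R * e)).
  by apply: le_trans (wcap _ _) _; rewrite rmorphN mulNr.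
have hsup := @lattice_support R w w0 wS r w_supp j0.
have := @killed_moment_bound R w w0 wS b (r + j0)%N j0 _ _ M0 wM hsup mom j1 x.
rewrite -jE -ix => /le_trans; apply.
have xe : x%:R * e <= 1 + Y.
  have -> : x%:R = i%:~R + b%:R :> R by rewrite ix intrD rmorphN /= subrK.
  by rewrite mulrDl; lra.
have tj1 : t <= 2 * time j1.
  by rewrite /t /time mulrA ler_pM2r// -natrM ler_nat /j1 /j0; clear; lia.
apply: (@le_trans _ _ (12 / (t * Num.sqrt t) +
    4 * x%:R * ((A2 + 2 * A1) * K / e ^+ 2) * e ^+ 3 * (3 / (t * Num.sqrt t)))).
  rewrite lerD// time32 -[leRHS]mulrA mulrA -[leLHS]mulrA ler_wpM2l//.
    by nneg.
  by rewrite ler_wpM2l ?exprn_ge0 ?(ltW e0)//; apply: s3 => //; rewrite time_gt0.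
have -> : 4 * x%:R * ((A2 + 2 * A1) * K / e ^+ 2) * e ^+ 3 * (3 / (t * Num.sqrt t)) =
   12 * (A2 + 2 * A1) * K * (x%:R * e) / (t * Num.sqrt t).
  by field; rewrite !gt_eqF ?sqrtr_gt0 ?time_gt0.
rewrite -mulrDl ler_pM2r ?invr_gt0//.
have h1 : 12 * (A2 + 2 * A1) * K * (x%:R * e) <= 12 * (A2 + 2 * A1) * K * (1 + Y).
  by apply: ler_wpM2l xe; nneg.
have h2 : 12 <= 12 * K * (1 + Y) by rewrite -mulrA ler_peMr// mulr_ege1 ?lerDl.
have -> : (12 + 12 * (A2 + 2 * A1)) * K * (1 + Y) = 12 * K * (1 + Y) + 12 * (A2 + 2 * A1) * K * (1 + Y) by ring.
exact: lerD h2 h1.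
Qed.

End LatticeBound.

(** * The ballot estimate for recursions on the real line *)

Section LineRecursion.

Variable R : realType.

Lemma expR_half_le2 : expR (1 / 2) <= 2 :> R.
Proof.
have := expR_ge1Dx (- (1 / 2) : R); rewrite expRN => h.
have x0 := expR_gt0 (1 / 2 : R).
by move: h; rewrite -(ler_pM2r x0) mulVf ?gt_eqF// => h; lra.
Qed.

(** Sampling [W] on the lattice through [z] with origin near [-s], and multiplying by [e^s], reduces
    to the lattice. The decay at rate [mu] bounds both initial moments with [K = 48 A mu^-3], and
    the offset of the origin is small enough for the cap 12. *)
Lemma line_sharp_bound (e : R) (W : nat -> R -> R) (s mu A : R) :
  0 < e <= 1 / 2 -> (forall j z, 0 <= W j z) ->
  (forall j z, W j.+1 z <= (W j (z - e) + W j (z + e)) / 2) ->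
  (forall j z, W j z <= 4 * expR z) ->
  0 < mu <= 1 -> 1 <= A ->
  (forall z, 0 <= z + s -> W 0 z <= expR (- s) * (A * (1 + (z + s)) * expR (- (mu * (z + s))))) ->
  forall j z Y, 2 <= j.+1%:R * e ^+ 2 -> 0 <= Y ->
  z + s + 3 / 2 * ln (j.+1%:R * e ^+ 2) <= Y ->
  W j z <= lattice_const R * 48 * A * mu ^- 3 * expR (- s) * (1 + Y) /
    (j.+1%:R * e ^+ 2 * Num.sqrt (j.+1%:R * e ^+ 2)).
Proof.
move=> /andP[e0 e12] W0 WS Wcap /andP[mu0 mu1] A1 hW0 j z Y t2 Y0 zY.
have e1 : e <= 1 by lra.
have e01 : 0 < e <= 1 by rewrite e0.
have A0 : 0 <= A by apply: le_trans A1.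
pose i0 : int := Num.floor ((z + s) / e); pose off := z + s - i0%:~R * e.
have /andP[off0 off1] : 0 <= off < e.
  have := floor_itv ((z + s) / e); rewrite -/i0 => /andP[h1 h2].
  move: h1 h2; rewrite ler_pdivlMr// ltr_pdivrMr// /off intrD mulrDl mul1r => h1 h2.
  apply/andP; split; lra.
(* Cutting along the right edge of the backward light cone of the evaluation point makes the initial
   data finitely supported above, keeps the recursion, and leaves the value at time [j]
   untouched. *)
pose w k (i : int) := if (i + k%:Z <= i0 + j%:Z)%R then expR s * W k (z + (i - i0)%:~R * e) else 0.
pose K := 48 * A * mu ^- 3.
have mu3 : 1 <= mu ^- 3 by rewrite -exprVn exprn_ege1// invf_ge1.
have K1 : 1 <= K by rewrite /K; nra.
have w0 k i : 0 <= w k i by rewrite /w; case: ifP => // _; rewrite mulr_ge0 ?expR_ge0.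
have wS k i : w k.+1 i <= (w k (i - 1) + w k (i + 1)) / 2.
  rewrite {1}/w; case: ifP => h; last by rewrite divr_ge0// addr_ge0.
  rewrite /w !ifT; [|clear -h; lia|clear -h; lia].
  rewrite -mulrDr -mulrA ler_wpM2l ?expR_ge0//.
  apply: le_trans (WS _ _) _; rewrite le_eqVlt; apply/orP; left; apply/eqP.
  by congr ((W _ _ + W _ _) / 2); rewrite !intrD ?rmorphN /=; ring.
have wcap k i : w k i <= 12 * expR (i%:~R * e).
  rewrite /w; case: ifP => _; last by rewrite mulr_ge0// expR_ge0.
  apply: (@le_trans _ _ (expR s * (4 * expR (z + (i - i0)%:~R * e)))).
    by rewrite ler_wpM2l ?expR_ge0.
  have -> : expR s * (4 * expR (z + (i - i0)%:~R * e)) = 4 * expR off * expR (i%:~R * e).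
    rewrite mulrCA -expRD -mulrA -expRD; congr (_ * expR _).
    by rewrite /off intrD rmorphN /=; ring.
  rewrite ler_wpM2r ?expR_ge0//.
  have : expR off <= expR (1 / 2) by rewrite ler_expR; lra.
  by have := expR_half_le2; lra.
have wb (k : nat) : (1 + k%:R * e) * w 0 k%:Z <= 16 * A * mu ^- 2 * expR (- (k%:R * (mu / 2 * e))).
  have x0 : 0 <= k%:R * e by nneg.
  rewrite /w; case: ifP => _; last by rewrite mulr0; nneg.
  set x := k%:R * e + off.
  have xE : z + (k%:Z - i0)%:~R * e + s = x by rewrite intrD rmorphN /= /x /off; ring.
  have x00 : 0 <= x by rewrite addr_ge0.
  have := hW0 (z + (k%:Z - i0)%:~R * e); rewrite xE => /(_ x00) h.
  apply: (@le_trans _ _ ((1 + x) * (A * (1 + x) * expR (- (mu * x))))).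
    apply: ler_pM; [nneg | nneg | by rewrite /x; lra |].
    apply: le_trans (ler_wpM2l (expR_ge0 s) h) _.
    by rewrite [leLHS]mulrA -expRD subrr expR0 mul1r.
  have q : 1 + x <= 4 / mu * expR (mu * x / 4).
    rewrite mulrAC ler_pdivlMr//; have := expR_ge1Dx (mu * x / 4).
    by move: (expR _) => E h3; nra.
  have qq : (1 + x) * (1 + x) <= 16 * mu ^- 2 * expR (mu * x / 2).
    apply: (@le_trans _ _ ((4 / mu * expR (mu * x / 4)) * (4 / mu * expR (mu * x / 4)))).
      by apply: ler_pM => //; nneg.
    rewrite mulrACA -expRD le_eqVlt; apply/orP; left; apply/eqP.
    by congr (_ * expR _); field; rewrite ?gt_eqF.
  have -> : (1 + x) * (A * (1 + x) * expR (- (mu * x))) = A * ((1 + x) * (1 + x) * expR (- (mu * x))) by ring.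
  apply: (@le_trans _ _ (A * (16 * mu ^- 2 * expR (mu * x / 2) * expR (- (mu * x))))).
    by rewrite ler_wpM2l ?(le_trans ler01)// ler_wpM2r ?expR_ge0.
  have -> : A * (16 * mu ^- 2 * expR (mu * x / 2) * expR (- (mu * x))) =
     16 * A * mu ^- 2 * expR (- (mu * x / 2)).
    rewrite -!mulrA -expRD; have -> : mu * (x * 2^-1) + - (mu * x) = - (mu * (x * 2^-1)) by field.
    ring.
  rewrite ler_wpM2l//; first by nneg.
  by rewrite ler_expR lerN2 /x; nra.
have geo L : \sum_(0 <= k < L) (1 + k%:R * e) * w 0 k%:Z <= K / e.
  apply: (@le_trans _ _ (16 * A * mu ^- 2 * (1 + (mu / 2 * e)^-1))).
    have A160 : 0 <= 16 * A * mu ^- 2 by nneg.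
    apply: (@le_trans _ _ (\sum_(0 <= k < L) 16 * A * mu ^- 2 * expR (- (k%:R * (mu / 2 * e))))).
      exact: ler_sum.
    rewrite -mulr_sumr ler_wpM2l//; case: L => [|L].
      by rewrite big_geq//; nneg.
    rewrite big_nat_recl// mul0r oppr0 expR0 lerD2l -(big_add1 _ _ 0 L.+1 xpredT (fun k => expR (- (k%:R * (mu / 2 * e))))).
    by apply: geometric_sum; rewrite !mulr_gt0.
  have -> : K / e = 16 * A * mu ^- 2 * (3 / (mu * e)) by rewrite /K; field; rewrite !gt_eqF.
  rewrite ler_wpM2l//; first by nneg.
  have -> : (mu / 2 * e)^-1 = 2 / (mu * e) by field; rewrite !gt_eqF.
  have : 1 <= (mu * e)^-1 by rewrite invf_ge1 ?mulr_gt0//; nra.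
  by move: (mu * e)^-1 => v; lra.
have hS0 L : \sum_(0 <= k < L) w 0 k%:Z <= K / e.
  apply: le_trans (geo L); apply: ler_sum => k _.
  by rewrite -[leLHS]mul1r ler_wpM2r// lerDl mulr_ge0// ltW.
have hS1 L : \sum_(0 <= k < L) k%:R * w 0 k%:Z <= K / e ^+ 2.
  have := geo L; rewrite ler_pdivlMr// => h; rewrite expr2 invfM mulrA ler_pdivlMr// ler_pdivlMr//.
  apply: le_trans h; rewrite ler_wpM2r ?(ltW e0)// mulr_suml; apply: ler_sum => k _.
  by rewrite mulrAC ler_wpM2r// lerDr.
have supp (i : int) : (`|(i0 + j%:Z)%R|%N%:Z < i)%R -> w 0 i = 0.
  by move=> h; rewrite /w ifF//; apply/negbTE; clear -h; lia.
have := lattice_sharp_bound e01 K1 w0 wS wcap hS0 hS1 supp (j := j) (i := i0) t2 Y0.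
have i0Y : i0%:~R * e + 3 / 2 * ln (j.+1%:R * e ^+ 2) <= Y by move: off0; rewrite /off; lra.
move=> /(_ i0Y); rewrite /w lexx subrr mul0r addr0 => h.
have es : expR (- s) * expR s = 1 by rewrite -expRD addNr expR0.
have -> : W j z = expR (- s) * (expR s * W j z) by rewrite mulrA es mul1r.
apply: le_trans (ler_wpM2l (expR_ge0 (- s)) h) _.
by rewrite le_eqVlt; apply/orP; left; apply/eqP; rewrite /K; ring.
Qed.

End LineRecursion.

(** * Integration against the normal law *)

Section NormalIntegrals.

Variables (R : realType) (m s : R).

Hypothesis s0 : s != 0.

Let nu := normal_prob m s : probability (measurableTypeR R) R.

Local Notation leb := (@lebesgue_measure R).

Lemma normal_ge0_integral (g : R -> R) : measurable_fun setT g -> (forall x, 0 <= g x) ->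
  (\int[nu]_x (g x)%:E = \int[leb]_x (g x * normal_pdf m s x)%:E)%E.
Proof.
move=> mg g0; have dom : nu `<< leb by exact: normal_prob_dominates.
rewrite -(Radon_Nikodym_SigmaFinite.change_of_variables dom)//; last exact/measurable_EFinP.
have mp : measurable_fun setT (fun x => (normal_pdf m s x)%:E).
  by apply/measurable_EFinP; exact: measurable_normal_pdf.
have irn := Radon_Nikodym_SigmaFinite.f_integrable dom.
apply: ae_eq_integral => //.
- by apply: emeasurable_funM; [exact/measurable_EFinP | exact: measurable_int irn].
- by apply/measurable_EFinP/measurable_funM => //; exact: measurable_normal_pdf.
have : ae_eq leb setT (Radon_Nikodym_SigmaFinite.f nu leb) (fun x => (normal_pdf m s x)%:E).
  apply: integral_ae_eq => // E _ mE.
  by rewrite -Radon_Nikodym_SigmaFinite.f_integral.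
by apply: filterS => x h /h ->; rewrite EFinM.
Qed.

(** Completing the square: the one-dimensional Cameron-Martin formula at the level of densities. *)
Lemma normal_pdf_tilt (a x : R) :
  normal_pdf m s (x + a * s ^+ 2) * expR (a * (x + a * s ^+ 2 - m)) =
  expR (a ^+ 2 * s ^+ 2 / 2) * normal_pdf m s x.
Proof.
have pdfE y : normal_pdf m s y = normal_peak s * expR (- (y - m) ^+ 2 / (s ^+ 2 *+ 2)).
  by rewrite normal_pdfE.
rewrite !pdfE -[LHS]mulrA -expRD [RHS]mulrCA -expRD; congr (_ * expR _).
by rewrite -(mulr_natr (s ^+ 2)); field.
Qed.

Lemma lebesgue_ge0_translation (G : R -> R) (c : R) : continuous G -> (forall x, 0 <= G x) ->
  (\int[leb]_x (G x)%:E = \int[leb]_x (G (x + c))%:E)%E.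
Proof.
move=> cG G0; pose F (x : R^o) : R^o := x + c.
have dF (x : R) : is_derive (x : R) 1 F 1.
  by apply: is_derive_eq; rewrite addr0.
have F'E : F^`()%classic = cst 1.
  by apply/funext => x; rewrite derive1E; have := dF x => -[_ ->].
rewrite (@increasing_ge0_integration_by_substitutionT R F G)//.
- by apply: eq_integral => x _; rewrite F'E /= mulr1.
- by move=> x y; rewrite /F ltrD2r.
- by rewrite F'E => ?; exact: cvg_cst.
- by rewrite F'E; exact: is_cvg_cst.
- by rewrite F'E; exact: is_cvg_cst.
- exact: cvg_addrr_Ny.
- exact: cvg_addrr.
Qed.

Lemma continuous_measurable (g : R -> R) : continuous g -> measurable_fun setT g.
Proof. exact: continuous_measurable_fun. Qed.

Lemma normal_ge0_tilt (g : R -> R) (a : R) : continuous g -> (forall x, 0 <= g x) ->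
  (\int[nu]_x (g (x - m) * expR (a * (x - m)))%:E =
   (expR (a ^+ 2 * s ^+ 2 / 2))%:E * \int[nu]_x (g (x - m + a * s ^+ 2))%:E)%E.
Proof.
move=> cg g0; have cgm c : continuous (fun x => g (x - m + c)).
  move=> x; apply: (@continuous_comp _ _ _ (fun x => x - m + c) g); last exact: cg.
  by apply: cvgD; [apply: cvgB; [exact: cvg_id | exact: cvg_cst] | exact: cvg_cst].
have cE : continuous (fun x : R => expR (a * (x - m))).
  move=> x; apply: (@continuous_comp _ _ _ (fun x => a * (x - m)) expR); last exact: continuous_expR.
  by apply: cvgM; [exact: cvg_cst | apply: cvgB; [exact: cvg_id | exact: cvg_cst]].
have cgE : continuous (fun x : R => g (x - m) * expR (a * (x - m))).
  move=> x; apply: cvgM; last exact: cE.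
  by have /= := cgm 0; under eq_fun do rewrite addr0; apply.
rewrite !normal_ge0_integral//; last 3 first.
- exact: continuous_measurable.
- by move=> x; rewrite mulr_ge0 ?expR_ge0.
- exact: continuous_measurable.
rewrite (lebesgue_ge0_translation (a * s ^+ 2)); last 2 first.
- by move=> x; apply: cvgM; [exact: cgE | exact: continuous_normal_pdf].
- by move=> x; rewrite !mulr_ge0 ?expR_ge0 ?normal_pdf_ge0.
rewrite -ge0_integralZl//; last 2 first.
- apply/measurable_EFinP/measurable_funM; last exact: measurable_normal_pdf.
  exact: continuous_measurable.
- by move=> x _; rewrite lee_fin mulr_ge0 ?normal_pdf_ge0.
apply: eq_integral => x _; rewrite -EFinM; congr EFin.
rewrite [RHS]mulrCA -normal_pdf_tilt -[LHS]mulrA.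
by congr (g _ * _); [rewrite addrAC | rewrite mulrC].
Qed.

Definition normal_mean (g : R -> R) : R := \int[nu]_x g (x - m).

Definition normal_summable (g : R -> R) : Prop :=
  nu.-integrable setT (fun x => (g (x - m))%:E).

Lemma continuous_center (g : R -> R) : continuous g -> continuous (fun x => g (x - m)).
Proof.
move=> cg x; apply: (@continuous_comp _ _ _ (fun x => x - m) g); last exact: cg.
by apply: cvgB; [exact: cvg_id | exact: cvg_cst].
Qed.

Lemma normal_mgf_ge0 (a : R) :
  (\int[nu]_x (expR (a * (x - m)))%:E = (expR (a ^+ 2 * s ^+ 2 / 2))%:E)%E.
Proof.
have := @normal_ge0_tilt (cst 1) a (fun x => cvg_cst _) (fun x => ler01).
under eq_integral do rewrite /= mul1r.
move=> ->; under eq_integral do rewrite /=.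
by rewrite integral_cst//= probability_setT mule1 mule1.
Qed.

Lemma summable_expR (a : R) : normal_summable (fun y => expR (a * y)).
Proof.
apply/integrableP; split.
  apply/measurable_EFinP; apply: continuous_measurable.
  apply: (@continuous_center (fun y => expR (a * y))) => x.
  apply: (@continuous_comp _ _ _ ( *%R a) expR); last exact: continuous_expR.
  by apply: cvgM; [exact: cvg_cst | exact: cvg_id].
rewrite -/nu; under eq_integral do rewrite /= ger0_norm ?expR_ge0//.
by rewrite normal_mgf_ge0 ltry.
Qed.

Lemma summable_cosh (C a : R) : normal_summable (fun y => C * (expR (a * y) + expR (- (a * y)))).
Proof.
rewrite /normal_summable; have -> : (fun x => (C * (expR (a * (x - m)) + expR (- (a * (x - m)))))%:E) =
   (fun x => C%:E * ((expR (a * (x - m)))%:E + (expR (- a * (x - m)))%:E))%E.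
  by apply/funext => x; rewrite mulNr.
by apply: integrableZl => //; apply: integrableD => //; exact: summable_expR.
Qed.

Lemma summable_dominated (g : R -> R) (C a : R) : continuous g ->
  (forall y, `|g y| <= C * (expR (a * y) + expR (- (a * y)))) -> normal_summable g.
Proof.
move=> cg gC; apply: (le_integrable measurableT _ _ (summable_cosh C a)) => //.
  by apply/measurable_EFinP; apply: continuous_measurable; exact: continuous_center.
by move=> x _; rewrite !abse_EFin lee_fin (le_trans (gC _))// ler_norm.
Qed.

Lemma is_derive_normal_mean (f df : R -> R -> R) (C b a : R) : 
  (forall c, continuous (f c)) -> 
  (forall c y : R, is_derive (c : R) 1 (f^~ y) (df c y)) ->
  (forall c y, `|c| <= `|a| + 1 -> `|f c y| <= C * (expR (b * y) + expR (- (b * y)))) ->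
  (forall c y, `|c| <= `|a| + 1 -> `|df c y| <= C * (expR (b * y) + expR (- (b * y)))) ->
  is_derive (a : R) 1 (fun c => normal_mean (f c)) (normal_mean (df a)).
Proof.
move=> cf fd fC dfC.
have aI : (`]a - 1, a + 1[%classic : set R) a.
  by rewrite /= in_itv/= ltrDl ltr01 ltrBlDr ltrDl ltr01.
have cI (c : R) : (`]a - 1, a + 1[%classic : set R) c -> `|c| <= `|a| + 1.
  rewrite /= in_itv/= => /andP[c1 c2].
  have := ler_norm a; have := ler_norm (- a); rewrite normrN => h1 h2.
  by rewrite ler_norml; apply/andP; split; lra.
have C0 : 0 <= C.
  have := dfC 0 0; rewrite normr0 => /(_ (ltac:(have := normr_ge0 a; lra))).
  by rewrite mulr0 oppr0 expR0 => h; have := normr_ge0 (df 0 0); lra.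
have i1 c : (`]a - 1, a + 1[%classic : set R) c -> nu.-integrable setT (EFin \o (fun x => f c (x - m))).
  by move=> /cI ca; apply: summable_dominated (fun y => fC c y ca).
have d1 c x : (`]a - 1, a + 1[%classic : set R) c -> setT x -> derivable (fun c => f c (x - m)) c 1.
  by move=> _ _; case: (fd c (x - m)).
have G0 x : 0 <= C * (expR (b * (x - m)) + expR (- (b * (x - m)))).
  by rewrite mulr_ge0// addr_ge0// expR_ge0.
have pE c x : partial1of2 (fun c x => f c (x - m)) c x = df c (x - m).
  by rewrite /partial1of2 derive1E; case: (fd c (x - m)).
have dd c x : (`]a - 1, a + 1[%classic : set R) c -> setT x ->
    `|partial1of2 (fun c x => f c (x - m)) c x| <= C * (expR (b * (x - m)) + expR (- (b * (x - m)))).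
  by move=> /cI ca _; rewrite pE; exact: dfC.
have := differentiation_under_integral measurableT aI i1 d1 G0 (summable_cosh C b) dd.
have dv := derivable_under_integral measurableT aI i1 d1 G0 (summable_cosh C b) dd.
rewrite derive1E => e; apply: DeriveDef; first exact: dv.
by rewrite [LHS]e; apply: eq_Rintegral => x _; rewrite pE.
Qed.

End NormalIntegrals.

(** * Moments and characteristic function of the normal law *)

Section NormalCharacteristic.

Variables (R : realType) (m s : R).

Hypothesis s0 : s != 0.

Local Notation M := (normal_mean m s).

Local Notation sumM := (normal_summable m s).

Lemma abs_le_exp2 (y : R) : `|y| <= 2 * expR `|y| /\ y ^+ 2 <= 2 * expR `|y|.
Proof.
have y0 := normr_ge0 y; have h := expR_ge1Dx `|y|; split; first by lra.
have : expR (`|y| / 4) ^+ 4 = expR `|y| by rewrite -expRM_natl; congr expR; field.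
have h1 := expR_ge1Dx (`|y| / 4).
have -> : y ^+ 2 = `|y| ^+ 2 by rewrite real_normK ?num_real.
move=> <-; have h2 : (1 + `|y| / 4) ^+ 4 <= expR (`|y| / 4) ^+ 4.
  by rewrite lerXn2r ?nnegrE ?expR_ge0//; lra.
apply: le_trans (_ : 2 * (1 + `|y| / 4) ^+ 4 <= _); last by rewrite ler_pM2l.
have h3 : `|y| <= (1 + `|y| / 4) ^+ 2 by have := sqr_ge0 (1 - `|y| / 4); lra.
have : `|y| ^+ 2 <= ((1 + `|y| / 4) ^+ 2) ^+ 2 by rewrite lerXn2r ?nnegrE ?sqr_ge0.
by rewrite -exprM => h4; have := sqr_ge0 `|y|; lra.
Qed.

Lemma expR_norm_le (y : R) : expR `|y| <= expR y + expR (- y).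
Proof. by case: (ger0P y) => _; rewrite ?lerDl ?lerDr expR_ge0. Qed.

Lemma dominated_exp (p C b c y : R) : 1 <= C -> `|p| <= 2 * expR `|y| -> `|c| + 1 <= b ->
  `|p * expR (c * y)| <= 2 * C * (expR (b * y) + expR (- (b * y))).
Proof.
move=> C1 py cb; rewrite normrM (ger0_norm (expR_ge0 _)).
have hc : 0 <= `|c| by [].
have E0 : 0 <= expR (b * y) + expR (- (b * y)) by rewrite addr_ge0 ?expR_ge0.
rewrite (@le_trans _ _ (2 * (expR `|y| * expR (c * y))))//.
  by rewrite mulrA ler_wpM2r ?expR_ge0.
rewrite -mulrA ler_pM2l// -expRD.
suff : expR (`|y| + c * y) <= expR (b * y) + expR (- (b * y)) by move=> h; nra.
have h : `|y| + c * y <= `|b * y|.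
  rewrite normrM (@ger0_norm _ b); last lra.
  have := ler_norm (c * y); rewrite normrM => h; have := normr_ge0 y; nra.
rewrite (@le_trans _ _ (expR `|b * y|)) ?ler_expR//.
by case: (ger0P (b * y)) => _; rewrite ?lerDl ?lerDr expR_ge0.
Qed.

Lemma continuous_expRM (c : R) : continuous (fun y : R => expR (c * y)).
Proof.
move=> x; apply: (@continuous_comp _ _ _ ( *%R c) expR); last exact: continuous_expR.
by apply: cvgM; [exact: cvg_cst | exact: cvg_id].
Qed.

Lemma normal_mean_expR (a : R) : M (fun y => expR (a * y)) = expR (a ^+ 2 * s ^+ 2 / 2).
Proof. by rewrite /normal_mean /Rintegral normal_mgf_ge0. Qed.

Lemma derive_unique (f : R -> R) (x a b : R) : is_derive x 1 f a -> is_derive x 1 f b -> a = b.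
Proof. by move=> [_ <-] [_ <-]. Qed.

Lemma normal_summable_exp (p : R -> R) (c : R) : continuous p ->
  (forall y, `|p y| <= 2 * expR `|y|) -> sumM (fun y => p y * expR (c * y)).
Proof.
move=> cp hp; apply: (@summable_dominated _ m s s0 _ (2 * 1) (`|c| + 1)).
  by move=> x; apply: cvgM; [exact: cp | exact: continuous_expRM].
by move=> y; apply: dominated_exp.
Qed.

Lemma is_derive_mean_tilt (p : R -> R) (a : R) : continuous p ->
  (forall y, `|p y| <= 2 * expR `|y|) -> (forall y, `|y * p y| <= 2 * expR `|y|) ->
  is_derive (a : R) 1 (fun c => M (fun y => p y * expR (c * y))) (M (fun y => y * p y * expR (a * y))).
Proof.
move=> cp h1 h2.
apply: (@is_derive_normal_mean _ m s s0 (fun c y => p y * expR (c * y))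
  (fun c y => y * p y * expR (c * y)) (2 * 1) (`|a| + 2)).
- by move=> c x; apply: cvgM; [exact: cp | exact: continuous_expRM].
- move=> c y; have h : is_derive (c : R) 1 (fun c => expR (c * y)) (expR (c * y) * y).
    have h0 : is_derive (c : R) 1 (fun c : R => c * y) y.
      by apply: is_derive_eq; rewrite scaler0 add0r /GRing.scale/= mulr1.
    exact: (@is_derive1_comp _ expR (fun c => c * y)).
  by apply: is_derive_eq; rewrite /GRing.scale/=; ring.
- by move=> c y ca; apply: dominated_exp => //; lra.
- by move=> c y ca; apply: dominated_exp => //; lra.
Qed.

Lemma normal_mean_eq (f g : R -> R) : f =1 g -> M f = M g.
Proof. by move=> fg; apply: eq_Rintegral => x _; rewrite fg. Qed.

Lemma is_derive_gauss (a : R) :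
  is_derive (a : R) 1 (fun a => expR (a ^+ 2 * s ^+ 2 / 2)) (expR (a ^+ 2 * s ^+ 2 / 2) * (a * s ^+ 2)).
Proof.
have h0 : is_derive (a : R) 1 (fun a : R => a ^+ 2 * s ^+ 2 / 2) (a * s ^+ 2).
  by apply: is_derive_eq; rewrite /GRing.scale/=; field.
exact: (@is_derive1_comp _ expR (fun a => a ^+ 2 * s ^+ 2 / 2)).
Qed.

Lemma normal_mean_id_tilt (a : R) :
  M (fun y => y * expR (a * y)) = expR (a ^+ 2 * s ^+ 2 / 2) * (a * s ^+ 2).
Proof.
apply: derive_unique (is_derive_gauss a).
have H : is_derive (a : R) 1 (fun c => M (fun y => cst 1 y * expR (c * y))) (M (fun y => y * cst 1 y * expR (a * y))).
  apply: is_derive_mean_tilt => y; first exact: cvg_cst.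
    by rewrite /= normr1; have := expR_ge1Dx `|y|; have := normr_ge0 y; lra.
  by rewrite /= mulr1; case: (abs_le_exp2 y).
rewrite (@normal_mean_eq _ (fun y => y * cst 1 y * expR (a * y))); last by move=> y /=; rewrite mulr1.
suff -> : (fun a => expR (a ^+ 2 * s ^+ 2 / 2)) = (fun c => M (fun y => cst 1 y * expR (c * y))) by [].
apply/funext => c; rewrite -normal_mean_expR.
by apply: normal_mean_eq => y; rewrite /= mul1r.
Qed.

Lemma normal_mean_id : M id = 0.
Proof.
have := normal_mean_id_tilt 0; rewrite mul0r mulr0 => <-.
by apply: normal_mean_eq => y; rewrite mul0r expR0 mulr1.
Qed.

Lemma normal_mean_sqr : M (fun y => y ^+ 2) = s ^+ 2.
Proof.
have : is_derive (0 : R) 1 (fun a => expR (a ^+ 2 * s ^+ 2 / 2) * (a * s ^+ 2)) (s ^+ 2).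
  have := is_derive_gauss 0 => h; apply: is_derive_eq.
  by rewrite /GRing.scale/= expr0n/= !mul0r expR0 /=; ring.
under eq_fun do rewrite -normal_mean_id_tilt.
move=> h; apply: derive_unique h.
rewrite (@normal_mean_eq _ (fun y => y * y * expR (0 * y))); last by move=> y; rewrite mul0r expR0 mulr1.
apply: (@is_derive_mean_tilt id).
- by move=> x; exact: cvg_id.
- by move=> y; case: (abs_le_exp2 y).
- move=> y; have [_] := abs_le_exp2 y.
  by rewrite -expr2 (@ger0_norm _ (y ^+ 2)) ?sqr_ge0.
Qed.

Lemma continuous_cos_affine (t p : R) : continuous (fun y : R => cos (t * y + p)).
Proof.
move=> x; apply: (@continuous_comp _ _ _ (fun y => t * y + p) cos); last exact: continuous_cos.
by apply: cvgD; [apply: cvgM; [exact: cvg_cst | exact: cvg_id] | exact: cvg_cst].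
Qed.

Lemma abs_cos_le (x : R) : `|cos x| <= 1.
Proof. by rewrite ler_norml cos_geN1 cos_le1. Qed.

Lemma cos_dom (x y : R) : `|cos x| <= 2 * expR `|y| /\ `|y * cos x| <= 2 * expR `|y|.
Proof.
have h := abs_cos_le x; have := expR_ge1Dx `|y|; have := normr_ge0 y => y0 e1.
split; first lra.
by rewrite normrM; have [+ _] := abs_le_exp2 y; have := normr_ge0 (cos x); nra.
Qed.

(** The tilt formula is available for nonnegative functions, hence for [1 + cos]; the contribution
    of the constant is subtracted afterwards. *)
Lemma normal_mean_cos_tilt (t p a : R) :
  M (fun y => cos (t * y + p) * expR (a * y)) =
  expR (a ^+ 2 * s ^+ 2 / 2) * M (fun y => cos (t * y + (p + t * (a * s ^+ 2)))).
Proof.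
have cg : continuous (fun y => 1 + cos (t * y + p)).
  by move=> x; apply: cvgD; [exact: cvg_cst | exact: continuous_cos_affine].
have g0 y : 0 <= 1 + cos (t * y + p) by have := cos_geN1 (t * y + p); lra.
have c1 y : `|cst 1 y : R| <= 2 * expR `|y|.
  by rewrite /= normr1; have := expR_ge1Dx `|y|; have := normr_ge0 y; lra.
have cE b : sumM (fun y => cst 1 y * expR (b * y)).
  by apply: normal_summable_exp => //; move=> x; exact: cvg_cst.
have cC q b : sumM (fun y => cos (t * y + q) * expR (b * y)).
  apply: normal_summable_exp; first exact: continuous_cos_affine.
  by move=> y; case: (cos_dom (t * y + q) y).
have MD q b : M (fun y => (1 + cos (t * y + q)) * expR (b * y)) =
    expR (b ^+ 2 * s ^+ 2 / 2) + M (fun y => cos (t * y + q) * expR (b * y)).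
  rewrite -(normal_mean_expR b) [X in X + _](@normal_mean_eq _ (fun y => cst 1 y * expR (b * y))); last first.
    by move=> y; rewrite /= mul1r.
  rewrite /normal_mean -RintegralD//; last 2 first.
  - exact: cE.
  - exact: cC.
  by apply: eq_Rintegral => x _; rewrite /= -mulrDl.
have E : M (fun y => (1 + cos (t * y + p)) * expR (a * y)) =
    expR (a ^+ 2 * s ^+ 2 / 2) * M (fun y => 1 + cos (t * (y + a * s ^+ 2) + p)).
  have H := @normal_ge0_tilt _ m s s0 (fun y => 1 + cos (t * y + p)) a cg g0.
  rewrite /normal_mean /Rintegral H fineM//.
  have fi := MD (p + t * (a * s ^+ 2)) 0.
  have i1 := integrableD measurableT (cE 0) (cC (p + t * (a * s ^+ 2)) 0).
  suff <- : ((fun x : measurableTypeR R => (cst 1 (x - m) * expR (0 * (x - m)))%:E) \+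
      (fun x : measurableTypeR R => (cos (t * (x - m) + (p + t * (a * s ^+ 2))) * expR (0 * (x - m)))%:E))%E =
      (fun x : measurableTypeR R => (1 + cos (t * (x - m + a * s ^+ 2) + p))%:E).
    exact: integrable_fin_num i1.
  apply/funext => x; rewrite /= mul0r expR0 !mulr1 -EFinD; congr (_ + cos _)%:E; ring.
move: E; rewrite MD => E.
have := MD (p + t * (a * s ^+ 2)) 0.
rewrite expr0n/= !mul0r expR0 (@normal_mean_eq _ (fun y => 1 + cos (t * (y + a * s ^+ 2) + p))); last first.
  by move=> y; rewrite mul0r expR0 mulr1; congr (_ + cos _); ring.
rewrite [in RHS](@normal_mean_eq _ (fun y => cos (t * y + (p + t * (a * s ^+ 2))))); last first.
  by move=> y; rewrite mul0r expR0 mulr1.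
by move=> E2; move: E; rewrite E2; lra.
Qed.

(** Gaussian integration by parts for the cosine, obtained by differentiating the tilt formula at
    [a = 0] in two ways. *)
Lemma normal_mean_id_cos (t p : R) :
  M (fun y => y * cos (t * y + p)) = - (t * s ^+ 2) * M (fun y => sin (t * y + p)).
Proof.
have sumc q : sumM (fun y => cos (t * y + q)).
  have : sumM (fun y => cos (t * y + q) * expR (0 * y)).
    apply: normal_summable_exp; first exact: continuous_cos_affine.
    by move=> y; case: (cos_dom (t * y + q) y).
  by congr normal_summable; apply/funext => y; rewrite mul0r expR0 mulr1.
have sinE y : sin (t * y + p) = cos (t * y + (p - pi / 2)) by rewrite addrA cosBpihalf.
have tiltE (a : R) : M (fun y => cos (t * y + p) * expR (a * y)) =
   expR (a ^+ 2 * s ^+ 2 / 2) * (cos (t * (a * s ^+ 2)) * M (fun y => cos (t * y + p)) -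
     sin (t * (a * s ^+ 2)) * M (fun y => sin (t * y + p))).
  rewrite normal_mean_cos_tilt; congr (_ * _).
  have sums : sumM (fun y => sin (t * y + p)).
    by have := sumc (p - pi / 2); congr normal_summable; apply/funext => y; rewrite sinE.
  have e1 c : c * M (fun y => cos (t * y + p)) = M (fun y => c * cos (t * y + p)).
    by rewrite /normal_mean RintegralZl//; exact: sumc.
  have e2 c : c * M (fun y => sin (t * y + p)) = M (fun y => c * sin (t * y + p)).
    by rewrite /normal_mean RintegralZl//; exact: sums.
  rewrite e1 e2 /normal_mean -RintegralB//; last 2 first.
  - exact: (integrableZl measurableT _ (sumc p)).
  - exact: (integrableZl measurableT _ sums).
  by apply: eq_Rintegral => x _; rewrite addrA cosD; ring.
have d1 : is_derive (0 : R) 1 (fun c => M (fun y => cos (t * y + p) * expR (c * y)))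
    (M (fun y => y * cos (t * y + p) * expR (0 * y))).
  apply: is_derive_mean_tilt; first exact: continuous_cos_affine.
  - by move=> y; case: (cos_dom (t * y + p) y).
  - by move=> y; case: (cos_dom (t * y + p) y).
have lin : is_derive (0 : R) 1 (fun a : R => t * (a * s ^+ 2)) (t * s ^+ 2).
  by apply: is_derive_eq; rewrite /GRing.scale/=; ring.
have d2 : is_derive (0 : R) 1 (fun c => M (fun y => cos (t * y + p) * expR (c * y)))
    (- (t * s ^+ 2) * M (fun y => sin (t * y + p))).
  under eq_fun do rewrite tiltE.
  have dg := is_derive_gauss 0.
  have dc : is_derive (0 : R) 1 (fun a : R => cos (t * (a * s ^+ 2))) (- sin (t * (0 * s ^+ 2)) * (t * s ^+ 2)).
    exact: (@is_derive1_comp _ cos (fun a => t * (a * s ^+ 2))).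
  have ds : is_derive (0 : R) 1 (fun a : R => sin (t * (a * s ^+ 2))) (cos (t * (0 * s ^+ 2)) * (t * s ^+ 2)).
    exact: (@is_derive1_comp _ sin (fun a => t * (a * s ^+ 2))).
  apply: is_derive_eq; rewrite /GRing.scale/= expr0n/= !(mul0r, mulr0) expR0 sin0 cos0; ring.
rewrite -(derive_unique d1 d2); apply: normal_mean_eq => y.
by rewrite mul0r expR0 mulr1.
Qed.

(** Integration by parts shows that [Phi(t) = M (cos (t y + p))] solves [Phi' = - t s^2 Phi]; hence
    [e^(t^2 s^2 / 2) Phi(t)] is constant, and its values at 0 and 1 are compared. *)
Lemma normal_cos (p : R) : M (fun y => cos (y + p)) = expR (- (s ^+ 2 / 2)) * cos p.
Proof.
have dPhi (t : R) : is_derive (t : R) 1 (fun t => M (fun y => cos (t * y + p)))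
    (- (t * s ^+ 2 * M (fun y => cos (t * y + p)))).
  have d0 : is_derive (t : R) 1 (fun t => M (fun y => cos (t * y + p)))
      (M (fun y => - (y * sin (t * y + p)))).
    apply: (@is_derive_normal_mean _ m s s0 (fun t y => cos (t * y + p))
      (fun t y => - (y * sin (t * y + p))) 2 1).
    - by move=> c; exact: continuous_cos_affine.
    - move=> c y; have h : is_derive (c : R) 1 (fun c => c * y + p) y.
        by apply: is_derive_eq; rewrite /GRing.scale/=; ring.
      have -> : - (y * sin (c * y + p)) = - sin (c * y + p) * y by ring.
      exact: (@is_derive1_comp _ cos (fun c => c * y + p)).
    - move=> c y _; have [h _] := cos_dom (c * y + p) y; apply: (le_trans h).
      by rewrite ler_pM2l// mul1r expR_norm_le.
    - move=> c y _; rewrite -cosBpihalf normrN; have [_ h] := cos_dom (c * y + p - pi / 2) y; apply: (le_trans h).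
      by rewrite ler_pM2l// mul1r expR_norm_le.
  have -> : - (t * s ^+ 2 * M (fun y => cos (t * y + p))) = M (fun y => - (y * sin (t * y + p))).
    rewrite (@normal_mean_eq (fun y => - (y * sin (t * y + p))) (fun y => y * cos (t * y + (p + pi / 2)))); last first.
      by move=> y; rewrite addrA cosDpihalf mulrN.
    rewrite normal_mean_id_cos (@normal_mean_eq (fun y => sin (t * y + (p + pi / 2))) (fun y => cos (t * y + p))).
      by rewrite mulNr.
    by move=> y; rewrite addrA sinDpihalf.
  exact: d0.
have dK (t : R) : is_derive (t : R) 1
    (fun t => expR (t ^+ 2 * s ^+ 2 / 2) * M (fun y => cos (t * y + p))) 0.
  have h1 := is_derive_gauss t; have h2 := dPhi t.
  by apply: is_derive_eq; rewrite /GRing.scale/=; ring.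
have := is_derive_0_is_cst 1 0 dK.
rewrite expr1n expr0n/= !mul0r expR0 !mul1r => h.
rewrite expRN -[RHS]mulrC; apply: (@mulfI _ (expR (s ^+ 2 / 2))); first by rewrite gt_eqF ?expR_gt0.
rewrite [RHS]mulrCA mulfV ?gt_eqF ?expR_gt0// mulr1.
move: h; rewrite (@normal_mean_eq _ (fun y => cos (y + p))); last by move=> y; rewrite mul1r.
move=> ->; rewrite (@normal_mean_eq _ (cst (cos p))); last by move=> y; rewrite mul0r add0r.
by rewrite /normal_mean /Rintegral /= integral_cst//= probability_setT mule1.
Qed.

End NormalCharacteristic.

(** * Random variables with a Gaussian law *)

Section GaussianVariable.

Context (R : realType) (d : measure_display) (Omega : measurableType d).

Variables (P : probability Omega R) (Z : Omega -> R).

Hypothesis mZ : measurable_fun setT Z.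

Section Transfer.

Variable nu : probability (measurableTypeR R) R.

Hypothesis lawZ : forall A : set R, measurable A -> P [set w | A (Z w)] = nu A.

Lemma transfer_ge0 (g : R -> R) : continuous g -> (forall x, 0 <= g x) ->
  (\int[P]_w (g (Z w))%:E = \int[nu]_x (g x)%:E)%E.
Proof.
move=> cg g0; have mg : measurable_fun setT (fun x : measurableTypeR R => (g x)%:E).
  by apply/measurable_EFinP; exact: continuous_measurable_fun.
rewrite -[LHS](@ge0_integral_pushforward _ _ _ _ _ (Z : Omega -> measurableTypeR R) mZ P setT (fun x => (g x)%:E))//; last by move=> x _; rewrite lee_fin.
by apply: eq_measure_integral => A mA _; exact: lawZ.
Qed.

Lemma transfer_integrable (g : R -> R) : continuous g ->
  nu.-integrable setT (fun x => (g x)%:E) ->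
  P.-integrable setT (fun w => (g (Z w))%:E) /\ \int[P]_w g (Z w) = \int[nu]_x g x.
Proof.
move=> cg /integrableP[mg gi].
have mgZ : measurable_fun setT (fun w => (g (Z w))%:E).
  apply/measurable_EFinP; apply: (measurableT_comp (f := g)) => //.
  exact: continuous_measurable_fun.
have iP : P.-integrable setT (fun w => (g (Z w))%:E).
  apply/integrableP; split => //.
  have cn : continuous (fun x => `|g x|) by move=> x; apply: cvg_norm; exact: cg.
  have := transfer_ge0 cn (fun x => normr_ge0 _) => h.
  by under eq_integral do rewrite abse_EFin; rewrite h.
split=> //; rewrite /Rintegral; congr fine.
rewrite -[LHS](@integral_pushforward _ _ _ _ _ (Z : Omega -> measurableTypeR R) mZ P setT (fun x => (g x)%:E))//.
by apply: eq_measure_integral => A mA _; exact: lawZ.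
Qed.

End Transfer.

(** The degenerate and the nondegenerate law are treated apart, since [gaussian_law] is a Dirac mass
    for [s = 0]; in both cases the vanishing mean forces [m = 0]. The absence of an atom at 0 later
    excludes ties of the field. *)
Lemma gaussian_variable : 
  (exists m s, forall A : set R, measurable A -> P [set w | A (Z w)] = gaussian_law m s A) ->
  \int[P]_w Z w = 0 ->
  exists s : R, [/\ P.-integrable setT (fun w => (Z w ^+ 2)%:E), \int[P]_w (Z w ^+ 2) = s ^+ 2,
    s != 0 -> P [set w | Z w = 0] = 0%E
    & forall p, \int[P]_w cos (Z w + p) = expR (- (s ^+ 2 / 2)) * cos p].
Proof.
move=> [m [s]]; rewrite /gaussian_law; have [_ | s0] := eqVneq s 0 => law EZ.
  have tr (g : R -> R) : continuous g -> P.-integrable setT (fun w => (g (Z w))%:E) /\ \int[P]_w g (Z w) = g m.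
    move=> cg; have mg : measurable_fun setT (fun x : measurableTypeR R => (g x)%:E).
      by apply/measurable_EFinP; exact: continuous_measurable_fun.
    have [] := @transfer_integrable (@dirac _ (measurableTypeR R) m R : probability (measurableTypeR R) R) law g cg.
      apply/integrableP; split => //; rewrite integral_dirac ?ltry//.
      by apply: measurableT_comp mg.
    by move=> ? ->; split => //; rewrite /Rintegral integral_dirac// diracT mul1e.
  have m0 : m = 0 by have [_] := tr id (fun x => cvg_id); rewrite EZ.
  exists 0; split => [||/eqP//|p].
  - by have [] := tr (fun x => x ^+ 2) (@exprn_continuous _ 2).
  - by have [_ ->] := tr (fun x => x ^+ 2) (@exprn_continuous _ 2); rewrite m0.
  - have cp : continuous (fun y : R => cos (y + p)).
      by have := @continuous_cos_affine R 1 p; under eq_fun do rewrite mul1r.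
    have [_ ->] := tr _ cp.
    by rewrite m0 add0r expr0n/= mul0r oppr0 expR0 mul1r.
pose nu := normal_prob m s : probability (measurableTypeR R) R.
have tr (g : R -> R) C a : continuous g -> (forall y, `|g y| <= C * (expR (a * y) + expR (- (a * y)))) ->
    P.-integrable setT (fun w => (g (Z w - m))%:E) /\ \int[P]_w g (Z w - m) = normal_mean m s g.
  move=> cg gC; have := summable_dominated m s0 cg gC; rewrite /normal_summable => h.
  by have [] := @transfer_integrable nu law (fun x => g (x - m)) (continuous_center cg) h.
have b1 (y : R) : `|y| <= 2 * (expR (1 * y) + expR (- (1 * y))).
  by rewrite mul1r; have [h _] := abs_le_exp2 y; have := expR_norm_le y; lra.
have b2 (y : R) : `|y ^+ 2| <= 2 * (expR (1 * y) + expR (- (1 * y))).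
  rewrite mul1r (@ger0_norm _ (y ^+ 2)) ?sqr_ge0//.
  by have [_ h] := abs_le_exp2 y; have := expR_norm_le y; lra.
have m0 : m = 0.
  have [i1] := tr id 2 1 (fun x => cvg_id) b1.
  rewrite (normal_mean_id m s0) RintegralB//; last 2 first.
  - have -> : EFin \o Z = ((fun w => (Z w - m)%:E) \+ (fun=> m%:E))%E.
      by apply/funext => w; rewrite /= -EFinD subrK.
    by apply: integrableD => //; exact: finite_measure_integrable_cst.
  - exact: finite_measure_integrable_cst.
  rewrite EZ Rintegral_cst//= probability_setT /= mulr1; lra.
exists s; split.
- by have [] := tr (fun x => x ^+ 2) 2 1 (@exprn_continuous _ 2) b2; rewrite m0; under eq_fun do rewrite subr0.
- have [_] := tr (fun x => x ^+ 2) 2 1 (@exprn_continuous _ 2) b2; rewrite normal_mean_sqr//.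
  by rewrite m0; under eq_Rintegral do rewrite subr0.
- move=> _; have -> : [set w | Z w = 0] = [set w | [set 0%R] (Z w)] by [].
  rewrite law//.
  have /null_content_dominatesP := @normal_prob_dominates R m s; apply => //.
  exact: lebesgue_measure_set1.
- move=> p; have cp : continuous (fun y : R => cos (y + p)).
    have := @continuous_cos_affine R 1 p; by under eq_fun do rewrite mul1r.
  have cb (y : R) : `|cos (y + p)| <= 2 * (expR (1 * y) + expR (- (1 * y))).
    have [h _] := cos_dom (y + p) y; apply: (le_trans h).
    by rewrite mul1r ler_pM2l// expR_norm_le.
  have [_] := tr _ 2 1 cp cb.
  by rewrite normal_cos// m0 => <-; under [RHS]eq_Rintegral do rewrite subr0.
Qed.

End GaussianVariable.

(** * Commuting averaging operators *)

Section ShiftOperators.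

Variables (R : realType) (V : lmodType R).

Implicit Types (F G : V -> R) (L : seq (R * V)) (st : R * V).

(* A step [(p, v)] averages over a centred two-point law on the line spanned by [v], with covariance [v v^T]. *)
Definition stp st F (x : V) : R :=
  st.1 * F (x + Num.sqrt ((1 - st.1) / st.1) *: st.2) +
  (1 - st.1) * F (x - Num.sqrt (st.1 / (1 - st.1)) *: st.2).

Definition run L F := foldr stp F L.

Definition admissible L := all (fun st => 0 < st.1 < 1) L.

Lemma stp_mono st F G : 0 < st.1 < 1 -> (forall x, F x <= G x) -> forall x, stp st F x <= stp st G x.
Proof.
by move=> /andP[p0 p1] FG x; rewrite lerD// ler_wpM2l ?FG// ?ltW// subr_gt0.
Qed.

Lemma run_mono L F G : admissible L -> (forall x, F x <= G x) -> forall x, run L F x <= run L G x.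
Proof. by elim: L => //= st L IH /andP[h1 h2] FG; apply: stp_mono => //; exact: IH. Qed.

Lemma stp_lin st a b F G x : stp st (fun y => a * F y + b * G y) x = a * stp st F x + b * stp st G x.
Proof. by rewrite /stp; ring. Qed.

Lemma eq_stp st F G : F =1 G -> stp st F =1 stp st G.
Proof. by move=> FG x; rewrite /stp !FG. Qed.

Lemma eq_run L F G : F =1 G -> run L F =1 run L G.
Proof. by move=> FG; elim: L => //= st L IH; exact: eq_stp. Qed.

Lemma run_lin L a b F G x : run L (fun y => a * F y + b * G y) x = a * run L F x + b * run L G x.
Proof.
elim: L x => //= st L IH x; rewrite -stp_lin; exact: eq_stp.
Qed.

Lemma stp_const st c x : stp st (fun=> c) x = c.
Proof. by rewrite /stp; ring. Qed.

Lemma run_const L c x : run L (fun=> c) x = c.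
Proof. by elim: L x => //= st L IH x; rewrite (eq_stp st IH) stp_const. Qed.

Lemma run_sum (J : Type) (r : seq J) L (F : J -> V -> R) x :
  run L (fun y => \sum_(j <- r) F j y) x = \sum_(j <- r) run L (F j) x.
Proof.
elim: r => [|j r IH].
  by rewrite big_nil -[RHS](run_const L 0 x); apply: eq_run => y; rewrite big_nil.
rewrite big_cons -IH -[in RHS](mul1r (run L (F j) x)) -[X in _ + X]mul1r -run_lin.
by apply: eq_run => y; rewrite big_cons !mul1r.
Qed.

Lemma run_le_add L F G c x : admissible L -> (forall x, F x <= G x + c) -> run L F x <= run L G x + c.
Proof.
move=> aL h; rewrite -[X in _ + X](run_const L c x) -[X in X + _]mul1r -[X in _ + X]mul1r -run_lin.
by apply: run_mono => // y; rewrite !mul1r.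
Qed.

Lemma stp_comm s t F x : stp s (stp t F) x = stp t (stp s F) x.
Proof.
rewrite /stp !mulrDr !mulrA; set a := Num.sqrt _; set b := Num.sqrt _; set c := Num.sqrt _; set e := Num.sqrt _.
have E u v : x + u + v = x + v + u by rewrite addrAC.
rewrite (E (b *: t.2) (a *: s.2)) (E (b *: t.2) (- (e *: s.2))).
rewrite (E (- (c *: t.2)) (a *: s.2)) (E (- (c *: t.2)) (- (e *: s.2))).
move: (F _) (F _) (F _) (F _) => f1 f2 f3 f4; ring.
Qed.

Lemma run_cat L L' F : run (L ++ L') F = run L (run L' F).
Proof. by rewrite /run foldr_cat. Qed.

Lemma run_stp L st F : run L (stp st F) =1 stp st (run L F).
Proof. by elim: L => //= s L IH x; rewrite (eq_stp s IH) stp_comm. Qed.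

Lemma run_comm L L' F : run L (run L' F) =1 run L' (run L F).
Proof.
elim: L => //= st L IH x; rewrite (eq_stp st IH); exact/esym/run_stp.
Qed.

Lemma run_perm L L' F : perm_eq L L' -> run L F =1 run L' F.
Proof.
elim: L L' F => [|st L IH] L' F; first by rewrite perm_sym => /perm_nilP ->.
move=> pL; have stL : st \in L' by rewrite -(perm_mem pL) mem_head.
case/splitPr: stL pL => L1 L2 pL x.
rewrite run_cat /= run_stp; apply: eq_stp => y.
rewrite -run_cat; apply: IH; move: pL.
by rewrite -cat1s perm_sym -[st :: L2]cat1s perm_catCA /= perm_cons perm_sym.
Qed.

Definition rpt m L := flatten (nseq m L).

Lemma admissible_rpt m L : admissible L -> admissible (rpt m L).
Proof. by rewrite /rpt /admissible => h; elim: m => //= m IH; rewrite all_cat h. Qed.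

Lemma perm_rpt_cat m L L' : perm_eq (rpt m (L ++ L')) (rpt m L ++ rpt m L').
Proof.
elim: m => //= m IH; rewrite /rpt /= -/(rpt m _) -/(rpt m _) -/(rpt m _).
rewrite -!catA perm_cat2l; apply: perm_trans (_ : perm_eq _ (L' ++ rpt m L ++ rpt m L')) _.
  by rewrite perm_cat2l.
by rewrite perm_catCA.
Qed.

(* Commuting positive averaging operators: the errors of [m] exchanged rounds add up. *)
Lemma run_rpt_compare m L L' F c : admissible L -> admissible L' ->
  (forall x, run L' F x <= run L F x + c) ->
  forall x, run (rpt m L') F x <= run (rpt m L) F x + m%:R * c.
Proof.
move=> aL aL' h; elim: m => [|m IH] x; first by rewrite mul0r addr0.
rewrite /rpt /= -/(rpt m _) -/(rpt m _) !run_cat.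
rewrite (run_comm L (rpt m L)) -natr1 mulrDl mul1r.
have h1 : run L' (run (rpt m L') F) x <= run L' (run (rpt m L) F) x + m%:R * c.
  by apply: run_le_add.
have h2 : run (rpt m L) (run L' F) x <= run (rpt m L) (run L F) x + c.
  by apply: run_le_add => //; exact: admissible_rpt.
by move: h1; rewrite (run_comm L' (rpt m L)) => h1; lra.
Qed.

End ShiftOperators.

(** * Mean value and Taylor estimates *)

Section Calculus.

Variable R : realType.

Lemma is_derive_bigsum (J : Type) (r : seq J) (f : J -> R -> R) (df : J -> R) (x : R) :
  (forall j, is_derive (x : R) 1 (f j) (df j)) ->
  is_derive (x : R) 1 (fun t => \sum_(j <- r) f j t) (\sum_(j <- r) df j).
Proof.
move=> fd; elim: r => [|j r IH].
  rewrite big_nil (_ : (fun t => _) = cst 0); first exact: is_derive_cst.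
  by apply/funext => t; rewrite big_nil.
rewrite big_cons (_ : (fun t => _) = (fun t => f j t + \sum_(j <- r) f j t)); last first.
  by apply/funext => t; rewrite big_cons.
by have h := fd j; apply: is_derive_eq.
Qed.

Lemma unit_increment (f df : R -> R) (M : R) : (forall x : R, is_derive (x : R) 1 f (df x)) ->
  (forall x, 0 <= x <= 1 -> `|df x| <= M) -> forall x, 0 <= x <= 1 -> `|f x - f 0| <= M.
Proof.
move=> fd dM x /andP[x0 x1]; have [c /andP[c0 cx] ->] := mean_value x0 fd.
have h := dM c (ltac:(by rewrite c0 (le_trans cx))).
by rewrite subr0 normrM (ger0_norm x0); have := normr_ge0 (df c); nra.
Qed.

Lemma taylor3 (f f1 f2 f3 : R -> R) (M : R) :
  (forall x : R, is_derive (x : R) 1 f (f1 x)) -> (forall x : R, is_derive (x : R) 1 f1 (f2 x)) ->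
  (forall x : R, is_derive (x : R) 1 f2 (f3 x)) -> (forall x, `|f3 x| <= M) ->
  `|f 1 - (f 0 + f1 0 + f2 0 / 2)| <= M.
Proof.
move=> d0 d1 d2 f3M.
have i2 := unit_increment d2 (fun x _ => f3M x).
have d1' (x : R) : is_derive (x : R) 1 (fun x => f1 x - x * f2 0) (f2 x - f2 0).
  by have h := d1 x; apply: is_derive_eq; rewrite /GRing.scale/=; ring.
have i1 := unit_increment d1' i2.
have d0' (x : R) : is_derive (x : R) 1 (fun x => f x - x * f1 0 - x ^+ 2 * (f2 0 / 2)) (f1 x - x * f2 0 - (f1 0 - 0 * f2 0)).
  by have h := d0 x; apply: is_derive_eq; rewrite /GRing.scale/=; field.
have := unit_increment d0' i1 (ltac:(by rewrite ler01 lexx) : 0 <= 1 <= 1).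
by congr (`|_| <= _); ring.
Qed.

End Calculus.

(** * The Laplace functional of a weighted sum of exponentials *)

Section ExponentialLaplace.

Variables (R : realType) (I : finType) (w : I -> R).

Hypothesis w0 : forall i, 0 <= w i.

Implicit Types (x u v a : I -> R) (L : seq (R * (I -> R))).

Definition zsum a x : R := \sum_i w i * a i * expR (x i).

Definition lapl x : R := expR (- \sum_i w i * expR (x i)).

(** Half of the second derivative of [lapl] in direction [v], that is, the second-order effect of
    one centred step along [v]. *)
Definition hess v x : R := lapl x * (zsum v x ^+ 2 - zsum (fun i => v i ^+ 2) x) / 2.

Lemma zsum_bound a x U : (forall i, `|a i| <= U) -> `|zsum a x| <= U * \sum_i w i * expR (x i).
Proof.
move=> aU; rewrite (le_trans (ler_norm_sum _ _ _))// mulr_sumr; apply: ler_sum => i _.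
rewrite mulrAC normrM (ger0_norm (mulr_ge0 (w0 i) (expR_ge0 _))) mulrC.
by rewrite ler_wpM2r ?mulr_ge0 ?expR_ge0.
Qed.

Lemma is_derive_zsum a x u (s : R) :
  is_derive (s : R) 1 (fun s : R => zsum a (x + s *: u)) (zsum (fun i => a i * u i) (x + s *: u)).
Proof.
rewrite /zsum.
have h i : is_derive (s : R) 1 (fun s : R => w i * a i * expR ((x + s *: u) i))
     (w i * (a i * u i) * expR ((x + s *: u) i)).
  have h0 : is_derive (s : R) 1 (fun s : R => (x + s *: u) i) (u i).
    rewrite (_ : (fun s : R => _) = (fun s : R => x i + s * u i)); last by apply/funext => t; rewrite !fctE.
    by apply: is_derive_eq; rewrite /GRing.scale/=; ring.
  have h1 := @is_derive1_comp _ expR (fun s : R => (x + s *: u) i) s _ _ (is_derive_expR _) h0.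
  by apply: is_derive_eq; rewrite /GRing.scale/=; ring.
exact: is_derive_bigsum.
Qed.

Lemma laplE x : lapl x = expR (- zsum (fun=> 1) x).
Proof. by congr (expR (- _)); apply: eq_bigr => i _; rewrite mulr1. Qed.

Lemma is_derive_lapl x u (s : R) :
  is_derive (s : R) 1 (fun s : R => lapl (x + s *: u)) (- zsum u (x + s *: u) * lapl (x + s *: u)).
Proof.
rewrite (_ : (fun s : R => _) = expR \o (fun s => - zsum (fun=> 1) (x + s *: u))); last first.
  by apply/funext => t; rewrite laplE.
rewrite laplE mulrC; apply: is_derive1_comp.
have h := is_derive_zsum (fun=> 1) x u s.
apply: is_derive_eq; congr (- _); apply: eq_bigr => i _; by rewrite mul1r.
Qed.

Lemma is_derive_zsum_lapl x u (s : R) :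
  is_derive (s : R) 1 (fun s : R => - zsum u (x + s *: u) * lapl (x + s *: u)) (2 * hess u (x + s *: u)).
Proof.
have h1 := is_derive_lapl x u s; have h2 := is_derive_zsum u x u s.
apply: is_derive_eq; rewrite /GRing.scale/= /hess.
have -> : zsum (fun i => u i * u i) (x + s *: u) = zsum (fun i => u i ^+ 2) (x + s *: u) by [].
by field.
Qed.

Definition third v u x : R := lapl x * (- zsum u x * (zsum v x ^+ 2 - zsum (fun i => v i ^+ 2) x) +
  2 * zsum v x * zsum (fun i => v i * u i) x - zsum (fun i => v i ^+ 2 * u i) x) / 2.

Lemma is_derive_hess v x u (s : R) :
  is_derive (s : R) 1 (fun s : R => hess v (x + s *: u)) (third v u (x + s *: u)).
Proof.
have h1 := is_derive_lapl x u s; have h2 := is_derive_zsum v x u s.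
have h3 := is_derive_zsum (fun i => v i ^+ 2) x u s.
by apply: is_derive_eq; rewrite /GRing.scale/= /third; field.
Qed.

Lemma exp_cube_bound (z : R) : 0 <= z -> (z ^+ 3 + 3 * z ^+ 2 + z) * expR (- z) <= 27.
Proof.
move=> z0; have h : 1 + z / 3 <= expR (z / 3) by exact: expR_ge1Dx.
have E3 : expR (z / 3) ^+ 3 = expR z by rewrite -expRM_natl; congr expR; field.
rewrite expRN ler_pdivrMr ?expR_gt0// -E3.
apply: le_trans (_ : 27 * (1 + z / 3) ^+ 3 <= _); last first.
  by rewrite ler_pM2l// lerXn2r ?nnegrE ?expR_ge0//; lra.
by have := exprn_ge0 2 z0; nra.
Qed.

(** Every sum is at most a multiple of [Z], the total of the [w i e^(x i)], while [lapl = e^(-Z)]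
    absorbs all powers of [Z]. The bound is therefore uniform in the weights and in the point. *)
Lemma third_bound v u x V U : 0 <= V -> 0 <= U -> (forall i, `|v i| <= V) -> (forall i, `|u i| <= U) ->
  `|third v u x| <= 27 / 2 * (U * V ^+ 2).
Proof.
move=> V0 U0 vV uU; set Z := \sum_i w i * expR (x i).
have Z0 : 0 <= Z by apply: sumr_ge0 => i _; rewrite mulr_ge0 ?expR_ge0.
have b1 := zsum_bound x vV; have b2 := zsum_bound x uU.
have v2 i : `|v i ^+ 2| <= V ^+ 2 by rewrite normrX lerXn2r ?nnegrE.
have b3 := zsum_bound x v2.
have b4 : `|zsum (fun i => v i * u i) x| <= V * U * Z.
  by apply: zsum_bound => i; rewrite normrM ler_pM.
have b5 : `|zsum (fun i => v i ^+ 2 * u i) x| <= V ^+ 2 * U * Z.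
  by apply: zsum_bound => i; rewrite normrM ler_pM.
rewrite -/Z in b1 b2 b3 b4 b5.
rewrite /third; move: (zsum (fun i => v i * u i) x) b4 => e b4; move: (zsum (fun i => v i ^+ 2 * u i) x) b5 => g b5.
move: (zsum (fun i => v i ^+ 2) x) b3 => c b3; move: (zsum v x) b1 => a b1; move: (zsum u x) b2 => b b2.
have p1 : `|- b * (a ^+ 2 - c)| <= U * V ^+ 2 * (Z ^+ 3 + Z ^+ 2).
  have h : `|a ^+ 2 - c| <= V ^+ 2 * (Z ^+ 2 + Z).
    rewrite (le_trans (ler_normB _ _))// mulrDr lerD// normrX -exprMn lerXn2r ?nnegrE//.
    by rewrite mulr_ge0.
  rewrite normrM normrN; apply: (le_trans (ler_pM (normr_ge0 _) (normr_ge0 _) b2 h)).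
  by rewrite le_eqVlt; apply/orP; left; apply/eqP; ring.
have p2 : `|2 * a * e| <= U * V ^+ 2 * (2 * Z ^+ 2).
  rewrite -mulrA normrM (ger0_norm (ler0n _ _)) normrM.
  have := ler_pM (normr_ge0 _) (normr_ge0 _) b1 b4; lra.
have h : `|- b * (a ^+ 2 - c) + 2 * a * e - g| <= U * V ^+ 2 * (Z ^+ 3 + 3 * Z ^+ 2 + Z).
  rewrite (le_trans (ler_normB _ _))// (le_trans (lerD (ler_normD _ _) (lexx _)))//; lra.
rewrite !normrM (ger0_norm (expR_ge0 _ : 0 <= lapl x)) (@ger0_norm _ 2^-1)//.
have := exp_cube_bound Z0; rewrite /lapl -/Z => h2.
have UV : 0 <= U * V ^+ 2 by rewrite mulr_ge0// exprn_ge0.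
have : expR (- Z) * `|- b * (a ^+ 2 - c) + 2 * a * e - g| <= U * V ^+ 2 * 27.
  rewrite (le_trans (ler_wpM2l (expR_ge0 _) h))// mulrCA ler_wpM2l// mulrC//.
by lra.
Qed.

Lemma addr_scale0 x u : x + (0 : R) *: u = x.
Proof. by rewrite scale0r addr0. Qed.

Lemma lapl_taylor x u U : 0 <= U -> (forall i, `|u i| <= U) ->
  `|lapl (x + u) - (lapl x - zsum u x * lapl x + hess u x)| <= 27 * U ^+ 3.
Proof.
move=> U0 uU; have d3 (s : R) : is_derive (s : R) 1 (fun s => 2 * hess u (x + s *: u)) (2 * third u u (x + s *: u)).
  by have h := is_derive_hess u x u s; apply: is_derive_eq; rewrite /GRing.scale/=; ring.
have := taylor3 (is_derive_lapl x u) (is_derive_zsum_lapl x u) d3 (M := 27 * U ^+ 3).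
rewrite scale1r !addr_scale0 (mulrAC 2) mulfV ?pnatr_eq0// mul1r mulNr; apply => s.
rewrite normrM (ger0_norm (ler0n _ _)); have := third_bound (x + s *: u) U0 U0 uU uU.
by have -> : U * U ^+ 2 = U ^+ 3 by []; lra.
Qed.

Lemma hess_shift v x u V U : 0 <= V -> 0 <= U -> (forall i, `|v i| <= V) -> (forall i, `|u i| <= U) ->
  `|hess v (x + u) - hess v x| <= 27 / 2 * (U * V ^+ 2).
Proof.
move=> V0 U0 vV uU.
have := unit_increment (is_derive_hess v x u) (fun s _ => third_bound (x + s *: u) V0 U0 vV uU)
  (ltac:(by rewrite ler01 lexx) : 0 <= 1 <= 1).
by rewrite scale1r addr_scale0.
Qed.

End ExponentialLaplace.

(** * Comparison of Laplace functionals under small steps *)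

Section LaplaceComparison.

Variables (R : realType) (I : finType) (w : I -> R).

Hypothesis w0 : forall i, 0 <= w i.

Implicit Types (x u v a : I -> R) (L X Y : seq (R * (I -> R))).

Local Notation lapl := (lapl w).

Local Notation hess := (hess w).

Lemma hessE v x : hess v x = lapl x * (zsum w v x ^+ 2 - zsum w (fun i => v i ^+ 2) x) / 2.
Proof. by []. Qed.

(** Keeps both displacement factors of a step at most 2. *)
Definition tame L := forall st, st \in L -> 1 / 4 <= st.1 <= 3 / 4.

Definition small (eta : R) L := forall st, st \in L -> forall i, `|st.2 i| <= eta.

(** The covariance matrix of the total displacement of one run over [L]. *)
Definition gram L i j : R := \sum_(st <- L) st.2 i * st.2 j.

Lemma tame_admissible L : tame L -> admissible L.
Proof. by move=> tL; apply/allP => st /tL /andP[h1 h2]; apply/andP; split; lra. Qed.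

(** The two-point law is centred (third clause) and has variance 1 (the last two clauses add up to
    1). *)
Lemma step_coefs (p : R) : 1 / 4 <= p <= 3 / 4 ->
  let a := Num.sqrt ((1 - p) / p) in let b := Num.sqrt (p / (1 - p)) in
  [/\ 0 <= a <= 2, 0 <= b <= 2, p * a = (1 - p) * b & p * a ^+ 2 = 1 - p /\ (1 - p) * b ^+ 2 = p].
Proof.
move=> /andP[p1 p2] a b; have p0 : 0 < p by lra.
have q0 : 0 < 1 - p by lra.
have two : (2 : R) = Num.sqrt (2 ^+ 2) by rewrite sqrtr_sqr ger0_norm.
have a2 : a ^+ 2 = (1 - p) / p by rewrite sqr_sqrtr// divr_ge0// ltW.
have b2 : b ^+ 2 = p / (1 - p) by rewrite sqr_sqrtr// divr_ge0// ltW.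
split; rewrite ?sqrtr_ge0/=.
- by rewrite [leRHS]two ler_wsqrtr// ler_pdivrMr//; lra.
- by rewrite [leRHS]two ler_wsqrtr// ler_pdivrMr//; lra.
- have a0 : 0 <= a by rewrite sqrtr_ge0.
  have b0 : 0 <= b by rewrite sqrtr_ge0.
  have h1 : 0 <= p * a by rewrite mulr_ge0// ltW.
  have h2 : 0 <= (1 - p) * b by rewrite mulr_ge0// ltW.
  apply/eqP; rewrite -(@eqrXn2 _ 2%N _ _ isT h1 h2) !exprMn a2 b2; apply/eqP.
  by field; rewrite !gt_eqF.
- by rewrite a2 b2; split; field; rewrite gt_eqF.
Qed.

Lemma zsum_scale (c : R) v x : zsum w (c *: v) x = c * zsum w v x.
Proof. by rewrite /zsum mulr_sumr; apply: eq_bigr => i _; rewrite !fctE /GRing.scale/=; ring. Qed.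

Lemma hess_scale (c : R) v x : hess (c *: v) x = c ^+ 2 * hess v x.
Proof.
rewrite !hessE zsum_scale.
have -> : zsum w (fun i => (c *: v) i ^+ 2) x = c ^+ 2 * zsum w (fun i => v i ^+ 2) x.
  by rewrite -zsum_scale; apply: eq_bigr => i _; rewrite !fctE /GRing.scale/= exprMn.
by ring.
Qed.

Lemma scale_bound (c eta : R) v : 0 <= eta -> `|c| <= 2 -> (forall i, `|v i| <= eta) ->
  forall i, `|(c *: v) i| <= 2 * eta.
Proof. by move=> e0 c2 ve i; rewrite !fctE /GRing.scale/= normrM ler_pM. Qed.

Lemma stp_lapl st x eta : 0 <= eta -> 1 / 4 <= st.1 <= 3 / 4 -> (forall i, `|st.2 i| <= eta) ->
  `|stp st lapl x - (lapl x + hess st.2 x)| <= 216 * eta ^+ 3.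
Proof.
case: st => p v /= e0 ph ve.
have [p0 q0] : 0 <= p /\ 0 <= 1 - p by case/andP: ph => p1 p2; split; lra.
have [/andP[a0 a2] /andP[b0 b2] ab [pa pb]] := step_coefs ph.
rewrite /stp/= -scaleNr; move: a0 a2 b0 b2 ab pa pb.
move: (Num.sqrt _) => a; move: (Num.sqrt _) => b a0 a2 b0 b2 ab pa pb.
have e2 : 0 <= 2 * eta by rewrite mulr_ge0.
have h1 := lapl_taylor w0 x e2 (scale_bound e0 (ltac:(by rewrite ger0_norm) : `|a| <= 2) ve).
have h2 := lapl_taylor w0 x e2 (scale_bound e0 (ltac:(by rewrite normrN ger0_norm) : `|- b| <= 2) ve).
rewrite !zsum_scale !hess_scale in h1 h2.
have -> : 216 * eta ^+ 3 = 27 * (2 * eta) ^+ 3 by ring.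
move: h1 h2; rewrite !ler_norml => /andP[h1 h1'] /andP[h2 h2'].
have E : lapl x + hess v x = p * (lapl x - a * zsum w v x * lapl x + a ^+ 2 * hess v x) +
   (1 - p) * (lapl x - - b * zsum w v x * lapl x + (- b) ^+ 2 * hess v x).
  have -> : p * (lapl x - a * zsum w v x * lapl x + a ^+ 2 * hess v x) +
   (1 - p) * (lapl x - - b * zsum w v x * lapl x + (- b) ^+ 2 * hess v x) =
   lapl x - (p * a) * zsum w v x * lapl x + (1 - p) * b * zsum w v x * lapl x +
   (p * a ^+ 2 + (1 - p) * b ^+ 2) * hess v x by ring.
  by rewrite ab pa pb; ring.
rewrite E; move: h1 h1' h2 h2'; clear -p0 q0; move: (lapl (x + a *: v)) (lapl (x + - b *: v)) => A B.
move: (lapl x - a * _ * _ + _) (lapl x - - b * _ * _ + _) ((2 * eta) ^+ 3) => A' B' e3 h1 h1' h2 h2'.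
by apply/andP; split; nra.
Qed.

Lemma stp_hess st v x eta : 0 <= eta -> 1 / 4 <= st.1 <= 3 / 4 -> (forall i, `|st.2 i| <= eta) ->
  (forall i, `|v i| <= eta) -> `|stp st (hess v) x - hess v x| <= 27 * eta ^+ 3.
Proof.
case: st => p u /= e0 ph ue ve.
have [p0 q0] : 0 <= p /\ 0 <= 1 - p by case/andP: ph => p1 p2; split; lra.
have [/andP[a0 a2] /andP[b0 b2] _ _] := step_coefs ph.
rewrite /stp/= -scaleNr; move: a0 a2 b0 b2.
move: (Num.sqrt _) => a; move: (Num.sqrt _) => b a0 a2 b0 b2.
have e2 : 0 <= 2 * eta by rewrite mulr_ge0.
have h1 := hess_shift w0 x e0 e2 ve (scale_bound e0 (ltac:(by rewrite ger0_norm) : `|a| <= 2) ue).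
have h2 := hess_shift w0 x e0 e2 ve (scale_bound e0 (ltac:(by rewrite normrN ger0_norm) : `|- b| <= 2) ue).
have E : 27 / 2 * (2 * eta * eta ^+ 2) = 27 * eta ^+ 3 by field.
rewrite E !ler_norml in h1 h2 *; case/andP: h1 => h1 h1'; case/andP: h2 => h2 h2'.
move: h1 h1' h2 h2'; clear -p0 q0; move: (hess v (x + a *: u)) (hess v (x + - b *: u)) (hess v x) (eta ^+ 3) => A B C e3 h1 h1' h2 h2'.
by apply/andP; split; nra.
Qed.

(** Each step contributes its own second-order term with error of order [eta^3]; carrying the terms
    of the other steps through it costs [27 eta^3] apiece, whence the square of the number of
    steps. *)
Lemma run_lapl L x eta : 0 <= eta -> tame L -> small eta L ->
  `|run L lapl x - (lapl x + \sum_(st <- L) hess st.2 x)| <= 216 * (size L)%:R ^+ 2 * eta ^+ 3.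
Proof.
move=> e0; elim: L x => [|st L IH] x tL sL; first by rewrite /= big_nil addr0 subrr normr0 expr0n/= mulr0 mul0r.
have tL' : tame L by move=> s h; apply: tL; rewrite inE h orbT.
have sL' : small eta L by move=> s h; apply: sL; rewrite inE h orbT.
have st1 := tL st (mem_head _ _); have st2 := sL st (mem_head _ _).
have st1' : 0 < st.1 < 1 by case/andP: st1 => h1 h2; apply/andP; split; lra.
pose H y := lapl y + \sum_(s <- L) hess s.2 y.
set e := 216 * (size L)%:R ^+ 2 * eta ^+ 3 in IH *.
have h1 : `|stp st (run L lapl) x - stp st H x| <= e.
  have aL : admissible [:: st] by rewrite /admissible /= st1'.
  have up y : run L lapl y <= H y + e.
    by have := IH y tL' sL'; rewrite ler_norml -/(H y) => /andP[_ h]; lra.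
  have lo y : H y <= run L lapl y + e.
    by have := IH y tL' sL'; rewrite ler_norml -/(H y) => /andP[h _]; lra.
  have {}up := run_le_add x aL up; have {}lo := run_le_add x aL lo.
  by move: up lo; rewrite /= ler_norml => up lo; apply/andP; split; lra.
have h2 : stp st H x = stp st lapl x + \sum_(s <- L) stp st (hess s.2) x.
  have := @run_sum _ _ _ L [:: st] (fun s => hess s.2) x => /= <-.
  rewrite -[X in X + _]mul1r -[X in _ + X]mul1r -stp_lin; apply: eq_stp => y; by rewrite !mul1r.
have h3 := stp_lapl x e0 st1 st2.
have h4 : `|\sum_(s <- L) stp st (hess s.2) x - \sum_(s <- L) hess s.2 x| <= (size L)%:R * (27 * eta ^+ 3).
  rewrite -sumrB (le_trans (ler_norm_sum _ _ _))//.
  have -> : (size L)%:R * (27 * eta ^+ 3) = \sum_(s <- L) (27 * eta ^+ 3).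
    by rewrite big_const_seq count_predT iter_addr_0 mulr_natl.
  by rewrite big_seq [leRHS]big_seq; apply: ler_sum => s sL0; apply: stp_hess => //; exact: sL'.
rewrite big_cons /=; rewrite h2 in h1.
rewrite -[(size L).+1%:R]natr1; have n0 : 0 <= (size L)%:R :> R by [].
have e3 : 0 <= eta ^+ 3 by rewrite exprn_ge0.
apply: (@le_trans _ _ (e + 216 * eta ^+ 3 + (size L)%:R * (27 * eta ^+ 3))); last first.
  by rewrite /e; nra.
have E : stp st (run L lapl) x - (lapl x + (hess st.2 x + \sum_(s <- L) hess s.2 x)) =
  (stp st (run L lapl) x - (stp st lapl x + \sum_(s <- L) stp st (hess s.2) x)) +
  (stp st lapl x - (lapl x + hess st.2 x)) +
  (\sum_(s <- L) stp st (hess s.2) x - \sum_(s <- L) hess s.2 x) by ring.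
rewrite E (le_trans (ler_normD _ _))// lerD//.
by rewrite (le_trans (ler_normD _ _))// lerD.
Qed.

Lemma sum_hess L x : \sum_(st <- L) hess st.2 x =
  lapl x / 2 * (\sum_i \sum_j w i * expR (x i) * (w j * expR (x j)) * gram L i j -
     \sum_i w i * expR (x i) * gram L i i).
Proof.
rewrite /gram; elim: L => [|st L IH].
  rewrite big_nil big1 ?big1 ?subrr ?mulr0// => i _; rewrite ?big_nil ?mulr0//.
  by rewrite big1// => j _; rewrite big_nil mulr0.
rewrite big_cons IH.
have -> : \sum_i \sum_j w i * expR (x i) * (w j * expR (x j)) * (\sum_(st0 <- st :: L) st0.2 i * st0.2 j) =
    zsum w st.2 x ^+ 2 + \sum_i \sum_j w i * expR (x i) * (w j * expR (x j)) * (\sum_(st0 <- L) st0.2 i * st0.2 j).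
  rewrite expr2 /zsum mulr_suml -big_split /=; apply: eq_bigr => i _.
  rewrite mulr_sumr -big_split /=; apply: eq_bigr => j _.
  by rewrite big_cons; ring.
have -> : \sum_i w i * expR (x i) * (\sum_(st0 <- st :: L) st0.2 i * st0.2 i) =
    zsum w (fun i => st.2 i ^+ 2) x + \sum_i w i * expR (x i) * (\sum_(st0 <- L) st0.2 i * st0.2 i).
  by rewrite -big_split /=; apply: eq_bigr => i _; rewrite big_cons; ring.
by rewrite hessE; ring.
Qed.

(* Slepian/Kahane: with equal variances, larger correlations make the Laplace functional larger. *)
Lemma lapl_comparison X Y x eta (n m : nat) : 0 <= eta -> tame X -> tame Y -> small eta X -> small eta Y ->
  (size X <= n)%N -> (size Y <= n)%N ->
  (forall i, gram X i i = gram Y i i) -> (forall i j, i != j -> gram Y i j <= gram X i j) ->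
  run (rpt m Y) lapl x <= run (rpt m X) lapl x + m%:R * (432 * n%:R ^+ 2 * eta ^+ 3).
Proof.
move=> e0 tX tY sX sY nX nY gd go; apply: run_rpt_compare => [||y]; try exact: tame_admissible.
have hX := run_lapl y e0 tX sX; have hY := run_lapl y e0 tY sY.
have cmp : \sum_(st <- Y) hess st.2 y <= \sum_(st <- X) hess st.2 y.
  rewrite !sum_hess ler_wpM2l ?divr_ge0 ?expR_ge0// lerD//; last first.
    by rewrite lerN2; apply: ler_sum => i _; rewrite gd.
  apply: ler_sum => i _; apply: ler_sum => j _; apply: ler_wpM2l.
    by rewrite !mulr_ge0 ?expR_ge0.
  by have [<-|ij] := eqVneq i j; [rewrite gd | exact: go].
have e3 : 0 <= eta ^+ 3 by rewrite exprn_ge0.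
have szb (k : nat) : (k <= n)%N -> 216 * k%:R ^+ 2 * eta ^+ 3 <= 216 * n%:R ^+ 2 * eta ^+ 3.
  move=> kn; rewrite ler_wpM2r//; apply: ler_wpM2l; first exact: (ler0n _ 216).
  by rewrite lerXn2r ?nnegrE// ler_nat.
have := szb _ nX; have := szb _ nY; move: hX hY; rewrite !ler_norml => /andP[h1 h2] /andP[h3 h4] h5 h6.
by lra.
Qed.

End LaplaceComparison.

(** * Approximation by trigonometric polynomials *)

Section TrigonometricApproximation.

Variables (R : realType) (I : finType).

Implicit Types (F G : (I -> R) -> R) (x a : I -> R).

Definition dotp a x : R := \sum_i a i * x i.

(** Trigonometric polynomials in finitely many coordinates. On each cosine both the coin-flip walk
    and the Gaussian vector act by an explicit factor, so the two are compared on this class. *)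
Inductive trig : ((I -> R) -> R) -> Prop :=
| trig_cos c a p : trig (fun x => c * cos (dotp a x + p))
| trig_add F G : trig F -> trig G -> trig (fun x => F x + G x).

Lemma trig_eq F G : trig F -> F =1 G -> trig G.
Proof. by move=> tF /funext <-. Qed.

Lemma trig_const c : trig (fun=> c).
Proof.
apply: trig_eq (trig_cos c (fun=> 0) 0) _ => x.
by rewrite /dotp big1 ?addr0 ?cos0 ?mulr1// => i _; rewrite mul0r.
Qed.

Lemma trig_scale c F : trig F -> trig (fun x => c * F x).
Proof.
elim=> [e a p|F1 F2 _ h1 _ h2]; first by apply: trig_eq (trig_cos (c * e) a p) _ => x; rewrite mulrA.
by apply: trig_eq (trig_add h1 h2) _ => x; rewrite mulrDr.
Qed.

Lemma trig_mul F G : trig F -> trig G -> trig (fun x => F x * G x).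
Proof.
elim=> [c a p|F1 F2 _ h1 _ h2] tG; last first.
  by apply: trig_eq (trig_add (h1 tG) (h2 tG)) _ => x; rewrite mulrDl.
elim: tG => [e b q|G1 G2 _ h1 _ h2]; last first.
  by apply: trig_eq (trig_add h1 h2) _ => x; rewrite mulrDr.
apply: trig_eq (trig_add (trig_cos (c * e / 2) (fun i => a i + b i) (p + q))
  (trig_cos (c * e / 2) (fun i => a i - b i) (p - q))) _ => x.
have -> : dotp (fun i => a i + b i) x + (p + q) = (dotp a x + p) + (dotp b x + q).
  by rewrite /dotp; under eq_bigr do rewrite mulrDl; rewrite big_split /=; ring.
have -> : dotp (fun i => a i - b i) x + (p - q) = (dotp a x + p) - (dotp b x + q).
  by rewrite /dotp; under eq_bigr do rewrite mulrBl; rewrite sumrB /=; ring.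
by rewrite cosD cosB; field.
Qed.

Lemma trig_prod (J : Type) (r : seq J) (F : J -> (I -> R) -> R) :
  (forall j, trig (F j)) -> trig (fun x => \prod_(j <- r) F j x).
Proof.
move=> tF; elim: r => [|j r IH].
  by apply: trig_eq (trig_const 1) _ => x; rewrite big_nil.
by apply: trig_eq (trig_mul (tF j) IH) _ => x; rewrite big_cons.
Qed.

(* Bernstein polynomial: [h k] averaged over the number of successes in [n] trials of probability [u], started at [k]. *)
Fixpoint bern (h : nat -> R) (n : nat) (u : R) (k : nat) : R :=
  if n is n'.+1 then u * bern h n' u k.+1 + (1 - u) * bern h n' u k else h k.

Lemma bern_mono (h g : nat -> R) n u k : 0 <= u <= 1 -> (forall k, h k <= g k) ->
  bern h n u k <= bern g n u k.
Proof.
move=> /andP[u0 u1] hg; elim: n k => [|n IH] k /=; first exact: hg.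
by rewrite lerD// ler_wpM2l// subr_ge0.
Qed.

Lemma bern_const (c : R) n u k : bern (fun=> c) n u k = c.
Proof. by elim: n k => //= n IH k; rewrite !IH; ring. Qed.

Lemma bern_sq (c : R) n u k : bern (fun k => (k%:R - c) ^+ 2) n u k =
  (k%:R + n%:R * u - c) ^+ 2 + n%:R * (u * (1 - u)).
Proof.
elim: n k => [|n IH] k /=; first by rewrite !mul0r !addr0.
by rewrite !IH -!natr1; ring.
Qed.

Lemma bern_lin (h g : nat -> R) (a b : R) n u k :
  bern (fun k => a * h k + b * g k) n u k = a * bern h n u k + b * bern g n u k.
Proof. by elim: n k => //= n IH k; rewrite !IH; ring. Qed.

(** Bernstein's argument: [|t - u| <= dlt + (t - u)^2 / dlt], and the mean of the square is the
    binomial variance divided by [n^2]. *)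
Lemma bern_approx (h : R -> R) (L dlt : R) (n : nat) (u : R) : (0 < n)%N -> 0 <= u <= 1 -> 0 < dlt -> 0 <= L ->
  (forall t, `|h t - h u| <= L * `|t - u|) ->
  `|bern (fun k => h (k%:R / n%:R)) n u 0 - h u| <= L * (dlt + (dlt * n%:R)^-1).
Proof.
move=> n0 u01 d0 L0 hL; have n0' : 0 < n%:R :> R by rewrite ltr0n.
pose q (k : nat) : R := (L / (dlt * n%:R ^+ 2)) * (k%:R - n%:R * u) ^+ 2 + L * dlt * 1.
have hq k : `|h (k%:R / n%:R) - h u| <= q k.
  apply: (le_trans (hL _)); rewrite /q mulr1.
  have E : L / (dlt * n%:R ^+ 2) * (k%:R - n%:R * u) ^+ 2 = L * (`|k%:R / n%:R - u| ^+ 2 / dlt).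
    by rewrite real_normK ?num_real//; field; rewrite !gt_eqF.
  rewrite E -mulrDr ler_wpM2l//; set y := `|_|; have y0 : 0 <= y by exact: normr_ge0.
  have : 0 <= y ^+ 2 / dlt by rewrite divr_ge0 ?sqr_ge0// ltW.
  have [yd|yd] := leP y dlt; first lra.
  have : y <= y ^+ 2 / dlt by rewrite ler_pdivlMr// expr2 ler_wpM2l// ltW.
  by move: d0; lra.
have Bq : bern q n u 0 <= L * (dlt + (dlt * n%:R)^-1).
  rewrite /q (bern_lin (fun k => (k%:R - n%:R * u) ^+ 2) (fun=> 1)) bern_sq bern_const.
  have -> : L / (dlt * n%:R ^+ 2) * ((0 + n%:R * u - n%:R * u) ^+ 2 + n%:R * (u * (1 - u))) + L * dlt * 1 =
      L * (dlt + (dlt * n%:R)^-1 * (u * (1 - u))) by field; rewrite !gt_eqF.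
  rewrite ler_wpM2l// lerD2l.
  have i0 : 0 <= (dlt * n%:R)^-1 by rewrite invr_ge0 mulr_ge0// ltW.
  by case/andP: u01 => u0 u1; rewrite ler_piMr//; nra.
move: hq Bq; clearbody q => hq Bq.
have up := @bern_mono (fun k => 1 * h (k%:R / n%:R) + - h u * 1) q n u 0 u01.
have lo := @bern_mono (fun k => -1 * q k + 0 * 1) (fun k => 1 * h (k%:R / n%:R) + - h u * 1) n u 0 u01.
have {}up := up (fun k => _); have {}lo := lo (fun k => _).
have {}up := up (ltac:(move=> k; have := hq k; rewrite ler_norml => /andP[_]; lra)).
have {}lo := lo (ltac:(move=> k; have := hq k; rewrite ler_norml => /andP[+ _]; lra)).
move: up lo; rewrite (bern_lin q (fun=> 1)) !(bern_lin (fun k => h (k%:R / n%:R)) (fun=> 1)) !bern_const => up lo.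
by rewrite ler_norml; apply/andP; split; lra.
Qed.

Lemma cos1_ge : 1 / 2 <= cos (1 : R).
Proof.
have f (x : R) : is_derive (x : R) 1 (fun x : R => cos x + x ^+ 2 / 2) (- sin x + x).
  by apply: is_derive_eq; rewrite /GRing.scale/=; field.
have [c /andP[c0 c1]] := mean_value (ler01 : 0 <= 1 :> R) f.
rewrite cos0 expr0n/= mul0r addr0 expr1n subr0 mulr1.
have g (x : R) : is_derive (x : R) 1 (fun x : R => x - sin x) (1 - cos x) by apply: is_derive_eq.
have [e _] := mean_value c0 g; rewrite sin0 !subr0 => h h2.
have : 0 <= (1 - cos e) * c by rewrite mulr_ge0// subr_ge0 cos_le1.
by rewrite -h; lra.
Qed.

Lemma cos_ge_half (c : R) : `|c| <= 1 -> 1 / 2 <= cos c.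
Proof.
move=> c1; have -> : cos c = cos `|c| by case: (ger0P c); rewrite ?cosN.
rewrite (le_trans cos1_ge)// leNgt; apply/negP => h.
have p1 := @pi_ge2 R; have n0 := normr_ge0 c.
by move: h; rewrite ltr_cos ?in_itv/=; [lra | apply/andP; split; lra..].
Qed.

Lemma sin_expand_le (s t : R) : -1 <= t -> t <= s -> s <= 1 -> s - t <= 2 * (sin s - sin t).
Proof.
move=> t1 ts s1; have [c /andP[c1 c2] ->] := mean_value ts (@is_derive_sin R).
have : 1 / 2 <= cos c by apply: cos_ge_half; rewrite ler_norml; apply/andP; split; lra.
by nra.
Qed.

Lemma sin_expand (s t : R) : `|s| <= 1 -> `|t| <= 1 -> `|s - t| <= 2 * `|sin s - sin t|.
Proof.
wlog st : s t / t <= s.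
  move=> H hs ht; have [ts|/ltW ts] := leP t s; first exact: H.
  by rewrite distrC (distrC (sin s)); exact: H.
rewrite (@ger0_norm _ (s - t)) ?subr_ge0// !ler_norml => /andP[s1 s2] /andP[t1 t2].
have := sin_expand_le t1 st s2; have := ler_norm (sin s - sin t); lra.
Qed.

Lemma sin_preimage (y : R) : `|y| <= sin 1 -> exists2 s, `|s| <= 1 & sin s = y.
Proof.
rewrite ler_norml => /andP[y1 y2].
have c : {within `[-1, 1], continuous (@sin R)} by apply: continuous_subspaceT => x; exact: continuous_sin.
have [|s] := IVT (ltac:(lra) : -1 <= 1 :> R) c (v := y).
  have s1 : 0 <= sin 1 :> R by rewrite sin_ge0_pi// ler01 (le_trans _ (@pi_ge2 R))// ler1n.
  by rewrite sinN min_l ?max_r ?y1//; lra.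
by rewrite in_itv/= -ler_norml => h <-; exists s.
Qed.

Lemma expexp_lipschitz (c s t : R) : 0 <= c ->
  `|expR (- (c * expR s)) - expR (- (c * expR t))| <= `|s - t|.
Proof.
move=> c0; wlog st : s t / t <= s.
  move=> H; have [ts|/ltW ts] := leP t s; first exact: H.
  by rewrite distrC (distrC s); exact: H.
have d (r : R) : is_derive (r : R) 1 (fun r => expR (- (c * expR r))) (expR (- (c * expR r)) * (- (c * expR r))).
  have h : is_derive (r : R) 1 (fun r => - (c * expR r)) (- (c * expR r)).
    by apply: is_derive_eq; rewrite /GRing.scale/=; ring.
  exact: (@is_derive1_comp _ expR (fun r => - (c * expR r))).
have [r _ ->] := mean_value st d; rewrite normrM ler_piMl//.
have z0 : 0 <= c * expR r by rewrite mulr_ge0 ?expR_ge0.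
move: z0; move: (c * expR r) => z z0.
rewrite normrM normrN (ger0_norm z0) (ger0_norm (expR_ge0 _)) expRN mulrC ler_pdivrMr ?expR_gt0// mul1r.
by have := expR_ge1Dx z; lra.
Qed.

Lemma clamp_lipschitz (b p q : R) : 
  `|Num.max (- b) (Num.min b p) - Num.max (- b) (Num.min b q)| <= `|p - q|.
Proof.
have mx (a x y : R) : `|Num.max a x - Num.max a y| <= `|x - y|.
  have n1 := ler_norm (x - y); have n2 := ler_norm (y - x); rewrite distrC in n2.
  move: n1 n2; move: `|x - y| => m n1 n2; rewrite ler_norml /Num.max.
  by case: ltP => h1; case: ltP => h2; apply/andP; split; lra.
have mn (a x y : R) : `|Num.min a x - Num.min a y| <= `|x - y|.
  have n1 := ler_norm (x - y); have n2 := ler_norm (y - x); rewrite distrC in n2.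
  move: n1 n2; move: `|x - y| => m n1 n2; rewrite ler_norml /Num.min.
  by case: ltP => h1; case: ltP => h2; apply/andP; split; lra.
exact: le_trans (mx _ _ _) (mn _ _ _).
Qed.

(** The coordinate is encoded by [u = (1 + sin (x/K)) / 2], a trigonometric polynomial with values
    in [[0, 1]]. A clamped inverse of the sine decodes it in a Lipschitz way on [[-K, K]], so a
    Bernstein polynomial in [u] approximates the function there. Outside, both sides lie in [[0, 1]]
    and [x^2 / K^2 >= 1] covers the difference. *)
Lemma trig_expexp (c e K : R) (i : I) : 0 <= c -> 0 < e -> 0 < K ->
  exists2 T, trig T & (forall x, 0 <= T x <= 1) /\
    forall x, `|T x - expR (- (c * expR (x i)))| <= e + x i ^+ 2 / K ^+ 2.
Proof.
move=> c0 e0 K0.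
pose cl (t : R) := Num.max (- sin 1) (Num.min (sin 1) (2 * t - 1)).
have s1 : 0 <= sin 1 :> R by rewrite sin_ge0_pi// ler01 (le_trans _ (@pi_ge2 R))// ler1n.
have clb t : `|cl t| <= sin 1.
  rewrite ler_norml /cl le_max lexx /= ge_max ge_min lexx /= andbT; lra.
pose A t := projT1 (cid2 (sin_preimage (clb t))).
have A1 t : `|A t| <= 1 by rewrite /A; case: cid2.
have sA t : sin (A t) = cl t by rewrite /A; case: cid2.
have Alip t u : `|A t - A u| <= 4 * `|t - u|.
  apply: (le_trans (sin_expand (A1 t) (A1 u))); rewrite !sA.
  suff : `|cl t - cl u| <= `|2 * t - 1 - (2 * u - 1)|.
    have -> : 2 * t - 1 - (2 * u - 1) = 2 * (t - u) by ring.
    by rewrite normrM (ger0_norm (ler0n _ _)); lra.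
  exact: clamp_lipschitz.
pose h t := expR (- (c * expR (K * A t))).
have hlip t u : `|h t - h u| <= 4 * K * `|t - u|.
  apply: (le_trans (expexp_lipschitz _ _ c0)); rewrite -mulrBr normrM (gtr0_norm K0).
  by have := ler_wpM2l (ltW K0) (Alip t u); lra.
pose dlt := e / (8 * K).
have d0 : 0 < dlt by rewrite divr_gt0// mulr_gt0.
have [n n0 hn] : exists2 n : nat, (0 < n)%N & dlt^-1 / dlt <= n%:R.
  exists (Num.truncn (dlt^-1 / dlt)).+1 => //.
  have q0 : 0 <= dlt^-1 / dlt by rewrite divr_ge0 ?invr_ge0 ?ltW.
  by have /andP[_ /ltW] := truncn_itv q0.
have n0' : 0 < n%:R :> R by rewrite ltr0n.
pose u x : R := (1 + sin (x i / K)) / 2.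
have u01 x : 0 <= u x <= 1.
  by rewrite /u; have := sin_geN1 (x i / K); have := sin_le1 (x i / K) => h1 h2; apply/andP; split; lra.
have tu : trig u.
  apply: trig_eq (trig_add (trig_const (1 / 2)) (trig_cos (1 / 2) (fun j => (j == i)%:R / K) (- (pi / 2)))) _ => x.
  rewrite /u cosBpihalf /dotp (bigD1 i)//= eqxx big1 ?addr0 => [|j /negbTE ->]; last by rewrite !mul0r.
  have -> : 1%:R / K * x i = x i / K by rewrite mul1r mulrC.
  by field.
have tbern n' k : trig (fun x => bern (fun k => h (k%:R / n%:R)) n' (u x) k).
  elim: n' k => [|n' IH] k /=; first exact: trig_const.
  apply: trig_add; first exact: trig_mul tu (IH _).
  apply: trig_mul; last exact: IH.
  by apply: trig_eq (trig_add (trig_const 1) (trig_scale (-1) tu)) _ => x; ring.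
have h01 t : 0 <= h t <= 1.
  by rewrite /h expR_ge0 /= -[leRHS]expR0 ler_expR oppr_le0 mulr_ge0 ?expR_ge0.
have b01 x : 0 <= bern (fun k => h (k%:R / n%:R)) n (u x) 0 <= 1.
  rewrite -[X in X <= bern _ _ _ _](bern_const 0 n (u x) 0%N) -[X in _ && (_ <= X)](bern_const 1 n (u x) 0%N).
  by apply/andP; split; apply: bern_mono => // k; case/andP: (h01 (k%:R / n%:R)).
exists (fun x => bern (fun k => h (k%:R / n%:R)) n (u x) 0); first exact: tbern.
split=> // x; have [xK|xK] := leP `|x i| K.
  have y1 : `|x i / K| <= 1 by rewrite normrM normfV (gtr0_norm K0) ler_pdivrMr// mul1r.
  have hu : h (u x) = expR (- (c * expR (x i))).
    rewrite /h; have -> : A (u x) = x i / K; last by rewrite mulrCA divff ?mulr1// gt_eqF.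
    apply/eqP; rewrite -subr_eq0 -normr_le0 (le_trans (sin_expand (A1 _) y1))// sA.
    suff -> : cl (u x) = sin (x i / K) by rewrite subrr normr0 mulr0.
    have E : 2 * u x - 1 = sin (x i / K) by rewrite /u; field.
    have sb : `|sin (x i / K)| <= sin 1.
      have p1 : (1 : R) <= pi / 2 by have := @pi_ge2 R; lra.
      move: y1; rewrite !ler_norml => /andP[h1 h2].
      have a1 := sin_expand_le (lexx (-1)) h1 h2; have a2 := sin_expand_le h1 h2 (lexx 1).
      by move: a1; rewrite sinN => a1; apply/andP; split; lra.
    move: sb; rewrite ler_norml => /andP[h1 h2].
    by rewrite /cl E min_r// max_r.
  rewrite -hu (le_trans (@bern_approx h (4 * K) dlt n (u x) n0 (u01 x) d0 _ _))//.
    by rewrite mulr_ge0// ltW.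
  have : (dlt * n%:R)^-1 <= dlt.
    have q1 : dlt^-1 <= n%:R * dlt by rewrite -ler_pdivrMr.
    by rewrite invfM ler_pdivrMr// mulrC.
  have E : 4 * K * (dlt + dlt) = e by rewrite /dlt; field; rewrite gt_eqF.
  have : 0 <= x i ^+ 2 / K ^+ 2 by rewrite divr_ge0 ?sqr_ge0.
  have : 0 <= 4 * K by rewrite mulr_ge0// ltW.
  by move: E; move: (x i ^+ 2 / _) (dlt * _)^-1 => p q; nra.
have : 1 <= x i ^+ 2 / K ^+ 2.
  rewrite ler_pdivlMr ?exprn_gt0// mul1r -(real_normK (num_real (x i))).
  by rewrite lerXn2r ?nnegrE// ltW.
have /andP[h1 h2] := b01 x; have h3 := expR_ge0 (- (c * expR (x i))).
have h4 : expR (- (c * expR (x i))) <= 1 by rewrite -[leRHS]expR0 ler_expR oppr_le0 mulr_ge0 ?expR_ge0.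
by move=> h5; rewrite ler_norml; apply/andP; split; lra.
Qed.

End TrigonometricApproximation.

(** * Gaussian limit of fair coin flips *)

Section RademacherLimit.

Variables (R : realType) (I : finType).

Implicit Types (x v a : I -> R) (X : seq (I -> R)) (m : nat).

(** Fair flips along the vectors of [X], scaled so that [m] rounds have the covariance [sum v v^T]
    over [X]. *)
Definition rad m X : seq (R * (I -> R)) := [seq (1 / 2, (Num.sqrt m%:R)^-1 *: v) | v <- X].

Lemma half_coef : Num.sqrt ((1 - 1 / 2) / (1 / 2)) = 1 :> R /\ Num.sqrt ((1 / 2) / (1 - 1 / 2)) = 1 :> R.
Proof. by split; rewrite -[RHS]sqrtr1; congr Num.sqrt; field. Qed.

Lemma stp_half v (F : (I -> R) -> R) x : stp (1 / 2, v) F x = (F (x + v) + F (x - v)) / 2.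
Proof. by rewrite /stp /=; case: half_coef => -> ->; rewrite !scale1r; field. Qed.

Lemma dotpD a x v (s : R) : dotp a (x + s *: v) = dotp a x + s * dotp a v.
Proof.
rewrite /dotp mulr_sumr -big_split /=; apply: eq_bigr => i _.
by rewrite !fctE /GRing.scale/=; ring.
Qed.

Lemma stp_half_cos (c p : R) a v x :
  stp (1 / 2, v) (fun x => c * cos (dotp a x + p)) x = cos (dotp a v) * (c * cos (dotp a x + p)).
Proof.
rewrite stp_half -scaleN1r -{1}(scale1r v) !dotpD.
have -> : dotp a x + 1 * dotp a v + p = dotp a x + p + dotp a v by ring.
have -> : dotp a x + -1 * dotp a v + p = dotp a x + p - dotp a v by ring.
by rewrite cosD cosB; field.
Qed.

Lemma run_half_cos (L : seq (R * (I -> R))) (c p : R) a x : (forall st, st \in L -> st.1 = 1 / 2) ->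
  run L (fun x => c * cos (dotp a x + p)) x = (\prod_(st <- L) cos (dotp a st.2)) * (c * cos (dotp a x + p)).
Proof.
elim: L x => [|[q v] L IH] x hL; first by rewrite big_nil mul1r.
have -> : q = 1 / 2 by exact: (hL (q, v) (mem_head _ _)).
have IH' y := IH y (fun st h => hL st (ltac:(by rewrite inE h orbT))).
rewrite /= (eq_stp _ IH') big_cons /= -mulrA [RHS]mulrCA -stp_half_cos.
by rewrite /stp /=; ring.
Qed.

Lemma prod_rpt m (L : seq (R * (I -> R))) (f : R * (I -> R) -> R) :
  \prod_(st <- rpt m L) f st = (\prod_(st <- L) f st) ^+ m.
Proof.
by elim: m => [|m IH]; rewrite ?big_nil ?expr0// /rpt /= -/(rpt m L) big_cat IH exprS.
Qed.

Lemma mem_rpt m (L : seq (R * (I -> R))) st : st \in rpt m L -> st \in L.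
Proof. by elim: m => //= m IH; rewrite /rpt /= mem_cat => /orP[//|/IH]. Qed.

Lemma rad_half m X st : st \in rad m X -> st.1 = 1 / 2.
Proof. by case/mapP => v _ ->. Qed.

Lemma run_half_sqr (L : seq (R * (I -> R))) i x : (forall st, st \in L -> st.1 = 1 / 2) ->
  run L (fun x => x i ^+ 2) x = x i ^+ 2 + \sum_(st <- L) st.2 i ^+ 2.
Proof.
elim: L x => [|[q v] L IH] x hL; first by rewrite big_nil addr0.
have -> : q = 1 / 2 by exact: (hL (q, v) (mem_head _ _)).
have IH' y := IH y (fun st h => hL st (ltac:(by rewrite inE h orbT))).
by rewrite /= (eq_stp _ IH') big_cons stp_half !fctE /=; field.
Qed.

Lemma sum_rpt m (L : seq (R * (I -> R))) (f : R * (I -> R) -> R) :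
  \sum_(st <- rpt m L) f st = m%:R * \sum_(st <- L) f st.
Proof.
elim: m => [|m IH]; first by rewrite big_nil mul0r.
by rewrite /rpt /= -/(rpt m L) big_cat /= IH -natr1; ring.
Qed.

Lemma run_rad_sqr m X i : (0 < m)%N ->
  run (rpt m (rad m X)) (fun x => x i ^+ 2) 0 = \sum_(v <- X) v i ^+ 2.
Proof.
move=> m0; rewrite run_half_sqr; last by move=> st /mem_rpt; exact: rad_half.
rewrite sum_rpt big_map /= expr0n/= add0r mulr_sumr; apply: eq_bigr => v _.
rewrite !fctE /GRing.scale/= exprMn exprVn sqr_sqrtr// mulrA mulfV ?mul1r//.
by rewrite pnatr_eq0 -lt0n.
Qed.

Lemma cos_gauss_approx (y : R) : y ^+ 2 <= 1 -> `|cos y - expR (- (y ^+ 2 / 2))| <= 2 * `|y| ^+ 3.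
Proof.
move=> y1.
have l (s : R) : is_derive (s : R) 1 (fun s : R => s * y) y.
  by apply: is_derive_eq; rewrite /GRing.scale/=; ring.
have dc (s : R) : is_derive (s : R) 1 (fun s => cos (s * y)) (- sin (s * y) * y).
  exact: (@is_derive1_comp _ cos (fun s => s * y)).
have ds (s : R) : is_derive (s : R) 1 (fun s => sin (s * y)) (cos (s * y) * y).
  exact: (@is_derive1_comp _ sin (fun s => s * y)).
have d1 (s : R) : is_derive (s : R) 1 (fun s => - sin (s * y) * y) (- cos (s * y) * y ^+ 2).
  by have h := ds s; apply: is_derive_eq; rewrite /GRing.scale/=; ring.
have d2 (s : R) : is_derive (s : R) 1 (fun s => - cos (s * y) * y ^+ 2) (sin (s * y) * y ^+ 3).
  by have h := dc s; apply: is_derive_eq; rewrite /GRing.scale/=; ring.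
have := taylor3 dc d1 d2 (M := `|y| ^+ 3) (fun s => _).
rewrite mul1r !mul0r cos0 sin0 oppr0 mul0r addr0 => H; have {}H := H (ltac:(
  by move=> s; rewrite normrM normrX ler_piMl ?exprn_ge0// ler_norml sin_geN1 sin_le1)).
set z := y ^+ 2 / 2 in H *; have z0 : 0 <= z by rewrite divr_ge0 ?sqr_ge0.
have e1 := expR_ge1Dx (- z); have e2 := expR_ge1Dx z.
have e3 : expR (- z) <= 1 - z + z ^+ 2.
  rewrite expRN -[leLHS]mul1r ler_pdivrMr ?expR_gt0//.
  apply: le_trans (_ : (1 - z + z ^+ 2) * (1 + z) <= _); last by rewrite ler_wpM2l//; have := sqr_ge0 z; have := sqr_ge0 (1 - z); lra.
  have -> : (1 - z + z ^+ 2) * (1 + z) = 1 + z ^+ 3 by ring.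
  by rewrite lerDl exprn_ge0.
have yy : `|y| <= 1 by rewrite -(@ler_pXn2r _ 2) ?nnegrE// expr1n real_normK ?num_real.
have z2 : z ^+ 2 <= `|y| ^+ 3.
  have -> : z ^+ 2 = `|y| ^+ 3 * `|y| / 4 by rewrite /z -(real_normK (num_real y)); field.
  by have := exprn_ge0 3 (normr_ge0 y); nra.
have zE : - cos (0 * y) * y ^+ 2 / 2 = - z by rewrite mul0r cos0 /z; field.
move: H; rewrite !ler_norml => /andP[h1 h2].
have E : cos y - (1 + - 1 * y ^+ 2 / 2) = cos y - (1 - z) by rewrite /z; field.
by rewrite E in h1 h2; apply/andP; split; lra.
Qed.

Lemma expr_diff_le (a b : R) m : `|a| <= 1 -> `|b| <= 1 -> `|a ^+ m - b ^+ m| <= m%:R * `|a - b|.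
Proof.
move=> a1 b1; elim: m => [|m IH]; first by rewrite subrr normr0 mul0r.
have -> : a ^+ m.+1 - b ^+ m.+1 = a * (a ^+ m - b ^+ m) + (a - b) * b ^+ m by rewrite !exprS; ring.
rewrite -natr1 [leRHS]mulrDl mul1r (le_trans (ler_normD _ _))// lerD//.
  by rewrite normrM (le_trans _ IH)// ler_piMl.
by rewrite normrM ler_piMr// normrX exprn_ile1.
Qed.

Lemma cos_pow_gauss (c : R) m : (0 < m)%N -> c ^+ 2 <= m%:R ->
  `|cos ((Num.sqrt m%:R)^-1 * c) ^+ m - expR (- (c ^+ 2 / 2))| <= 2 * `|c| ^+ 3 / Num.sqrt m%:R.
Proof.
move=> m0 cm; have mR : 0 < m%:R :> R by rewrite ltr0n.
have s0 : 0 < Num.sqrt m%:R :> R by rewrite sqrtr_gt0.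
have s2 : Num.sqrt m%:R ^+ 2 = m%:R :> R by rewrite sqr_sqrtr// ltW.
set y := _^-1 * c; have y2 : y ^+ 2 = c ^+ 2 / m%:R by rewrite exprMn exprVn s2 mulrC.
have -> : expR (- (c ^+ 2 / 2)) = expR (- (y ^+ 2 / 2)) ^+ m.
  by rewrite -expRM_natl; congr expR; rewrite y2; field; rewrite gt_eqF.
have y1 : y ^+ 2 <= 1 by rewrite y2 ler_pdivrMr// mul1r.
apply: le_trans (expr_diff_le _ _ _) _; first exact: abs_cos_le.
  by rewrite ger0_norm ?expR_ge0// -[leRHS]expR0 ler_expR oppr_le0 divr_ge0 ?sqr_ge0.
apply: le_trans (ler_wpM2l (ltW mR) (cos_gauss_approx y1)) _.
rewrite le_eqVlt; apply/orP; left; apply/eqP.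
rewrite /y normrM normfV (gtr0_norm s0); move: s0 s2; clear.
by move: (Num.sqrt _) => q q0 <-; field; exact: lt0r_neq0.
Qed.

Lemma prod_diff_le (J : Type) (r : seq J) (f g : J -> R) : (forall j, `|f j| <= 1) -> (forall j, `|g j| <= 1) ->
  `|\prod_(j <- r) f j - \prod_(j <- r) g j| <= \sum_(j <- r) `|f j - g j|.
Proof.
move=> f1 g1; have pg s : `|\prod_(j <- s) g j| <= 1.
  by elim: s => [|j s IH]; rewrite ?big_nil ?normr1// big_cons normrM mulr_ile1.
elim: r => [|j r IH]; first by rewrite !big_nil subrr normr0.
rewrite !big_cons; have -> : f j * \prod_(j <- r) f j - g j * \prod_(j <- r) g j =
  (f j - g j) * \prod_(j <- r) g j + f j * (\prod_(j <- r) f j - \prod_(j <- r) g j) by ring.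
rewrite (le_trans (ler_normD _ _))// lerD// normrM; first by rewrite ler_piMr.
by rewrite (le_trans _ IH)// ler_piMl.
Qed.

Definition qform X a : R := \sum_(v <- X) dotp a v ^+ 2.

(** A fair step multiplies a cosine by [cos (a.v / sqrt m)], which reduces the central limit theorem
    to [cos (c / sqrt m)^m -> e^(-c^2 / 2)]. *)
Lemma run_rad_cos X a (c p : R) (e : R) : 0 < e ->
  exists m0, forall m, (m0 <= m)%N ->
  `|run (rpt m (rad m X)) (fun x => c * cos (dotp a x + p)) 0 - c * (expR (- (qform X a / 2)) * cos p)| <= e.
Proof.
move=> e0; pose C := `|c| * \sum_(v <- X) (2 * `|dotp a v| ^+ 3).
have C0 : 0 <= C by rewrite mulr_ge0// sumr_ge0// => v _; rewrite mulr_ge0// exprn_ge0.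
pose B := \sum_(v <- X) dotp a v ^+ 2.
(* [m >= B] keeps all angles at most 1 in absolute value, and [m >= (C/e)^2] brings the error
   [C / sqrt m] below [e]. *)
exists (maxn (Num.truncn B).+1 (maxn 1 (Num.truncn ((C / e) ^+ 2)).+1)) => m.
rewrite !geq_max => /and3P[hB m1 hC].
have mR : 0 < m%:R :> R by rewrite ltr0n.
have s0 : 0 < Num.sqrt m%:R :> R by rewrite sqrtr_gt0.
have Bm : B <= m%:R.
  have B0 : 0 <= B by rewrite sumr_ge0// => v _; rewrite sqr_ge0.
  have /andP[_ /ltW h] := truncn_itv B0; apply: (le_trans h); by rewrite ler_nat.
have Cm : C / Num.sqrt m%:R <= e.
  rewrite ler_pdivrMr// mulrC -ler_pdivrMr// -[leLHS](@ger0_norm _ (C / e)); last by rewrite divr_ge0// ltW.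
  rewrite -sqrtr_sqr ler_wsqrtr//.
  have /andP[_ /ltW h] := truncn_itv (sqr_ge0 (C / e)); apply: (le_trans h); by rewrite ler_nat.
apply: le_trans Cm.
rewrite run_half_cos; last by move=> st /mem_rpt; exact: rad_half.
have d0 : dotp a 0 = 0 by rewrite /dotp big1// => i _; rewrite mulr0.
rewrite prod_rpt big_map d0 add0r /=.
have dE v : dotp a ((Num.sqrt m%:R)^-1 *: v) = (Num.sqrt m%:R)^-1 * dotp a v.
  by have := dotpD a 0 v (Num.sqrt m%:R)^-1; rewrite add0r d0 add0r.
under eq_bigr do rewrite dE.
have -> : expR (- (qform X a / 2)) = \prod_(v <- X) expR (- (dotp a v ^+ 2 / 2)).
  rewrite /qform mulr_suml -sumrN; elim: X {C C0 B hB hC Bm} => [|v X IH]; rewrite ?big_nil ?expR0// !big_cons expRD IH//.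
have -> : forall A B', A * (c * cos p) - c * (B' * cos p) = c * cos p * (A - B') by move=> *; ring.
rewrite normrM -prodrXl /C -mulrA.
apply: le_trans (ler_pM _ _ (_ : _ <= `|c|) (prod_diff_le _ _ _)) _ => //.
- by rewrite normrM ler_piMr// abs_cos_le.
- by move=> v; rewrite normrX exprn_ile1// abs_cos_le.
- by move=> v; rewrite ger0_norm ?expR_ge0// -[leRHS]expR0 ler_expR oppr_le0 divr_ge0 ?sqr_ge0.
rewrite ler_wpM2l// mulr_suml big_seq [leRHS]big_seq; apply: ler_sum => v vX.
rewrite cos_pow_gauss// (le_trans _ Bm)// /B (big_rem v)//= lerDl sumr_ge0// => u _; exact: sqr_ge0.
Qed.

(** * Identification of the limit with the law of a Gaussian vector *)

Section Identification.

Context (d : measure_display) (Omega : measurableType d) (P : probability Omega R).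

Lemma bounded_integrable (f : Omega -> R) (B : R) : measurable_fun setT f -> (forall w, `|f w| <= B) ->
  P.-integrable setT (EFin \o f).
Proof.
move=> mf fB; apply: (@le_integrable _ _ _ _ _ measurableT _ (EFin \o cst B)) => //.
- exact/measurable_EFinP.
- by move=> w _; rewrite /= lee_fin (le_trans (fB w))// ler_norm.
- exact: finite_measure_integrable_cst.
Qed.

Lemma Rintegral_bigsum (J : Type) (r : seq J) (f : J -> Omega -> R) :
  (forall j, P.-integrable setT (EFin \o f j)) ->
  P.-integrable setT (EFin \o (fun w => \sum_(j <- r) f j w)) /\
  \int[P]_w (\sum_(j <- r) f j w) = \sum_(j <- r) \int[P]_w f j w.
Proof.
move=> fi; elim: r => [|j r [IH1 IH2]].
  rewrite (_ : (fun w => \sum_(j <- [::]) f j w) = cst 0); last by apply/funext => w; rewrite big_nil.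
  by rewrite big_nil Rintegral_cst// mul0r; split => //; exact: finite_measure_integrable_cst.
rewrite (_ : (fun w => \sum_(j <- j :: r) f j w) = (fun w => f j w + \sum_(j <- r) f j w)); last by apply/funext => w; rewrite big_cons.
by rewrite big_cons -IH2 RintegralD//; split => //; exact: (integrableD measurableT (fi j) IH1).
Qed.

Variable Z : I -> Omega -> R.

Hypothesis mZ : forall i, measurable_fun setT (Z i).

Local Notation vec w := (fun i => Z i w).

Lemma measurable_dotp a : measurable_fun setT (fun w => dotp a (vec w)).
Proof. by apply: measurable_sum => i; apply: measurable_funM => //; exact: measurable_cst. Qed.

Lemma trig_vec (F : (I -> R) -> R) : trig F ->
  measurable_fun setT (fun w => F (vec w)) /\ exists B, forall x, `|F x| <= B.
Proof.
elim=> [c a p|F1 F2 _ [m1 [B1 h1]] _ [m2 [B2 h2]]]; last first.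
  split; first exact: measurable_funD.
  by exists (B1 + B2) => x; rewrite (le_trans (ler_normD _ _))// lerD.
split; last by exists `|c| => x; rewrite normrM ler_piMr// abs_cos_le.
apply: measurable_funM; first exact: measurable_cst.
apply: (measurableT_comp (f := cos)); first by apply: continuous_measurable_fun; exact: continuous_cos.
by apply: measurable_funD; [exact: measurable_dotp | exact: measurable_cst].
Qed.

Lemma trig_vec_integrable (F : (I -> R) -> R) : trig F -> P.-integrable setT (EFin \o (fun w => F (vec w))).
Proof. by case/trig_vec => mF [B FB]; apply: (@bounded_integrable _ B). Qed.

Variable X : seq (I -> R).

Hypothesis charZ : forall a p, \int[P]_w cos (dotp a (vec w) + p) = expR (- (qform X a / 2)) * cos p.

Hypothesis sqrZ : forall i, P.-integrable setT (EFin \o (fun w => Z i w ^+ 2)).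

Hypothesis varZ : forall i, \int[P]_w (Z i w ^+ 2) = \sum_(v <- X) v i ^+ 2.

Lemma trig_limit (F : (I -> R) -> R) : trig F -> forall e, 0 < e ->
  exists m0, forall m, (m0 <= m)%N -> `|run (rpt m (rad m X)) F 0 - \int[P]_w F (vec w)| <= e.
Proof.
elim=> [c a p|F1 F2 t1 h1 t2 h2] e e0.
  have [m0 hm] := run_rad_cos X a c p e0; exists m0 => m mm; rewrite (le_trans _ (hm m mm))//.
  rewrite RintegralZl ?charZ//.
  have := trig_vec_integrable (trig_cos 1 a p); by under eq_fun do rewrite mul1r.
have e2 : 0 < e / 2 by rewrite divr_gt0.
have [m1 k1] := h1 _ e2; have [m2 k2] := h2 _ e2.
exists (maxn m1 m2) => m; rewrite geq_max => /andP[/k1 {}k1 /k2 {}k2].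
rewrite RintegralD//; [|exact: trig_vec_integrable..].
have -> : run (rpt m (rad m X)) (fun x => F1 x + F2 x) 0 = run (rpt m (rad m X)) F1 0 + run (rpt m (rad m X)) F2 0.
  rewrite -[X in X + _]mul1r -[X in _ + X]mul1r -run_lin.
  by apply: eq_run => x; rewrite !mul1r.
move: k1 k2; rewrite !ler_norml => /andP[a1 a2] /andP[a3 a4]; apply/andP; split; lra.
Qed.

Lemma lapl_le1 (w : I -> R) x : (forall i, 0 <= w i) -> 0 <= lapl w x <= 1.
Proof.
move=> w0; rewrite expR_ge0 /= -[leRHS]expR0 ler_expR oppr_le0 sumr_ge0// => i _.
by rewrite mulr_ge0 ?expR_ge0.
Qed.

Lemma trig_lapl (w : I -> R) (e K : R) : (forall i, 0 <= w i) -> 0 < e -> 0 < K ->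
  exists2 T, trig T & forall x, `|T x - lapl w x| <= \sum_i (e + x i ^+ 2 / K ^+ 2).
Proof.
move=> w0 e0 K0.
have ex i : exists T, trig T /\ (forall x, 0 <= T x <= 1) /\
    forall x, `|T x - expR (- (w i * expR (x i)))| <= e + x i ^+ 2 / K ^+ 2.
  by have [T tT h] := @trig_expexp R I (w i) e K i (w0 i) e0 K0; exists T.
have [T hT] := choice ex.
exists (fun x => \prod_i T i x); first by apply: trig_prod => i; case: (hT i).
move=> x; have -> : lapl w x = \prod_i expR (- (w i * expR (x i))).
  by rewrite /lapl -sumrN; elim/big_ind2: _ => [|? ? ? ? <- <-|//]; rewrite ?expR0 ?expRD.
apply: le_trans (prod_diff_le _ _ _) _.
- by move=> i; case: (hT i) => _ [T01 _] /=; rewrite ger0_norm; case/andP: (T01 x).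
- move=> i; rewrite ger0_norm ?expR_ge0// -[leRHS]expR0 ler_expR oppr_le0.
  by rewrite mulr_ge0 ?expR_ge0.
by apply: ler_sum => i _; case: (hT i) => _ [_ h]; exact: h.
Qed.

Lemma measurable_lapl (w : I -> R) : measurable_fun setT (fun t => lapl w (vec t)).
Proof.
apply: (measurableT_comp (f := expR)) => //.
apply: measurableT_comp => //; apply: measurable_sum => i.
apply: measurable_funM; first exact: measurable_cst.
exact: (measurableT_comp (f := expR)).
Qed.

(** The trigonometric approximation is uniform only up to a quadratic error in the coordinates. This
    is harmless because the walk and the Gaussian vector have the same second moments, so the error
    has the same small mean on both sides. *)
Theorem lapl_limit (w : I -> R) (e : R) : (forall i, 0 <= w i) -> 0 < e ->
  exists m0, forall m, (m0 <= m)%N ->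
    `|run (rpt m (rad m X)) (lapl w) 0 - \int[P]_t lapl w (vec t)| <= e.
Proof.
move=> w0 e0; pose Q := \sum_i \sum_(v <- X) v i ^+ 2.
have Q0 : 0 <= Q by rewrite !sumr_ge0// => i _; rewrite sumr_ge0// => v _; rewrite sqr_ge0.
pose n := #|I|%:R + 1 : R; have n0 : 0 < n by rewrite ltr_wpDl.
(* Chosen, like [K2], so that the two parts of the mean error are at most [e / 8] each. *)
pose dlt := e / (8 * n); have d0 : 0 < dlt by rewrite divr_gt0// mulr_gt0.
pose K2 := 8 * (Q + 1) / e; have K20 : 0 < K2 by rewrite divr_gt0// mulr_gt0// ltr_wpDl.
pose K := Num.sqrt K2; have K0 : 0 < K by rewrite sqrtr_gt0.
have KK : K ^+ 2 = K2 by rewrite sqr_sqrtr// ltW.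
have [T tT hT] := trig_lapl w0 d0 K0.
pose err x := #|I|%:R * dlt + (\sum_i x i ^+ 2) / K2 : R.
have hT' x : `|T x - lapl w x| <= err x.
  by rewrite (le_trans (hT x))// big_split /= sumr_const -mulr_suml KK /err mulr_natl.
have errQ : #|I|%:R * dlt + Q / K2 <= e / 4.
  have a1 : #|I|%:R * dlt <= e / 8.
    rewrite /dlt mulrA ler_pdivrMr ?mulr_gt0//.
    have -> : e / 8 * (8 * n) = n * e by field.
    by rewrite ler_pM2r// /n lerDl.
  have a2 : Q / K2 <= e / 8.
    rewrite ler_pdivrMr// /K2; have -> : e / 8 * (8 * (Q + 1) / e) = Q + 1 by field; rewrite gt_eqF.
    by rewrite lerDl.
  by lra.
have e4 : 0 < e / 4 by rewrite divr_gt0.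
have [m0 hm] := trig_limit tT e4; exists (maxn 1 m0) => m; rewrite geq_max => /andP[m1 /hm {}hm].
have aL : admissible (rpt m (rad m X)).
  by apply/allP => st /mem_rpt /rad_half ->; apply/andP; split; lra.
have R1 : run (rpt m (rad m X)) err 0 = #|I|%:R * dlt + Q / K2.
  rewrite (_ : run _ _ _ = run (rpt m (rad m X)) (fun x => (#|I|%:R * dlt) * 1 + K2^-1 * \sum_i x i ^+ 2) 0); last first.
    by apply: eq_run => x; rewrite /err mulr1 [_ / K2]mulrC.
  rewrite run_lin run_const run_sum mulr1 (mulrC Q); congr (_ + _ * _).
  by apply: eq_bigr => i _; exact: run_rad_sqr.
have up1 : run (rpt m (rad m X)) T 0 <= run (rpt m (rad m X)) (lapl w) 0 + e / 4.
  apply: (@le_trans _ _ (run (rpt m (rad m X)) (fun x => 1 * lapl w x + 1 * err x) 0)).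
    by apply: run_mono => // x; have := hT' x; rewrite ler_norml => /andP[_]; lra.
  by rewrite run_lin R1 !mul1r lerD2l.
have lo1 : run (rpt m (rad m X)) (lapl w) 0 <= run (rpt m (rad m X)) T 0 + e / 4.
  apply: (@le_trans _ _ (run (rpt m (rad m X)) (fun x => 1 * T x + 1 * err x) 0)).
    by apply: run_mono => // x; have := hT' x; rewrite ler_norml => /andP[+ _]; lra.
  by rewrite run_lin R1 !mul1r lerD2l.
have il : P.-integrable setT (EFin \o (fun t => lapl w (vec t))).
  apply: (@bounded_integrable _ 1); first exact: measurable_lapl.
  by move=> t; have /andP[h1 h2] := lapl_le1 (vec t) w0; rewrite ger0_norm.
have iT := trig_vec_integrable tT.
have [isum Esum] := Rintegral_bigsum (index_enum I) sqrZ.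
have ierr : P.-integrable setT (EFin \o (fun t => err (vec t))).
  rewrite (_ : EFin \o _ = (cst (#|I|%:R * dlt)%:E \+ (fun t => (K2^-1)%:E * (\sum_i Z i t ^+ 2)%:E))%E); last first.
    by apply/funext => t; rewrite /= -EFinM -EFinD /err [_ / K2]mulrC.
  apply: (integrableD measurableT); first exact: finite_measure_integrable_cst.
  exact: (integrableZl measurableT _ isum).
have Eerr : \int[P]_t err (vec t) = #|I|%:R * dlt + Q / K2.
  rewrite /err RintegralD//; last 2 first.
  - exact: finite_measure_integrable_cst.
  - have := integrableZl measurableT K2^-1 isum; congr integrable; apply/funext => t; by rewrite /= -EFinM mulrC.
  rewrite Rintegral_cst//= probability_setT /= mulr1 RintegralZr// Esum; congr (_ + _ / _).
  by apply: eq_bigr => i _; exact: varZ.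
have up2 : \int[P]_t T (vec t) <= \int[P]_t lapl w (vec t) + e / 4.
  apply: (@le_trans _ _ (\int[P]_t (lapl w (vec t) + err (vec t)))).
    apply: le_Rintegral => //; first exact: (integrableD measurableT il ierr).
    by move=> t _; have := hT' (vec t); rewrite ler_norml => /andP[_]; lra.
  by rewrite RintegralD// Eerr lerD2l.
have lo2 : \int[P]_t lapl w (vec t) <= \int[P]_t T (vec t) + e / 4.
  apply: (@le_trans _ _ (\int[P]_t (T (vec t) + err (vec t)))).
    apply: le_Rintegral => //; first exact: (integrableD measurableT iT ierr).
    by move=> t _; have := hT' (vec t); rewrite ler_norml => /andP[+ _]; lra.
  by rewrite RintegralD// Eerr lerD2l.
move: hm; rewrite !ler_norml => /andP[h1 h2].
by apply/andP; split; lra.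
Qed.

End Identification.

End RademacherLimit.

(** * The biased micro step of the tree *)

Section MicroStep.

Variable R : realType.

Implicit Types (x : R) (m : nat).

Definition ch x := (expR x + expR (- x)) / 2.

Definition sh x := (expR x - expR (- x)) / 2.

Lemma is_derive_expRN x : is_derive (x : R) 1 (fun x => expR (- x)) (- expR (- x)).
Proof.
have h : is_derive (x : R) 1 (fun x : R => - x) (-1) by apply: is_derive_eq.
have := @is_derive1_comp _ expR (fun x : R => - x) x _ _ (is_derive_expR _) h.
by rewrite mulrN1.
Qed.

Lemma is_derive_ch x : is_derive (x : R) 1 ch (sh x).
Proof. by have h := is_derive_expRN x; apply: is_derive_eq; rewrite /GRing.scale/= /sh; field. Qed.

Lemma is_derive_sh x : is_derive (x : R) 1 sh (ch x).
Proof. by have h := is_derive_expRN x; apply: is_derive_eq; rewrite /GRing.scale/= /ch; field. Qed.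

Lemma ch_ge1 x : 1 <= ch x.
Proof.
rewrite /ch expRN; have e0 := expR_gt0 x; rewrite ler_pdivlMr// mul1r.
have -> : expR x + (expR x)^-1 = (expR x ^+ 2 + 1) / expR x by field; rewrite gt_eqF.
by rewrite ler_pdivlMr//; have := sqr_ge0 (expR x - 1); lra.
Qed.

Lemma sh_ge x : 0 <= x -> x <= sh x.
Proof.
move=> x0; have [c _] := mean_value x0 is_derive_sh.
rewrite {2}/sh oppr0 expR0 subrr mul0r !subr0 => ->.
by have := ch_ge1 c; nra.
Qed.

Lemma ch_sq_sub x : ch x ^+ 2 - sh x ^+ 2 = 1.
Proof.
have -> : ch x ^+ 2 - sh x ^+ 2 = expR x * expR (- x) by rewrite /ch /sh; field.
by rewrite -expRD subrr expR0.
Qed.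

Lemma sh_le_mul x : 0 <= x -> sh x <= x * ch x.
Proof.
move=> x0; have d (z : R) : is_derive (z : R) 1 (fun z => z * ch z - sh z) (z * sh z).
  have h1 := is_derive_ch z; have h2 := is_derive_sh z.
  by apply: is_derive_eq; rewrite /GRing.scale/=; ring.
have [c /andP[c0 _]] := mean_value x0 d.
have h := sh_ge c0; have -> : sh 0 = 0 by rewrite /sh oppr0 subrr mul0r.
rewrite mul0r !subr0 => e; have := mulr_ge0 (mulr_ge0 c0 (le_trans c0 h)) x0.
by lra.
Qed.

Lemma ch_le_gauss x : ch x <= expR (x ^+ 2 / 2).
Proof.
wlog x0 : x / 0 <= x.
  move=> H; have [|/ltW x0] := leP 0 x; first exact: H.
  have := H (- x); rewrite oppr_ge0 sqrrN => /(_ x0).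
  by rewrite /ch opprK addrC.
have d (z : R) : is_derive (z : R) 1 (fun z => ch z * expR (- (z ^+ 2 / 2))) ((sh z - z * ch z) * expR (- (z ^+ 2 / 2))).
  have h0 : is_derive (z : R) 1 (fun z : R => - (z ^+ 2 / 2)) (- z) by apply: is_derive_eq; rewrite /GRing.scale/=; field.
  have h1 := @is_derive1_comp _ expR (fun z : R => - (z ^+ 2 / 2)) z _ _ (is_derive_expR _) h0.
  have h2 := is_derive_ch z.
  by apply: is_derive_eq; rewrite /GRing.scale/=; ring.
have [c /andP[c0 _]] := mean_value x0 d.
have -> : ch 0 * expR (- (0 ^+ 2 / 2)) = 1.
  by rewrite expr0n/= mul0r oppr0 expR0 mulr1 /ch oppr0 expR0; field.
rewrite subr0 => e; have : (sh c - c * ch c) * expR (- (c ^+ 2 / 2)) * x <= 0.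
  by rewrite mulr_le0_ge0// mulr_le0_ge0 ?expR_ge0// subr_le0 sh_le_mul.
rewrite -e subr_le0 => h; move: h; rewrite expRN => h.
by move: h; rewrite ler_pdivrMr ?expR_gt0// mul1r.
Qed.

(** Variance of the field per dyadic level, since the covariance is [- 4 ln |x - y|] up to terms
    without [x - y]. As [ln 4 = v1 / 2], four children per level have critical speed [v1] and
    critical tilt 1. *)
Definition v1 : R := 4 * ln 2.

Lemma v1_bounds : 2 <= v1 <= 4.
Proof.
have E2 : expR (ln 2) = 2 :> R by rewrite lnK// posrE.
rewrite /v1; have h1 := expR_ge1Dx (ln 2 : R); have h2 := expR_half_le2 R.
have : expR (1 / 2) <= expR (ln 2) :> R by rewrite E2.
by rewrite ler_expR => h; apply/andP; split; lra.
Qed.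

(* [mth m] is the hyperbolic cosine of the micro step [meps m], so that [m] micro steps contribute a factor exactly [4]. *)
Definition mth m : R := expR (ln 4 / m%:R).

Definition meps m : R := ln (mth m + Num.sqrt (mth m ^+ 2 - 1)).

Definition msig m : R := meps m / mth m.

(** Probability of the upward displacement of the field. With this bias the displacement factors are
    [e^(meps)] and [e^(- meps)], and after weighting by [e^(-y)] both outcomes have the same weight
    [1 / (2 mth)]; see [Ph_tilt]. *)
Definition mp m : R := expR (- meps m) / (2 * mth m).

(** Speed per level of the frame in which the tilted step is symmetric; close to [v1] for large
    [m]. *)
Definition mdrift m : R := m%:R * (meps m * (sh (meps m) / mth m)).

Lemma ln4E : ln 4 = v1 / 2 :> R.
Proof.
have -> : 4 = 2 * 2 :> R by ring.
by rewrite lnM ?posrE// /v1; field.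
Qed.

Variable m : nat.

Hypothesis m0 : (0 < m)%N.

Let mR : 0 < m%:R :> R. Proof. by rewrite ltr0n. Qed.

Lemma mth_ge1 : 1 <= mth m.
Proof.
rewrite /mth -[leLHS]expR0 ler_expR divr_ge0// ln4E.
by have /andP[h _] := v1_bounds; lra.
Qed.

Lemma mth_pow : mth m ^+ m = 4.
Proof. by rewrite /mth -expRM_natl mulrCA divff ?gt_eqF// mulr1 lnK ?posrE. Qed.

Lemma ch_meps : ch (meps m) = mth m.
Proof.
have h := mth_ge1; set th := mth m in h *; set s := Num.sqrt (th ^+ 2 - 1).
have h2 : 0 <= th ^+ 2 - 1 by nra.
have s2 : s ^+ 2 = th ^+ 2 - 1 by rewrite sqr_sqrtr.
have s0 : 0 <= s by rewrite sqrtr_ge0.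
have p : 0 < th + s by lra.
have E : expR (meps m) = th + s by rewrite /meps lnK ?posrE.
rewrite /ch expRN E; have -> : (th + s)^-1 = th - s.
  apply: (mulfI (lt0r_neq0 p)); rewrite mulfV ?gt_eqF//.
  have -> : (th + s) * (th - s) = th ^+ 2 - s ^+ 2 by ring.
  by rewrite s2; ring.
by field.
Qed.

Lemma meps_ge0 : 0 <= meps m.
Proof.
rewrite /meps ln_ge0//; have := mth_ge1; have := sqrtr_ge0 (mth m ^+ 2 - 1); lra.
Qed.

(** From [y <= sh y], [msig^2 <= 1 - mth^-2], and [1 - e^(-x) <= x] finishes. The variance of a tree
    level thus never exceeds [v1], so the tree stays below the field in covariance for every [m]. *)
Lemma msig_sq_le : m%:R * msig m ^+ 2 <= v1.
Proof.
have h := mth_ge1; have th0 : 0 < mth m by lra.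
have s1 := sh_ge meps_ge0.
have h1 : msig m ^+ 2 <= 1 - (mth m ^+ 2)^-1.
  have -> : 1 - (mth m ^+ 2)^-1 = (sh (meps m) / mth m) ^+ 2.
    have := ch_sq_sub (meps m); rewrite ch_meps => e.
    have -> : (sh (meps m) / mth m) ^+ 2 = (mth m ^+ 2 - 1) / mth m ^+ 2.
      by rewrite exprMn exprVn; congr (_ / _); lra.
    by field; rewrite gt_eqF.
  have e0 := meps_ge0; rewrite /msig; move: s1 e0; move: (meps m) (sh _) => y z s1 e0.
  rewrite lerXn2r ?nnegrE ?divr_ge0 ?(ltW th0) ?(le_trans e0 s1)//.
  by rewrite ler_wpM2r// invr_ge0 ltW.
have h2 : 1 - (mth m ^+ 2)^-1 <= 2 * (ln 4 / m%:R).
  have -> : (mth m ^+ 2)^-1 = expR (- (2 * (ln 4 / m%:R))) by rewrite /mth -expRM_natl expRN.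
  by have := expR_ge1Dx (- (2 * (ln 4 / m%:R)) : R); lra.
have := le_trans h1 h2; rewrite ln4E -(ler_pM2l mR).
by have -> : m%:R * (2 * (v1 / 2 / m%:R)) = v1 by field; rewrite gt_eqF.
Qed.

Lemma meps_sq_ge : v1 <= m%:R * meps m ^+ 2.
Proof.
have := ch_le_gauss (meps m); rewrite ch_meps /mth ler_expR ln4E ler_pdivrMr//; lra.
Qed.

Lemma meps_sqE : m%:R * meps m ^+ 2 = m%:R * msig m ^+ 2 * mth m ^+ 2.
Proof. by rewrite /msig; field; rewrite gt_eqF// (lt_le_trans _ mth_ge1). Qed.

Lemma mdrift_bounds : v1 / mth m <= mdrift m <= v1 * mth m ^+ 2.
Proof.
have h := mth_ge1; have th0 : 0 < mth m by lra.
have s1 := sh_ge meps_ge0; have e0 := meps_ge0.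
apply/andP; split.
  have := meps_sq_ge; rewrite /mdrift; move: s1 e0; move: (meps m) (sh _) => y z s1 e0 h1.
  have -> : m%:R * (y * (z / mth m)) = (m%:R * y * z) / mth m by ring.
  rewrite ler_wpM2r ?invr_ge0 ?(ltW th0)// (le_trans h1)// expr2 mulrA ler_wpM2l// mulr_ge0//.
have t1 : sh (meps m) <= meps m * mth m by rewrite -ch_meps; exact: sh_le_mul.
have : mdrift m <= m%:R * meps m ^+ 2.
  rewrite /mdrift ler_pM2l// expr2 ler_wpM2l// ler_pdivrMr//.
move=> h1; apply: (le_trans h1); rewrite meps_sqE ler_wpM2r ?sqr_ge0//; exact: msig_sq_le.
Qed.

Lemma mp_coefs : meps m <= 1 / 4 ->
  [/\ 1 / 4 <= mp m <= 3 / 4, 1 - mp m = expR (meps m) / (2 * mth m),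
   Num.sqrt ((1 - mp m) / mp m) = expR (meps m) & Num.sqrt (mp m / (1 - mp m)) = expR (- meps m)].
Proof.
move=> e1; have h := mth_ge1; have th0 : 0 < mth m by lra.
have q : 1 - mp m = expR (meps m) / (2 * mth m).
  have E : expR (meps m) + expR (- meps m) = 2 * mth m by rewrite -ch_meps /ch; field.
  rewrite /mp; have -> : expR (- meps m) = 2 * mth m - expR (meps m) by lra.
  by field; rewrite gt_eqF.
have e0 := expR_gt0 (meps m); have e0' := expR_gt0 (- meps m).
have r : (1 - mp m) / mp m = expR (meps m) ^+ 2.
  rewrite q /mp expRN; field; by rewrite !gt_eqF.
have r' : mp m / (1 - mp m) = expR (- meps m) ^+ 2.
  by rewrite q /mp expRN; field; rewrite !gt_eqF.
split => //; last 2 first.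
- by rewrite r sqrtr_sqr ger0_norm// ltW.
- by rewrite r' sqrtr_sqr ger0_norm// ltW.
have E : expR (meps m) + expR (- meps m) = 2 * mth m by rewrite -ch_meps /ch; field.
have ee : expR (meps m) * expR (- meps m) = 1 by rewrite -expRD subrr expR0.
have e2 : expR (meps m) <= 4 / 3.
  have := expR_ge1Dx (- meps m); rewrite expRN => h4.
  have : (3 / 4) * expR (meps m) <= 1; last by lra.
  by rewrite -ler_pdivlMr// mul1r; lra.
have th4 : mth m = (expR (meps m) + expR (- meps m)) / 2 by lra.
have ge1 : 1 <= expR (meps m) by rewrite -[leLHS]expR0 ler_expR meps_ge0.
rewrite /mp; apply/andP; split.
  rewrite ler_pdivlMr ?mulr_gt0// th4; nra.
by rewrite ler_pdivrMr ?mulr_gt0// th4; nra.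
Qed.

End MicroStep.

(** * Comparison of the field with a tree of biased steps *)

Section TreeComparison.

Variables (R : realType) (I : finType).

Implicit Types (x v a w : I -> R) (X T A : seq (I -> R)) (m : nat) (L : seq (R * (I -> R))).

Definition gramv X i j : R := \sum_(v <- X) v i * v j.

Lemma gramv_cat X A i j : gramv (X ++ A) i j = gramv X i j + gramv A i j.
Proof. by rewrite /gramv big_cat. Qed.

Definition halves L := forall st, st \in L -> st.1 = 1 / 2.

(** Flipping all fair coins does not change their law, so runs from [x + y] and [x - y] can be
    paired outcome by outcome; the pairing survives each step of the induction. *)
Lemma run_sign L (f : (I -> R) -> R) : halves L -> (forall x y, f x <= f (x + y) + f (x - y)) ->
  forall x, f x <= 2 * run L f x.
Proof.
move=> hL hf; suff H x y : f x <= run L f (x + y) + run L f (x - y).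
  by move=> x; have := H x 0; rewrite addr0 subr0; lra.
elim: L hL x y => [|[p v] L IH] hL x y; first exact: hf.
have -> : p = 1 / 2 by exact: (hL (p, v) (mem_head _ _)).
have {}IH := IH (fun st h => hL st (ltac:(by rewrite inE h orbT))).
rewrite [run _ _]/= !stp_half.
have h1 := IH x (y + v); have h2 := IH x (y - v).
rewrite opprD opprB !addrA in h1 h2; rewrite [x + v - y]addrAC in h2; lra.
Qed.

Lemma expR_sign (y : R) : 1 <= expR y + expR (- y).
Proof. by have := ch_ge1 y; rewrite /ch; lra. Qed.

Lemma lapl_sign w x y : (forall i, 0 <= w i) ->
  1 - lapl w x <= (1 - lapl w (x + y)) + (1 - lapl w (x - y)).
Proof.
move=> w0; rewrite /lapl; set a := \sum_i w i * expR ((x + y) i); set b := \sum_i w i * expR ((x - y) i).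
have pos z : 0 <= \sum_i w i * expR (z i) by rewrite sumr_ge0// => i _; rewrite mulr_ge0 ?expR_ge0.
have ab : \sum_i w i * expR (x i) <= a + b.
  rewrite /a /b -big_split /=; apply: ler_sum => i _; rewrite -mulrDr ler_wpM2l// !fctE !expRD -mulrDr.
  by rewrite ler_peMr ?expR_ge0// expR_sign.
have : expR (- (a + b)) <= expR (- \sum_i w i * expR (x i)) by rewrite ler_expR lerN2.
have le1 (z : R) : 0 <= z -> 0 <= 1 - expR (- z) by move=> z0; rewrite subr_ge0 -[leRHS]expR0 ler_expR oppr_le0.
have := mulr_ge0 (le1 a (pos _)) (le1 b (pos _)).
rewrite opprD expRD; move: (expR (- a)) (expR (- b)) (expR (- \sum_i _)); clear; intros; lra.
Qed.

Lemma gram_rpt m L i j : gram (rpt m L) i j = m%:R * gram L i j.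
Proof. by rewrite /gram sum_rpt. Qed.

Lemma rpt_halves m L : halves L -> halves (rpt m L).
Proof. by move=> h st /mem_rpt /h. Qed.

Lemma halves_admissible L : halves L -> admissible L.
Proof. by move=> hL; apply/allP => st /hL ->; apply/andP; split; lra. Qed.

Lemma lapl_mono w w' x : (forall i, w i <= w' i) -> lapl w' x <= lapl w x.
Proof. by move=> ww; rewrite ler_expR lerN2; apply: ler_sum => i _; rewrite ler_wpM2r ?expR_ge0. Qed.

(** Convexity of [e^(-z)] moves the average over the signs into the exponent, and
    [cosh v <= e^(v^2 / 2)] bounds the averaged weights. *)
Lemma run_lapl_jensen L w x : halves L -> (forall i, 0 <= w i) ->
  lapl (fun i => w i * expR (gram L i i / 2)) x <= run L (lapl w) x.
Proof.
move=> + w0; elim: L x => [|[p v] L IH] x hL.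
  by apply: lapl_mono => i; rewrite /gram big_nil mul0r expR0 mulr1.
have pE : p = 1 / 2 by exact: (hL (p, v) (mem_head _ _)).
have {}IH y := IH y (fun st h => hL st (ltac:(by rewrite inE h orbT))).
have p1 : 0 < (p, v).1 < 1 by rewrite pE /=; apply/andP; split; lra.
apply: le_trans (stp_mono p1 IH x); rewrite pE stp_half /lapl.
set w' := fun i => w i * expR (gram L i i / 2).
set a := \sum_i _ * expR ((x + v) i); set b := \sum_i _ * expR ((x - v) i).
have h : (a + b) / 2 <= \sum_i w i * expR (gram ((p, v) :: L) i i / 2) * expR (x i).
  rewrite /a /b -big_split /= mulr_suml; apply: ler_sum => i _.
  rewrite !fctE !expRD /gram big_cons /=.
  have -> : (v i * v i + \sum_(st <- L) st.2 i * st.2 i) / 2 = v i ^+ 2 / 2 + gram L i i / 2 by rewrite /gram; field.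
  rewrite expRD; have := ch_le_gauss (v i); rewrite /ch => h.
  have c0 : 0 <= w i * expR (gram L i i / 2) * expR (x i) by rewrite !mulr_ge0 ?expR_ge0.
  have := ler_wpM2l c0 h; rewrite /gram; lra.
have -> : - \sum_i w i * expR (gram ((1 / 2, v) :: L) i i / 2) * expR (x i) =
    - \sum_i w i * expR (gram ((p, v) :: L) i i / 2) * expR (x i) by rewrite pE.
apply: (@le_trans _ _ (expR (- ((a + b) / 2)))); first by rewrite ler_expR lerN2.
have ea : expR (- a) = expR (- a / 2) ^+ 2 by rewrite -expRM_natl; congr expR; field.
have eb : expR (- b) = expR (- b / 2) ^+ 2 by rewrite -expRM_natl; congr expR; field.
have -> : expR (- ((a + b) / 2)) = expR (- a / 2) * expR (- b / 2) by rewrite -expRD; congr expR; field.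
rewrite ea eb; have := sqr_ge0 (expR (- a / 2) - expR (- b / 2)).
by move: (expR (- a / 2)) (expR (- b / 2)); clear; intros; lra.
Qed.

Definition tst m T : seq (R * (I -> R)) := [seq (mp R m, msig R m *: v) | v <- T].

(** One vector per index: independent noise of variance [b i], used to make the diagonals equal. *)
Definition spike (b : I -> R) : seq (I -> R) := [seq (fun j => (j == i)%:R * Num.sqrt (b i)) | i <- enum I].

Lemma gramv_spike (b : I -> R) i j : (forall i, 0 <= b i) -> gramv (spike b) i j = (i == j)%:R * b i.
Proof.
move=> b0; rewrite /gramv big_map big_enum /= (bigD1 i)//= eqxx mul1r big1 ?addr0; last first.
  by move=> k /negbTE ki; rewrite eq_sym ki !mul0r.
by rewrite mulrCA [j == i]eq_sym -expr2 sqr_sqrtr.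
Qed.

Lemma gram_rad m X i j : (0 < m)%N -> gram (rad m X) i j = gramv X i j / m%:R.
Proof.
move=> m0; rewrite /gram big_map /gramv mulr_suml; apply: eq_bigr => v _.
have E : m%:R = Num.sqrt m%:R ^+ 2 :> R by rewrite sqr_sqrtr.
have : 0 < Num.sqrt m%:R :> R by rewrite sqrtr_gt0 ltr0n.
rewrite !fctE /GRing.scale/= [in RHS]E; move: (Num.sqrt _) => q q0.
by field; rewrite gt_eqF.
Qed.

Lemma gram_tst m T i j : gram (tst m T) i j = msig R m ^+ 2 * gramv T i j.
Proof.
rewrite /gram big_map /gramv mulr_sumr; apply: eq_bigr => v _.
by rewrite !fctE /GRing.scale/=; ring.
Qed.

Lemma gram_cat L L' i j : gram (L ++ L') i j = gram L i j + gram L' i j.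
Proof. by rewrite /gram big_cat. Qed.

Lemma micro_large (e : R) : 0 < e -> exists m0, forall m, (m0 <= m)%N ->
  [/\ (0 < m)%N, m%:R^-1 <= e & (Num.sqrt m%:R)^-1 <= e].
Proof.
move=> e0; have q0 : 0 <= e^-1 + (e^-1) ^+ 2 by rewrite addr_ge0 ?sqr_ge0 ?invr_ge0 ?ltW.
exists (Num.truncn (e^-1 + (e^-1) ^+ 2)).+1 => m hm; have m0 : (0 < m)%N by apply: leq_ltn_trans hm.
have mR : 0 < m%:R :> R by rewrite ltr0n.
have /andP[_ /ltW h] := truncn_itv q0.
have {}h : e^-1 + e^-1 ^+ 2 <= m%:R by apply: (le_trans h); rewrite ler_nat.
have ei : 0 < e^-1 by rewrite invr_gt0.
split=> //.
  by rewrite -[leRHS]invrK lef_pV2 ?posrE//; have := sqr_ge0 e^-1; lra.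
rewrite -[leRHS]invrK lef_pV2 ?posrE ?sqrtr_gt0// -(ger0_norm (ltW ei)) -sqrtr_sqr.
by rewrite ler_wsqrtr//; lra.
Qed.

Lemma meps_small m : (0 < m)%N -> m%:R^-1 <= (64 * 64)^-1 :> R -> meps R m <= 1 / 4.
Proof.
move=> m0 hm; have mR : 0 < m%:R :> R by rewrite ltr0n.
have /andP[_ hv] := v1_bounds R.
have th1 := mth_ge1 R m; have th4 : mth R m <= 4.
  by rewrite -(mth_pow R m0) -[leLHS]expr1 ler_weXn2l.
have h := msig_sq_le R m0; have := meps_sqE R m; have e0 := meps_ge0 R m.
move=> E; have : m%:R * meps R m ^+ 2 <= 64.
  rewrite E; apply: (@le_trans _ _ (v1 R * mth R m ^+ 2)); first by rewrite ler_wpM2r// sqr_ge0.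
  by nra.
rewrite -ler_pdivlMl// => h2.
have h3 : meps R m ^+ 2 <= (1 / 8) ^+ 2 by apply: (le_trans h2); lra.
have : meps R m <= 1 / 8 by rewrite -(@ler_pXn2r _ 2) ?nnegrE.
lra.
Qed.

Lemma rpt_cat_run m L L' (F : (I -> R) -> R) : run (rpt m (L ++ L')) F =1 run (rpt m L) (run (rpt m L') F).
Proof. by move=> x; rewrite (run_perm _ (perm_rpt_cat m L L')) run_cat. Qed.

Lemma run_one_sub L (F : (I -> R) -> R) x : run L (fun y => 1 - F y) x = 1 - run L F x.
Proof.
have := run_lin L 1 (-1) (fun=> 1) F x; rewrite run_const mul1r mulN1r => <-.
by apply: eq_run => y; rewrite mulN1r.
Qed.

Lemma run_scale L (c : R) (F : (I -> R) -> R) x : run L (fun y => c * F y) x = c * run L F x.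
Proof.
have := run_lin L c 0 F F x; rewrite mul0r addr0 => <-.
by apply: eq_run => y; rewrite mul0r addr0.
Qed.

Lemma half_quarters (p : R) : p = 1 / 2 -> 1 / 4 <= p <= 3 / 4.
Proof. by move=> ->; apply/andP; split; lra. Qed.

(** The comparison requires equal variances, so the tree is given independent noise of the missing
    variance, which Jensen then turns into larger weights. The [+ 1] in the weights absorbs the
    discretisation error [v1 - m msig^2] of the tree variance. *)
Lemma run_tree_lapl X T w (s : I -> R) (e : R) : 0 < e -> (forall i, 0 <= w i) ->
  (forall i j, i != j -> v1 R * gramv T i j <= gramv X i j) ->
  (forall i, v1 R * gramv T i i <= gramv X i i <= v1 R * gramv T i i + s i) ->
  (forall i j, 0 <= gramv T i j) ->
  exists m0, forall m, (m0 <= m)%N ->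
    run (rpt m (tst m T)) (lapl (fun i => w i * expR ((s i + 1) / 2))) 0 <=
    run (rpt m (rad m X)) (lapl w) 0 + e.
Proof.
move=> e0 w0 off diag T0; have /andP[v2 v4] := v1_bounds R.
pose B := 1 + \sum_(v <- X ++ T) \sum_i `|v i| + \sum_i gramv X i i.
have gX i : 0 <= gramv X i i by rewrite sumr_ge0// => v _; rewrite -expr2 sqr_ge0.
have sB0 : 0 <= \sum_(v <- X ++ T) \sum_i `|v i| by rewrite sumr_ge0// => v _; rewrite sumr_ge0.
have sX0 : 0 <= \sum_i gramv X i i by rewrite sumr_ge0.
have B1 : 1 <= B by rewrite /B; lra.
have BB : B <= 2 * B by lra.
have B20 : 0 <= 2 * B by lra.
have vB v i : v \in X ++ T -> `|v i| <= B.
  move=> vXT; have : `|v i| <= \sum_(v <- X ++ T) \sum_i `|v i|.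
    rewrite (big_rem v)//= (bigD1 i)//= -!addrA lerDl addr_ge0//; first by rewrite sumr_ge0.
    by rewrite sumr_ge0// => u _; rewrite sumr_ge0.
  by rewrite /B; lra.
have gB i : Num.sqrt (gramv X i i) <= B.
  have : gramv X i i <= \sum_i gramv X i i by rewrite (bigD1 i)//= lerDl sumr_ge0.
  have := sqr_sqrtr (gX i); have := sqrtr_ge0 (gramv X i i); rewrite /B; nra.
pose n := (size X + size T + #|I|)%N.
have [K [K0 KE]] : exists K : R, 0 <= K /\ K = 8 * (432 * n%:R ^+ 2).
  by eexists; split; [|reflexivity]; apply: mulr_ge0 (ler0n _ _) (mulr_ge0 (ler0n _ _) (sqr_ge0 _)).
pose C := K * B ^+ 3.
have C0 : 0 <= C.
  have B0 : 0 <= B by lra.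
  exact: mulr_ge0 K0 (exprn_ge0 _ B0).
pose S := \sum_i gramv T i i; have S0 : 0 <= S by rewrite sumr_ge0.
(* Three demands on the fineness: the comparison error [C / sqrt m] is below [e], the variance
   defect [16 / m] times the trace is below 1, and [meps] is at most [1/4]. *)
pose del := Num.min (e / (C + 1)) (Num.min (16 * (S + 1))^-1 (64 * 64)^-1).
have del0 : 0 < del.
  have C1 : 0 < C + 1 by rewrite ltr_wpDl.
  have S1 : 0 < S + 1 by rewrite ltr_wpDl.
  by rewrite /del !lt_min divr_gt0//= !invr_gt0 !mulr_gt0.
have [m0 hm0] := micro_large del0; exists m0 => m /hm0 [m1 md smd].
have mR : 0 < m%:R :> R by rewrite ltr0n.
have /and3P[d1 d2 d3] : [&& del <= e / (C + 1), del <= (16 * (S + 1))^-1 & del <= (64 * 64)^-1].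
  by rewrite /del !ge_min !lexx /= !orbT.
have e14 := meps_small m1 (le_trans md d3).
have [ph _ _ _] := mp_coefs e14.
have ms := msig_sq_le R m1; have th1 := mth_ge1 R m.
have ms0 : 0 <= msig R m by rewrite divr_ge0 ?meps_ge0// (le_trans ler01).
pose b i := gramv X i i - m%:R * msig R m ^+ 2 * gramv T i i.
have b0 i : 0 <= b i.
  by have /andP[h _] := diag i; rewrite /b subr_ge0 (le_trans _ h)// ler_wpM2r.
have bX i : b i <= gramv X i i by rewrite /b lerBlDr lerDl mulr_ge0// mulr_ge0// sqr_ge0.
have bs i : b i <= s i + 1.
  have /andP[_ h] := diag i; have TS : gramv T i i <= S by rewrite /S (bigD1 i)//= lerDl sumr_ge0.
  have h1 : v1 R - 16 * m%:R^-1 <= m%:R * msig R m ^+ 2.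
    have h2 : v1 R * expR (- (v1 R / m%:R)) <= m%:R * msig R m ^+ 2.
      have -> : expR (- (v1 R / m%:R)) = (mth R m ^+ 2)^-1.
        by rewrite /mth -expRM_natl expRN ln4E; congr (expR _)^-1; field; rewrite gt_eqF.
      have t2 : 0 < mth R m ^+ 2 by rewrite exprn_gt0// (lt_le_trans ltr01 th1).
      by rewrite ler_pdivrMr// -meps_sqE//; exact: meps_sq_ge.
    have := expR_ge1Dx (- (v1 R / m%:R)) => h3.
    have mi : 0 <= m%:R^-1 :> R by rewrite invr_ge0.
    have v0 : 0 <= v1 R := le_trans (ler0n _ 2) v2.
    have vv : v1 R * v1 R <= 16 by clear -v2 v4; nra.
    move: (ler_wpM2l v0 h3) (ler_wpM2r mi vv) h2; clear; lra.
  have h2 : 16 * m%:R^-1 * gramv T i i <= 1.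
    have mi : 0 <= m%:R^-1 :> R by rewrite invr_ge0.
    have : m%:R^-1 <= (16 * (S + 1))^-1 :> R := le_trans md d2.
    rewrite -[(16 * (S + 1))^-1]mul1r ler_pdivlMr; last by rewrite mulr_gt0// ltr_wpDl.
    by have := ler_wpM2l mi TS; move: mi; clear; lra.
  by rewrite /b; move: (T0 i i) h1 h2 h; clear; nra.
pose Y := tst m T ++ rad m (spike b).
have cmp := @lapl_comparison R I w w0 (rad m X) Y 0 (2 * B * (Num.sqrt m%:R)^-1) n m.
have sq0 : 0 < (Num.sqrt m%:R)^-1 :> R by rewrite invr_gt0 sqrtr_gt0.
have msq : msig R m <= 2 * (Num.sqrt m%:R)^-1.
  have a0 : 0 <= 2 * (Num.sqrt m%:R)^-1 :> R by rewrite mulr_ge0 ?(ltW sq0).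
  have E : (2 * (Num.sqrt m%:R)^-1) ^+ 2 = 4 / m%:R :> R.
    have := sqr_sqrtr (ltW mR); move: sq0; rewrite invr_gt0; move: (Num.sqrt _) => q q0 <-.
    by field; rewrite gt_eqF.
  by rewrite -(@ler_pXn2r _ 2) ?nnegrE// E ler_pdivlMr// mulrC; move: ms v4; clear; lra.
have eta0 : 0 <= 2 * B * (Num.sqrt m%:R)^-1 by rewrite mulr_ge0 ?(ltW sq0).
have rad_small (U : seq (I -> R)) : (forall v i, v \in U -> `|v i| <= B) -> small (2 * B * (Num.sqrt m%:R)^-1) (rad m U).
  move=> UB st /mapP[v vU ->] i /=; rewrite !fctE /GRing.scale/= normrM gtr0_norm//.
  by rewrite mulrC ler_pM2r// (le_trans (UB v i vU)).
have {}cmp := cmp eta0.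
have tX : tame (rad m X) by move=> st /rad_half; exact: half_quarters.
have tY : tame Y.
  move=> st; rewrite mem_cat => /orP[/mapP[v _ ->]//|/rad_half]; exact: half_quarters.
have sX : small (2 * B * (Num.sqrt m%:R)^-1) (rad m X).
  by apply: rad_small => v i vX; apply: vB; rewrite mem_cat vX.
have sY : small (2 * B * (Num.sqrt m%:R)^-1) Y.
  move=> st; rewrite mem_cat => /orP[/mapP[v vT ->] i|].
    rewrite /= !fctE /GRing.scale/= normrM (ger0_norm ms0).
    have := vB v i (ltac:(by rewrite mem_cat vT orbT)); have := normr_ge0 (v i) => h1 h2.
    by rewrite [leRHS]mulrAC; exact: (ler_pM ms0 h1 msq h2).
  apply: rad_small => v i /mapP[j _ ->]; rewrite normrM (ger0_norm (sqrtr_ge0 _)).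
  apply: le_trans (_ : Num.sqrt (b j) <= _).
    by rewrite ler_piMl ?sqrtr_ge0// ger0_norm// lern1; case: (i == j).
  by rewrite (le_trans _ (gB j))// ler_wsqrtr.
have szX : (size (rad m X) <= n)%N by rewrite size_map /n -addnA leq_addr.
have szY : (size Y <= n)%N.
  by rewrite size_cat !size_map -enumT -cardE /n -addnA leq_addl.
have {}cmp := cmp tX tY sX sY szX szY.
have gY i j : gram Y i j = msig R m ^+ 2 * gramv T i j + (i == j)%:R * b i / m%:R.
  by rewrite gram_cat gram_tst gram_rad// gramv_spike.
have {}cmp : run (rpt m Y) (lapl w) 0 <= run (rpt m (rad m X)) (lapl w) 0 + m%:R * (432 * n%:R ^+ 2 * (2 * B * (Num.sqrt m%:R)^-1) ^+ 3).
  apply: cmp => [i|i j ij].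
    by rewrite gY eqxx mul1r gram_rad// /b; field; rewrite gt_eqF.
  rewrite gY (negbTE ij) !mul0r addr0 gram_rad// ler_pdivlMr// mulrC mulrA.
  by apply: le_trans (off _ _ ij); rewrite ler_wpM2r.
have errE : m%:R * (432 * n%:R ^+ 2 * (2 * B * (Num.sqrt m%:R)^-1) ^+ 3) <= e.
  have -> : m%:R * (432 * n%:R ^+ 2 * (2 * B * (Num.sqrt m%:R)^-1) ^+ 3) = C * (Num.sqrt m%:R)^-1.
    rewrite /C KE -[X in X * (432 * _ * _)](sqr_sqrtr (ltW mR)); move: sq0; rewrite invr_gt0; move: (Num.sqrt _) => q q0.
    by field; rewrite gt_eqF.
  have : (Num.sqrt m%:R)^-1 <= e / (C + 1) by exact: le_trans smd d1.
  rewrite ler_pdivlMr ?ltr_wpDl// => h; apply: le_trans h.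
  by rewrite mulrDr mulr1 mulrC lerDl ltW.
apply: le_trans (le_trans cmp _); last by rewrite lerD2l.
rewrite /Y rpt_cat_run; apply: run_mono.
  apply: admissible_rpt; apply: tame_admissible => st /mapP[v _ ->]; exact: ph.
move=> x; apply: le_trans (run_lapl_jensen x _ w0); last first.
  by apply: rpt_halves => st; exact: rad_half.
apply: lapl_mono => i; rewrite ler_wpM2l// ler_expR gram_rpt gram_rad// gramv_spike// eqxx mul1r.
by rewrite [m%:R * _]mulrC divfK ?gt_eqF// ler_pM2r// bs.
Qed.

Section OnOmega.

Context (d : measure_display) (Omega : measurableType d) (P : probability Omega R).

Variable Z : I -> Omega -> R.

Hypothesis mZ : forall i, measurable_fun setT (Z i).

Variable X : seq (I -> R).

Hypothesis charZ : forall a p, \int[P]_t cos (dotp a (fun i => Z i t) + p) = expR (- (qform X a / 2)) * cos p.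

Hypothesis sqrZ : forall i, P.-integrable setT (EFin \o (fun t => Z i t ^+ 2)).

Hypothesis varZ : forall i, \int[P]_t (Z i t ^+ 2) = \sum_(v <- X) v i ^+ 2.

(* Adding an independent symmetric vector costs at most a factor [2]. *)
Theorem tree_comparison A T w (s : I -> R) (e : R) : 0 < e -> (forall i, 0 <= w i) ->
  (forall i j, i != j -> v1 R * gramv T i j <= gramv (X ++ A) i j) ->
  (forall i, v1 R * gramv T i i <= gramv (X ++ A) i i <= v1 R * gramv T i i + s i) ->
  (forall i j, 0 <= gramv T i j) ->
  exists m0, forall m, (m0 <= m)%N ->
    1 - \int[P]_t lapl w (fun i => Z i t) <=
    2 * run (rpt m (tst m T)) (fun x => 1 - lapl (fun i => w i * expR ((s i + 1) / 2)) x) 0 + e.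
Proof.
move=> e0 w0 off diag T0; have e4 : 0 < e / 4 by rewrite divr_gt0.
have [m1 h1] := lapl_limit mZ charZ sqrZ varZ w0 e4.
have [m2 h2] := run_tree_lapl e4 w0 off diag T0.
exists (maxn m1 m2) => m; rewrite geq_max => /andP[/h1 {}h1 /h2 {}h2].
rewrite run_one_sub.
have hA : halves (rpt m (rad m A)) by apply: rpt_halves => st; exact: rad_half.
have hX : admissible (rpt m (rad m X)).
  by apply: halves_admissible; apply: rpt_halves => st; exact: rad_half.
have sgn x := @run_sign (rpt m (rad m A)) (fun x => 1 - lapl w x) hA (fun x y => lapl_sign x y w0) x.
have := run_mono hX sgn 0.
have -> : run (rpt m (rad m X)) (fun x => 2 * run (rpt m (rad m A)) (fun y => 1 - lapl w y) x) 0 =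
   2 * run (rpt m (rad m (X ++ A))) (fun y => 1 - lapl w y) 0.
  rewrite /rad map_cat -/(rad m X) -/(rad m A) rpt_cat_run.
  by rewrite run_scale.
rewrite !run_one_sub; move: h1 h2; rewrite ler_norml => /andP[h1 h1'] h2; lra.
Qed.

End OnOmega.

End TreeComparison.

(** * The branching recursion as a symmetric walk under a cap *)

Section BranchingIteration.

Variables (R : realType) (m : nat).

Hypothesis m0 : (0 < m)%N.

Hypothesis eps_small : meps R m <= 1 / 4.

Implicit Types (f g : R -> R) (y z : R).

Local Notation eps := (meps R m).

Local Notation theta := (mth R m).

Definition dd : R := eps * (sh eps / theta).

(** A micro step acting on functions of the distance [y] that is still missing to the threshold. *)
Definition Ph g y : R := mp R m * g (y - (dd + eps)) + (1 - mp R m) * g (y - (dd - eps)).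

Definition Av f z : R := (f (z - eps) + f (z + eps)) / 2.

(** One level: a union bound over four children after [m] micro steps, capped at 1 because a
    probability is being bounded. *)
Definition Phi g y : R := Num.min 1 (4 * iter m Ph g y).

Lemma expNK z (x : R) : expR z * (expR (- z) * x) = x.
Proof. by rewrite mulrA -expRD subrr expR0 mul1r. Qed.

Lemma mdriftE : mdrift R m = m%:R * dd. Proof. by []. Qed.

Let th0 : 0 < theta. Proof. by apply: lt_le_trans (mth_ge1 R m). Qed.

Lemma mp_bounds : 0 <= mp R m /\ 0 <= 1 - mp R m.
Proof. by have [/andP[h1 h2] _ _ _] := mp_coefs eps_small; split; lra. Qed.

Lemma Av_mono f g : (forall y, f y <= g y) -> forall y, Av f y <= Av g y.
Proof. by move=> fg y; rewrite /Av ler_pM2r// lerD. Qed.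

Lemma iter_Ph_ge0 j g : (forall y, 0 <= g y) -> forall y, 0 <= iter j Ph g y.
Proof.
have [p0 p1] := mp_bounds => g0; elim: j => //= j IH y.
by rewrite addr_ge0// mulr_ge0.
Qed.

Lemma Phi_bounds g : (forall y, 0 <= g y) -> forall y, 0 <= Phi g y <= 1.
Proof.
move=> g0 y; rewrite /Phi ge_min lexx /= le_min ler01 /=.
by rewrite mulr_ge0// iter_Ph_ge0.
Qed.

Lemma Ph_tilt f y : Ph (fun y => expR (- y) * f y) y = expR (- (y - dd)) / theta * Av f (y - dd).
Proof.
have [_ q _ _] := mp_coefs eps_small; rewrite /Ph q /Av /mp.
have -> : y - (dd + eps) = y - dd - eps by ring.
have -> : y - (dd - eps) = y - dd + eps by ring.
have e1 : expR (- (y - dd - eps)) = expR (- (y - dd)) * expR eps by rewrite -expRD; congr expR; ring.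
have e2 : expR (- (y - dd + eps)) = expR (- (y - dd)) * expR (- eps) by rewrite -expRD; congr expR; ring.
rewrite e1 e2 expRN; field; by rewrite !gt_eqF ?expR_gt0.
Qed.

Lemma Av_shift f (c t z : R) : Av (fun y => c * f (y - t)) z = c * Av f (z - t).
Proof.
rewrite /Av; have -> : z - eps - t = z - t - eps by ring.
have -> : z + eps - t = z - t + eps by ring.
by field.
Qed.

Lemma iter_Av_shift j f (c t z : R) : iter j Av (fun y => c * f (y - t)) z = c * iter j Av f (z - t).
Proof.
elim: j z => //= j IH z; rewrite -(Av_shift _ c t z).
by rewrite /Av !IH.
Qed.

Lemma iter_Ph_tilt j f y : iter j Ph (fun y => expR (- y) * f y) y =
  expR (- (y - j%:R * dd)) / theta ^+ j * iter j Av f (y - j%:R * dd).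
Proof.
elim: j y => [|j IH] y; first by rewrite /= mul0r subr0 expr0 divr1.
have E : iter j Ph (fun y => expR (- y) * f y) =
   (fun y => expR (- y) * (expR (j%:R * dd) / theta ^+ j * iter j Av f (y - j%:R * dd))).
  apply/funext => x; rewrite IH [RHS]mulrA; congr (_ * _); rewrite [RHS]mulrA -expRD.
  by congr (expR _ / _); ring.
rewrite [LHS]/= E; clear E.
rewrite Ph_tilt Av_shift -natr1 exprS.
have -> : y - (j%:R + 1) * dd = y - dd - j%:R * dd by ring.
have -> : expR (- (y - dd - j%:R * dd)) = expR (- (y - dd)) * expR (j%:R * dd) by rewrite -expRD; congr expR; ring.
by rewrite -[Av (iter j Av f)]/(iter j.+1 Av f) invfM; ring.
Qed.

Variable g0 : R -> R.

Hypothesis g01 : forall y, 0 <= g0 y <= 1.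

Local Notation gl l := (iter l Phi g0).

Lemma gl_bounds l y : 0 <= gl l y <= 1.
Proof. by elim: l y => //= l IH y; apply: Phi_bounds => {}y; case/andP: (IH y). Qed.

(** The iterate in the frame moving by [mdrift] per level, weighted by [e^z]. In these coordinates a
    level is plain symmetric averaging, since [mth^m = 4] cancels the four children. *)
Definition om l z : R := expR z * gl l (z + l%:R * mdrift R m).

Lemma om_step l z : om l.+1 z <= iter m Av (om l) z.
Proof.
rewrite /om /=; set y := z + _.
have h : Phi (gl l) y <= 4 * iter m Ph (gl l) y by rewrite /Phi ge_min lexx orbT.
apply: le_trans (ler_wpM2l (expR_ge0 z) h) _.
pose f x := expR (l%:R * mdrift R m) * om l (x - l%:R * mdrift R m).
have E : iter m Ph (gl l) y = iter m Ph (fun y => expR (- y) * f y) y.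
  congr (iter m Ph _ y); apply/funext => x; rewrite /f /om subrK !mulrA -!expRD.
  by rewrite (_ : - x + _ + _ = 0) ?expR0 ?mul1r//; ring.
rewrite E iter_Ph_tilt iter_Av_shift mth_pow// -mdriftE.
have yE : y - mdrift R m = z + l%:R * mdrift R m by rewrite /y -natr1; ring.
rewrite yE addrK.
have -> : expR z * (4 * (expR (- (z + l%:R * mdrift R m)) / 4 * (expR (l%:R * mdrift R m) * iter m Av (om l) z))) =
  (expR z * expR (- (z + l%:R * mdrift R m)) * expR (l%:R * mdrift R m)) * iter m Av (om l) z by field.
by rewrite -!expRD (_ : z + _ + _ = 0) ?expR0 ?mul1r//; ring.
Qed.

Lemma om_ge0 l z : 0 <= om l z.
Proof. by rewrite mulr_ge0 ?expR_ge0//; case/andP: (gl_bounds l (z + l%:R * mdrift R m)). Qed.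

Lemma om_cap l z : om l z <= expR z.
Proof. by rewrite ler_piMr ?expR_ge0//; case/andP: (gl_bounds l (z + l%:R * mdrift R m)). Qed.

(** Interpolates [om] inside a level so that [j] counts micro steps, which is the time of the walk
    on the line. *)
Definition Wm j z : R := iter (j %% m) Av (om (j %/ m)) z.

Lemma Wm_ge0 j z : 0 <= Wm j z.
Proof.
rewrite /Wm; elim: (j %% m)%N z => [|r IH] z /=; first exact: om_ge0.
by rewrite /Av divr_ge0// addr_ge0.
Qed.

Lemma Wm_step j z : Wm j.+1 z <= Av (Wm j) z.
Proof.
rewrite /Wm; have E : j = (j %/ m * m + j %% m)%N by exact: divn_eq.
have rm := ltn_pmod j m0; set q := (j %/ m)%N in E *; set r := (j %% m)%N in E rm *.
have [rm'|rm'] := ltnP r.+1 m.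
  have -> : (j.+1 %% m = r.+1)%N by rewrite E -addnS modnMDl modn_small.
  by have -> : (j.+1 %/ m = q)%N by rewrite E -addnS divnMDl// divn_small// addn0.
have rE : r.+1 = m by apply/eqP; rewrite eqn_leq rm rm'.
have E2 : j.+1 = (q.+1 * m)%N by rewrite E -addnS rE mulSn addnC.
rewrite E2 modnMl mulnK//=; apply: le_trans (om_step q z) _.
by rewrite -{1}rE.
Qed.

(** At full levels [om <= e^z]; inside a level each averaging multiplies [e^z] by [mth], and fewer
    than [m] of them give at most [mth^m = 4]. *)
Lemma Wm_cap j z : Wm j z <= 4 * expR z.
Proof.
have h r y : iter r Av (om (j %/ m)) y <= theta ^+ r * expR y.
  elim: r y => [|r IH] y /=; first by rewrite mul1r om_cap.
  have -> : theta ^+ r.+1 * expR y = Av (fun y => theta ^+ r * expR y) y.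
    by rewrite /Av !expRD -ch_meps exprS /ch; field.
  exact: Av_mono.
apply: le_trans (h _ z) _; rewrite ler_wpM2r ?expR_ge0//.
by rewrite -(mth_pow R m0) ler_weXn2l ?mth_ge1// ltnW// ltn_pmod.
Qed.

Hypothesis eps_pos : 0 < eps.

Hypothesis theta_small : theta ^+ 2 <= 2.

Definition pass_const : R := lattice_const R * 48.

(** The ballot estimate after [k m] micro steps, expressed in levels: the time [t] of the walk lies
    between [2 k] and [16 k]. *)
Lemma pass_bound (s mu A : R) k z Y : (0 < k)%N -> 0 < mu <= 1 -> 1 <= A ->
  (forall z, 0 <= z + s -> g0 z <= expR (- z) * (expR (- s) * (A * (1 + (z + s)) * expR (- (mu * (z + s)))))) ->
  0 <= Y -> z + s + 3 / 2 * ln k%:R + 6 <= Y ->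
  gl k (z + k%:R * mdrift R m) <= expR (- z) * (pass_const * A * mu ^- 3 * expR (- s) * (1 + Y) / (k%:R * Num.sqrt k%:R)).
Proof.
move=> k0 hmu A1 hg Y0 hY; have kR : 1 <= k%:R :> R by rewrite ler1n.
have mR : 1 <= m%:R :> R by rewrite ler1n.
have /andP[v2 v4] := v1_bounds R.
have me := meps_sq_ge R m0; have me2 := meps_sqE R m; have ms := msig_sq_le R m0.
have me3 : m%:R * eps ^+ 2 <= 8.
  rewrite me2; have := ler_pM (mulr_ge0 (ler0n _ _) (sqr_ge0 _)) (sqr_ge0 _) ms theta_small; lra.
pose j := (k * m)%N; set t := j.+1%:R * eps ^+ 2.
have e2 : 0 <= eps ^+ 2 by rewrite sqr_ge0.
have tE : t = k%:R * (m%:R * eps ^+ 2) + eps ^+ 2 by rewrite /t -natr1 natrM; ring.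
have t1 : k%:R * 2 <= t by rewrite tE; nra.
have t2 : t <= 16 * k%:R.
  have : eps ^+ 2 <= 8 by nra.
  by rewrite tE; nra.
have tpos : 0 < t by lra.
(* Origin of the additive 6 in the hypothesis: [3/2 ln 16 <= 6]. *)
have lnt : 3 / 2 * ln t <= 3 / 2 * ln k%:R + 6.
  have h1 : ln t <= ln (16 * k%:R) by rewrite ler_ln ?posrE//; lra.
  have h2 : ln (16 * k%:R) = 2 * v1 R / 2 + ln k%:R.
    rewrite lnM ?posrE//; last lra.
    have -> : 16 = 4 * 4 :> R by ring.
    by rewrite lnM ?posrE// ln4E; field.
  lra.
have hW0 z' : 0 <= z' + s -> Wm 0 z' <= expR (- s) * (A * (1 + (z' + s)) * expR (- (mu * (z' + s)))).
  move=> hz; rewrite /Wm mod0n div0n /= /om mul0r addr0 /=.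
  apply: le_trans (ler_wpM2l (expR_ge0 z') (hg z' hz)) _.
  by rewrite expNK.
have eb : 0 < eps <= 1 / 2 by have es := eps_small; rewrite eps_pos /=; lra.
have jt : 2 <= j.+1%:R * eps ^+ 2 by rewrite -/t; lra.
have hz : z + s + 3 / 2 * ln (j.+1%:R * eps ^+ 2) <= Y by rewrite -/t; lra.
have := @line_sharp_bound R eps Wm s mu A eb Wm_ge0 Wm_step Wm_cap hmu A1 hW0 j z Y jt Y0 hz.
rewrite {1}/Wm /j modnMl mulnK//= /om -/j -/t -/pass_const => H.
have e0 := expR_gt0 z.
rewrite -(ler_pM2l e0) expNK (le_trans H)//.
have C0 : 0 <= pass_const * A * mu ^- 3 * expR (- s) * (1 + Y).
  have c0 := lattice_const_gt0 R; case/andP: hmu => mu0 _.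
  by rewrite !mulr_ge0 ?expR_ge0 ?invr_ge0 ?exprn_ge0 ?(ltW mu0) ?(ltW c0) ?addr_ge0 ?(le_trans ler01 A1).
rewrite ler_wpM2l// lef_pV2 ?posrE ?mulr_gt0 ?sqrtr_gt0//; [|lra..].
by rewrite ler_pM ?sqrtr_ge0 ?ler_wsqrtr//; lra.
Qed.

(** Affine functions are harmonic for the symmetric walk, and below the barrier [b] the cap is at
    most [4 e^b]; their sum is a supersolution. This passes a bound through any number of levels
    without using the ballot factor again. *)
Lemma affine_bound (b c : R) l z : 0 <= c ->
  (forall z, b <= z -> g0 z <= expR (- z) * (c * (1 + (z - b)))) -> b <= z ->
  gl l (z + l%:R * mdrift R m) <= expR (- z) * (4 * expR b + c * (1 + (z - b))).
Proof.
move=> c0 hg bz.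
have H j y : b <= y -> Wm j y <= 4 * expR b + c * (1 + (y - b)).
  elim: j y => [|j IH] y by_.
    rewrite /Wm mod0n div0n /= /om mul0r addr0 /= (le_trans (ler_wpM2l (expR_ge0 y) (hg y by_)))//.
    by rewrite expNK lerDr mulr_ge0 ?expR_ge0.
  apply: le_trans (Wm_step j y) _; rewrite /Av.
  have ep := eps_pos; have hp := IH (y + eps) (ltac:(lra)); have es := eps_small.
  suff hm : Wm j (y - eps) <= 4 * expR b + c * (1 + (y - eps - b)) by lra.
  have [h|h] := leP b (y - eps); first exact: IH.
  apply: le_trans (Wm_cap _ _) _.
  have : expR (y - eps) <= expR b by rewrite ler_expR ltW.
  have : 0 <= c * (1 + (y - eps - b)) by rewrite mulr_ge0//; lra.
  lra.
have := H (l * m)%N z bz; rewrite {1}/Wm modnMl mulnK//= /om => h.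
by rewrite -(ler_pM2l (expR_gt0 z)) expNK.
Qed.

End BranchingIteration.

(** * Recursion over the blocks of the tree *)

Section TreeRecursion.

Variables (R : realType) (I : finType) (K : choiceType) (blk : nat -> I -> K) (c : nat -> R) (m : nat).

Hypothesis blk_step : forall l i j, blk l i = blk l j -> blk l.+1 i = blk l.+1 j.

Hypothesis m0 : (0 < m)%N.

Hypothesis eps_small : meps R m <= 1 / 4.

Implicit Types (x : I -> R) (w : I -> R) (l : nat) (b : K) (r : R) (F G : (I -> R) -> R).

Definition blocks l : seq K := undup [seq blk l i | i <- enum I].

Definition children l b : seq K := undup [seq blk l i | i <- enum I & blk l.+1 i == b].

(** The independent variable attached to block [b] acts on all points of the block with the weight
    [c l] of its level. *)
Definition bvec l b : I -> R := fun i => c l * (blk l i == b)%:R.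

Definition lvec l : seq (I -> R) := [seq bvec l b | b <- blocks l].

Fixpoint tvec n : seq (I -> R) := if n is n'.+1 then lvec n' ++ tvec n' else [::].

(** The [m] rounds of the tree rearranged level by level, coarsest level outermost; steps commute,
    so by [perm_TL] a run is unchanged. *)
Fixpoint TL n : seq (R * (I -> R)) := if n is n'.+1 then rpt m (tst m (lvec n')) ++ TL n' else [::].

Lemma mem_blocks l i : blk l i \in blocks l.
Proof. by rewrite mem_undup map_f// mem_enum. Qed.

Lemma sum_indic (s : seq K) (a : K) : uniq s -> \sum_(b <- s) (a == b)%:R = (a \in s)%:R :> R.
Proof.
elim: s => [|b s IH] /=; first by rewrite big_nil.
case/andP => bs /IH {}IH; rewrite big_cons IH inE; have [->|] := eqVneq a b; last by rewrite add0r.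
by rewrite (negbTE bs) addr0.
Qed.

Lemma gramv_tvec n i j : gramv (tvec n) i j = \sum_(l < n) c l ^+ 2 * (blk l i == blk l j)%:R.
Proof.
elim: n => [|n IH]; first by rewrite /gramv /= big_nil big_ord0.
rewrite /= gramv_cat IH big_ord_recr /= addrC; congr (_ + _).
rewrite /gramv big_map.
have -> : \sum_(b <- blocks n) bvec n b i * bvec n b j =
   \sum_(b <- blocks n) c n ^+ 2 * (blk n i == blk n j)%:R * (blk n i == b)%:R.
  apply: eq_bigr => b _; rewrite /bvec.
  have [->|nb] := eqVneq (blk n i) b; last by rewrite !mulr0 mul0r.
  rewrite [blk n j == b]eq_sym; have -> : true%:R = 1 :> R by [].
  by move: ((b == blk n j)%:R) => z; ring.
by rewrite -mulr_sumr sum_indic ?undup_uniq// mem_blocks mulr1.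
Qed.

Lemma perm_TL n : perm_eq (rpt m (tst m (tvec n))) (TL n).
Proof.
elim: n => [|n IH] /=; first by rewrite /rpt /=; elim: m.
rewrite /tst map_cat -/(tst m _) -/(tst m _).
by apply: perm_trans (perm_rpt_cat _ _ _) _; rewrite perm_cat2l.
Qed.

Lemma TL_admissible n : admissible (TL n).
Proof.
have [/andP[p1 p2] _ _ _] := mp_coefs eps_small.
elim: n => //= n IH; rewrite /admissible all_cat -/(admissible (TL n)) IH andbT.
apply: admissible_rpt; apply/allP => st /mapP[v _ ->] /=; apply/andP; split; lra.
Qed.

Definition wb w l b : I -> R := fun i => w i * (blk l i == b)%:R.

Definition fb w l b x : R := 1 - lapl (wb w l b) x.

Definition dep l b F := forall x y, (forall i, blk l i = b -> x i = y i) -> F x = F y.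

Lemma dep_run l b L F : dep l b F -> dep l b (run L F).
Proof.
move=> dF; elim: L => //= st L IH x y xy; rewrite /stp.
by congr (_ * _ + _ * _); apply: IH => i ib; rewrite !fctE xy.
Qed.

Lemma dep_fb w l b : dep l b (fb w l b).
Proof.
move=> x y xy; rewrite /fb /lapl /wb; congr (1 - expR (- _)); apply: eq_bigr => i _.
by have [/xy ->|] := eqVneq (blk l i) b; rewrite ?mulr0 ?mul0r.
Qed.

Lemma stp_other l b b' p F x (s : R) : dep l b F -> b != b' -> stp (p, s *: bvec l b') F x = F x.
Proof.
move=> dF bb; rewrite /stp /= -(dF x (x + _)) -?(dF x (x - _)); first by ring.
  by move=> i ib; rewrite !fctE /GRing.scale/= /bvec ib (negbTE bb) !mulr0 subr0.
by move=> i ib; rewrite !fctE /GRing.scale/= /bvec ib (negbTE bb) !mulr0 addr0.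
Qed.

(** Steps of the other blocks do not move the coordinates on which [F] depends, so they average
    out. *)
Lemma run_level l b F : dep l b F -> b \in blocks l ->
  run (tst m (lvec l)) F =1 stp (mp R m, msig R m *: bvec l b) F.
Proof.
move=> dF; rewrite /tst /lvec -map_comp.
have : uniq (blocks l) by exact: undup_uniq.
elim: (blocks l) => //= b' s IH /andP[b's us]; rewrite inE => /orP[/eqP E|bs] x.
  have H y : run [seq ((fun v => (mp R m, msig R m *: v)) \o [eta bvec l]) i | i <- s] F y = F y.
    have : b \notin s by rewrite E.
    elim: s {IH b's us} y => //= a s IH y; rewrite inE negb_or => /andP[ba bs].
    by rewrite (@stp_other l b a _ _ _ _ _ ba) ?IH//; exact: dep_run.
  by rewrite E; exact: (eq_stp _ H).
have bb : b != b' by apply/eqP => E; move: b's; rewrite -E bs.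
by rewrite (@stp_other l b b' _ _ _ _ _ bb); [exact: IH | exact: dep_run].
Qed.

(** A micro step seen from a block: its points move together, so their common value [r] is the only
    state. *)
Definition Pc (cc : R) (g : R -> R) r : R :=
  mp R m * g (r + cc * (msig R m * expR (meps R m))) + (1 - mp R m) * g (r - cc * (msig R m * expR (- meps R m))).

Lemma run_level_const l b F : dep l b F -> b \in blocks l -> forall j r,
  run (rpt j (tst m (lvec l))) F (fun=> r) = iter j (Pc (c l)) (fun r => F (fun=> r)) r.
Proof.
move=> dF bl; elim=> // j IH r.
rewrite /rpt /= -/(rpt j _) run_cat (run_level (dep_run _ dF) bl).
have [_ _ a1 a2] := mp_coefs eps_small.
rewrite /stp /= a1 a2 /Pc -!IH; have dH := dep_run (rpt j (tst m (lvec l))) dF.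
congr (_ * _ + _ * _); apply: dH => i ib; rewrite !fctE /GRing.scale/= /bvec ib eqxx mulr1; ring.
Qed.

Lemma one_sub_exp_sum (J : Type) (s : seq J) (a : J -> R) : (forall j, 0 <= a j) ->
  1 - expR (- \sum_(j <- s) a j) <= \sum_(j <- s) (1 - expR (- a j)).
Proof.
move=> a0; elim: s => [|j s IH]; first by rewrite !big_nil oppr0 expR0 subrr.
rewrite !big_cons opprD expRD; apply: le_trans (lerD (lexx _) IH).
set e := expR (- \sum_(_ <- _) _).
have h1 : expR (- a j) <= 1 by rewrite -[leRHS]expR0 ler_expR oppr_le0.
have h2 : e <= 1 by rewrite -[leRHS]expR0 ler_expR oppr_le0 sumr_ge0.
by have := expR_ge0 (- a j); nra.
Qed.

Lemma fb_children w l b x : (forall i, 0 <= w i) ->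
  fb w l.+1 b x <= \sum_(g <- children l b) fb w l g x.
Proof.
move=> w0; have E : \sum_i wb w l.+1 b i * expR (x i) =
    \sum_(g <- children l b) \sum_i wb w l g i * expR (x i).
  rewrite exchange_big /=; apply: eq_bigr => i _; rewrite -mulr_suml /wb -mulr_sumr.
  congr (_ * _ * _); rewrite sum_indic ?undup_uniq//; congr (nat_of_bool _)%:R.
  rewrite mem_undup; apply/eqP/mapP => [ib|[j]].
    by exists i => //; rewrite mem_filter ib eqxx mem_enum.
  by rewrite mem_filter => /andP[/eqP <- _] /blk_step.
rewrite /fb /lapl E; apply: one_sub_exp_sum => g.
by rewrite sumr_ge0// => i _; rewrite /wb mulr_ge0 ?expR_ge0// mulr_ge0.
Qed.

Definition Ul w l b r : R := run (TL l) (fb w l b) (fun=> r).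

Lemma children_blocks l b g : g \in children l b -> g \in blocks l.
Proof.
by rewrite !mem_undup => /mapP[i _ ->]; rewrite map_f// mem_enum.
Qed.

Lemma Ul_step w l b r : (forall i, 0 <= w i) ->
  Ul w l.+1 b r <= \sum_(g <- children l b) iter m (Pc (c l)) (Ul w l g) r.
Proof.
move=> w0; rewrite /Ul; apply: le_trans (run_mono (TL_admissible l.+1) (fun x => fb_children l b x w0) _) _.
rewrite run_sum le_eqVlt; apply/orP; left; apply/eqP.
rewrite big_seq [RHS]big_seq; apply: eq_bigr => g /children_blocks gb.
by rewrite /= run_cat (run_level_const (dep_run _ (@dep_fb w l g)) gb).
Qed.

Lemma fb_bounds w l b x : (forall i, 0 <= w i) -> 0 <= fb w l b x <= 1.
Proof.
move=> w0; have wb0 i : 0 <= wb w l b i by rewrite mulr_ge0.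
by rewrite /fb; have /andP[h1 h2] := lapl_le1 x wb0; apply/andP; split; lra.
Qed.

Lemma Ul_bounds w l b r : (forall i, 0 <= w i) -> 0 <= Ul w l b r <= 1.
Proof.
move=> w0; rewrite /Ul; apply/andP; split.
  rewrite -[leLHS](run_const (TL l) 0 (fun=> r)); apply: run_mono => [|x]; first exact: TL_admissible.
  by case/andP: (fb_bounds l b x w0).
rewrite -[leRHS](run_const (TL l) 1 (fun=> r)); apply: run_mono => [|x]; first exact: TL_admissible.
by case/andP: (fb_bounds l b x w0).
Qed.

Lemma Pc_mono cc (g h : R -> R) : (forall r, g r <= h r) -> forall r, Pc cc g r <= Pc cc h r.
Proof. by have [p0 p1] := mp_bounds eps_small; move=> gh r; rewrite lerD// ler_wpM2l. Qed.

Lemma iter_Pc_mono j cc (g h : R -> R) : (forall r, g r <= h r) -> forall r, iter j (Pc cc) g r <= iter j (Pc cc) h r.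
Proof. by move=> gh; elim: j => //= j IH; exact: Pc_mono. Qed.

Lemma iter_Pc_Ph j cc (h : R -> R) r : 0 < cc ->
  iter j (Pc cc) (fun r => h (- r / cc)) r = iter j (Ph m) h (- r / cc).
Proof.
move=> cc0; elim: j r => //= j IH r; rewrite /Pc /Ph !IH.
have th0 : 0 < mth R m by apply: lt_le_trans (mth_ge1 R m).
have Ec := ch_meps R m; rewrite /dd /msig.
have e1 : expR (meps R m) = ch (meps R m) + sh (meps R m) by rewrite /ch /sh; field.
have e2 : expR (- meps R m) = ch (meps R m) - sh (meps R m) by rewrite /ch /sh; field.
rewrite e1 e2 Ec; congr (_ * _ + _ * _); congr (iter j _ h _); field; by rewrite !gt_eqF.
Qed.

Section Averaged.

Variables (A : finType) (q : A -> R) (w : A -> I -> R).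

Hypothesis q0 : forall a, 0 <= q a.

Hypothesis q1 : \sum_a q a = 1.

Hypothesis w0 : forall a i, 0 <= w a i.

Definition UA l b r : R := \sum_a q a * Ul (w a) l b r.

Lemma iter_Pc_sum (J : Type) (s : seq J) (f : J -> R) (g : J -> R -> R) cc j r :
  iter j (Pc cc) (fun r => \sum_(a <- s) f a * g a r) r = \sum_(a <- s) f a * iter j (Pc cc) (g a) r.
Proof.
elim: j r => //= j IH r; rewrite /Pc !IH !mulr_sumr -big_split /=.
by apply: eq_bigr => a _; ring.
Qed.

Lemma UA_step l b r : UA l.+1 b r <= \sum_(g <- children l b) iter m (Pc (c l)) (UA l g) r.
Proof.
rewrite /UA; apply: (@le_trans _ _ (\sum_a q a * \sum_(g <- children l b) iter m (Pc (c l)) (Ul (w a) l g) r)).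
  by apply: ler_sum => a _; rewrite ler_wpM2l// Ul_step.
under eq_bigr do rewrite mulr_sumr.
rewrite exchange_big /=; apply: ler_sum => g _.
by rewrite -(iter_Pc_sum _ q (fun a => Ul (w a) l g)).
Qed.

Lemma UA_bounds l b r : 0 <= UA l b r <= 1.
Proof.
rewrite /UA sumr_ge0 /=; last by move=> a _; rewrite mulr_ge0//; case/andP: (Ul_bounds l b r (w0 a)).
rewrite -q1; apply: ler_sum => a _; rewrite ler_piMr//; by case/andP: (Ul_bounds l b r (w0 a)).
Qed.

Hypothesis children4 : forall l b, (size (children l b) <= 4)%N.

(** The substitution [y = - r / cc] turns the state of a block into a distance to the threshold, and
    each level is then dominated by [Phi]: its 4 counts the children and its cap comes from
    [UA_bounds]. *)
Lemma UA_pass l0 k cc (g : R -> R) : 0 < cc -> (forall l, (l0 <= l < l0 + k)%N -> c l = cc) ->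
  (forall y, 0 <= g y) ->
  (forall b r, UA l0 b r <= g (- r / cc)) ->
  forall b r, UA (l0 + k) b r <= iter k (Phi m) g (- r / cc).
Proof.
move=> cc0 + g0 h0; elim: k => [|k IH] hc b r; first by rewrite addn0; exact: h0.
have {}IH := IH (fun l h => hc l (ltac:(by case/andP: h => -> /=; rewrite addnS => /ltnW))).
rewrite addnS iterS [leRHS]/Phi le_min; case/andP: (UA_bounds (l0 + k).+1 b r) => _ -> /=.
apply: le_trans (UA_step _ _ _) _; rewrite hc ?leq_addr ?addnS//=.
have gk0 y : 0 <= iter k (Phi m) g y.
  by elim: k y {IH hc} => //= k IH y; case/andP: (Phi_bounds eps_small IH y).
have i0 y : 0 <= iter m (Ph m) (iter k (Phi m) g) y by exact: iter_Ph_ge0.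
apply: (@le_trans _ _ (\sum_(g' <- children (l0 + k) b) iter m (Ph m) (iter k (Phi m) g) (- r / cc))).
  apply: ler_sum => g' _; rewrite -(iter_Pc_Ph m (iter k (Phi m) g) r cc0).
  exact: iter_Pc_mono.
rewrite big_const_seq count_predT iter_addr_0.
have sz : (size (children (l0 + k) b))%:R <= 4 :> R by rewrite ler_nat.
by rewrite -[leLHS]mulr_natl; have := ler_wpM2r (i0 (- r / cc)) sz.
Qed.

End Averaged.

Lemma run_tree n w : (forall i j, blk n i = blk n j) -> (forall i, 0 <= w i) -> forall i0,
  run (rpt m (tst m (tvec n))) (fun x => 1 - lapl w x) 0 = Ul w n (blk n i0) 0.
Proof.
move=> hr w0 i0; rewrite (run_perm _ (perm_TL n)) /Ul.
rewrite (_ : (0 : I -> R) = (fun=> 0))//; apply: eq_run => x; rewrite /fb; congr (1 - expR (- _)).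
by apply: eq_bigr => i _; rewrite /wb (hr i i0) eqxx mulr1.
Qed.

End TreeRecursion.

(** * Bounds for the iterates at the root *)

Section RootBounds.

Variable R : realType.

Implicit Types (m n k : nat) (g h : R -> R) (y z s t : R).

(** The micro steps are fine enough for [n] levels; the last clause lets the total drift be replaced
    by [n v1] at the cost of 1. *)
Definition micro_ok n m := [/\ (0 < m)%N, meps R m <= 1 / 4, 0 < meps R m, mth R m ^+ 2 <= 2 &
  `|n%:R * (mdrift R m - v1 R)| <= 1].

Lemma micro_ok_eventually n : exists m0, forall m, (m0 <= m)%N -> micro_ok n m.
Proof.
have e1 : 0 < (64 * 64)^-1 :> R by rewrite invr_gt0 mulr_gt0.
have e2 : 0 < (32 * (n%:R + 1))^-1 :> R by rewrite invr_gt0 mulr_gt0// ltr_wpDl.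
have [m1 h1] := micro_large e1; have [m2 h2] := micro_large e2.
exists (maxn m1 m2) => m; rewrite geq_max => /andP[/h1[m0 a1 _] /h2[_ a2 _]].
have mR : 0 < m%:R :> R by rewrite ltr0n.
have /andP[v2 v4] := v1_bounds R; set i := m%:R^-1 in a1 a2.
have i0 : 0 < i by rewrite invr_gt0.
have i8 : i <= 1 / 8 by rewrite (le_trans a1)// -[leRHS]invrK lef_pV2 ?posrE//; lra.
have th1 := mth_ge1 R m.
have th2 : mth R m ^+ 2 <= 1 + 8 * i.
  have -> : mth R m ^+ 2 = expR (v1 R * i) by rewrite /mth -expRM_natl ln4E; congr expR; rewrite /i; field; rewrite gt_eqF.
  have := expR_ge1Dx (- (v1 R * i)); rewrite expRN => h.
  have e0 := expR_gt0 (v1 R * i).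
  have : (1 - v1 R * i) * expR (v1 R * i) <= 1 by rewrite -ler_pdivlMr// mul1r.
  have : 1 - 4 * i <= 1 - v1 R * i by nra.
  by nra.
have eg := meps_sq_ge R m0.
split => //.
- exact: meps_small.
- rewrite lt_def meps_ge0// andbT; apply/eqP => e; move: eg; rewrite e expr0n/= mulr0; lra.
- by lra.
- have /andP[d1 d2] := mdrift_bounds R m0.
  have t0 : 0 < mth R m by lra.
  have d1' : v1 R * (1 - 8 * i) <= mdrift R m.
    apply: le_trans d1; rewrite ler_pM2l; last lra.
    rewrite -[leRHS]mul1r ler_pdivlMr//; nra.
  have hi : n%:R * (32 * i) <= 1.
    have n0 : 0 <= n%:R :> R by [].
    have : i * (32 * (n%:R + 1)) <= 1 by rewrite -ler_pdivlMr ?mul1r// mulr_gt0// ltr_wpDl.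
    by nra.
  have dd : `|mdrift R m - v1 R| <= 32 * i by rewrite ler_norml; apply/andP; split; nra.
  by rewrite normrM ger0_norm// (le_trans _ hi)// ler_wpM2l.
Qed.

Section Fixed.

Variables (m n : nat).

Hypothesis mok : micro_ok n m.

Local Notation c0 := (mdrift R m).

Local Notation P := (Phi m).

Let m0 : (0 < m)%N. Proof. by case: mok. Qed.

Let es : meps R m <= 1 / 4. Proof. by case: mok. Qed.

Let ep : 0 < meps R m. Proof. by case: mok. Qed.

Let ts : mth R m ^+ 2 <= 2. Proof. by case: mok. Qed.

Lemma iter_Phi_shift j g (a y : R) : iter j P (fun y => g (y - a)) y = iter j P g (y - a).
Proof.
elim: j y => //= j IH y.
have -> : iter j P (fun y => g (y - a)) = (fun y => iter j P g (y - a)) by apply/funext => z; exact: IH.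
rewrite /Phi; congr (Num.min 1 (4 * _)); move: (iter j P g) => f.
have H i z : iter i (Ph m) (fun y0 => f (y0 - a)) z = iter i (Ph m) f (z - a).
  elim: i z => //= i IHi z; rewrite /Ph !IHi.
  have -> : z - (dd R m + meps R m) - a = z - a - (dd R m + meps R m) by ring.
  by have -> : z - (dd R m - meps R m) - a = z - a - (dd R m - meps R m) by ring.
exact: H.
Qed.

(** [Phi] commutes with translations, so the moving frame can be started at level [k] instead of the
    leaves. *)
Lemma root_full h k (s mu A t Y : R) : (k < n)%N -> (forall y, 0 <= h y <= 1) -> 0 < mu <= 1 -> 1 <= A ->
  (forall z, 0 <= z + s -> h (z + k%:R * c0) <= expR (- z) * (expR (- s) * (A * (1 + (z + s)) * expR (- (mu * (z + s)))))) ->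
  0 <= Y -> t - n%:R * c0 + s + 3 / 2 * ln (n - k)%:R + 6 <= Y ->
  iter (n - k) P h t <=
    expR (- (t - n%:R * c0)) * (pass_const R * A * mu ^- 3 * expR (- s) * (1 + Y) / ((n - k)%:R * Num.sqrt (n - k)%:R)).
Proof.
move=> kn h01 hmu A1 hh Y0 hY.
pose g z := h (z + k%:R * c0).
have g01 y : 0 <= g y <= 1 by exact: h01.
have nk : (0 < n - k)%N by rewrite subn_gt0.
have := @pass_bound R m m0 es g g01 ep ts s mu A (n - k) (t - n%:R * c0) Y nk hmu A1 hh Y0 hY.
rewrite natrB ?(ltnW kn)//.
have -> : t - n%:R * c0 + (n%:R - k%:R) * c0 = t - k%:R * c0 by ring.
suff -> : iter (n - k) P g (t - k%:R * c0) = iter (n - k) P h t by [].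
rewrite -(iter_Phi_shift _ g); congr (iter _ _ _ _); apply/funext => y.
by rewrite /g subrK.
Qed.

(** Between [k] and [kb] the ballot estimate is used, and thinning at level [kb] multiplies the
    result by [p]. From [kb] to the root only a barrier at depth [a] below the starting height is
    used: falling below it costs [4 e^(-a)], staying above it costs the affine factor [1 + a]. *)
Lemma root_block h k kb (s mu A p a t B : R) : (k < kb <= n)%N -> (forall y, 0 <= h y <= 1) -> 0 < mu <= 1 -> 1 <= A ->
  (forall z, 0 <= z + s -> h (z + k%:R * c0) <= expR (- z) * (expR (- s) * (A * (1 + (z + s)) * expR (- (mu * (z + s)))))) ->
  0 <= p <= 1 -> 0 <= a -> 0 <= B -> t - n%:R * c0 - a + s + 3 / 2 * ln (kb - k)%:R + 6 <= B ->
  iter (n - kb) P (fun y => p * iter (kb - k) P h y) t <= 4 * expR (- a) + 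
    expR (- (t - n%:R * c0)) * (p * (pass_const R * A * mu ^- 3 * expR (- s) / ((kb - k)%:R * Num.sqrt (kb - k)%:R)) * (1 + B) * (1 + a)).
Proof.
case/andP=> kkb kbn h01 hmu A1 hh /andP[p0 p1] a0 B0 hB.
pose g z := h (z + k%:R * c0).
have g01 y : 0 <= g y <= 1 by exact: h01.
have nk : (0 < kb - k)%N by rewrite subn_gt0.
set Q := pass_const R * A * mu ^- 3 * expR (- s) / _.
have nkR : 0 < (kb - k)%:R :> R by rewrite ltr0n.
have Q0 : 0 <= Q.
  have c0' := lattice_const_gt0 R; case/andP: hmu => mu0 _.
  by rewrite /Q /pass_const !mulr_ge0 ?expR_ge0 ?invr_ge0 ?exprn_ge0 ?mulr_ge0 ?sqrtr_ge0 ?(ltW mu0) ?(ltW c0')//; lra.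
pose g2 z := p * iter (kb - k) P h (z + kb%:R * c0).
have hb01 y : 0 <= iter (kb - k) P h y <= 1 by exact: gl_bounds.
have g201 y : 0 <= g2 y <= 1.
  by have /andP[i0 i1] := hb01 (y + kb%:R * c0); rewrite /g2 mulr_ge0//= mulr_ile1.
pose b := t - n%:R * c0 - a.
have hg2 z : b <= z -> g2 z <= expR (- z) * (p * Q * (1 + B) * (1 + (z - b))).
  move=> bz; have zb : 0 <= z - b by rewrite subr_ge0.
  have Y0 : 0 <= B + (z - b) by rewrite addr_ge0.
  have hY : z + s + 3 / 2 * ln (kb - k)%:R + 6 <= B + (z - b) by rewrite /b; lra.
  have := @pass_bound R m m0 es g g01 ep ts s mu A (kb - k) z (B + (z - b)) nk hmu A1 hh Y0 hY.
  have -> : iter (kb - k) (Phi m) g (z + (kb - k)%:R * c0) = iter (kb - k) P h (z + kb%:R * c0).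
    have -> : z + (kb - k)%:R * c0 = z + kb%:R * c0 - k%:R * c0 by rewrite natrB ?(ltnW kkb)//; ring.
    rewrite -(iter_Phi_shift _ g); congr (iter _ _ _ _); apply/funext => y.
    by rewrite /g subrK.
  move=> H; rewrite /g2; apply: le_trans (ler_wpM2l p0 H) _.
  have -> : pass_const R * A * mu ^- 3 * expR (- s) * (1 + (B + (z - b))) / ((kb - k)%:R * Num.sqrt (kb - k)%:R) = Q * (1 + (B + (z - b))).
    by rewrite /Q; ring.
  have -> : p * (expR (- z) * (Q * (1 + (B + (z - b))))) = expR (- z) * (p * Q * (1 + (B + (z - b)))) by ring.
  have -> : expR (- z) * (p * Q * (1 + B) * (1 + (z - b))) = expR (- z) * (p * Q * ((1 + B) * (1 + (z - b)))) by ring.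
  have pQ : 0 <= p * Q by exact: mulr_ge0.
  rewrite ler_wpM2l ?expR_ge0// ler_wpM2l//.
  by have := mulr_ge0 B0 zb; lra.
have B1 : 0 <= 1 + B by lra.
have c00 : 0 <= p * Q * (1 + B) := mulr_ge0 (mulr_ge0 p0 Q0) B1.
have ba : b <= t - n%:R * c0 by rewrite /b; lra.
have := @affine_bound R m m0 es g2 g201 ep b (p * Q * (1 + B)) (n - kb) (t - n%:R * c0) c00 hg2 ba.
have -> : iter (n - kb) (Phi m) g2 (t - n%:R * c0 + (n - kb)%:R * c0) = iter (n - kb) P (fun y => p * iter (kb - k) P h y) t.
  have -> : t - n%:R * c0 + (n - kb)%:R * c0 = t - kb%:R * c0 by rewrite natrB//; ring.
  rewrite -(iter_Phi_shift _ g2); congr (iter _ _ _ _); apply/funext => y.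
  by rewrite /g2 subrK.
move=> H; apply: (le_trans H); rewrite mulrDr lerD//.
  by rewrite mulrCA -expRD /b (_ : - _ + _ = - a)//; ring.
by rewrite /b (_ : t - n%:R * c0 - (t - n%:R * c0 - a) = a)//; ring.
Qed.

(* Change of measure at level [k]: from there on the field enters with weight [2 + kap] instead of [2]. *)
Lemma tilt_initial g k (s D kap C E : R) : (0 < k <= n)%N -> 0 <= s -> 0 <= D -> 1 <= C ->
  kap = (1 + s + D)^-1 -> E = v1 R * k%:R - 3 / 2 * ln k%:R + D ->
  (forall y, 0 <= g y <= 1) -> (forall y, g y <= expR (- s) * (C * expR (- (2 * y)))) -> (forall y, g y <= expR (- s)) ->
  forall z, 0 <= z + (3 / 2 * ln k%:R + s) ->
  forall y, y = z + k%:R * c0 ->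
  iter k P g (y + kap / 2 * (y - E)) <= expR (- z) * (expR (- (3 / 2 * ln k%:R + s)) *
    (96 * (1 + pass_const R) * C * (1 + s) ^+ 3 * (1 + (z + (3 / 2 * ln k%:R + s))) * expR (- (kap / 2 * (z + (3 / 2 * ln k%:R + s)))))).
Proof.
case/andP=> k0 kn s0 D0 C1 kapE EE g01 gC gs z; set xi := z + (3 / 2 * ln k%:R + s) => xi0 y yz.
have kR : 1 <= k%:R :> R by rewrite ler1n.
have sD : 0 < 1 + s + D by lra.
have kap0 : 0 < kap by rewrite kapE invr_gt0.
have kap1 : kap <= 1 by rewrite kapE invf_le1//; lra.
have ksD : kap * (1 + s + D) = 1 by rewrite kapE mulVf// gt_eqF.
have s1 : 0 < 1 + s by lra.
have mu01 : 0 < (1 + s)^-1 <= 1 by rewrite invr_gt0 s1 /= invf_le1//; lra.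
have A1 : 1 <= 3 * C by lra.
have e3 : expR 1 <= 4 :> R.
  have := expR_half_le2 R; have -> : expR 1 = expR (1 / 2) ^+ 2 :> R by rewrite -expRM_natl; congr expR; field.
  by have := expR_ge0 (1 / 2 : R); nra.
(* On [[-s, 0]] nothing better than [g <= e^(-s)] is known. A decay rate as slow as [(1 + s)^-1]
   loses only a factor [e] there; the price is the power [(1 + s)^3]. *)
have init z' : 0 <= z' + s -> g z' <= expR (- z') * (expR (- s) * (4 * C * (1 + (z' + s)) * expR (- ((1 + s)^-1 * (z' + s))))).
  move=> hz; have es0 := expR_gt0 (- s).
  have mu0 : 0 < (1 + s)^-1 by rewrite invr_gt0.
  have q : expR (- ((1 + s)^-1 * (z' + s))) * 4 >= expR (- (Num.max 0 z')).
    have : expR (- Num.max 0 z') <= expR (- ((1 + s)^-1 * (z' + s))) * expR 1.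
      rewrite -expRD ler_expR.
      have h1 : (1 + s)^-1 * (z' + s) <= Num.max 0 z' + 1.
        rewrite ler_pdivrMl//; have : z' <= Num.max 0 z' by rewrite le_max lexx orbT.
        have : 0 <= Num.max 0 z' by rewrite le_max lexx.
        by move: (Num.max 0 z') => M hM hz'; nra.
      lra.
    by move=> h; apply: (le_trans h); rewrite ler_wpM2l ?expR_ge0.
  have e0 := expR_gt0 (- ((1 + s)^-1 * (z' + s))).
  set ee := expR (- ((1 + s)^-1 * _)) in q e0 *.
  have hg : g z' <= expR (- z') * (expR (- s) * (C * expR (- (Num.max 0 z')))).
    have [z0|z0] := leP 0 z'.
      apply: le_trans (gC z') _.
      have -> : expR (- z') * (expR (- s) * (C * expR (- z'))) = expR (- s) * (C * (expR (- z') * expR (- z'))) by ring.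
      rewrite -expRD; have -> : - z' + - z' = - (2 * z') by ring.
      by [].
    rewrite oppr0 expR0 mulr1; apply: le_trans (gs z') _.
    rewrite mulrCA -[leLHS]mulr1 ler_pM2l//.
    have : 1 <= expR (- z') by rewrite -[leLHS]expR0 ler_expR; lra.
    by nra.
  apply: le_trans hg _; rewrite ler_wpM2l ?expR_ge0// ler_wpM2l ?expR_ge0//.
  have -> : 4 * C * (1 + (z' + s)) * ee = C * ((1 + (z' + s)) * (ee * 4)) by ring.
  rewrite ler_wpM2l//; [lra|]; apply: le_trans q _.
  by rewrite ler_peMl ?mulr_ge0 ?(ltW e0)//; lra.
have [_ _ _ _ hd] := mok.
set eta := k%:R * (c0 - v1 R).
have eta1 : `|eta| <= 1.
  apply: le_trans hd; rewrite /eta !normrM ler_wpM2r// !ger0_norm// ler_nat//.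
pose zeff := z + kap / 2 * (y - E).
have yE : y - E = xi - s - D + eta by rewrite yz EE /xi /eta; ring.
move: eta1; rewrite ler_norml => /andP[eta1 eta2].
(* The choice of [kap] gives [kap (s + D) <= 1], so the changed weight costs a bounded factor, while
   the term [kap / 2 * xi] provides the decay for the coarser levels. *)
have zeff1 : - zeff <= - z - kap / 2 * xi + 1 / 2.
  rewrite /zeff yE.
  have : kap / 2 * (s + D - eta) <= 1 / 2 by nra.
  by nra.
have Yok : zeff + s + 3 / 2 * ln k%:R + 6 <= 3 / 2 * xi + 7.
  have -> : zeff + s + 3 / 2 * ln k%:R + 6 = xi + kap / 2 * (xi - s - D + eta) + 6 by rewrite /zeff yE /xi; ring.
  have : kap / 2 * (xi - s - D + eta) <= kap / 2 * (xi + 1) by rewrite ler_pM2l; [lra|rewrite divr_gt0].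
  have : kap / 2 * (xi + 1) <= 1 / 2 * (xi + 1) by rewrite ler_wpM2r; lra.
  lra.
have Y0 : 0 <= 3 / 2 * xi + 7 by lra.
have A4 : 1 <= 4 * C by lra.
have H := @pass_bound R m m0 es g g01 ep ts s (1 + s)^-1 (4 * C) k zeff (3 / 2 * xi + 7) k0 mu01 A4 init Y0 Yok.
have -> : y + kap / 2 * (y - E) = zeff + k%:R * c0 by rewrite /zeff yz; ring.
apply: (le_trans H); have kk : expR (- (3 / 2 * ln k%:R)) = (k%:R * Num.sqrt k%:R)^-1 :> R by rewrite t32E// (lt_le_trans ltr01).
set pc := pass_const R; have pc0 : 0 < pc by rewrite /pc /pass_const mulr_gt0 ?lattice_const_gt0.
have -> : expR (- (3 / 2 * ln k%:R + s)) = expR (- s) * (k%:R * Num.sqrt k%:R)^-1 by rewrite -kk -expRD; congr expR; ring.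
have mu3 : (1 + s)^-1 ^- 3 = (1 + s) ^+ 3 by rewrite exprVn invrK.
rewrite mu3; have s3 : 0 < (1 + s) ^+ 3 by rewrite exprn_gt0.
have ki : 0 < (k%:R * Num.sqrt k%:R)^-1 :> R by rewrite invr_gt0 mulr_gt0 ?sqrtr_gt0 ?(lt_le_trans ltr01).
set G := expR (- s) * (k%:R * Num.sqrt k%:R)^-1; have G0 : 0 < G by rewrite mulr_gt0 ?expR_gt0.
have e1 : expR (- zeff) <= expR (- z) * (expR (- (kap / 2 * xi)) * 2).
  apply: (@le_trans _ _ (expR (- z - kap / 2 * xi + 1 / 2))); first by rewrite ler_expR.
  by rewrite !expRD mulrA ler_wpM2l ?mulr_ge0 ?expR_ge0// expR_half_le2.
have -> : pc * (4 * C) * (1 + s) ^+ 3 * expR (- s) * (1 + (3 / 2 * xi + 7)) / (k%:R * Num.sqrt k%:R) =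
   G * (pc * (4 * C) * (1 + s) ^+ 3 * (1 + (3 / 2 * xi + 7))) by rewrite /G; ring.
have F0 : 0 <= G * (pc * (4 * C) * (1 + s) ^+ 3 * (1 + (3 / 2 * xi + 7))).
  have c4 : 0 <= 4 * C by rewrite (le_trans ler01).
  have x7 : 0 <= 1 + (3 / 2 * xi + 7) by rewrite addr_ge0.
  exact: mulr_ge0 (ltW G0) (mulr_ge0 (mulr_ge0 (mulr_ge0 (ltW pc0) c4) (ltW s3)) x7).
clearbody G pc.
apply: le_trans (ler_wpM2r F0 e1) _.
have ek := expR_ge0 (- (kap / 2 * xi)).
clear F0; move: ek; move: (expR (- (kap / 2 * xi))) => ee ek.
move: G0 s3; move: G ((1 + s) ^+ 3) => G S3 G0 S30.
have -> : expR (- z) * (ee * 2) * (G * (pc * (4 * C) * S3 * (1 + (3 / 2 * xi + 7)))) =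
  expR (- z) * ((G * C * S3 * ee) * (8 * pc * (8 + 3 / 2 * xi))) by field.
have -> : expR (- z) * (G * (96 * (1 + pc) * C * S3 * (1 + xi) * ee)) =
  expR (- z) * ((G * C * S3 * ee) * (96 * (1 + pc) * (1 + xi))) by ring.
rewrite ler_wpM2l ?expR_ge0//.
have C0 : 0 <= C by rewrite (le_trans ler01).
have GC := mulr_ge0 (mulr_ge0 (mulr_ge0 (ltW G0) C0) (ltW S30)) ek.
by rewrite ler_wpM2l//; clear -pc0 xi0; nra.
Qed.

End Fixed.

End RootBounds.

(** * The planar walk and its potential kernel truncated in time *)

Section PlanarKernel.

Variable R : realType.

Implicit Types (n r j : nat) (u v : int) (z : Z2).

Local Notation srw := (srw1 R).

Lemma srw1_abs n u : srw n u = srw n (`|u|%N)%:Z.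
Proof. by case: u => k //; rewrite NegzE srw1N. Qed.

(** Shows that [p(r) (n + 1 + r^2 / 4)] decreases in steps of 2, which yields the tail
    [sqrt n / r^2] by mere monotonicity. *)
Lemma srw1_far_step n r : srw n (r%:Z + 2) * (n%:R + 1 + (r%:R + 2) ^+ 2 / 4) <= srw n r%:Z * (n%:R + 1 + r%:R ^+ 2 / 4).
Proof.
have h := srw1_ratio R n r%:Z; rewrite -pmulrn in h.
have n0 : 0 <= n%:R :> R by []; have r0 : 0 <= r%:R :> R by [].
have b0 := srw1_ge0 R n r%:Z.
have q0 : 0 < n%:R + r%:R + 2 :> R by lra.
rewrite -(ler_pM2l q0) mulrA h.
have : 0 <= srw n r%:Z * ((r%:R + 1) * (n%:R + 2 + r%:R ^+ 2 / 2 + r%:R)).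
  by rewrite !mulr_ge0//; have := sqr_ge0 (r%:R : R); lra.
by lra.
Qed.

Lemma srw1_far_nat n r : srw n r%:Z * r%:R ^+ 2 <= 8 * Num.sqrt n.+1%:R.
Proof.
have n0 : 0 <= n%:R :> R by [].
have s0 : 0 < Num.sqrt n.+1%:R :> R by rewrite sqrtr_gt0 ltr0n.
have s2 : Num.sqrt n.+1%:R ^+ 2 = n%:R + 1 :> R by rewrite sqr_sqrtr// -natr1.
have H h (b : bool) : srw n (b + h.*2)%:Z * (n%:R + 1 + (b + h.*2)%:R ^+ 2 / 4) <= 2 * Num.sqrt n.+1%:R.
  elim: h => [|h IH].
    rewrite addn0; have le1 := srw1_le R n (b : nat)%:Z.
    apply: (@le_trans _ _ ((Num.sqrt n.+1%:R)^-1 * (2 * Num.sqrt n.+1%:R ^+ 2))).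
      rewrite ler_pM ?srw1_ge0 ?addr_ge0 ?divr_ge0 ?sqr_ge0//; rewrite s2.
      by case: b {le1}; rewrite ?expr1n ?expr0n/=; lra.
    by rewrite expr2 mulrCA mulKf ?gt_eqF.
  apply: le_trans IH; have := srw1_far_step n (b + h.*2).
  have -> : (b + h.+1.*2)%:Z = (b + h.*2)%:Z + 2 by rewrite doubleS !addnS; lia.
  have -> : (b + h.+1.*2)%:R = (b + h.*2)%:R + 2 :> R by rewrite doubleS !addnS -!natr1; ring.
  by [].
have E : r = (odd r + (r./2).*2)%N by rewrite odd_double_half.
have := H (r./2) (odd r); rewrite -E.
have b0 := srw1_ge0 R n r%:Z.
have : 0 <= srw n r%:Z * (n%:R + 1) by rewrite mulr_ge0//; lra.
by lra.
Qed.

Lemma srw1_near n h : srw n 0 * (1 - h.*2%:R ^+ 2 / n.+1%:R) <= srw n h.*2%:Z.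
Proof.
have n1 : 0 < n.+1%:R :> R by rewrite ltr0n.
have b0 := srw1_ge0 R n 0.
elim: h => [|h IH]; first by rewrite /= expr0n/= mul0r subr0 mulr1.
set q := h.*2%:R in IH *; have q0 : 0 <= q :> R by rewrite /q.
have -> : h.+1.*2%:R = q + 2 :> R by rewrite doubleS -!natr1 /q; ring.
have [neg|pos] := leP (1 - (q + 2) ^+ 2 / n.+1%:R) 0.
  by rewrite (le_trans (mulr_ge0_le0 b0 neg))// srw1_ge0.
have h1 := srw1_ratio R n h.*2%:Z; rewrite -pmulrn -/q in h1.
have -> : h.+1.*2%:Z = h.*2%:Z + 2 by lia.
have nE : n.+1%:R = n%:R + 1 :> R by rewrite natr1.
have n0 : 0 <= n%:R :> R by [].
have p0 : 0 < n%:R + q + 2 by lra.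
rewrite -(ler_pM2l p0) h1.
have pos' : (q + 2) ^+ 2 < n%:R + 1.
  by move: pos; rewrite subr_gt0 ltr_pdivrMr// mul1r nE.
have nq : 0 <= n%:R - q by have := sqr_ge0 (q + 1); lra.
apply: le_trans (ler_wpM2l nq IH).
rewrite mulrCA [leRHS]mulrCA ler_wpM2l// nE.
have n1' : 0 < n%:R + 1 :> R by lra.
rewrite -(ler_pM2l n1') !mulrA.
have -> : (n%:R + 1) * (n%:R + q + 2) * (1 - (q + 2) ^+ 2 / (n%:R + 1)) = (n%:R + q + 2) * (n%:R + 1 - (q + 2) ^+ 2) by field; rewrite gt_eqF.
have -> : (n%:R + 1) * (n%:R - q) * (1 - q ^+ 2 / (n%:R + 1)) = (n%:R - q) * (n%:R + 1 - q ^+ 2) by field; rewrite gt_eqF.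
have -> : (n%:R - q) * (n%:R + 1 - q ^+ 2) = (n%:R + q + 2) * (n%:R + 1 - (q + 2) ^+ 2) +
  (n%:R * (2 * q + 2) + (q + 2) ^+ 3 + q ^+ 3 - 2 * q - 2) by ring.
rewrite lerDl; have := sqr_ge0 (q + 2); have : 0 <= n%:R * (2 * q + 2) by rewrite mulr_ge0//; lra.
have : 0 <= q ^+ 3 by rewrite exprn_ge0.
have : 4 * (q + 2) <= (q + 2) ^+ 3.
  have : 4 <= (q + 2) ^+ 2 by nra.
  by rewrite exprS; nra.
lra.
Qed.

Lemma ln_le_sub1 (x : R) : 0 < x -> ln x <= x - 1.
Proof. by move=> x0; have := expR_ge1Dx (ln x); rewrite lnK ?posrE//; lra. Qed.

Lemma harmonic_bounds (a b : nat) : (0 < a <= b)%N ->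
  ln b%:R - ln a%:R <= \sum_(a <= j < b) (j%:R : R)^-1 <= ln b%:R - ln a%:R + a%:R^-1 - b%:R^-1.
Proof.
case/andP=> a0 ab; rewrite -(subnKC ab); elim: (b - a)%N => [|k IH].
  by rewrite addn0 big_geq// subrr add0r subrr lexx.
rewrite addnS big_nat_recr ?leq_addr//=; set m := (a + k)%N in IH *.
have m0 : 0 < m%:R :> R by rewrite ltr0n /m addn_gt0 a0.
have m1 : 0 < m.+1%:R :> R by rewrite ltr0n.
have mE : m.+1%:R = m%:R + 1 :> R by rewrite natr1.
have l1 : ln m.+1%:R - ln m%:R <= m%:R^-1 :> R.
  rewrite -ln_div ?posrE//; apply: le_trans (ln_le_sub1 _) _; first by rewrite divr_gt0.
  by rewrite mE mulrDl mulfV ?gt_eqF// mul1r; lra.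
have l2 : ln m%:R - ln m.+1%:R <= - (m.+1%:R^-1) :> R.
  rewrite -ln_div ?posrE//; apply: le_trans (ln_le_sub1 _) _; first by rewrite divr_gt0.
  have -> : m%:R / m.+1%:R - 1 = - (m.+1%:R^-1) :> R by rewrite mE; field; rewrite gt_eqF// -mE.
  by [].
by case/andP: IH => h1 h2; move: h1 h2 l1 l2; clear => h1 h2 l1 l2; apply/andP; split; move: h1 h2 l1 l2;
  move: (ln m.+1%:R) (ln m%:R) (ln a%:R) => x y v; move: (m.+1%:R^-1) (m%:R^-1) (a%:R^-1) => q q' ia;
  move: (\sum_(_ <= _ < _) _) => S; lra.
Qed.

Lemma ln_ratio_sq (a b : nat) : (0 < a)%N -> (0 < b)%N ->
  4 * ln (a%:R / b%:R) = 2 * (ln (a ^ 2)%:R - ln (b ^ 2)%:R) :> R.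
Proof.
move=> a0 b0; rewrite ln_div ?posrE ?ltr0n// !natrX !lnXn ?ltr0n//.
by move: (ln _) (ln _) => x y; rewrite !mulr2n; lra.
Qed.

(** Transition probability of the planar walk from 0 to [z]: along the two diagonals its coordinates
    are independent simple walks. *)
Definition pz n z : R := srw n (z.1 + z.2) * srw n (z.1 - z.2).

(** The maximum norm, raised to 1 at the origin so that its logarithm is 0 there. *)
Definition dist z : nat := maxn 1 (maxn `|z.1|%N `|z.2|%N).

Definition evenz z := ~~ odd `|(z.1 + z.2)%R|%N.

Definition EJ (J : nat) z : R := \sum_(0 <= j < J) pz j.*2 z.

Lemma pz_ge0 n z : 0 <= pz n z.
Proof. by rewrite mulr_ge0 ?srw1_ge0. Qed.

Lemma pz_le n z : pz n z <= n.+1%:R^-1.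
Proof.
have h := srw1_le R n; have s0 : 0 < Num.sqrt n.+1%:R :> R by rewrite sqrtr_gt0 ltr0n.
apply: le_trans (ler_pM (srw1_ge0 _ _ _) (srw1_ge0 _ _ _) (h _) (h _)) _.
by rewrite -invfM -expr2 sqr_sqrtr.
Qed.

Lemma dist_gt0 z : (0 < dist z)%N. Proof. by rewrite leq_max. Qed.

Lemma pz_far n z : pz n z <= 8 / (dist z)%:R ^+ 2.
Proof.
have d0 : 0 < (dist z)%:R ^+ 2 :> R by rewrite exprn_gt0// ltr0n dist_gt0.
rewrite ler_pdivlMr//; have s0 : 0 < Num.sqrt n.+1%:R :> R by rewrite sqrtr_gt0 ltr0n.
have F u v : (dist z <= `|u|)%N -> srw n u * srw n v * (dist z)%:R ^+ 2 <= 8.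
  move=> du; have h1 := srw1_far_nat n `|u|; rewrite -srw1_abs in h1.
  have h2 : srw n u * (dist z)%:R ^+ 2 <= 8 * Num.sqrt n.+1%:R.
    by apply: le_trans h1; rewrite ler_wpM2l ?srw1_ge0// lerXn2r ?nnegrE// ler_nat.
  have h3 := srw1_le R n v.
  have := ler_pM (mulr_ge0 (srw1_ge0 R n u) (sqr_ge0 _)) (srw1_ge0 R n v) h2 h3.
  by rewrite mulfK ?gt_eqF// mulrAC.
have [z0|] := eqVneq (maxn `|z.1|%N `|z.2|%N) 0%N.
  have -> : dist z = 1%N by rewrite /dist z0.
  rewrite expr1n mulr1; apply: le_trans (pz_le _ _) _; apply: (@le_trans _ _ 1); last by lra.
  by rewrite invf_le1 ?ltr0n// ler1n.
rewrite -lt0n => zpos; have dE : dist z = maxn `|z.1|%N `|z.2|%N by apply/maxn_idPr.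
have [h|h] : (dist z <= `|(z.1 + z.2)%R|)%N \/ (dist z <= `|(z.1 - z.2)%R|)%N.
- by rewrite dE; case: z {F d0 zpos dE} => z1 z2 /=; lia.
- by rewrite /pz; exact: F.
- by rewrite /pz (mulrC (srw _ _)); exact: F.
Qed.

Lemma srw1_even_le j u : srw j.*2 u <= srw j.*2 0.
Proof.
rewrite srw1_abs; apply: le_trans (srw1_le_parity _ _ _) _.
case: (boolP (odd `|u|)) => // _.
by rewrite (@srw1_parity R j.*2 true) ?srw1_ge0// odd_double.
Qed.

Lemma pz_le_wallis j z : (0 < j)%N -> pz j.*2 z <= 1 / (pi * j%:R).
Proof.
move=> j0; have [_ h] := srw1_center_wallis R j; apply: le_trans (h j0).
by rewrite expr2 ler_pM ?srw1_ge0// srw1_even_le.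
Qed.

(** [16 pi] is [2 pi] times the bound 8 for the times before [dist^2]; the 100 covers distances
    beyond [N] and the rounding of the harmonic sum. *)
Definition green_const : R := 16 * pi + 100.

(** Before time [dist^2] each term is at most [8 / dist^2]; afterwards it is at most [1 / (pi j)],
    and [2 pi / pi] times the harmonic sum from [dist^2] to [N^2] is [4 ln (N / dist)]. *)
Lemma EJ_upper (N : nat) z : (0 < N)%N -> (dist z <= 10 * N)%N ->
  2 * pi * EJ (N ^ 2) z <= 4 * ln (N%:R / (dist z)%:R) + green_const.
Proof.
move=> N0 dN; have p0 := pi_gt0 R; have d0 := dist_gt0 z.
have dR : 0 < (dist z)%:R :> R by rewrite ltr0n.
have NR : 0 < N%:R :> R by rewrite ltr0n.
have small (J : nat) : (J <= dist z ^ 2)%N -> EJ J z <= 8.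
  move=> Jd; apply: (@le_trans _ _ (\sum_(0 <= j < J) (8 / (dist z)%:R ^+ 2 : R))).
    by apply: ler_sum => j _; exact: pz_far.
  rewrite sumr_const_nat subn0 -[leLHS]mulr_natr [leLHS]mulrAC ler_pdivrMr; last by rewrite exprn_gt0.
  by rewrite ler_pM2l// -natrX ler_nat.
have lnE : 4 * ln (N%:R / (dist z)%:R) = 2 * (ln (N ^ 2)%:R - ln (dist z ^ 2)%:R) :> R.
  exact: ln_ratio_sq.
rewrite /green_const; have [h|h] := leqP (N ^ 2) (dist z ^ 2).
  have := ler_wpM2l (mulr_ge0 (ler0n _ 2) (ltW p0)) (small _ h).
  have : - 80 <= 4 * ln (N%:R / (dist z)%:R) :> R.
    rewrite -[_ / _]invrK lnV ?posrE ?invr_gt0 ?divr_gt0// invf_div.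
    have : ln ((dist z)%:R / N%:R) <= 10 :> R.
      apply: le_trans (ln_le_sub1 _) _; first by rewrite divr_gt0.
      have : (dist z)%:R / N%:R <= 10 :> R by rewrite ler_pdivrMr// -natrM ler_nat.
      lra.
    lra.
  move: (2 * pi * EJ _ _) (ln _) => A l; lra.
rewrite lnE /EJ; rewrite (big_cat_nat (n := (dist z ^ 2)%N)) /=; [|by []|exact: ltnW].
have h1 := small _ (leqnn _); rewrite /EJ in h1.
have h2 : \sum_(dist z ^ 2 <= j < N ^ 2) pz j.*2 z <= pi^-1 * \sum_(dist z ^ 2 <= j < N ^ 2) (j%:R : R)^-1.
  rewrite mulr_sumr !big_nat; apply: ler_sum => j /andP[dj _].
  have j0 : (0 < j)%N by apply: leq_trans dj; rewrite expn_gt0 d0.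
  by rewrite (le_trans (pz_le_wallis z j0))// div1r invfM.
have d2 : (0 < dist z ^ 2 <= N ^ 2)%N by rewrite expn_gt0 d0 /= ltnW.
have /andP[_ h3] := harmonic_bounds d2.
have i1 : (dist z ^ 2)%:R^-1 <= 1 :> R by rewrite invf_le1 ?ltr0n ?ler1n; case/andP: d2.
have i2 : 0 <= (N ^ 2)%:R^-1 :> R by rewrite invr_ge0.
have h4 := le_trans h2 (ler_wpM2l (ltW (_ : 0 < pi^-1)) h3).
have {}h4 := h4 (ltac:(by rewrite invr_gt0)).
have pp : pi * pi^-1 = 1 :> R by rewrite mulfV// gt_eqF.
move: h1 h4 pp; move: (\sum_(0 <= _ < _) _) => S1; move: (\sum_(_ <= _ < _) _) => S2 h1 h4 pp.
move: i1 i2 h4; move: (ln _ - ln _) (_^-1) (_^-1) => L a b i1 i2 h4.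
have := ler_wpM2l (ltW p0) h4; rewrite mulrA pp mul1r => h5.
have := ler_wpM2l (ltW p0) h1; move: p0 h5 i1 i2; clear; move: pi => p p0; rewrite mulrDr; lra.
Qed.

Lemma pz_lower j z : evenz z -> 2 / (pi * j.*2.+1%:R) * (1 - 4 * (dist z)%:R ^+ 2 / j.*2.+1%:R) <= pz j.*2 z.
Proof.
move=> ez; have [wl _] := srw1_center_wallis R j; have p0 := pi_gt0 R.
have n1 : 0 < j.*2.+1%:R :> R by rewrite ltr0n.
have w0 : 0 <= 2 / (pi * j.*2.+1%:R) :> R by rewrite divr_ge0// mulr_ge0// ltW.
have [neg|pos] := leP (1 - 4 * (dist z)%:R ^+ 2 / j.*2.+1%:R : R) 0.
  by rewrite (le_trans (mulr_ge0_le0 w0 neg))// pz_ge0.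
pose f u : R := (`|u|%N)%:R ^+ 2 / j.*2.+1%:R.
have near u : ~~ odd `|u| -> srw j.*2 0 * (1 - f u) <= srw j.*2 u.
  move=> ou; have := srw1_near j.*2 (`|u|)./2; rewrite even_halfK// -srw1_abs.
  by [].
have f0 u : 0 <= f u by rewrite divr_ge0// sqr_ge0.
have ev : ~~ odd `|(z.1 - z.2)%R| by move: ez; rewrite /evenz; case: (z) => a b /=; lia.
have fuv : f (z.1 + z.2) + f (z.1 - z.2) <= 4 * (dist z)%:R ^+ 2 / j.*2.+1%:R.
  have sq u : (`|u|%N)%:R ^+ 2 = u%:~R ^+ 2 :> R.
    by rewrite natr_absz intr_norm real_normK ?num_real.
  rewrite /f -mulrDl ler_pM2r ?invr_gt0// !sq intrD intrB.
  have e1 : (`|z.1|%N)%:R ^+ 2 <= (dist z)%:R ^+ 2 :> R.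
    by rewrite lerXn2r ?nnegrE// ler_nat /dist !leq_max leqnn orbT.
  have e2 : (`|z.2|%N)%:R ^+ 2 <= (dist z)%:R ^+ 2 :> R.
    by rewrite lerXn2r ?nnegrE// ler_nat /dist !leq_max leqnn !orbT.
  by move: e1 e2; rewrite !sq; clear; lra.
have b2 := wl; rewrite /pz; clearbody f.
move: (4 * _ ^+ 2 / _) fuv pos => q fuv pos.
have g1 : 0 <= 1 - f (z.1 + z.2) by have := f0 (z.1 - z.2); lra.
have g2 : 0 <= 1 - f (z.1 - z.2) by have := f0 (z.1 + z.2); lra.
have c0 := srw1_ge0 R j.*2 0.
apply: le_trans (ler_pM (mulr_ge0 c0 g1) (mulr_ge0 c0 g2) (near _ ez) (near _ ev)).
rewrite mulrACA -expr2; apply: ler_pM => //; first exact: ltW.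
by have := mulr_ge0 (f0 (z.1 + z.2)) (f0 (z.1 - z.2)); lra.
Qed.

Lemma EJ_lower (N : nat) z : (0 < N)%N -> evenz z ->
  4 * ln (N%:R / (dist z)%:R) - 6 <= 2 * pi * EJ (N ^ 2) z.
Proof.
move=> N0 ez; have p0 := pi_gt0 R; have d0 := dist_gt0 z.
have dR : 0 < (dist z)%:R :> R by rewrite ltr0n.
have NR : 0 < N%:R :> R by rewrite ltr0n.
have lnE : 4 * ln (N%:R / (dist z)%:R) = 2 * (ln (N ^ 2)%:R - ln (dist z ^ 2)%:R) :> R.
  exact: ln_ratio_sq.
have [h|h] := leqP (N ^ 2) (dist z ^ 2).
  apply: (@le_trans _ _ 0); last first.
    by rewrite !mulr_ge0 ?pi_ge0// sumr_ge0// => j _; exact: pz_ge0.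
  rewrite lnE; have : ln (N ^ 2)%:R <= ln (dist z ^ 2)%:R :> R.
    by rewrite ler_ln ?posrE ?ltr0n ?expn_gt0 ?N0 ?d0// ler_nat.
  lra.
rewrite lnE /EJ; rewrite (big_cat_nat (n := (dist z ^ 2)%N)) /=; [|by []|exact: ltnW].
have h1 : 0 <= \sum_(0 <= j < dist z ^ 2) pz j.*2 z by rewrite sumr_ge0// => j _; exact: pz_ge0.
pose D : R := (dist z)%:R ^+ 2.
have DE : D = (dist z ^ 2)%:R by rewrite natrX.
have D1 : 1 <= D by rewrite DE ler1n expn_gt0 d0.
(* The error terms of order [D / j^2] are dominated by a telescoping difference, whose sum is at
   most 3. *)
have h2 : \sum_(dist z ^ 2 <= j < N ^ 2) ((j%:R : R)^-1 - (1 + 2 * D) * (j%:R^-1 - j.+1%:R^-1)) <=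
          pi * \sum_(dist z ^ 2 <= j < N ^ 2) pz j.*2 z.
  rewrite mulr_sumr !big_nat; apply: ler_sum => j /andP[dj _].
  have j0 : (0 < j)%N by apply: leq_trans dj; rewrite expn_gt0 d0.
  apply: le_trans (ler_wpM2l (ltW p0) (pz_lower j ez)).
  have jR : 0 < j%:R :> R by rewrite ltr0n.
  have -> : j.*2.+1%:R = 2 * j%:R + 1 :> R by rewrite -natr1 -mul2n natrM.
  rewrite -/D; have -> : j.+1%:R = j%:R + 1 :> R by rewrite natr1.
  set x := j%:R in jR *.
  have -> : pi * (2 / (pi * (2 * x + 1)) * (1 - 4 * D / (2 * x + 1))) = 2 * (2 * x + 1)^-1 * (1 - 4 * D / (2 * x + 1)).
    by field; rewrite !gt_eqF//; lra.
  rewrite -subr_ge0.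
  have -> : 2 * (2 * x + 1)^-1 * (1 - 4 * D / (2 * x + 1)) - (x^-1 - (1 + 2 * D) * (x^-1 - (x + 1)^-1))
     = ((2 * x + 1) * x + 2 * D) / (x * (x + 1) * (2 * x + 1) ^+ 2).
    by field; rewrite !gt_eqF//; lra.
  by rewrite divr_ge0// ?addr_ge0 ?mulr_ge0 ?exprn_ge0//; lra.
have d2 : (0 < dist z ^ 2 <= N ^ 2)%N by rewrite expn_gt0 d0 /= ltnW.
have /andP[h3 _] := harmonic_bounds d2.
have tel : \sum_(dist z ^ 2 <= j < N ^ 2) (j%:R^-1 - j.+1%:R^-1 : R) = (dist z ^ 2)%:R^-1 - (N ^ 2)%:R^-1.
  have T := telescope_sumr (fun j => - (j%:R : R)^-1) (ltnW h).
  rewrite /= opprK addrC in T; rewrite -T.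
  by apply: eq_bigr => j _; rewrite opprK addrC.
rewrite sumrB -mulr_sumr tel -DE in h2.
have i2 : 0 <= (N ^ 2)%:R^-1 :> R by rewrite invr_ge0.
have i1 : (1 + 2 * D) * (D^-1 - (N ^ 2)%:R^-1) <= 3.
  apply: (@le_trans _ _ ((1 + 2 * D) * D^-1)); first by rewrite ler_wpM2l; lra.
  by rewrite ler_pdivrMr; lra.
move: h1 h2 h3 i1 p0; clear.
move: (_ * (_ - _)) => q; move: (\sum_(0 <= _ < _) _) => b; move: (\sum_(_ <= _ < _) (_^-1)) => a; move: (\sum_(_ <= _ < _) _) => c h1 h2 h3 i1 p0.
have := mulr_ge0 (ltW p0) h1; move: pi h2 p0 => p h2 p0 h4; move: (ln _ - ln _) h3 => l h3; lra.
Qed.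

Lemma EJ_odd J z : ~~ evenz z -> EJ J z = 0.
Proof.
rewrite /evenz negbK => oz; rewrite /EJ big1// => j _; rewrite /pz srw1_abs.
suff -> : srw j.*2 (`|(z.1 + z.2)%R|%N)%:Z = 0 by rewrite mul0r.
apply: le_anti; rewrite srw1_ge0 andbT (le_trans (srw1_le_parity _ _ _))// oz.
by rewrite (@srw1_parity R j.*2 true)// odd_double.
Qed.

Definition nbavg (f : Z2 -> R) z : R :=
  (f (z.1 + 1, z.2) + f (z.1 - 1, z.2) + f (z.1, z.2 + 1) + f (z.1, z.2 - 1)) / 4.

Lemma pzS n z : pz n.+1 z = nbavg (pz n) z.
Proof.
case: z => a b; rewrite /nbavg /pz /=.
have -> : a + 1 + b = a + b + 1 by ring. have -> : a - 1 + b = a + b - 1 by ring.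
have -> : a + (b + 1) = a + b + 1 by ring. have -> : a + (b - 1) = a + b - 1 by ring.
have -> : a + 1 - b = a - b + 1 by ring. have -> : a - 1 - b = a - b - 1 by ring.
have -> : a - (b + 1) = a - b - 1 by ring. have -> : a - (b - 1) = a - b + 1 by ring.
by field.
Qed.

Definition KM M z : R := \sum_(n < M) pz n z.

Lemma KM_EJ J z : KM J.*2 z = EJ J z + nbavg (EJ J) z.
Proof.
rewrite /KM /EJ; elim: J => [|J IH].
  by rewrite /nbavg big_ord0 !big_nil; field.
rewrite doubleS !big_ord_recr/= IH /nbavg !big_nat_recr//= pzS /nbavg; ring.
Qed.

(** Parity selects the even or the odd times. At an odd site the odd-time sum is the mean of the
    even-time sums at the four neighbours, whose logarithmic distances differ from that of the site
    by a constant. *)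
Lemma KM_bound (N : nat) z : (0 < N)%N -> (dist z <= 9 * N)%N ->
  `|2 * pi * KM (N ^ 2).*2 z - 4 * ln (N%:R / (dist z)%:R)| <= green_const + 14.
Proof.
move=> N0 dN; have p0 := pi_gt0 R; rewrite KM_EJ mulrDr.
have NR : 0 < N%:R :> R by rewrite ltr0n.
have g0 : 0 <= green_const by rewrite /green_const; lra.
have B y : evenz y -> (dist y <= 10 * N)%N ->
   4 * ln (N%:R / (dist y)%:R) - 6 <= 2 * pi * EJ (N ^ 2) y <= 4 * ln (N%:R / (dist y)%:R) + green_const.
  by move=> ey dy; rewrite EJ_lower//= EJ_upper.
have [ez|oz] := boolP (evenz z).
  have -> : nbavg (EJ (N ^ 2)) z = 0.
    rewrite /nbavg !EJ_odd ?addr0 ?mul0r//; move: ez; case: (z) => a b; rewrite /evenz/=; lia.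
  have /andP[h1 h2] := B _ ez (leq_trans dN (leq_mul (isT : (9 <= 10)%N) (leqnn N))).
  by rewrite mulr0 addr0 ler_norml; apply/andP; split; lra.
rewrite (EJ_odd _ oz) mulr0 add0r.
have C y : (y.1 = z.1 /\ `|(y.2 - z.2)%R|%N = 1%N) \/ (y.2 = z.2 /\ `|(y.1 - z.1)%R|%N = 1%N) ->
   4 * ln (N%:R / (dist z)%:R) - 14 <= 2 * pi * EJ (N ^ 2) y <= 4 * ln (N%:R / (dist z)%:R) + green_const + 14.
  move=> yz; have ey : evenz y by move: oz yz; rewrite /evenz; case: (z) (y) => a b [c d]/=; lia.
  have [e1 e2] : (dist y <= dist z + 1)%N /\ (dist z <= dist y + 1)%N.
    have Q (a b c d : nat) : (c <= a + 1 -> d <= b + 1 -> maxn 1 (maxn c d) <= maxn 1 (maxn a b) + 1)%N.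
      by clear => *; rewrite !geq_max; apply/and3P; split; lia.
    have K (u v : int) : `|(u - v)%R|%N = 1%N -> (`|u| <= `|v| + 1)%N /\ (`|v| <= `|u| + 1)%N by clear; lia.
    by rewrite /dist; case: yz => -[e /K[h1 h2]]; rewrite e; split; apply: Q; rewrite ?leq_addr.
  have := dist_gt0 y; have := dist_gt0 z; move=> dz0 dy0.
  have d1 : (dist y <= 2 * dist z)%N by move: e1 dz0; clear; lia.
  have d2 : (dist z <= 2 * dist y)%N by move: e2 dy0; clear; lia.
  have d3 : (dist y <= 10 * N)%N by move: e1 dN N0; clear; lia.
  have L (u v : nat) : (u <= 2 * v)%N -> (0 < u)%N -> (0 < v)%N -> ln u%:R <= ln v%:R + 2 :> R.
    move=> uv u0 v0; have := ln_le_sub1 (ltr0n _ 2 : 0 < 2 :> R).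
    have : ln u%:R <= ln (2 * v%:R) :> R by rewrite ler_ln ?posrE ?mulr_gt0 ?ltr0n// -natrM ler_nat.
    by rewrite lnM ?posrE ?ltr0n//; lra.
  have /andP[h1 h2] := B _ ey d3.
  have l1 := L _ _ d1 (dist_gt0 y) (dist_gt0 z); have l2 := L _ _ d2 (dist_gt0 z) (dist_gt0 y).
  move: h1 h2; rewrite !ln_div ?posrE ?ltr0n ?dist_gt0// => h1 h2.
  by apply/andP; split; lra.
have E1 (a : int) : `|(a + 1 - a)%R|%N = 1%N by rewrite addrAC subrr.
have E2 (a : int) : `|(a - 1 - a)%R|%N = 1%N by rewrite addrAC subrr.
have /andP[a1 a2] := C (z.1 + 1, z.2) (or_intror (conj erefl (E1 _))).
have /andP[b1 b2] := C (z.1 - 1, z.2) (or_intror (conj erefl (E2 _))).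
have /andP[c1 c2] := C (z.1, z.2 + 1) (or_introl (conj erefl (E1 _))).
have /andP[d1 d2] := C (z.1, z.2 - 1) (or_introl (conj erefl (E2 _))).
have -> : 2 * pi * nbavg (EJ (N ^ 2)) z = (2 * pi * EJ (N ^ 2) (z.1 + 1, z.2) + 2 * pi * EJ (N ^ 2) (z.1 - 1, z.2)
  + 2 * pi * EJ (N ^ 2) (z.1, z.2 + 1) + 2 * pi * EJ (N ^ 2) (z.1, z.2 - 1)) / 4 by rewrite /nbavg; ring.
move: a1 a2 b1 b2 c1 c2 d1 d2 g0; clear; move: (2 * pi * EJ _ _) => A; move: (2 * pi * EJ _ _) => B; move: (2 * pi * EJ _ _) => C; move: (2 * pi * EJ _ _) => D; move: (ln _) green_const => l g *.
rewrite ler_norml; apply/andP; split; lra.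
Qed.

End PlanarKernel.

(** * Sums over boxes and summation by parts *)

Section BoxSums.

Variable R : realType.

Implicit Types (f g : Z2 -> R) (L : nat) (x y z : Z2).

Definition bs L f : R := \sum_(i < L.*2.+1) \sum_(j < L.*2.+1) f (i%:Z - L%:Z, j%:Z - L%:Z).

(** The function vanishes already on the outer layer of the box, so unit translations do not change
    its sum over the box. *)
Definition supp L f := forall z, (L <= `|z.1|)%N || (L <= `|z.2|)%N -> f z = 0.

Definition tr (a b : int) f : Z2 -> R := fun z => f (z.1 + a, z.2 + b).

Lemma s1_shift L (g : int -> R) : g (- L%:Z) = 0 -> g (L%:Z + 1) = 0 ->
  \sum_(i < L.*2.+1) g (i%:Z - L%:Z + 1) = \sum_(i < L.*2.+1) g (i%:Z - L%:Z).
Proof.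
move=> g1 g2; rewrite big_ord_recr [RHS]big_ord_recl/= sub0r g1 add0r.
have -> : (L.*2)%:Z - L%:Z + 1 = L%:Z + 1 by lia.
by rewrite g2 addr0; apply: eq_bigr => i _; congr g; rewrite /bump /= PoszD; ring.
Qed.

Lemma s1_shiftN L (g : int -> R) : g (- L%:Z - 1) = 0 -> g L%:Z = 0 ->
  \sum_(i < L.*2.+1) g (i%:Z - L%:Z - 1) = \sum_(i < L.*2.+1) g (i%:Z - L%:Z).
Proof.
move=> g1 g2; rewrite -(s1_shift (g := fun u => g (u - 1))) ?addrK//.
by apply: eq_bigr => i _; rewrite addrK.
Qed.

Lemma eq_bs L f g : f =1 g -> bs L f = bs L g.
Proof. by move=> fg; apply: eq_bigr => i _; apply: eq_bigr => j _; rewrite fg. Qed.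

Lemma bsD L f g : bs L (fun z => f z + g z) = bs L f + bs L g.
Proof. by rewrite /bs -big_split/=; apply: eq_bigr => i _; rewrite -big_split. Qed.

Lemma bsZ L (c : R) f : bs L (fun z => c * f z) = c * bs L f.
Proof. by rewrite /bs mulr_sumr; apply: eq_bigr => i _; rewrite mulr_sumr. Qed.

Lemma bsB L f g : bs L (fun z => f z - g z) = bs L f - bs L g.
Proof.
by rewrite -[- bs L g]mulN1r -bsZ -bsD; apply: eq_bs => z; rewrite mulN1r.
Qed.

Lemma bs_le L f g : (forall z, f z <= g z) -> bs L f <= bs L g.
Proof. by move=> fg; apply: ler_sum => i _; apply: ler_sum. Qed.

Lemma bs_ge0 L f : (forall z, 0 <= f z) -> 0 <= bs L f.
Proof. by move=> f0; apply: sumr_ge0 => i _; apply: sumr_ge0. Qed.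

Lemma bs_sum L (n : nat) (F : nat -> Z2 -> R) : bs L (fun z => \sum_(k < n) F k z) = \sum_(k < n) bs L (F k).
Proof.
elim: n => [|n IH].
  by rewrite big_ord0 /bs big1// => i _; rewrite big1// => j _; rewrite big_ord0.
by rewrite big_ord_recr/= -IH -bsD; apply: eq_bs => z; rewrite big_ord_recr.
Qed.

Lemma bs_tr10 L f : supp L f -> bs L (tr 1 0 f) = bs L f.
Proof.
move=> sf; rewrite /bs exchange_big [RHS]exchange_big/=; apply: eq_bigr => j _.
rewrite /tr /=; under eq_bigr do rewrite addr0.
by apply: (s1_shift (g := fun u => f (u, j%:Z - L%:Z))); apply: sf => /=; lia.
Qed.

Lemma bs_tr01 L f : supp L f -> bs L (tr 0 1 f) = bs L f.
Proof.
move=> sf; rewrite /bs; apply: eq_bigr => j _.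
rewrite /tr /=; under eq_bigr do rewrite addr0.
by apply: (s1_shift (g := fun u => f (j%:Z - L%:Z, u))); apply: sf => /=; lia.
Qed.

Lemma bs_trN10 L f : supp L f -> bs L (tr (- 1) 0 f) = bs L f.
Proof.
move=> sf; rewrite /bs exchange_big [RHS]exchange_big/=; apply: eq_bigr => j _.
rewrite /tr /=; under eq_bigr do rewrite addr0.
by apply: (s1_shiftN (g := fun u => f (u, j%:Z - L%:Z))); apply: sf => /=; lia.
Qed.

Lemma bs_trN01 L f : supp L f -> bs L (tr 0 (- 1) f) = bs L f.
Proof.
move=> sf; rewrite /bs; apply: eq_bigr => j _.
rewrite /tr /=; under eq_bigr do rewrite addr0.
by apply: (s1_shiftN (g := fun u => f (j%:Z - L%:Z, u))); apply: sf => /=; lia.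
Qed.

Lemma nbavgE f z : nbavg f z = (tr 1 0 f z + tr (- 1) 0 f z + tr 0 1 f z + tr 0 (- 1) f z) / 4.
Proof. by rewrite /nbavg /tr !addr0. Qed.

Lemma bs_nbavg L f : supp L f -> bs L (nbavg f) = bs L f.
Proof.
move=> sf; rewrite (@eq_bs _ _ (fun z => 4^-1 * (tr 1 0 f z + tr (- 1) 0 f z + tr 0 1 f z + tr 0 (- 1) f z))); last first.
  by move=> z; rewrite nbavgE mulrC.
by rewrite bsZ !bsD bs_tr10// bs_trN10// bs_tr01// bs_trN01//; field.
Qed.

Lemma suppMl L f g : supp L f -> supp L (fun z => f z * g z).
Proof. by move=> sf z /sf ->; rewrite mul0r. Qed.

Definition lap g z : R := g z - nbavg g z.

Definition grad (a b : int) f z : R := tr a b f z - f z.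

(* Summation by parts; it makes the form [bs L (f * lap g)] symmetric and nonnegative. *)
Lemma dirichlet L f g : supp L f -> supp L g ->
  bs L (fun z => f z * lap g z) =
  4^-1 * (bs L (fun z => grad 1 0 f z * grad 1 0 g z) + bs L (fun z => grad 0 1 f z * grad 0 1 g z)).
Proof.
move=> sf sg; set d := fun z => f z * g z.
have sd : supp L d by exact: suppMl.
have E (a b : int) : bs L (tr a b d) = bs L d -> bs L (tr a b (fun z => f z * tr (- a) (- b) g z)) = bs L (fun z => f z * tr (- a) (- b) g z) ->
   bs L (fun z => grad a b f z * grad a b g z) = 2 * bs L d - bs L (fun z => f z * tr (- a) (- b) g z) - bs L (fun z => f z * tr a b g z).
  move=> h1 h2.
  rewrite (@eq_bs _ _ (fun z => tr a b d z - tr a b (fun z => f z * tr (- a) (- b) g z) z - f z * tr a b g z + d z)).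
    by rewrite bsD !bsB h1 h2; ring.
  move=> z; rewrite /grad /tr /d /= !addrK; case: z => u v /=; ring.
have e1 := E 1 0 (bs_tr10 sd) (bs_tr10 (suppMl _ sf)).
have e2 := E 0 1 (bs_tr01 sd) (bs_tr01 (suppMl _ sf)).
rewrite oppr0 in e1 e2; rewrite e1 e2.
rewrite (@eq_bs _ _ (fun z => d z - 4^-1 * (f z * tr 1 0 g z + f z * tr (- 1) 0 g z + f z * tr 0 1 g z + f z * tr 0 (- 1) g z))).
  by rewrite bsB bsZ !bsD; field.
by move=> z; rewrite /lap nbavgE /d; field.
Qed.

Lemma bs_delta L f x : (`|x.1| <= L)%N -> (`|x.2| <= L)%N -> bs L (fun z => f z * (x == z)%:R) = f x.
Proof.
case: x => a b /= ha hb; rewrite /bs.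
have ia : (absz (a + L%:Z)%R < L.*2.+1)%N by lia.
have ib : (absz (b + L%:Z)%R < L.*2.+1)%N by lia.
have ea : a = (absz (a + L%:Z))%:Z - L%:Z by lia.
have eb : b = (absz (b + L%:Z))%:Z - L%:Z by lia.
rewrite (eq_bigr (fun i : 'I_L.*2.+1 => if i == Ordinal ia then f (a, b) else 0)) => [|i _].
  by rewrite -big_mkcond/= big_pred1_eq.
rewrite (eq_bigr (fun j : 'I_L.*2.+1 => if j == Ordinal ib then (if i == Ordinal ia then f (a, b) else 0) else 0)) => [|j _].
  by rewrite -big_mkcond/= big_pred1_eq.
rewrite xpair_eqE.
have -> : (a == i%:Z - L%:Z) = (i == Ordinal ia) by apply/eqP/eqP => [e|->//]; apply/val_inj => /=; lia.
have -> : (b == j%:Z - L%:Z) = (j == Ordinal ib) by apply/eqP/eqP => [e|->//]; apply/val_inj => /=; lia.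
have [->|_] := eqVneq i; have [->|_] := eqVneq j; rewrite /= ?mulr1 ?mulr0//.
by rewrite -ea -eb.
Qed.

Lemma bs_delta1 L x : bs L (fun z => (x == z)%:R) <= 1.
Proof.
have [h|h] := boolP ((`|x.1| <= L)%N && (`|x.2| <= L)%N).
  case/andP: h => h1 h2; rewrite (@eq_bs _ _ (fun z => 1 * (x == z)%:R)) ?bs_delta// => z.
  by rewrite mul1r.
rewrite /bs big1// => i _; rewrite big1// => j _.
case: eqP => // e; move: h; rewrite e /=; have := ltn_ord i; have := ltn_ord j; lia.
Qed.

Definition box L : seq Z2 := [seq (i%:Z - L%:Z, j%:Z - L%:Z) | i : 'I_L.*2.+1 <- enum 'I_L.*2.+1, j : 'I_L.*2.+1 <- enum 'I_L.*2.+1].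

Lemma bs_box L f : \sum_(z <- box L) f z = bs L f.
Proof. by rewrite /box big_allpairs_dep/= big_enum; apply: eq_bigr => i _; rewrite big_enum. Qed.

(** One vector per lattice edge: the gradient of [F x] across it, with squared weight
    [pi / 2 = 2 pi / 4]. By [dirichlet] the Gram matrix is [2 pi] times an energy, so a covariance
    given by an energy becomes an explicit sum of rank-one terms. *)
Definition edges L (F : Z2 -> Z2 -> R) : seq (Z2 -> R) :=
  [seq (fun x => Num.sqrt (2 * pi) / 2 * grad 1 0 (F x) z) | z <- box L] ++
  [seq (fun x => Num.sqrt (2 * pi) / 2 * grad 0 1 (F x) z) | z <- box L].

Lemma edges_gram L F x y : supp L (F x) -> supp L (F y) ->
  \sum_(v <- edges L F) v x * v y = 2 * pi * bs L (fun z => F x z * lap (F y) z).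
Proof.
move=> sx sy; rewrite dirichlet// /edges big_cat !big_map/= !bs_box.
have E (a b : int) : bs L (fun z => Num.sqrt (2 * pi) / 2 * grad a b (F x) z * (Num.sqrt (2 * pi) / 2 * grad a b (F y) z))
   = pi / 2 * bs L (fun z => grad a b (F x) z * grad a b (F y) z).
  rewrite -bsZ; apply: eq_bs => z.
  have : Num.sqrt (2 * pi) ^+ 2 = 2 * pi :> R by rewrite sqr_sqrtr// mulr_ge0 ?pi_ge0.
  by rewrite mulrACA; move: (Num.sqrt _) => s e; congr (_ * _); lra.
by rewrite !E; field.
Qed.

Lemma pz_supp n z : (n < `|z.1|)%N || (n < `|z.2|)%N -> pz R n z = 0.
Proof.
suff H m u : (m < `|u|)%N -> srw1 R m u = 0.
  move=> h; have [h1|h1] : (n < `|(z.1 + z.2)%R|)%N \/ (n < `|(z.1 - z.2)%R|)%N by move: h; case: (z) => a b /=; lia.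
  - by rewrite /pz H// mul0r.
  - by rewrite /pz (H _ (z.1 - z.2))// mulr0.
elim: m u => [|m IH] u mu /=.
  by case: eqP mu => // ->.
by rewrite !IH ?addr0 ?mul0r//; lia.
Qed.

Lemma pzN n z : pz R n (- z.1, - z.2) = pz R n z.
Proof. by rewrite /pz /= -!opprD !srw1N. Qed.

Definition pzc n x z : R := pz R n (z.1 - x.1, z.2 - x.2).

Lemma pzc_supp n L x : (n + `|x.1| < L)%N -> (n + `|x.2| < L)%N -> supp L (pzc n x).
Proof. by move=> h1 h2 z h; apply: pz_supp => /=; move: h h1 h2; case: (z) (x) => a b [c d] /=; lia. Qed.

Lemma pzcS n x z : pzc n.+1 x z = nbavg (pzc n x) z.
Proof.
rewrite /pzc pzS /nbavg /=; congr (_ / _).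
by congr (_ + _ + _ + _); congr (pz _ _ (_, _)); ring.
Qed.

Lemma pzc0 x z : pzc 0 x z = (x == z)%:R.
Proof.
rewrite /pzc /pz /= -natrM mulnb; congr (nat_of_bool _)%:R.
by case: x z => a b [c d]; rewrite xpair_eqE/=; lia.
Qed.

Lemma pzc_mass n L x : (n + `|x.1| < L)%N -> (n + `|x.2| < L)%N -> bs L (pzc n x) = 1.
Proof.
elim: n => [|n IH] h1 h2.
  rewrite (@eq_bs _ _ (fun z => 1 * (x == z)%:R)); last by move=> z; rewrite mul1r pzc0.
  by rewrite bs_delta//; lia.
have h1' : (n + `|x.1| < L)%N by lia. have h2' : (n + `|x.2| < L)%N by lia.
by rewrite (@eq_bs L _ _ (@pzcS n x)) bs_nbavg ?IH//; exact: pzc_supp.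
Qed.

Definition Kc M x z : R := \sum_(n < M) pzc n x z.

Lemma lap_Kc M x z : lap (Kc M x) z = (x == z)%:R - pzc M x z.
Proof.
rewrite /lap; have -> : nbavg (Kc M x) z = \sum_(n < M) pzc n.+1 x z.
  rewrite (eq_bigr _ (fun (n : 'I_M) _ => pzcS n x z)) /nbavg /Kc -mulr_suml; congr (_ / _).
  by rewrite !big_split.
rewrite /Kc; elim: M => [|M IH]; first by rewrite !big_ord0 pzc0 !subrr.
by rewrite !big_ord_recr/=; move: IH; move: (\sum_(n < M) _) (\sum_(n < M) _) => a b; lra.
Qed.

End BoxSums.

(** * The killed Green function against the free kernel *)

Section GreenComparison.

Variables (R : realType) (N : nat) (G : Z2 -> Z2 -> R).

Let V (x : Z2) := (`|x.1| < N)%N && (`|x.2| < N)%N.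

Hypothesis GC : forall x y, G x y = G y x.

Hypothesis G_supp : forall x y, ~~ V y -> G x y = 0.

Hypothesis G_ge0 : forall x y, 0 <= G x y.

Hypothesis G_lap : forall x y, V x -> V y -> lap (G x) y = (x == y)%:R.

Hypothesis G_mass : forall L x, V x -> bs L (G x) <= 2 * N%:R ^+ 2.

Let M := (N ^ 2).*2.

Let L := (M + N).+2.

Let Bf x z := Kc R M x z - G x z.

Let sG x : V x -> supp L (G x).
Proof. by move=> Vx z h; apply: G_supp; move: h; rewrite /V /L; lia. Qed.

Let sp x n : V x -> (n <= M)%N -> supp L (pzc R n x).
Proof. by rewrite /V /L => /andP[h1 h2] nM; apply: pzc_supp; lia. Qed.

Let sK x : V x -> supp L (Kc R M x).
Proof.
by move=> Vx z h; rewrite /Kc big1// => n _; apply: sp => //; apply: ltnW.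
Qed.

Let sB x : V x -> supp L (Bf x).
Proof. by move=> Vx z h; rewrite /Bf (sK Vx h) (sG Vx h) subrr. Qed.

Definition field_vectors := edges L G.

(** The energy of [K - G] supplies a noise of covariance [2 pi (K - G)] up to bounded terms. Added
    to the field, it restores the translation-invariant logarithm up to the boundary, where the
    Green function alone is too small. *)
Definition noise_vectors := edges L Bf.

Let GlapG x y (Vx : V x) (Vy : V y) : bs L (fun z => G x z * lap (G y) z) = G x y.
Proof.
have [h1 h2] : (`|y.1| <= L)%N /\ (`|y.2| <= L)%N by move: Vy; rewrite /V /L; lia.
rewrite -(bs_delta (L := L) (G x) h1 h2); apply: eq_bs => z.
have [Vz|nVz] := boolP (V z); first by rewrite G_lap.
by rewrite G_supp// !mul0r.
Qed.

Lemma field_vectors_gram x y : V x -> V y -> \sum_(v <- field_vectors) v x * v y = 2 * pi * G x y.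
Proof.
by move=> Vx Vy; rewrite /field_vectors edges_gram ?GlapG//; exact: sG.
Qed.

Lemma noise_vectors_gram x y : V x -> V y ->
  \sum_(v <- noise_vectors) v x * v y = 2 * pi *
   (Kc R M x y - bs L (fun z => Kc R M x z * pzc R M y z) - G x y + bs L (fun z => G x z * pzc R M y z) + bs L (fun z => G y z * pzc R M x z)).
Proof.
move=> Vx Vy; rewrite /noise_vectors edges_gram; [|exact: sB|exact: sB].
congr (_ * _).
have [h1 h2] : (`|y.1| <= L)%N /\ (`|y.2| <= L)%N by move: Vy; rewrite /V /L; lia.
have [k1 k2] : (`|x.1| <= L)%N /\ (`|x.2| <= L)%N by move: Vx; rewrite /V /L; lia.
have sym (f g : Z2 -> R) : supp L f -> supp L g -> bs L (fun z => f z * lap g z) = bs L (fun z => g z * lap f z).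
  move=> sf sg; rewrite !dirichlet//; congr (_ * (_ + _)); apply: eq_bs => z; exact: mulrC.
have K1 (f : Z2 -> R) (u : Z2) : (`|u.1| <= L)%N -> (`|u.2| <= L)%N -> bs L (fun z => f z * lap (Kc R M u) z) = f u - bs L (fun z => f z * pzc R M u z).
  move=> u1 u2; rewrite -(bs_delta f u1 u2) -bsB; apply: eq_bs => z; by rewrite lap_Kc mulrBr.
rewrite (@eq_bs _ _ _ (fun z => (Kc R M x z * lap (Kc R M y) z - Kc R M x z * lap (G y) z) - (G x z * lap (Kc R M y) z - G x z * lap (G y) z))); last first.
  by move=> z; rewrite /Bf /lap /nbavg; field.
rewrite !bsB (sym (Kc R M x) (G y)); [|exact: sK|exact: sG].
by rewrite !K1// GlapG// (GC y x); ring.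
Qed.

Definition cov_const : R := green_const R + 14 + 6 * pi.

(** With [M = 2 N^2], every pairing with the time-[M] kernel lies in [[0, 1]]: this kernel is at
    most [1 / M], while the Green function and the truncated kernel have mass at most [M]. *)
Lemma covariance_bound x y : (0 < N)%N -> V x -> V y ->
  `|\sum_(v <- field_vectors ++ noise_vectors) v x * v y - 4 * ln (N%:R / (dist (x.1 - y.1, x.2 - y.2))%:R)| <= cov_const.
Proof.
move=> N0 Vx Vy; rewrite big_cat/= field_vectors_gram// noise_vectors_gram//.
have M0 : 0 < M%:R :> R by rewrite ltr0n /M double_gt0 expn_gt0 N0.
have ME : M%:R = 2 * N%:R ^+ 2 :> R by rewrite /M -mul2n natrM natrX.
have pM u z : 0 <= pzc R M u z <= M%:R^-1.
  rewrite pz_ge0/=; apply: le_trans (pz_le _ _ _) _; rewrite lef_pV2 ?posrE// ?ltr0n//.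
  by rewrite ler_nat.
have H (f : Z2 -> R) u c : (forall z, 0 <= f z) -> bs L f <= c * M%:R -> 0 <= bs L (fun z => f z * pzc R M u z) <= c.
  move=> f0 fc; apply/andP; split.
    by apply: bs_ge0 => z; have /andP[p0 _] := pM u z; rewrite mulr_ge0.
  apply: (@le_trans _ _ (bs L (fun z => M%:R^-1 * f z))).
    by apply: bs_le => z; rewrite mulrC; have /andP[_ p1] := pM u z; rewrite ler_wpM2r.
  by rewrite bsZ mulrC ler_pdivrMr.
have b1 : 0 <= bs L (fun z => Kc R M x z * pzc R M y z) <= 1.
  apply: H => [z|]; first by apply: sumr_ge0 => n _; exact: pz_ge0.
  rewrite /Kc (bs_sum L M (fun n => pzc R n x)) (eq_bigr (fun=> 1)) ?sumr_const ?card_ord ?mul1r// => n _.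
  by move: Vx; rewrite /V => /andP[h1 h2]; apply: pzc_mass; have := ltn_ord n; move: h1 h2; rewrite /L; clear; lia.
have /andP[c0 c1] : 0 <= bs L (fun z => G x z * pzc R M y z) <= 1 by apply: H => //; rewrite mul1r ME G_mass.
have /andP[d0 d1] : 0 <= bs L (fun z => G y z * pzc R M x z) <= 1 by apply: H => //; rewrite mul1r ME G_mass.
have := @KM_bound R N (x.1 - y.1, x.2 - y.2) N0.
have -> : KM R (N ^ 2).*2 (x.1 - y.1, x.2 - y.2) = Kc R M x y.
  by apply: eq_bigr => n _; rewrite /pzc -[RHS]pzN /= !opprB.
have dN : (dist (x.1 - y.1, x.2 - y.2)%R <= 9 * N)%N.
  by move: Vx Vy; rewrite /V /dist; case: (x) (y) => a b [c d] /= /andP[? ?] /andP[? ?]; rewrite !geq_max; apply/and3P; split; lia.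
move=> /(_ dN); case/andP: b1 => b0 b1; rewrite /cov_const.
have p0 := pi_ge0 R.
move: (4 * _) (Kc _ _ _ _) b0 b1 c0 c1 d0 d1; move: (bs _ _) (bs _ _) (bs _ _) => A B C l K b0 b1 c0 c1 d0 d1.
have q (X : R) : 0 <= X -> X <= 1 -> 0 <= 2 * pi * X <= 2 * pi.
  by move=> X0 X1; rewrite mulr_ge0 ?mulr_ge0//= -[leRHS]mulr1 ler_wpM2l// mulr_ge0.
have /andP[? ?] := q _ b0 b1; have /andP[? ?] := q _ c0 c1; have /andP[? ?] := q _ d0 d1.
rewrite !ler_norml => /andP[h1 h2]; apply/andP; split; lra.
Qed.

End GreenComparison.

(** * The walk killed on leaving the box *)

Section KilledWalk.

Variables (R : realType) (N : nat).

Definition inV (x : Z2) := (`|x.1| < N)%N && (`|x.2| < N)%N.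

Lemma VNP x : VN N x <-> inV x.
Proof. by rewrite /VN /inV /=; split; case: x => a b /=; lia. Qed.

Definition killed (f : Z2 -> R) w : R := (inV w)%:R * f w.

Lemma killed_supp f : supp N (killed f).
Proof. by move=> z h; rewrite /killed (_ : inV z = false) ?mul0r// /inV; lia. Qed.

(** Probability of being at [y] at time [j] with the times [1, ..., j] spent inside the box; the
    starting point is not tested. *)
Fixpoint kv j (z y : Z2) : R :=
  if j is j'.+1 then nbavg (killed (fun w => kv j' w y)) z else (z == y)%:R.

Lemma nbavg_ge0 (f : Z2 -> R) z : (forall w, 0 <= f w) -> 0 <= nbavg f z.
Proof. by move=> f0; rewrite /nbavg divr_ge0// !addr_ge0. Qed.

Lemma nbavg_le (f g : Z2 -> R) z : (forall w, (`|(w.1 - z.1)%R| + `|(w.2 - z.2)%R| = 1)%N -> f w <= g w) -> nbavg f z <= nbavg g z.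
Proof.
move=> fg; rewrite /nbavg ler_pM2r// !lerD// fg//=; rewrite ?subrr ?addr0 ?add0n; clear; lia.
Qed.

Lemma kv_ge0 j z y : 0 <= kv j z y.
Proof.
elim: j z => [|j IH] z /=; first by rewrite ler0n.
by apply: nbavg_ge0 => w; rewrite mulr_ge0.
Qed.

Definition kvs m x y : R := \sum_(j < m) kv j x y.

Lemma kvsS m x y : kvs m.+1 x y = (x == y)%:R + nbavg (killed (fun w => kvs m w y)) x.
Proof.
rewrite /kvs big_ord_recl/=; congr (_ + _).
rewrite /nbavg /killed /bump /= -mulr_suml !big_split/=.
by rewrite -!mulr_sumr.
Qed.

(** [2 N^2 - |x|^2] decreases by exactly 1 per step on average and is nonnegative at the first site
    outside, hence it bounds the expected time spent inside. *)
Lemma kvs_mass L m x : inV x -> bs L (kvs m x) <= 2 * N%:R ^+ 2 - x.1%:~R ^+ 2 - x.2%:~R ^+ 2.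
Proof.
have sqN (a : int) : (`|a| <= N)%N -> a%:~R ^+ 2 <= N%:R ^+ 2 :> R.
  by move=> h; rewrite -[a%:~R ^+ 2]real_normK ?num_real// -intr_norm -natr_absz lerXn2r ?nnegrE// ler_nat.
elim: m x => [|m IH] x Vx.
  rewrite /bs big1 => [|i _]; last by rewrite big1// => j _; rewrite /kvs big_ord0.
  by move: Vx => /andP[/ltnW/sqN h1 /ltnW/sqN h2]; lra.
rewrite (@eq_bs _ L _ _ (fun y => kvsS m x y)) bsD.
have -> : bs L (fun y => nbavg (killed (fun w => kvs m w y)) x) = nbavg (killed (fun w => bs L (kvs m w))) x.
  rewrite (@eq_bs _ L _ (fun y => 4^-1 * ((inV (x.1 + 1, x.2))%:R * kvs m (x.1 + 1, x.2) y + (inV (x.1 - 1, x.2))%:R * kvs m (x.1 - 1, x.2) y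
    + (inV (x.1, x.2 + 1))%:R * kvs m (x.1, x.2 + 1) y + (inV (x.1, x.2 - 1))%:R * kvs m (x.1, x.2 - 1) y))).
    by rewrite bsZ !bsD !bsZ /nbavg /killed mulrC.
  by move=> y; rewrite /nbavg /killed mulrC.
have B : nbavg (killed (fun w => bs L (kvs m w))) x <= nbavg (fun w => 2 * N%:R ^+ 2 - w.1%:~R ^+ 2 - w.2%:~R ^+ 2) x.
  apply: nbavg_le => w wx; rewrite /killed; case: (boolP (inV w)) => [/IH|_]; first by rewrite mul1r.
  rewrite mul0r; have [h1 h2] : (`|w.1| <= N)%N /\ (`|w.2| <= N)%N by move: Vx wx; rewrite /inV; clear; case: (x) (w) => a b [c d] /=; lia.
  by move: (sqN _ h1) (sqN _ h2); lra.
have := lerD (bs_delta1 R L x) B; rewrite /nbavg /= !intrD !intrN => h; apply: (le_trans h).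
rewrite -subr_ge0; set e := (X in 0 <= X); suff -> : e = 0 by [].
by rewrite /e; field.
Qed.

Lemma bs_delta_supp L (f : Z2 -> R) v : supp L f -> bs L (fun z => f z * (v == z)%:R) = f v.
Proof.
move=> sf; have [/andP[h1 h2]|h] := boolP ((`|v.1| <= L)%N && (`|v.2| <= L)%N); first by rewrite bs_delta.
have fv : f v = 0.
  by apply: sf; move: h; rewrite negb_and -!ltnNge => /orP[] h; rewrite (ltnW h) ?orbT.
rewrite fv /bs big1// => i _; rewrite big1// => j _.
by case: eqP => [<-|_]; rewrite ?fv ?mul0r ?mulr0.
Qed.

Lemma srw_transE u z : srw_trans R u z =
  (((u.1 + 1, u.2) == z)%:R + ((u.1 - 1, u.2) == z)%:R + ((u.1, u.2 + 1) == z)%:R + ((u.1, u.2 - 1) == z)%:R) / 4.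
Proof.
rewrite -!natrD /srw_trans.
have -> : ((((u.1 + 1, u.2)%R == z) + ((u.1 - 1, u.2)%R == z) + ((u.1, u.2 + 1)%R == z) + ((u.1, u.2 - 1)%R == z))%N
  = nat_of_bool (`|z.1 - u.1| + `|z.2 - u.2| == 1)%R).
  by case: u z => a b [c d]; rewrite !xpair_eqE /=; lia.
by case: ifP => _; rewrite ?mul1r ?mul0r.
Qed.

Lemma bs_srw_trans L (f : Z2 -> R) u : supp L f -> bs L (fun z => srw_trans R u z * f z) = nbavg f u.
Proof.
move=> sf; rewrite (@eq_bs _ L _ (fun z => 4^-1 * (f z * ((u.1 + 1, u.2) == z)%:R + f z * ((u.1 - 1, u.2) == z)%:R
   + f z * ((u.1, u.2 + 1) == z)%:R + f z * ((u.1, u.2 - 1) == z)%:R))).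
  by rewrite bsZ !bsD !bs_delta_supp// mulrC.
by move=> z; rewrite srw_transE; ring.
Qed.

Lemma box_uniq L : uniq (box L).
Proof.
apply: allpairs_uniq; rewrite ?enum_uniq// => -[i j] [k l] _ _ /= [e1 e2].
by congr (_, _); apply/val_inj => /=; lia.
Qed.

Lemma inV_box x : inV x -> x \in box N.
Proof.
case: x => a b; rewrite /inV /= => /andP[ha hb].
have ia : (absz (a + N%:Z)%R < N.*2.+1)%N by lia.
have ib : (absz (b + N%:Z)%R < N.*2.+1)%N by lia.
apply/allpairsP; exists (Ordinal ia, Ordinal ib); rewrite !mem_enum; split => //=.
by congr (_, _); lia.
Qed.

End KilledWalk.

(** * The Green function of the walk as a series *)

Section WalkGreen.

Variables (R : realType) (dS : measure_display) (OmegaS : measurableType dS).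

Variables (Px : probability OmegaS R) (x : Z2) (S : nat -> OmegaS -> Z2) (N : nat).

Hypothesis srwS : simple_random_walk Px x S.

Let mS n z : measurable [set w | S n w = z]. Proof. exact: (proj1 srwS). Qed.

Let EV m (p : nat -> Z2) j y := [set w | (forall k, (k <= m)%N -> S k w = p k) /\
  (forall i, (i < j)%N -> inV N (S (m + i).+1 w)) /\ S (m + j) w = y].

Let cyl m (p : nat -> Z2) : R := (p 0%N == x)%:R * \prod_(k < m) srw_trans R (p k) (p k.+1).

Let minV n : measurable [set w | inV N (S n w)].
Proof.
have -> : [set w | inV N (S n w)] = \bigcup_(z in [set` [seq z <- box N | inV N z]]) [set w | S n w = z].
  apply/seteqP; split => [w /= h|w [z /=]]; last by rewrite mem_filter => /andP[h _] ->.
  by exists (S n w) => //=; rewrite mem_filter h inV_box.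
by apply: fin_bigcup_measurable => // z _; exact: mS.
Qed.

Let mforall (Q : nat -> set OmegaS) (n : nat) : (forall k, measurable (Q k)) -> measurable [set w | forall k, (k < n)%N -> Q k w].
Proof.
move=> mQ; have -> : [set w | forall k, (k < n)%N -> Q k w] = \bigcap_(k in `I_n) Q k.
  by apply/seteqP; split => w /= h k kn; exact: h.
by apply: bigcap_measurableType => // k _; exact: mQ.
Qed.

Let mEV m p j y : measurable (EV m p j y).
Proof.
apply: measurableI; first by apply: (mforall m.+1 (fun k => mS k (p k))).
apply: measurableI; last exact: mS.
exact: (mforall j (fun i => minV (m + i).+1)).
Qed.

(** The Markov property, derived from the cylinder probabilities alone: the prescribed path is
    extended by one site and the event is split according to that site. *)
Let PEV m p j y : Px (EV m p j y) = (cyl m p * kv R N j (p m) y)%:E.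
Proof.
elim: j m p => [|j IH] m p.
  have [e|ne] := eqVneq (p m) y.
    rewrite /= e eqxx mulr1 -(proj2 srwS); congr (Px _).
    apply/seteqP; split => w /=; first by case.
    by move=> h; split => //; split => //; rewrite addn0 h.
  rewrite /= (negbTE ne) mulr0; have -> : EV m p 0 y = set0; last by rewrite measure0.
  rewrite -subset0 => w [h [_]]; rewrite addn0 h// => e; by rewrite e eqxx in ne.
pose q z k := if (k <= m)%N then p k else z.
have qm z : q z m.+1 = z by rewrite /q ltnn.
have cq z : cyl m.+1 (q z) = cyl m p * srw_trans R (p m) z.
  rewrite /cyl big_ord_recr/= mulrA; congr (_ * _ * _); last by rewrite qm /q leqnn.
  by apply: eq_bigr => k _; rewrite /q ltn_ord ltnW.
have -> : EV m p j.+1 y = \bigcup_(z in [set` [seq z <- box N | inV N z]]) EV m.+1 (q z) j y.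
  apply/seteqP; split => w.
    move=> [h1 [h2 h3]]; have v1 := h2 0%N isT; rewrite addn0 in v1.
    exists (S m.+1 w) => /=; first by rewrite mem_filter v1 inV_box.
    split=> [k|]; first by rewrite /q leq_eqVlt => /orP[/eqP ->|]; [rewrite ltnn|rewrite ltnS => km; rewrite km h1].
    by split=> [i ij|]; [rewrite addSnnS; apply: h2|rewrite addSnnS].
  move=> [z /=]; rewrite mem_filter => /andP[Vz _] [h1 [h2 h3]]; split=> [k km|].
    by rewrite h1 ?/q ?km// leqW.
  split=> [[|i] ij|]; [by rewrite addn0 h1// qm|by rewrite -addSnnS; exact: h2|by rewrite -addSnnS].
rewrite measure_fin_bigcup; [|exact: finite_seq| |by move=> z _; exact: mEV]; last first.
  move=> z1 z2 _ _ [w [[h1 _] [h2 _]]].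
  by have := h1 m.+1 (leqnn _); rewrite h2// !qm.
rewrite -fsbig_seq ?filter_uniq ?box_uniq//= (eq_bigr (fun z => (cyl m p * (srw_trans R (p m) z * kv R N j z y))%:E)); last first.
  by move=> z _; rewrite IH qm cq mulrA.
rewrite sumEFin big_filter big_mkcond/= -(bs_srw_trans (p m) (@killed_supp R N _)) -bs_box mulr_sumr.
by congr EFin; apply: eq_bigr => z _; rewrite /killed; case: (inV N z); rewrite ?mul1r ?mul0r ?mulr0.
Qed.

Lemma lt_exit_time n w : (n%:R%:E < exit_time R (VN N) S w)%E <-> forall k, (k <= n)%N -> inV N (S k w).
Proof.
split=> [h k kn|h].
  apply: contraTT isT => /negP nV; have : (exit_time R (VN N) S w <= k%:R%:E)%E.
    by apply: ereal_inf_lbound; exists k => //= /VNP.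
  move=> /(lt_le_trans h); rewrite lte_fin ltr_nat; lia.
apply: (@lt_le_trans _ _ n.+1%:R%:E); first by rewrite lte_fin ltr_nat.
apply: le_ereal_inf_tmp => _ [k /= nV <-]; rewrite lee_fin ler_nat ltnNge; apply/negP => kn.
by apply: nV; apply/VNP/h.
Qed.

Lemma green_kv y : inV N x -> green Px S (VN N) y = (\sum_(0 <= n <oo) (kv R N n x y)%:E)%E.
Proof.
move=> Vx; rewrite /green.
pose E n := [set w | (forall k, (k < n.+1)%N -> inV N (S k w)) /\ S n w = y].
have mE n : measurable (E n) by apply: measurableI; [exact: (mforall n.+1 minV)|exact: mS].
rewrite (eq_integral (fun w => \sum_(0 <= n <oo) (\1_(E n) w)%:E)%E); last first.
  move=> w _; rewrite eseries_mkcond; apply: eq_eseriesr => n _.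
  case: ifPn => [/lt_exit_time h|h].
    rewrite !indicE; congr (_ *+ nat_of_bool _)%:E.
    by apply/idP/idP; rewrite !inE; [move=> e; split|case].
  rewrite indicE (_ : w \in E n = false)//; apply/negP; rewrite inE => -[h1 _].
  by move/negP: h; apply; apply/lt_exit_time => k kn; exact: h1.
rewrite integral_nneseries//; last first.
  by move=> n; apply/measurable_EFinP; exact: measurable_indic.
apply: eq_eseriesr => n _; rewrite integral_indic// setIT.
have -> : E n = EV 0 (fun=> x) n y `|` (E n `\` [set w | S 0%N w = x]).
  apply/seteqP; split => w.
    move=> [h1 h2]; have [e|e] := eqVneq (S 0%N w) x; last by right; split => //; apply/eqP.
    by left; split=> [k|]; [rewrite leqn0 => /eqP ->|split=> // i ij; apply: h1; rewrite add0n].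
  case=> [[h1 [h2 h3]]|[]//]; split=> // -[|k] kn; first by rewrite h1.
  exact: h2.
have P1 : Px [set w | S 0%N w = x] = 1%E.
  have := proj2 srwS 0%N (fun=> x); rewrite eqxx big_ord0 mul1r => <-; congr (Px _).
  by apply/seteqP; split => w /= h => [[]|]//; exact: h.
rewrite measureU//; last 2 first.
- by apply: measurableD.
- rewrite -subset0 => w [[h1 _] [_ h2]]; apply: h2; exact: h1.
rewrite [X in (X + _)%E](_ : _ = (kv R N n x y)%:E); last first.
  by apply: (etrans (PEV 0 (fun=> x) n y)); rewrite /cyl eqxx big_ord0 !mul1r.
have Z : Px (E n `\` [set w | S 0%N w = x]) = 0%E.
  apply/eqP; rewrite -measure_le0; apply: (@le_trans _ _ (Px (~` [set w | S 0%N w = x]))).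
    apply: le_measure; rewrite ?inE; [by apply: measurableD; [exact: mE|exact: mS]|by apply: measurableC; exact: mS|by move=> w []].
  by rewrite probability_setC// P1 subee.
by rewrite [X in (_ + X)%E](_ : _ = 0%E) ?adde0.
Qed.

End WalkGreen.

(** * Convergence of the series and its one-step equation *)

Section GreenFunction.

Variables (R : realType) (N : nat).

Lemma kvs_le m x y : inV N x -> kvs R N m x y <= 2 * N%:R ^+ 2.
Proof.
move=> Vx; pose L := maxn `|y.1| `|y.2|.
have h1 : (`|y.1| <= L)%N by rewrite leq_maxl.
have h2 : (`|y.2| <= L)%N by rewrite leq_maxr.
have k0 z : 0 <= kvs R N m x z by rewrite sumr_ge0// => j _; exact: kv_ge0.
rewrite -(bs_delta (kvs R N m x) h1 h2).
apply: (@le_trans _ _ (bs L (kvs R N m x))).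
  by apply: bs_le => z; case: eqP => _; rewrite ?mulr1 ?mulr0.
apply: le_trans (@kvs_mass R N L m x Vx) _; have := sqr_ge0 (x.1%:~R : R); have := sqr_ge0 (x.2%:~R : R); lra.
Qed.

Lemma kvs_cvg x y : inV N x -> cvgn (fun m => kvs R N m x y).
Proof.
move=> Vx; apply: nondecreasing_is_cvgn.
  move=> a b /subnKC <-; elim: (b - a)%N => [|k IH]; first by rewrite addn0.
  by rewrite addnS (le_trans IH)// /kvs big_ord_recr/= lerDl kv_ge0.
by exists (2 * N%:R ^+ 2) => _ [m _ <-]; exact: kvs_le.
Qed.

Definition Gw x y : R := if inV N x && inV N y then limn (fun m => kvs R N m x y) else 0.

Lemma Gw_cvg x y : inV N y -> (inV N x)%:R * kvs R N m x y @[m --> \oo] --> Gw x y.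
Proof.
rewrite /Gw => Vy; case: (boolP (inV N x)) => Vx; rewrite ?Vy /=; last first.
  by under eq_fun do rewrite mul0r; exact: cvg_cst.
by under eq_fun do rewrite mul1r; exact: kvs_cvg.
Qed.

Lemma Gw_step x y : inV N x -> inV N y -> Gw x y = (x == y)%:R + nbavg (fun w => Gw w y) x.
Proof.
move=> Vx Vy; have h1 : kvs R N m.+1 x y @[m --> \oo] --> Gw x y.
  have := @Gw_cvg x _ Vy; rewrite -cvg_shiftS Vx; apply: cvg_trans; apply: near_eq_cvg.
  by near=> m; rewrite /= mul1r.
apply: (cvg_unique _ h1); first exact: norm_hausdorff.
rewrite (_ : (fun m => _) = (fun m => (x == y)%:R + nbavg (killed N (fun w => kvs R N m w y)) x)); last first.
  by apply/funext => m; exact: kvsS.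
apply: cvgD; first exact: cvg_cst.
rewrite /nbavg /killed; apply: cvgM; last exact: cvg_cst.
by do 3 (apply: cvgD; last exact: Gw_cvg); exact: Gw_cvg.
Unshelve. all: by end_near. Qed.

Lemma Gw_ge0 x y : 0 <= Gw x y.
Proof.
rewrite /Gw; case: ifP => // /andP[Vx _]; apply: limr_ge; first exact: kvs_cvg.
by near=> m; rewrite sumr_ge0// => j _; exact: kv_ge0.
Unshelve. all: by end_near. Qed.

Lemma Gw_mass L x : inV N x -> bs L (Gw x) <= 2 * N%:R ^+ 2.
Proof.
move=> Vx; have cv : bs L (fun y => (inV N y)%:R * kvs R N m x y) @[m --> \oo] --> bs L (Gw x).
  apply: cvg_big => [|i _]; first exact: add_continuous.
  apply: cvg_big => [|j _]; first exact: add_continuous.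
  rewrite /Gw Vx; case: (inV N _) => /=.
    by under eq_fun do rewrite mul1r; exact: kvs_cvg.
  by under eq_fun do rewrite mul0r; exact: cvg_cst.
rewrite -(cvg_lim _ cv)//; apply: limr_le; first by apply/cvg_ex; eexists; exact: cv.
near=> m; apply: (@le_trans _ _ (bs L (kvs R N m x))).
  apply: bs_le => z; case: (inV N z); rewrite ?mul1r ?mul0r//.
  by rewrite sumr_ge0// => j _; exact: kv_ge0.
apply: le_trans (@kvs_mass R N L m x Vx) _; have := sqr_ge0 (x.1%:~R : R); have := sqr_ge0 (x.2%:~R : R); lra.
Unshelve. all: by end_near. Qed.

Lemma green_Gw (dS : measure_display) (OmegaS : measurableType dS) (Px : probability OmegaS R) (S : nat -> OmegaS -> Z2) x y :
  simple_random_walk Px x S -> inV N x -> inV N y -> green Px S (VN N) y = (Gw x y)%:E.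
Proof.
move=> hS Vx Vy; rewrite (green_kv hS)// /Gw Vx Vy -EFin_lim; last exact: kvs_cvg.
congr (limn _); apply/funext => m; by rewrite /= /kvs -sumEFin big_mkord.
Qed.

End GreenFunction.

(** * The field as a Gaussian vector with explicit covariance vectors *)

Section FieldVectors.

Variables (R : realType) (dS : measure_display) (OmegaS : measurableType dS).

Variables (PS : Z2 -> probability OmegaS R) (S : nat -> OmegaS -> Z2) (N : nat).

Hypothesis hS : forall x, simple_random_walk (PS x) x S.

Context (d : measure_display) (Omega : measurableType d) (P : probability Omega R).

Variable h : Z2 -> {RV P >-> R}.

Hypothesis N0 : (0 < N)%N.

Hypothesis hh : dgff PS S N h.

(** Symmetry is inherited from the covariance of the field, which avoids reversing paths of the
    walk. *)
Lemma GwC x y : Gw R N x y = Gw R N y x.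
Proof.
case: (boolP (inV N x)) => Vx; case: (boolP (inV N y)) => Vy; rewrite /Gw ?(negbTE Vx) ?(negbTE Vy) ?andbF//.
have [_ _ cov _] := hh.
have := covarianceC P (h x) (h y); rewrite !cov ?VNP// !(green_Gw (hS _))// => -[].
by rewrite /Gw Vx Vy.
Qed.

Definition VX := field_vectors N (Gw R N).

Definition VA := noise_vectors N (Gw R N).

Let lapG x y : inV N x -> inV N y -> lap (Gw R N x) y = (x == y)%:R.
Proof.
move=> Vx Vy; rewrite /lap GwC (@Gw_step R N y x Vy Vx) eq_sym.
rewrite (_ : nbavg (fun w => Gw R N w x) y = nbavg (Gw R N x) y) ?addrK//.
by rewrite /nbavg !(GwC x).
Qed.

Let suppG x y : ~~ inV N y -> Gw R N x y = 0.
Proof. by rewrite /Gw => /negbTE ->; rewrite andbF. Qed.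

Lemma VX_gram x y : inV N x -> inV N y -> \sum_(v <- VX) v x * v y = 2 * pi * Gw R N x y.
Proof. exact: (field_vectors_gram suppG lapG). Qed.

Lemma VC_bound x y : inV N x -> inV N y ->
  `|\sum_(v <- VX ++ VA) v x * v y - 4 * ln (N%:R / (dist (x.1 - y.1, x.2 - y.2))%:R)| <= cov_const R.
Proof. exact: (covariance_bound GwC suppG (@Gw_ge0 _ _) lapG (@Gw_mass _ _) N0). Qed.

Lemma comb_gaussian (a : Z2 -> R) :
  exists m s : R, forall A : set R, measurable A ->
    P [set w | A (\sum_(x <- fset_set (VN N)) a x * h x w)] = gaussian_law m s A.
Proof. by have [g _ _ _] := hh; exact: g. Qed.

Lemma mem_VN x : (x \in fset_set (VN N)) = inV N x.
Proof.
rewrite in_fset_set; last first.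
  apply: (@sub_finite_set _ _ [set` box N]); last exact: finite_seq.
  by move=> z /VNP /inV_box.
by apply/idP/idP; rewrite inE => /VNP.
Qed.

Lemma comb_delta (x : Z2) (f : Z2 -> R) : inV N x -> \sum_(z <- fset_set (VN N)) (x == z)%:R * f z = f x.
Proof.
move=> Vx; rewrite (bigD1_seq x) ?mem_VN ?fset_uniq//= eqxx mul1r big1 ?addr0// => z.
by rewrite eq_sym => /negbTE ->; rewrite mul0r.
Qed.

Lemma h_mean x : inV N x -> \int[P]_w h x w = 0.
Proof.
by move=> Vx; have [_ e _ _] := hh; have := e x (proj2 (VNP N x) Vx); rewrite unlock /Rintegral => ->.
Qed.

Let mh x : measurable_fun setT (h x : Omega -> R). Proof. exact: measurable_funPT. Qed.

Lemma h_sq x : inV N x -> P.-integrable setT (fun w => (h x w ^+ 2)%:E).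
Proof.
move=> Vx; have [m [s g]] := comb_gaussian (fun z => (x == z)%:R).
have ex : exists m s : R, forall A : set R, measurable A -> P [set w | A (h x w)] = gaussian_law m s A.
  by exists m, s => A mA; rewrite -g//; congr (P _); apply/seteqP; split => w /=; rewrite comb_delta.
by have [s' []] := gaussian_variable (mh x) ex (h_mean Vx).
Qed.

Lemma h_int x : inV N x -> P.-integrable setT (EFin \o (h x : Omega -> R)).
Proof.
move=> Vx; apply: (@le_integrable _ _ _ P _ measurableT _ (fun w => ((h x w ^+ 2)%:E + 1)%E)).
- by apply/measurable_EFinP.
- move=> w _; change ((`|h x w|)%:E <= (`|h x w ^+ 2 + 1|)%:E)%E; rewrite lee_fin [leRHS]ger0_norm ?addr_ge0 ?sqr_ge0//.
  rewrite -[h x w ^+ 2]real_normK ?num_real//; have := sqr_ge0 (`|h x w| - 1); rewrite !expr2.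
  by have := normr_ge0 (h x w); move: `|h x w| => t t0 h1; nra.
- by apply: integrableD => //; [exact: h_sq|exact: finite_measure_integrable_cst].
Qed.

Lemma h_cov x y : inV N x -> inV N y ->
  P.-integrable setT (EFin \o (fun w => h x w * h y w)) /\ \int[P]_w (h x w * h y w) = Gw R N x y.
Proof.
move=> Vx Vy; have [_ e cov _] := hh; split.
  apply: (@le_integrable _ _ _ P _ measurableT _ (fun w => ((h x w ^+ 2)%:E + (h y w ^+ 2)%:E)%E)).
  - by apply/measurable_EFinP; apply: measurable_funM.
  - move=> w _ /=; rewrite lee_fin [leRHS]ger0_norm ?addr_ge0 ?sqr_ge0// ler_norml.
    move: (h x w) (h y w) => a b; have := sqr_ge0 (a - b); have := sqr_ge0 (a + b); have := sqr_ge0 a; have := sqr_ge0 b; rewrite !expr2 => *.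
    by apply/andP; split; lra.
  - by apply: integrableD => //; exact: h_sq.
have := cov x y (proj2 (VNP N x) Vx) (proj2 (VNP N y) Vy); rewrite (green_Gw (hS _))// unlock.
rewrite !e ?VNP//= => c; rewrite /Rintegral -[RHS]/(fine (Gw R N x y)%:E) -c unlock; congr fine.
by apply: eq_integral => w _; rewrite !fctE /= !subr0.
Qed.

Lemma h_comb (a : Z2 -> R) : let Z w := \sum_(x <- fset_set (VN N)) a x * h x w in
  exists s : R, [/\ P.-integrable setT (fun w => (Z w ^+ 2)%:E) /\ \int[P]_w (Z w ^+ 2) = s ^+ 2,
    \sum_(x <- fset_set (VN N)) \sum_(y <- fset_set (VN N)) a x * a y * Gw R N x y = s ^+ 2,
    s != 0 -> P [set w | Z w = 0] = 0%E
    & forall p, \int[P]_w cos (Z w + p) = expR (- (s ^+ 2 / 2)) * cos p].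
Proof.
move=> Z; set r := fset_set (VN N).
have Vr x : x \in r -> inV N x by rewrite mem_VN.
pose hv x : Omega -> R := fun w => (inV N x)%:R * h x w.
have ZE w : Z w = \sum_(x <- r) a x * hv x w.
  by apply: eq_big_seq => x /Vr Vx; rewrite /hv Vx mul1r.
have ih x : P.-integrable setT (EFin \o (fun w => a x * hv x w)).
  case: (boolP (inV N x)) => Vx; rewrite /hv ?Vx ?(negbTE Vx).
    rewrite (_ : EFin \o _ = (fun w => (a x)%:E * (h x w)%:E)%E); first by apply: integrableZl => //; exact: h_int.
    by apply/funext => w /=; rewrite mul1r.
  rewrite (_ : EFin \o _ = cst 0%E); first exact: integrable0.
  by apply/funext => w /=; rewrite mul0r mulr0.
have [i1 i2] := Rintegral_bigsum r ih.
have EZ : \int[P]_w Z w = 0.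
  rewrite (_ : Z = fun w => \sum_(x <- r) a x * hv x w); last by apply/funext.
  rewrite i2 big1_seq// => x /andP[_ /Vr Vx]; rewrite RintegralZl//=.
    by rewrite /hv Vx; under eq_Rintegral do rewrite mul1r; rewrite h_mean ?mulr0.
  by rewrite /hv Vx; under eq_fun do rewrite mul1r; exact: h_int.
have mZ : measurable_fun setT Z.
  by apply: measurable_sum => x; apply: measurable_funM => //.
have [s [si s2 s0 sc]] := gaussian_variable mZ (comb_gaussian a) EZ.
exists s; split => //; rewrite -s2.
pose hw x y : Omega -> R := fun w => a x * a y * (hv x w * hv y w).
have ihw x y : P.-integrable setT (EFin \o hw x y) /\ \int[P]_w hw x y w = a x * a y * Gw R N x y.
  rewrite /hw /hv; case: (boolP (inV N x)) => Vx; case: (boolP (inV N y)) => Vy /=; last 3 first.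
  - split; last by rewrite (suppG _ Vy) mulr0; under eq_Rintegral do rewrite mul0r !mulr0; rewrite Rintegral_cst//= mul0r.
    rewrite (_ : EFin \o _ = cst 0%E); first exact: integrable0.
    by apply/funext => w /=; rewrite mul0r !mulr0.
  - split; last by rewrite GwC (suppG _ Vx) mulr0; under eq_Rintegral do rewrite !mul0r !mulr0; rewrite Rintegral_cst//= mul0r.
    rewrite (_ : EFin \o _ = cst 0%E); first exact: integrable0.
    by apply/funext => w /=; rewrite !mul0r !mulr0.
  - split; last by rewrite GwC (suppG _ Vx) mulr0; under eq_Rintegral do rewrite !mul0r !mulr0; rewrite Rintegral_cst//= mul0r.
    rewrite (_ : EFin \o _ = cst 0%E); first exact: integrable0.
    by apply/funext => w /=; rewrite !mul0r !mulr0.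
  have [j1 j2] := h_cov Vx Vy.
  split; last by under eq_Rintegral do rewrite !mul1r; rewrite RintegralZl// j2.
  rewrite (_ : EFin \o _ = (fun w => (a x * a y)%:E * (h x w * h y w)%:E)%E); first by apply: integrableZl.
  by apply/funext => w /=; rewrite !mul1r.
have ihw2 x := Rintegral_bigsum r (fun y => (ihw x y).1).
have [_ e2] := Rintegral_bigsum r (fun x => (ihw2 x).1).
under eq_Rintegral do rewrite ZE expr2 mulr_suml.
rewrite (_ : (fun w => _) = (fun w => \sum_(x <- r) \sum_(y <- r) hw x y w)); last first.
  by apply/funext => w; apply: eq_bigr => x _; rewrite mulr_sumr; apply: eq_bigr => y _; rewrite /hw; ring.
rewrite e2; apply: eq_bigr => x _; rewrite (ihw2 x).2; apply: eq_bigr => y _; by rewrite (ihw x y).2.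
Qed.

Variables (I : finType) (pos : I -> Z2).

Hypothesis posV : forall i, inV N (pos i).

Definition field (i : I) (w : Omega) : R := alpha R * h (pos i) w.

Definition pull (L : seq (Z2 -> R)) : seq (I -> R) := [seq (fun i => v (pos i)) | v <- L].

Lemma alpha2 : alpha R ^+ 2 = 2 * pi.
Proof. by rewrite /alpha sqr_sqrtr// mulr_ge0// pi_ge0. Qed.

Lemma gramv_pull L i j : gramv (pull L) i j = \sum_(v <- L) v (pos i) * v (pos j).
Proof. by rewrite /gramv /pull big_map. Qed.

Lemma field_meas i : measurable_fun setT (field i).
Proof. by apply: measurable_funM => //. Qed.

Lemma field_comb (a : I -> R) : exists b : Z2 -> R, [/\
  (forall w, \sum_(x <- fset_set (VN N)) b x * h x w = dotp a (fun i => field i w)) &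
  \sum_(x <- fset_set (VN N)) \sum_(y <- fset_set (VN N)) b x * b y * Gw R N x y = qform (pull VX) a].
Proof.
exists (fun x => \sum_i (pos i == x)%:R * (alpha R * a i)).
have E (f : Z2 -> R) : \sum_(x <- fset_set (VN N)) (\sum_i (pos i == x)%:R * (alpha R * a i)) * f x = \sum_i alpha R * a i * f (pos i).
  under eq_bigr do rewrite mulr_suml.
  rewrite exchange_big/=; apply: eq_bigr => i _.
  rewrite (eq_bigr (fun x => (pos i == x)%:R * (alpha R * a i * f x))) ?comb_delta// => x _; ring.
split=> [w|].
  by rewrite E; apply: eq_bigr => i _; rewrite /field; ring.
rewrite /qform (eq_bigr (fun v : I -> R => \sum_i \sum_j a i * a j * (v i * v j))); last first.
  move=> v _; rewrite expr2 /dotp mulr_suml; apply: eq_bigr => i _; rewrite mulr_sumr; apply: eq_bigr => j _; ring.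
rewrite [RHS]exchange_big/=.
rewrite (eq_bigr (fun x => (\sum_i (pos i == x)%:R * (alpha R * a i)) * (\sum_j alpha R * a j * Gw R N x (pos j)))); last first.
  by move=> x _; rewrite -E mulr_sumr; apply: eq_bigr => y _; rewrite mulrA.
rewrite E; apply: eq_bigr => i _; rewrite exchange_big mulr_sumr/=; apply: eq_bigr => j _.
rewrite -mulr_sumr -/(gramv (pull VX) i j) gramv_pull VX_gram// -alpha2; ring.
Qed.

Lemma field_char a p : \int[P]_t cos (dotp a (fun i => field i t) + p) = expR (- (qform (pull VX) a / 2)) * cos p.
Proof.
have [b [b1 b2]] := field_comb a; have [s [_ s1 _ s2]] := h_comb b.
rewrite -b2 s1 -s2; congr fine; apply: eq_integral => w _; by rewrite b1.
Qed.

Lemma field_lin a : P.-integrable setT (EFin \o (fun t => dotp a (fun i => field i t) ^+ 2)) /\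
  \int[P]_t (dotp a (fun i => field i t) ^+ 2) = qform (pull VX) a.
Proof.
have [b [b1 b2]] := field_comb a; have [s [[s1 s2] s3 _ _]] := h_comb b.
have E : (fun w => (\sum_(x <- fset_set (VN N)) b x * h x w) ^+ 2) = (fun t => dotp a (fun i => field i t) ^+ 2).
  by apply/funext => w; rewrite b1.
by move: s1 s2; rewrite -b2 s3 => s1 s2; rewrite -E; split.
Qed.

(** If [h x - h y] had variance 0, then [f = G x - G y] would have zero Dirichlet energy and vanish,
    against [lap f = delta_x - delta_y]. Hence the difference is nondegenerate and has no atom at
    0. *)
Lemma no_tie x y : inV N x -> inV N y -> x != y -> P [set w | h x w = h y w] = 0%E.
Proof.
move=> Vx Vy xy; have [s [_ s1 s0 _]] := h_comb (fun z => (x == z)%:R - (y == z)%:R).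
have c f : \sum_(z <- fset_set (VN N)) ((x == z)%:R - (y == z)%:R) * f z = f x - f y :> R.
  by under eq_bigr do rewrite mulrBl; rewrite sumrB !comb_delta.
rewrite (_ : [set w | h x w = h y w] = [set w | \sum_(z <- fset_set (VN N)) ((x == z)%:R - (y == z)%:R) * h z w = 0]); last first.
  by apply/seteqP; split => w /=; rewrite (c (fun z => h z w)) => /eqP; [move/eqP ->; rewrite subrr|rewrite subr_eq0 => /eqP].
apply: s0; apply/negP => /eqP s0; move: s1.
rewrite (eq_bigr (fun z => ((x == z)%:R - (y == z)%:R) * (Gw R N z x - Gw R N z y))); last first.
  by move=> z _; rewrite -c mulr_sumr; apply: eq_bigr => u _; rewrite mulrA.
rewrite (c (fun z => Gw R N z x - Gw R N z y)) s0 expr0n /= => e.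
pose f z := Gw R N x z - Gw R N y z.
have sf : supp N f by move=> z hz; rewrite /f !suppG ?subrr// /inV; lia.
have lapf z : inV N z -> lap f z = (x == z)%:R - (y == z)%:R.
  by move=> Vz; rewrite -(lapG Vx Vz) -(lapG Vy Vz) /lap /nbavg /f; ring.
have Q : bs N (fun z => f z * lap f z) = 0.
  rewrite (@eq_bs _ _ _ (fun z => f z * (x == z)%:R - f z * (y == z)%:R)); last first.
    move=> z; case: (boolP (inV N z)) => Vz; first by rewrite lapf// mulrBr.
    by rewrite /f !suppG// subrr !mul0r subrr.
  by rewrite bsB !bs_delta_supp// /f -[RHS]e (GwC y x); ring.
have gr z : (`|z.1| <= N)%N -> (`|z.2| <= N)%N -> grad 1 0 f z = 0.
  move=> z1 z2; apply/eqP; rewrite -sqrf_eq0 eq_le sqr_ge0 andbT.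
  move: Q; rewrite dirichlet// => /eqP; rewrite mulf_eq0 invr_eq0 (negbTE (lt0r_neq0 (_ : 0 < 4)))//= => /eqP Q.
  rewrite -(bs_delta (fun z => grad 1 0 f z ^+ 2) z1 z2).
  apply: (@le_trans _ _ (bs N (fun z => grad 1 0 f z * grad 1 0 f z))).
    by apply: bs_le => u; rewrite -expr2; case: (z == u); rewrite ?mulr1 ?mulr0 ?sqr_ge0.
  have : 0 <= bs N (fun z => grad 0 1 f z * grad 0 1 f z) by apply: bs_ge0 => u; rewrite -expr2 sqr_ge0.
  by move: Q; move: (bs _ _) (bs _ _) => A B; lra.
(* The vanishing horizontal gradient carries the value 0 inwards from the side of the box, column by
   column. *)
have f0 k : forall a b, N%:Z - a <= k%:Z -> f (a, b) = 0.
  elim: k => [|k IH] a b ak; first by apply: sf => /=; lia.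
  have [ha|ha] := leqP N `|a|; first by apply: sf; rewrite /= ha.
  have [hb|hb] := leqP N `|b|; first by apply: sf; rewrite /= hb orbT.
  have := gr (a, b) (ltnW ha) (ltnW hb); rewrite /grad /tr /= addr0 IH ?sub0r => [/eqP|]; last by lia.
  by rewrite oppr_eq0 => /eqP.
have fz z : f z = 0.
  by case: z => a b; apply: (f0 `|(N%:Z - a)%R|%N); lia.
have := lapf x Vx; rewrite /lap /nbavg !fz eqxx eq_sym (negbTE xy) !addr0 mul0r !subr0 => /esym/eqP.
by rewrite oner_eq0.
Qed.

End FieldVectors.

(** * Independent thinning of a finite set *)

Section Thinning.

Variables (R : realType) (K : finType) (p : R).

Hypothesis p01 : 0 <= p <= 1.

Definition thin (J : {set K}) : R := \prod_(b : K) (if b \in J then p else 1 - p).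

Lemma thin_ge0 J : 0 <= thin J.
Proof. by case/andP: p01 => p0 p1; apply: prodr_ge0 => b _; case: ifP => // _; rewrite subr_ge0. Qed.

Lemma thin_sum : \sum_(J : {set K}) thin J = 1.
Proof.
by rewrite /thin -(bigA_distr _ _ (fun=> p) (fun=> 1 - p)) big1// => b _ /=; rewrite addrC subrK.
Qed.

Definition meets (J S : {set K}) := [exists b, (b \in J) && (b \in S)].

Lemma thin_miss (S : {set K}) : \sum_(J : {set K}) thin J * (~~ meets J S)%:R = (1 - p) ^+ #|S|.
Proof.
rewrite (eq_bigr (fun J : {set K} => \prod_(b : K) (if b \in J then p * (b \notin S)%:R else 1 - p))); last first.
  move=> J _; rewrite /thin; case: (boolP (meets J S)) => dJ.
    have /existsP[b /andP[bJ bS]] := dJ.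
    by rewrite mulr0 (bigD1 b)//= bJ bS mulr0 mul0r.
  rewrite mulr1; apply: eq_bigr => b _; case: ifP => // bJ; case: (boolP (b \in S)) => bS; last by rewrite mulr1.
  by move/negP: dJ => []; apply/existsP; exists b; rewrite bJ.
rewrite -(bigA_distr _ _ (fun b => p * (b \notin S)%:R) (fun=> 1 - p)).
rewrite (bigID (mem S))/= [X in _ * X]big1 ?mulr1.
  rewrite (eq_bigr (fun=> 1 - p)) => [|b ->]; last by rewrite mulr0 add0r.
  by rewrite prodr_const.
by move=> b /= ->; rewrite mulr1 addrC subrK.
Qed.

Lemma thin_hit (S : {set K}) : \sum_(J : {set K}) thin J * (meets J S)%:R = 1 - (1 - p) ^+ #|S|.
Proof.
rewrite -thin_miss -[X in _ = X - _]thin_sum -sumrB; apply: eq_bigr => J _.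
by case: (meets J S); rewrite /= ?mulr0 ?mulr1 ?subrr ?subr0.
Qed.

Lemma thin_mem b : \sum_(J : {set K}) thin J * (b \in J)%:R = p.
Proof.
have := thin_hit [set b]%SET; rewrite cards1 expr1 opprB addrC subrK => <-.
apply: eq_bigr => J _; congr (_ * (nat_of_bool _)%:R); apply/idP/existsP => [bJ|[b' /andP[bJ]]].
  by exists b; rewrite bJ set11.
by rewrite inE => /eqP <-.
Qed.

Lemma thin_hit_large (S : {set K}) (e : R) : e <= p * #|S|%:R -> 1 - expR (- e) <= 1 - (1 - p) ^+ #|S|.
Proof.
case/andP: p01 => p0 p1 eS; rewrite lerD2l lerN2.
apply: (@le_trans _ _ (expR (- p) ^+ #|S|)).
  by rewrite lerXn2r ?nnegrE ?expR_ge0 ?subr_ge0// expR_ge1Dx.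
by rewrite -expRM_natr ler_expR mulNr lerN2.
Qed.

End Thinning.

(** * Laplace functionals averaged over the thinning *)

Section ThinnedFunctional.

Variables (R : realType) (I K : finType) (blk : nat -> I -> K) (c : nat -> R).

Hypothesis blk_step : forall l i j, blk l i = blk l j -> blk l.+1 i = blk l.+1 j.

Context (d : measure_display) (Omega : measurableType d) (P : probability Omega R).

Variables (p : R) (kb n : nat) (w : I -> R).

Hypothesis p01 : 0 <= p <= 1.

Hypothesis w0 : forall i, 0 <= w i.

Definition wJ (v : I -> R) (J : {set K}) i : R := v i * (blk kb i \in J)%:R.

(** The thinning is averaged inside the functional, so it needs no randomness on [Omega]; only
    points in selected blocks of level [kb] keep their weight. *)
Definition phi (Z : I -> Omega -> R) t : R := \sum_J thin p J * (1 - lapl (wJ w J) (fun i => Z i t)).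

Definition hits (Z : I -> Omega -> R) t : {set K} := [set b | [exists i, (blk kb i == b) && (1 <= w i * expR (Z i t))]]%SET.

Lemma wJ_ge0 v J i : (forall i, 0 <= v i) -> 0 <= wJ v J i.
Proof. by move=> v0; rewrite mulr_ge0. Qed.

(** As soon as a selected block contains a point with [w i e^(Z i) >= 1], the exponent is at least
    1. *)
Lemma phi_hits Z t : (1 - expR (- 1)) * (\sum_J thin p J * (meets J (hits Z t))%:R) <= phi Z t.
Proof.
rewrite mulr_sumr; apply: ler_sum => J _; rewrite mulrCA ler_wpM2l ?thin_ge0//.
have /andP[_ l1] := lapl_le1 (fun i => Z i t) (fun i => wJ_ge0 J i w0).
case: (boolP (meets _ _)) => dJ; last by rewrite mulr0 subr_ge0.
rewrite mulr1 lerD2l lerN2 /lapl ler_expR lerN2.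
have /existsP[b] := dJ; rewrite !inE => /andP[bJ /existsP[i /andP[/eqP ib wi]]].
rewrite (bigD1 i)//= {1}/wJ ib bJ mulr1; apply: (le_trans wi); rewrite lerDl sumr_ge0// => j _.
by rewrite mulr_ge0 ?expR_ge0 ?wJ_ge0.
Qed.

Variables (Z : I -> Omega -> R) (X A : seq (I -> R)) (s : I -> R).

Hypothesis mZ : forall i, measurable_fun setT (Z i).

Hypothesis charZ : forall a q, \int[P]_t cos (dotp a (fun i => Z i t) + q) = expR (- (qform X a / 2)) * cos q.

Hypothesis sqrZ : forall i, P.-integrable setT (EFin \o (fun t => Z i t ^+ 2)).

Hypothesis varZ : forall i, \int[P]_t (Z i t ^+ 2) = \sum_(v <- X) v i ^+ 2.

Hypothesis off : forall i j, i != j -> v1 R * gramv (tvec blk c n) i j <= gramv (X ++ A) i j.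

Hypothesis diag : forall i, v1 R * gramv (tvec blk c n) i i <= gramv (X ++ A) i i <= v1 R * gramv (tvec blk c n) i i + s i.

Hypothesis root : forall i j, blk n i = blk n j.

Definition wn i : R := w i * expR ((s i + 1) / 2).

Lemma wn_ge0 i : 0 <= wn i. Proof. by rewrite mulr_ge0 ?expR_ge0. Qed.

Lemma phi_integrable : P.-integrable setT (EFin \o phi Z) /\
  \int[P]_t phi Z t = \sum_J thin p J * (1 - \int[P]_t lapl (wJ w J) (fun i => Z i t)).
Proof.
have il J : P.-integrable setT (EFin \o (fun t => lapl (wJ w J) (fun i => Z i t))).
  apply: (@bounded_integrable _ _ _ _ _ 1); first exact: measurable_lapl.
  move=> t; have /andP[l0 l1] := lapl_le1 (fun i => Z i t) (fun i => wJ_ge0 J i w0).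
  by rewrite ger0_norm// ltW.
have i1 : P.-integrable setT (EFin \o (fun=> 1 : R)) by exact: finite_measure_integrable_cst.
have iJ J : P.-integrable setT (EFin \o (fun t => thin p J * (1 - lapl (wJ w J) (fun i => Z i t)))).
  exact: (integrableZl measurableT (thin p J) (integrableB measurableT i1 (il J))).
have [h1 h2] := Rintegral_bigsum (index_enum {set K}) iJ; split; first exact: h1.
rewrite h2; apply: eq_bigr => J _.
rewrite RintegralZl//=; last by apply: (integrableB measurableT i1 (il J)).
by congr (_ * _); rewrite RintegralB//= Rintegral_cst//= probability_setT /= mul1r.
Qed.

Lemma int_phi (i0 : I) (B : R) :
  (forall m, micro_ok R n m -> UA blk c m (thin p) (fun J => wJ wn J) n (blk n i0) 0 <= B) ->
  \int[P]_t phi Z t <= 2 * B.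
Proof.
move=> hB; apply/ler_addgt0Pr => e e0; rewrite (phi_integrable).2.
have T0 i j : 0 <= gramv (tvec blk c n) i j.
  by rewrite gramv_tvec sumr_ge0// => l _; rewrite mulr_ge0 ?sqr_ge0.
have ex J := tree_comparison mZ charZ sqrZ varZ e0 (fun i => wJ_ge0 J i w0) off diag T0.
pose mJ J := projT1 (cid (ex J)).
have hJ J m : (mJ J <= m)%N -> _ := projT2 (cid (ex J)) m.
have [m0 hm0] := @micro_ok_eventually R n.
(* The recursion averages over all thinning sets at once, so one [m] has to serve each of these
   finitely many sets. *)
pose m := maxn m0 (\max_J mJ J).
have mok : micro_ok R n m by apply: hm0; rewrite leq_maxl.
have [mp0 meps4 _ _ _] := mok.
apply: (@le_trans _ _ (\sum_J (thin p J * (2 * Ul blk c m (wJ wn J) n (blk n i0) 0) + thin p J * e))).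
  apply: ler_sum => J _; rewrite -mulrDr ler_wpM2l ?thin_ge0//.
  apply: (le_trans (hJ J m _)); first by rewrite leq_max (leq_bigmax J) orbT.
  rewrite lerD2r ler_wpM2l// -(run_tree c m root (fun i => wJ_ge0 J i wn_ge0) i0) le_eqVlt; apply/orP; left; apply/eqP.
  apply: eq_run => x; congr (1 - expR (- _)); apply: eq_bigr => i _; by rewrite /wJ /wn; ring.
rewrite big_split/= -mulr_suml thin_sum mul1r lerD2r.
apply: le_trans (ler_wpM2l (ler0n _ 2) (hB m mok)); rewrite /UA mulr_sumr le_eqVlt; apply/orP; left; apply/eqP.
by apply: eq_bigr => J _; ring.
Qed.

End ThinnedFunctional.

(** * The recursion with thinning *)

Section ThinnedTree.

Variables (R : realType) (I K : finType) (blk : nat -> I -> K) (c : nat -> R) (m n kb : nat) (p t : R) (w : I -> R).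

Hypothesis blk_step : forall l i j, blk l i = blk l j -> blk l.+1 i = blk l.+1 j.

Hypothesis children4 : forall l b, (size (children blk l b) <= 4)%N.

Hypothesis mok : micro_ok R n m.

Hypothesis p01 : 0 <= p <= 1.

Hypothesis w0 : forall i, 0 <= w i.

Let m0 : (0 < m)%N. Proof. by case: mok. Qed.

Let es : meps R m <= 1 / 4. Proof. by case: mok. Qed.

(** At the thinning level a block is kept or discarded as a whole, so averaging multiplies its value
    by the probability [p] of being kept. *)
Lemma UA_thin b r : UA blk c m (thin p) (wJ blk kb w) kb b r = p * Ul blk c m w kb b r.
Proof.
rewrite /UA -[X in _ = X * _](thin_mem p b) mulr_suml; apply: eq_bigr => J _; rewrite -mulrA; congr (_ * _).
rewrite /Ul; case: (boolP (b \in J)) => bJ.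
  rewrite mul1r; apply: eq_run => x; rewrite /fb; congr (1 - expR (- _)); apply: eq_bigr => i _.
  by rewrite /wb /wJ; case: eqP => [->|_]; rewrite ?bJ ?mulr1// !mulr0.
rewrite mul0r -[RHS](run_const (TL blk c m kb) 0 (fun=> r)); apply: eq_run => x.
rewrite /fb /lapl big1 ?oppr0 ?expR0 ?subrr// => i _.
by rewrite /wb /wJ; case: eqP => [->|_]; rewrite ?(negbTE bJ) ?mulr0 ?mul0r.
Qed.

Lemma UA_pass_shift (A : finType) (q : A -> R) (v : A -> I -> R) l0 k cc (g : R -> R) :
  (forall a, 0 <= q a) -> \sum_a q a = 1 -> (forall a i, 0 <= v a i) ->
  0 < cc -> (forall l, (l0 <= l < l0 + k)%N -> c l = cc) -> (forall y, 0 <= g y) ->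
  (forall b r, UA blk c m q v l0 b r <= g (t - r / cc)) ->
  forall b r, UA blk c m q v (l0 + k) b r <= iter k (Phi m) g (t - r / cc).
Proof.
move=> q0 q1 v0 cc0 hc g0 entry b r.
have := UA_pass blk_step es q0 q1 v0 children4 cc0 hc (fun y => g0 (y - - t)) _ b r.
rewrite iter_Phi_shift opprK mulNr addrC; apply=> b' r'.
by apply: le_trans (entry b' r') _; rewrite mulNr addrC.
Qed.

Lemma Ul_UA l b r : Ul blk c m w l b r = UA blk c m (fun _ : unit => 1) (fun=> w) l b r.
Proof. by rewrite /UA big_const card_unit /= addr0 mul1r. Qed.

Variables (h : R -> R) (k : nat) (cc s mu A : R).

Hypothesis cc0 : 0 < cc.

Hypothesis hc : forall l, (k <= l < n)%N -> c l = cc.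

Hypothesis h01 : forall y, 0 <= h y <= 1.

Hypothesis mu01 : 0 < mu <= 1.

Hypothesis A1 : 1 <= A.

Hypothesis hh : forall z, 0 <= z + s -> h (z + k%:R * mdrift R m) <=
  expR (- z) * (expR (- s) * (A * (1 + (z + s)) * expR (- (mu * (z + s))))).

Lemma UA_root_full b Y : (k < n)%N -> 
  (forall b r, UA blk c m (thin p) (wJ blk kb w) k b r <= h (t - r / cc)) ->
  0 <= Y -> t - n%:R * mdrift R m + s + 3 / 2 * ln (n - k)%:R + 6 <= Y ->
  UA blk c m (thin p) (wJ blk kb w) n b 0 <=
    expR (- (t - n%:R * mdrift R m)) * (pass_const R * A * mu ^- 3 * expR (- s) * (1 + Y) / ((n - k)%:R * Num.sqrt (n - k)%:R)).
Proof.
move=> kn entry Y0 hY.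
apply: le_trans (root_full mok kn h01 mu01 A1 hh Y0 hY).
have := UA_pass_shift (thin_ge0 p01) (thin_sum K p) (fun J i => wJ_ge0 blk kb J i w0) cc0 _ _ entry b 0.
rewrite mul0r subr0 => /(_ (n - k)%N); rewrite (subnKC (ltnW kn)) => /(_ hc); apply => y.
by case/andP: (h01 y).
Qed.

Lemma UA_root_block b (a B : R) : (k < kb <= n)%N ->
  (forall b r, Ul blk c m w k b r <= h (t - r / cc)) ->
  0 <= a -> 0 <= B -> t - n%:R * mdrift R m - a + s + 3 / 2 * ln (kb - k)%:R + 6 <= B ->
  UA blk c m (thin p) (wJ blk kb w) n b 0 <= 4 * expR (- a) +
    expR (- (t - n%:R * mdrift R m)) * (p * (pass_const R * A * mu ^- 3 * expR (- s) / ((kb - k)%:R * Num.sqrt (kb - k)%:R)) * (1 + B) * (1 + a)).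
Proof.
move=> /andP[kkb kbn] entry a0 B0 hB.
have kk : (k < kb <= n)%N by rewrite kkb.
apply: le_trans (root_block mok kk h01 mu01 A1 hh p01 a0 B0 hB).
have e1 b' r : Ul blk c m w kb b' r <= iter (kb - k) (Phi m) h (t - r / cc).
  rewrite Ul_UA -{1}(subnKC (ltnW kkb)); apply: UA_pass_shift => //.
  - by rewrite big_const card_unit /= addr0.
  - by move=> l; rewrite (subnKC (ltnW kkb)) => /andP[h1 h2]; apply: hc; rewrite h1 (leq_trans h2).
  - by move=> y; case/andP: (h01 y).
  - by move=> b2 r2; rewrite -Ul_UA.
pose g y := p * iter (kb - k) (Phi m) h y.
have g0 y : 0 <= g y.
  rewrite /g mulr_ge0//; first by case/andP: p01.
  elim: (kb - k)%N y => [|j IH] y /=; first by case/andP: (h01 y).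
  by case/andP: (Phi_bounds es IH y).
have := UA_pass_shift (thin_ge0 p01) (thin_sum K p) (fun J i => wJ_ge0 blk kb J i w0) cc0 _ g0 _ b 0.
rewrite mul0r subr0 => /(_ kb (n - kb)%N); rewrite (subnKC kbn) => h1; apply: h1 => [l /andP[h1 h2]|b' r].
  by apply: hc; rewrite h2 (leq_trans (ltnW kkb)).
rewrite UA_thin /g ler_wpM2l//; by case/andP: p01.
Qed.

End ThinnedTree.

(** * Linear functionals of the field *)

Section LinearFunctionals.

Variables (R : realType) (I : finType).

Definition lin (f : (I -> R) -> R) := exists M, forall v, f v = dotp M v.

Lemma lin_ev i : lin (fun v => v i).
Proof.
exists (fun j => (i == j)%:R) => v; rewrite /dotp (bigD1 i)//= eqxx mul1r big1 ?addr0// => j.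
by rewrite eq_sym => /negbTE ->; rewrite mul0r.
Qed.

Lemma lin_add f g : lin f -> lin g -> lin (fun v => f v + g v).
Proof.
move=> [M fM] [M' gM]; exists (fun i => M i + M' i) => v; rewrite fM gM /dotp -big_split/=.
by apply: eq_bigr => i _; rewrite mulrDl.
Qed.

Lemma lin_scale c f : lin f -> lin (fun v => c * f v).
Proof.
move=> [M fM]; exists (fun i => c * M i) => v; rewrite fM /dotp mulr_sumr.
by apply: eq_bigr => i _; rewrite mulrA.
Qed.

Lemma lin_sum (J : Type) (r : seq J) (f : J -> (I -> R) -> R) : (forall j, lin (f j)) -> lin (fun v => \sum_(j <- r) f j v).
Proof.
move=> lf; elim: r => [|j r IH].
  by exists (fun=> 0) => v; rewrite big_nil /dotp big1// => i _; rewrite mul0r.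
have [M fM] := lin_add (lf j) IH; exists M => v; by rewrite big_cons fM.
Qed.

Lemma lin_ext f g : f =1 g -> lin f -> lin g.
Proof. by move=> fg [M h]; exists M => v; rewrite -fg. Qed.

Definition Gam (W : seq (I -> R)) (f g : (I -> R) -> R) : R := \sum_(v <- W) f v * g v.

Lemma GamC W f g : Gam W f g = Gam W g f.
Proof. by apply: eq_bigr => v _; rewrite mulrC. Qed.

Lemma Gam_scale W c f g : Gam W (fun v => c * f v) g = c * Gam W f g.
Proof. by rewrite /Gam mulr_sumr; apply: eq_bigr => v _; rewrite mulrA. Qed.

Lemma Gam_sum W (J : Type) (r : seq J) (f : J -> (I -> R) -> R) g :
  Gam W (fun v => \sum_(j <- r) f j v) g = \sum_(j <- r) Gam W (f j) g.
Proof. by rewrite /Gam exchange_big/=; apply: eq_bigr => v _; rewrite mulr_suml. Qed.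

End LinearFunctionals.

(** * Gaussian vectors obtained as linear images *)

Section LinearImage.

Variables (R : realType) (I J : finType).

Context (d : measure_display) (Omega : measurableType d) (P : probability Omega R).

Variables (eta : I -> Omega -> R) (X : seq (I -> R)).

Hypothesis meta : forall i, measurable_fun setT (eta i).

Hypothesis chareta : forall a q, \int[P]_t cos (dotp a (fun i => eta i t) + q) = expR (- (qform X a / 2)) * cos q.

Hypothesis lineta : forall a, P.-integrable setT (EFin \o (fun t => dotp a (fun i => eta i t) ^+ 2)) /\
  \int[P]_t (dotp a (fun i => eta i t) ^+ 2) = qform X a.

Variable f : J -> (I -> R) -> R.

Hypothesis lf : forall j, lin (f j).

Definition img (j : J) (t : Omega) : R := f j (fun i => eta i t).

Definition imgv (W : seq (I -> R)) : seq (J -> R) := [seq (fun j => f j v) | v <- W].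

Lemma gramv_imgv W i j : gramv (imgv W) i j = Gam W (f i) (f j).
Proof. by rewrite /gramv /imgv big_map. Qed.

Lemma img_meas j : measurable_fun setT (img j).
Proof.
have [M fM] := lf j; rewrite (_ : img j = fun t => \sum_i M i * eta i t); last by apply/funext => t; rewrite /img fM.
by apply: measurable_sum => i; apply: measurable_funM.
Qed.

Lemma img_char a q : \int[P]_t cos (dotp a (fun j => img j t) + q) = expR (- (qform (imgv X) a / 2)) * cos q.
Proof.
have [M fM] : lin (fun v => dotp a (fun j => f j v)).
  by apply: lin_sum => j; apply: lin_scale; exact: lf.
have -> : qform (imgv X) a = qform X M by rewrite /qform /imgv big_map; apply: eq_bigr => v _; rewrite fM.
rewrite -chareta; congr fine; apply: eq_integral => t _; congr (cos (_ + _))%:E; exact: fM.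
Qed.

Lemma img_sq j : P.-integrable setT (EFin \o (fun t => img j t ^+ 2)).
Proof.
have [M fM] := lf j; rewrite (_ : EFin \o _ = EFin \o (fun t => dotp M (fun i => eta i t) ^+ 2)); first exact: (lineta M).1.
by apply/funext => t; rewrite /img /= fM.
Qed.

Lemma img_var j : \int[P]_t (img j t ^+ 2) = \sum_(v <- imgv X) v j ^+ 2.
Proof.
have [M fM] := lf j; rewrite /imgv big_map (eq_bigr (fun v => dotp M v ^+ 2)); last by move=> v _; rewrite fM.
rewrite -/(qform X M) -(lineta M).2; congr fine; apply: eq_integral => t _; by rewrite /img fM.
Qed.

End LinearImage.

Lemma average_close (R : realType) (F : nat -> R) (M : nat) (x e : R) : (0 < M)%N -> (forall u, (u < M)%N -> `|F u - x| <= e) ->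
  `|M%:R^-1 * (\sum_(u < M) F u) - x| <= e.
Proof.
move=> M0 h; have MR : 0 < M%:R :> R by rewrite ltr0n.
have -> : M%:R^-1 * (\sum_(u < M) F u) - x = M%:R^-1 * \sum_(u < M) (F u - x).
  rewrite sumrB mulrBr sumr_const card_ord; congr (_ - _).
  by rewrite -[x *+ M]mulr_natl mulrA mulVf ?mul1r// gt_eqF.
have i0 : 0 <= M%:R^-1 :> R by rewrite invr_ge0 ltW.
rewrite normrM (ger0_norm i0).
have S : `|\sum_(u < M) (F u - x)| <= M%:R * e.
  apply: le_trans (ler_norm_sum _ _ _) _; apply: (@le_trans _ _ (\sum_(u < M) e)).
    by apply: ler_sum => u _; exact: h.
  by rewrite sumr_const card_ord mulr_natl.
by apply: le_trans (ler_wpM2l i0 S) _; rewrite mulrA mulVf ?mul1r// gt_eqF.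
Qed.

(** * Points, segments and logarithmic distances *)

Section Geometry.

Variables (R : realType) (N' : nat).

Definition Pt := ('I_N'.*2.+1 * 'I_N'.*2.+1)%type.

Definition pos (i : Pt) : Z2 := ((i.1 : nat)%:Z - N'%:Z, (i.2 : nat)%:Z - N'%:Z).

Lemma pos_inV i : inV N'.+1 (pos i).
Proof. by case: i => a b; rewrite /inV /pos /=; have := ltn_ord a; have := ltn_ord b; lia. Qed.

Lemma pos_inj : injective pos.
Proof. by move=> [a b] [c e] [h1 h2]; congr (_, _); apply/val_inj => /=; lia. Qed.

Lemma pos_surj x : inV N'.+1 x -> exists i, pos i = x.
Proof.
case: x => a b; rewrite /inV /= => h.
have ia : (absz (a + N'%:Z)%R < N'.*2.+1)%N by lia.
have ib : (absz (b + N'%:Z)%R < N'.*2.+1)%N by lia.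
by exists (Ordinal ia, Ordinal ib); rewrite /pos /=; congr (_, _); lia.
Qed.

Definition dst (i j : Pt) : nat := dist ((pos i).1 - (pos j).1, (pos i).2 - (pos j).2).

Lemma dstE i j : dst i j = maxn 1 (maxn `|(i.1 : nat)%:Z - (j.1 : nat)%:Z|%N `|(i.2 : nat)%:Z - (j.2 : nat)%:Z|%N).
Proof. by rewrite /dst /dist /pos /=; congr (maxn _ (maxn `|_|%N `|_|%N)); lia. Qed.

Lemma dst_gt0 i j : (0 < dst i j)%N. Proof. exact: dist_gt0. Qed.

Lemma dstC i j : dst i j = dst j i.
Proof. by rewrite !dstE; congr (maxn _ (maxn _ _)); lia. Qed.

Lemma dst_tri i j k : (dst i k <= dst i j + dst j k)%N.
Proof.
rewrite !dstE !geq_max; apply/and3P; split; first by rewrite (leq_trans _ (leq_addr _ _))// leq_max.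
- apply: (@leq_trans (`|(i.1 : nat)%:Z - (j.1 : nat)%:Z| + `|(j.1 : nat)%:Z - (k.1 : nat)%:Z|)%N); first lia.
  by apply: leq_add; rewrite !leq_max leqnn orbT.
- apply: (@leq_trans (`|(i.2 : nat)%:Z - (j.2 : nat)%:Z| + `|(j.2 : nat)%:Z - (k.2 : nat)%:Z|)%N); first lia.
  by apply: leq_add; rewrite !leq_max leqnn !orbT.
Qed.

Definition lnd i j : R := ln (dst i j)%:R.

Lemma lnd_ii i : lnd i i = 0.
Proof. by rewrite /lnd dstE !subrr /= ln1. Qed.

Lemma lnd_le i j (a b : nat) : (dst i j <= a + b)%N -> (0 < a)%N -> (0 < b)%N -> lnd i j <= Num.max (ln a%:R) (ln b%:R) + 1.
Proof.
move=> h a0 b0; apply: (@le_trans _ _ (ln (2 * (maxn a b)%:R))).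
  rewrite /lnd ler_ln ?posrE ?ltr0n ?dst_gt0 ?mulr_gt0 ?ltr0n ?leq_max ?a0//.
  by rewrite -natrM ler_nat; lia.
rewrite lnM ?posrE ?ltr0n ?leq_max ?a0// addrC; have := ln_le_sub1 (ltr0n _ 2 : 0 < 2 :> R) => h2.
apply: lerD; last by lra.
by rewrite le_max; case: (leqP a b) => _; rewrite lexx ?orbT.
Qed.

(* A horizontal segment of length [2 ^ k] starting at the point and going towards the centre, so as to stay inside the box. *)
Definition seg (i : Pt) (u : nat) : Pt := (if (i.1 <= N')%N then inord (i.1 + u) else inord (i.1 - u), i.2).

Lemma seg1 i u k : (2 ^ k <= N'.+1)%N -> (u < 2 ^ k)%N ->
  ((seg i u).1 : nat) = (if (i.1 <= N')%N then i.1 + u else i.1 - u)%N.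
Proof. by move=> kN uk; rewrite /seg /=; have := ltn_ord i.1; case: ifP => h h1; rewrite inordK//; lia. Qed.

Lemma dst_seg i u k : (2 ^ k <= N'.+1)%N -> (u < 2 ^ k)%N -> (dst i (seg i u) <= 2 ^ k)%N.
Proof.
move=> kN uk; rewrite dstE (seg1 i kN uk) /seg/= subrr !geq_max expn_gt0 /= andbT.
by case: ifP => h; lia.
Qed.

(** At least one end of the interval is at distance about half its length from [a]; removing that
    end leaves a claim of the same form, so the singularity of the logarithm at [a] never has to be
    located. *)
Lemma log_average (M : nat) (a : int) :
  M%:R * ln M%:R - 3 * M%:R <= \sum_(u < M) ln (maxn 1 `|u%:Z - a|%N)%:R :> R.
Proof.
elim: M a => [|[|M] IH] a; first by rewrite big_ord0 !mul0r mulr0 subrr.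
  by rewrite big_ord_recr big_ord0/= add0r ln1 mulr0 sub0r mulr1; apply: (@le_trans _ _ 0); [lra|rewrite ln_ge0// ler1n leq_max].
have M0 : 0 < M.+1%:R :> R by rewrite ltr0n.
have step (x S : R) : ln M.+2%:R - 2 <= x -> M.+1%:R * ln M.+1%:R - 3 * M.+1%:R <= S ->
   M.+2%:R * ln M.+2%:R - 3 * M.+2%:R <= S + x.
  move=> h1 h2; have E : M.+2%:R = M.+1%:R + 1 :> R by rewrite natr1.
  have : ln M.+2%:R - ln M.+1%:R <= M.+1%:R^-1 :> R.
    rewrite -ln_div ?posrE ?ltr0n//; apply: le_trans (ln_le_sub1 _) _; first by rewrite divr_gt0 ?ltr0n.
    by rewrite E mulrDl mulfV ?gt_eqF// mul1r addrAC subrr add0r.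
  move=> /(ler_wpM2l (ltW M0)); rewrite mulfV ?gt_eqF// {1}E.
  move: h1 h2; rewrite E; move: (ln (M.+1%:R + 1)) => l2; move: (ln M.+1%:R) => l1; move: (M.+1%:R : R) => q; lra.
have far (c : nat) : (M.+1 <= 2 * c)%N -> ln M.+2%:R - 2 <= ln (maxn 1 c)%:R :> R.
  move=> hc; have : ln M.+2%:R <= ln (2 * (2 * c%:R)) :> R.
    by rewrite ler_ln ?posrE ?mulr_gt0 ?ltr0n// -?natrM ?ler_nat; lia.
  rewrite (maxn_idPr _); last by lia.
  have c0 : 0 < c%:R :> R by rewrite ltr0n; lia.
  rewrite lnM ?posrE ?mulr_gt0// lnM ?posrE//.
  have := ln_le_sub1 (ltr0n _ 2 : 0 < 2 :> R); lra.
have [h|h] := leqP M.+1 (2 * `|M.+1%:Z - a|).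
  by rewrite big_ord_recr/=; apply: step; [exact: far|exact: IH].
rewrite big_ord_recl [leRHS]addrC; apply: step; first by apply: far; rewrite /=; lia.
apply: le_trans (IH (a - 1)) _; rewrite le_eqVlt; apply/orP; left; apply/eqP.
by apply: eq_bigr => u _; rewrite lift0; congr (ln (maxn 1 `|_|)%:R); lia.
Qed.

(** The logarithmic distance at resolution [2^k], as seen by averages over segments of that
    length. *)
Definition rho (k : nat) i j : R := Num.max (k%:R * ln 2) (lnd i j).

Lemma ln_pow2 k : ln (2 ^ k)%:R = k%:R * ln 2 :> R.
Proof. by rewrite natrX lnXn// mulr_natl. Qed.

Lemma rho_near k i i' j : (dst i i' <= 2 ^ k)%N -> rho k i' j <= rho k i j + 1.
Proof.
move=> h; rewrite {1}/rho ge_max; apply/andP; split.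
  by rewrite /rho; apply: (@le_trans _ _ (k%:R * ln 2 + 1)); [lra|rewrite lerD2r le_max lexx].
rewrite /rho -ln_pow2; apply: lnd_le; rewrite ?expn_gt0 ?dst_gt0//.
by apply: leq_trans (dst_tri i' i j) _; rewrite (dstC i') leq_add2r.
Qed.

Lemma rhoC k i j : rho k i j = rho k j i.
Proof. by rewrite /rho /lnd dstC. Qed.

Lemma rho_avg k i j : (2 ^ k <= N'.+1)%N ->
  rho k i j - 5 <= (2 ^ k)%:R^-1 * (\sum_(u < 2 ^ k) lnd i (seg j u)) <= rho k i j + 5.
Proof.
move=> kN; have M0 : (0 < 2 ^ k)%N by rewrite expn_gt0.
have MR : 0 < (2 ^ k)%:R :> R by rewrite ltr0n.
have ln2 := ln_le_sub1 (ltr0n _ 2 : 0 < 2 :> R).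
have up u : (u < 2 ^ k)%N -> lnd i (seg j u) <= rho k i j + 1.
  move=> uk; apply: le_trans (_ : rho k (seg j u) i <= _); first by rewrite rhoC /rho le_max lexx orbT.
  by rewrite (rhoC k i); apply: rho_near; exact: dst_seg.
have avg_le (F : nat -> R) x : (forall u, (u < 2 ^ k)%N -> F u <= x) -> (2 ^ k)%:R^-1 * (\sum_(u < 2 ^ k) F u) <= x.
  move=> h; rewrite mulrC ler_pdivrMr// mulr_natr; apply: (@le_trans _ _ (\sum_(u < 2 ^ k) x)).
    by apply: ler_sum => u _; exact: h.
  by rewrite sumr_const card_ord.
apply/andP; split; last by apply: (avg_le (fun u => lnd i (seg j u))) => u uk; have := up u uk; lra.
(* Far from the segment the logarithm is nearly constant along it; nearby, only [log_average]
   prevents the singularity from lowering the mean. *)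
have [h|h] := leqP (2 * 2 ^ k) (dst i j).
  have lo u : (u < 2 ^ k)%N -> - lnd i (seg j u) <= - (rho k i j - 5).
    move=> uk; have := dst_tri i (seg j u) j; rewrite (dstC (seg j u) j) => t1.
    have t2 := dst_seg j kN uk; have t3 : (dst i j <= 2 * dst i (seg j u))%N by lia.
    have : lnd i j <= lnd i (seg j u) + 1.
      have := @lnd_le i j (dst i (seg j u)) (dst i (seg j u)); rewrite maxxx => H; apply: H; rewrite ?dst_gt0//; lia.
    have -> : rho k i j = lnd i j; last by lra.
    apply/max_idPr; rewrite -ln_pow2 /lnd ler_ln ?posrE ?ltr0n ?dst_gt0// ler_nat; lia.
  have := avg_le (fun u => - lnd i (seg j u)) _ lo; rewrite sumrN mulrN lerN2; done.
have rk : rho k i j <= k%:R * ln 2 + 1.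
  rewrite /rho ge_max; apply/andP; split; first by lra.
  have := @lnd_le i j (2 ^ k) (2 ^ k); rewrite maxxx ln_pow2; apply; rewrite ?expn_gt0//; lia.
have : ln (2 ^ k)%:R - 3 <= (2 ^ k)%:R^-1 * (\sum_(u < 2 ^ k) lnd i (seg j u)).
  rewrite mulrC ler_pdivlMr// mulrBl mulrC.
  (* Position of [i] relative to the start of the segment, measured in the direction in which the
     segment runs; the vertical distance is dropped. *)
  pose a : int := if (j.1 <= N')%N then (i.1 : nat)%:Z - (j.1 : nat)%:Z else (j.1 : nat)%:Z - (i.1 : nat)%:Z.
  apply: le_trans (log_average (2 ^ k) a) _; apply: ler_sum => u _; have uM := ltn_ord u; have jM := ltn_ord j.1.
  rewrite /lnd ler_ln ?posrE ?ltr0n ?dst_gt0 ?leq_max// ler_nat dstE (seg1 j kN (ltn_ord u)).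
  by rewrite geq_max !leq_max /=; apply/orP; right; rewrite /a; case: ifP => h'; apply/orP; left; lia.
by rewrite ln_pow2; move: rk; move: (rho _ _ _) (_^-1 * _) => x y; lra.
Qed.

End Geometry.

(** * Covariances of points and segment means *)

Section CovEstimates.

Variables (R : realType) (N' n k : nat) (W : seq (Pt N' -> R)) (c1 : R).

Notation Pt := (Pt N').

Hypothesis kN : (2 ^ k <= N'.+1)%N.

Definition ev (i : Pt) (v : Pt -> R) : R := v i.

Definition sg (i : Pt) (v : Pt -> R) : R := (2 ^ k)%:R^-1 * \sum_(u < 2 ^ k) v (seg i u).

Let V : R := v1 R * n%:R.

Hypothesis HC : forall i j, `|Gam W (ev i) (ev j) - (V - 4 * lnd R i j)| <= c1.

Let r := @rho R N' k.

Let M0 : (0 < 2 ^ k)%N. Proof. by rewrite expn_gt0. Qed.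

Lemma lin_sg i : lin (sg i).
Proof. by apply: lin_scale; apply: lin_sum => u; exact: lin_ev. Qed.

Lemma Gam_sg i g : Gam W (sg i) g = (2 ^ k)%:R^-1 * \sum_(u < 2 ^ k) Gam W (ev (seg i u)) g.
Proof. by rewrite /sg Gam_scale Gam_sum. Qed.

Lemma cov_pp_ge i j : V - 4 * r i j - c1 <= Gam W (ev i) (ev j).
Proof.
have := HC i j; rewrite ler_norml => /andP[h _].
have : lnd R i j <= r i j by rewrite le_max lexx orbT.
lra.
Qed.

Lemma cov_sp i j : `|Gam W (sg i) (ev j) - (V - 4 * r i j)| <= c1 + 20.
Proof.
rewrite Gam_sg; have /andP[a1 a2] := rho_avg R j i kN; rewrite rhoC -/r in a1 a2.
have : `|(2 ^ k)%:R^-1 * \sum_(u < 2 ^ k) (Gam W (ev (seg i u)) (ev j) - (V - 4 * lnd R j (seg i u)))| <= c1.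
  have := average_close (F := fun u => Gam W (ev (seg i u)) (ev j) - (V - 4 * lnd R j (seg i u))) (x := 0) (e := c1) M0; rewrite subr0; apply=> u uk.
  by rewrite subr0 /lnd dstC; exact: HC.
have -> : (2 ^ k)%:R^-1 * \sum_(u < 2 ^ k) (Gam W (ev (seg i u)) (ev j) - (V - 4 * lnd R j (seg i u))) =
   (2 ^ k)%:R^-1 * (\sum_(u < 2 ^ k) Gam W (ev (seg i u)) (ev j)) - V + 4 * ((2 ^ k)%:R^-1 * (\sum_(u < 2 ^ k) lnd R j (seg i u))).
  rewrite sumrB sumrB sumr_const card_ord -mulr_sumr -[V *+ _]mulr_natl; field.
  by rewrite gt_eqF// ltr0n.
rewrite !ler_norml => /andP[h1 h2]; move: a1 a2 h1 h2.
move: (_^-1 * _) (_^-1 * _) => x y *; apply/andP; split; lra.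
Qed.

Lemma cov_ss i j : `|Gam W (sg i) (sg j) - (V - 4 * r i j)| <= c1 + 24.
Proof.
rewrite Gam_sg; apply: (average_close (F := fun u => Gam W (ev (seg i u)) (sg j)) M0) => u uk.
have := cov_sp j (seg i u); rewrite GamC.
have h1 := rho_near R j (dst_seg i kN uk); 
have h2 := rho_near R j (_ : (dst (seg i u) i <= 2 ^ k)%N); 
have {}h2 := h2 (ltac:(by rewrite dstC dst_seg)).
rewrite /r (rhoC R k j (seg i u)) !ler_norml => /andP[a1 a2]; apply/andP; split; lra.
Qed.

Lemma cov_near i i' j : (dst i i' <= 2 ^ k)%N ->
  `|Gam W (sg j) (ev i') - (V - 4 * r i j)| <= c1 + 24.
Proof.
move=> h; have h1 := rho_near R j h; have h2 := rho_near R j (_ : (dst i' i <= 2 ^ k)%N).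
have {}h2 := h2 (ltac:(by rewrite dstC)).
have := cov_sp j i'; rewrite /r (rhoC R k j i') !ler_norml => /andP[a1 a2]; apply/andP; split; lra.
Qed.

Lemma cov_near_pp i i' j j' : (dst i i' <= 2 ^ k)%N -> (dst j j' <= 2 ^ k)%N -> V - 4 * r i j - (c1 + 8) <= Gam W (ev i') (ev j').
Proof.
move=> h h'; have h1 := rho_near R j h; have h2 := rho_near R i' h'.
have := cov_pp_ge i' j'; rewrite /r; move: h2; rewrite (rhoC R k j' i') (rhoC R k j i') => h2; lra.
Qed.

End CovEstimates.

(** * Dyadic blocks and the covariance of the tree *)

Section Blocks.

Variables (R : realType) (N' : nat).

Notation Pt := (Pt N').

Definition blk (l : nat) (i : Pt) : Pt := (inord (i.1 %/ 2 ^ l), inord (i.2 %/ 2 ^ l)).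

Lemma blk_val l i : ((blk l i).1 : nat) = (i.1 %/ 2 ^ l)%N /\ ((blk l i).2 : nat) = (i.2 %/ 2 ^ l)%N.
Proof. by rewrite /blk /=; split; rewrite inordK// (leq_ltn_trans (leq_div _ _)). Qed.

Lemma blkP l i j : blk l i = blk l j <-> (i.1 %/ 2 ^ l = j.1 %/ 2 ^ l)%N /\ (i.2 %/ 2 ^ l = j.2 %/ 2 ^ l)%N.
Proof.
have [h1 h2] := blk_val l i; have [h3 h4] := blk_val l j; split.
  by move=> e; rewrite -h1 -h2 -h3 -h4 e.
by move=> [e1 e2]; rewrite /blk e1 e2.
Qed.

Lemma blk_step l i j : blk l i = blk l j -> blk l.+1 i = blk l.+1 j.
Proof. by move=> /blkP[e1 e2]; apply/blkP; rewrite !expnSr !divnMA e1 e2. Qed.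

Lemma blk_root n i j : (N'.*2 < 2 ^ n)%N -> blk n i = blk n j.
Proof.
move=> h; apply/blkP; rewrite !divn_small//; apply: leq_trans h; exact: ltn_ord.
Qed.

Lemma blk0_inj : injective (blk 0).
Proof.
by move=> [a b] [c e] /blkP /=; rewrite !expn0 !divn1 => -[h1 h2]; congr (_, _); exact: val_inj.
Qed.

Lemma blk_dst l i j : blk l i = blk l j -> (dst i j <= 2 ^ l)%N.
Proof.
have H (a b m : nat) : (0 < m)%N -> (a %/ m = b %/ m)%N -> (`|a%:Z - b%:Z| < m)%N.
  move=> m0 e; have := divn_eq a m; have := divn_eq b m; rewrite e.
  have := ltn_pmod a m0; have := ltn_pmod b m0; move: (a %% m)%N (b %% m)%N (b %/ m * m)%N => x y z; lia.
move=> /blkP[/H h1 /H h2]; rewrite dstE !geq_max expn_gt0/=.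
by rewrite (ltnW (h1 _)) ?(ltnW (h2 _)) ?expn_gt0.
Qed.

Lemma blk_children l b : (size (children blk l b) <= 4)%N.
Proof.
rewrite -[4%N]/(size [:: (inord (b.1 * 2), inord (b.2 * 2)); (inord (b.1 * 2).+1, inord (b.2 * 2));
   (inord (b.1 * 2), inord (b.2 * 2).+1); (inord (b.1 * 2).+1, inord (b.2 * 2).+1) : Pt]).
apply: uniq_leq_size; first exact: undup_uniq.
move=> g; rewrite mem_undup => /mapP[i]; rewrite mem_filter => /andP[/eqP ib _] ->.
have [h1 h2] := blk_val l.+1 i; rewrite ib expnSr divnMA in h1; rewrite ib expnSr divnMA in h2.
have H (a : nat) (m : nat) : (m = a %/ 2)%N -> a = (m * 2)%N \/ a = (m * 2).+1.
  by move=> ->; have := divn_eq a 2; have := ltn_pmod a (isT : 0 < 2)%N; lia.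
rewrite /blk !inE; case: (H _ _ h1) => ->; case: (H _ _ h2) => ->; by rewrite eqxx ?orbT.
Qed.

Definition cfun (k : nat) (a b : R) (l : nat) : R := if (l < k)%N then a else b.

Lemma count_levels (e : nat -> bool) (x : R) m : (forall l, e l -> x <= l%:R * ln 2) ->
  \sum_(l < m) (e l)%:R * ln 2 <= Num.max (m%:R * ln 2 - x) 0 :> R.
Proof.
have l2 : 0 <= ln 2 :> R by rewrite ln_ge0//; lra.
move=> h; elim: m => [|m IH]; first by rewrite big_ord0 le_max lexx orbT.
rewrite big_ord_recr/= -[m.+1%:R]natr1 mulrDl mul1r; case: (boolP (e m)) => em; last first.
  rewrite mul0r addr0; apply: (le_trans IH); rewrite ge_max !le_max lexx orbT andbT.
  by apply/orP; left; lra.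
have := h _ em; rewrite mul1r => xm; apply: le_trans (lerD IH (lexx _)) _.
by rewrite (max_idPl _) ?subr_ge0// le_max; apply/orP; left; lra.
Qed.

Variables (n k : nat) (a b : R).

Hypothesis nN : (N'.*2 < 2 ^ n)%N.

Hypothesis kN : (2 ^ k <= N'.+1)%N.

Lemma leq_kn : (k <= n)%N.
Proof. rewrite -(leq_exp2l k n (isT : 1 < 2)%N); lia. Qed.

Lemma lnd_le_n (i j : Pt) : lnd R i j <= n%:R * ln 2.
Proof.
rewrite -ln_pow2 /lnd ler_ln ?posrE ?ltr0n ?dst_gt0 ?expn_gt0// ler_nat.
exact/blk_dst/blk_root.
Qed.

(** Points in a common block of level [l] are within [2^l], which bounds the number of common levels
    from above. There is no matching lower bound, as close points can be separated by a block
    boundary; a smaller tree covariance is what the comparison tolerates. *)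
Lemma tree_upper (i j : Pt) : v1 R * gramv (tvec blk (cfun k a b) n) i j <=
  b ^+ 2 * (v1 R * n%:R - 4 * rho R k i j) + 4 * a ^+ 2 * (rho R k i j - lnd R i j).
Proof.
have l2 : 0 <= ln 2 :> R by rewrite ln_ge0//; lra.
rewrite gramv_tvec; pose e l := blk l i == blk l j.
have eP l : e l -> lnd R i j <= l%:R * ln 2.
  by move=> /eqP /blk_dst h; rewrite -ln_pow2 /lnd ler_ln ?posrE ?ltr0n ?dst_gt0 ?expn_gt0// ler_nat.
have H1 := @count_levels (fun l => e l && (l < k)%N) (lnd R i j) k (fun l h => eP l (proj1 (andP h))).
have H2 := @count_levels (fun l => e l && (k <= l)%N) (rho R k i j) n.
have {}H2 := H2 (fun l h => ltac:(by case/andP: h => h1 h2; rewrite /rho ge_max eP// andbT ler_wpM2r// ler_nat)).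
have -> : v1 R * \sum_(l < n) cfun k a b l ^+ 2 * (blk l i == blk l j)%:R =
   4 * a ^+ 2 * (\sum_(l < k) (e l && (l < k)%N)%:R * ln 2) + 4 * b ^+ 2 * (\sum_(l < n) (e l && (k <= l)%N)%:R * ln 2).
  have -> : \sum_(l < k) (e l && (l < k)%N)%:R * ln 2 = \sum_(l < n) (e l && (l < k)%N)%:R * ln 2 :> R.
    rewrite -!(big_mkord xpredT (fun l => (e l && (l < k)%N)%:R * ln 2 : R)) [RHS](big_cat_nat (n := k)) ?leq_kn//=.
    rewrite [X in _ = _ + X]big1_seq ?addr0// => l; rewrite mem_index_iota => /and3P[_ h _].
    by rewrite ltnNge h andbF mul0r.
  rewrite !mulr_sumr -big_split/=; apply: eq_bigr => l _; rewrite /cfun /v1 -/(e l) [(k <= l)%N]leqNgt.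
  by case: (e l); case: (l < k)%N; rewrite /= ?mulr1n ?mulr0n; ring.
have r1 : lnd R i j <= rho R k i j by rewrite le_max lexx orbT.
have r2 : k%:R * ln 2 <= rho R k i j by rewrite le_max lexx.
have r3 : rho R k i j <= n%:R * ln 2.
  by rewrite ge_max lnd_le_n andbT ler_wpM2r// ler_nat leq_kn.
rewrite (max_idPl _) in H2; last by rewrite subr_ge0.
have {}H1 : \sum_(l < k) (e l && (l < k)%N)%:R * ln 2 <= rho R k i j - lnd R i j.
  by apply: (le_trans H1); rewrite ge_max subr_ge0 r1 andbT lerB.
have := ler_wpM2l (mulr_ge0 (ler0n _ 4) (sqr_ge0 a)) H1.
have := ler_wpM2l (mulr_ge0 (ler0n _ 4) (sqr_ge0 b)) H2.
rewrite /v1; move: (\sum_(_ < _) _) (\sum_(_ < _) _) => x y; lra.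
Qed.

Lemma tree_diag i : v1 R * gramv (tvec blk (cfun k a b) n) i i =
  b ^+ 2 * (v1 R * n%:R - 4 * (k%:R * ln 2)) + 4 * a ^+ 2 * (k%:R * ln 2).
Proof.
rewrite gramv_tvec -(subnKC leq_kn) big_split_ord/=.
rewrite (eq_bigr (fun=> a ^+ 2)) => [|l _]; last by rewrite /cfun /= ltn_ord eqxx mulr1.
rewrite [X in _ + X](eq_bigr (fun=> b ^+ 2)) => [|l _]; last by rewrite /cfun /= ltnNge leq_addr /= eqxx mulr1.
by rewrite !sumr_const !card_ord -[a ^+ 2 *+ _]mulr_natr -[b ^+ 2 *+ _]mulr_natr natrD /v1; ring.
Qed.

End Blocks.

(** * The two functionals and the trees that dominate them *)

Section Comparisons.

Variables (R : realType) (N' n k : nat) (WX WA : seq (Pt N' -> R)) (c1 kap : R).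

Notation Pt := (Pt N').

Hypothesis nN : (N'.*2 < 2 ^ n)%N.

Hypothesis kN : (2 ^ k <= N'.+1)%N.

Hypothesis c10 : 0 <= c1.

Hypothesis kap01 : 0 <= kap <= 1.

Let W := WX ++ WA.

Hypothesis HC : forall i j, `|Gam W (ev i) (ev j) - (v1 R * n%:R - 4 * lnd R i j)| <= c1.

(** Nine is the total weight of the covariances in [Gam_f1] and in [Gam_f2], each of them being
    known up to [c1 + 24]. *)
Definition c2 : R := 9 * (c1 + 24).

Let V : R := v1 R * n%:R.

Lemma c2_ge0 : 0 <= c2. Proof. by have h := c10; rewrite /c2; lra. Qed.

(** One common Gaussian variable raises all covariances by [c2] and so turns an approximation with
    error [c2] into the one-sided inequality required by the comparison. *)
Lemma gram_noise (J : finType) (f : J -> (Pt -> R) -> R) i j :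
  gramv (imgv f WX ++ (imgv f WA ++ [:: fun=> Num.sqrt c2])) i j = Gam W (f i) (f j) + c2.
Proof.
rewrite catA gramv_cat; congr (_ + _); last by rewrite /gramv big_seq1 -expr2 sqr_sqrtr// c2_ge0.
by rewrite -gramv_imgv /imgv map_cat.
Qed.

(** The segment mean sees only scales above [2^k], so the point has weight 2 on the fine levels and
    [2 + kap] on the coarse ones. *)
Definition f1 (i : Pt) (v : Pt -> R) : R := 2 * v i + kap * sg k i v.

Lemma lin_f1 i : lin (f1 i).
Proof. by apply: lin_add; apply: lin_scale; [exact: lin_ev|exact: lin_sg]. Qed.

Lemma Gam_f1 i j : Gam W (f1 i) (f1 j) = 4 * Gam W (ev i) (ev j) + 2 * kap * Gam W (sg k j) (ev i) +
  2 * kap * Gam W (sg k i) (ev j) + kap ^+ 2 * Gam W (sg k i) (sg k j).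
Proof.
rewrite /Gam !mulr_sumr -!big_split/=; apply: eq_bigr => v _; rewrite /f1 /ev; ring.
Qed.

Lemma f1_close i j : `|Gam W (f1 i) (f1 j) - ((2 + kap) ^+ 2 * (V - 4 * rho R k i j) + 16 * (rho R k i j - lnd R i j))| <= c2.
Proof.
rewrite Gam_f1; have /andP[k0 k1] := kap01; have cc := c10.
have := HC i j; have := cov_sp kN HC i j; have := cov_sp kN HC j i; have := cov_ss kN HC i j; rewrite -/V (rhoC R k j i).
have kk : 0 <= kap ^+ 2 <= 1 by rewrite sqr_ge0 exprn_ile1.
move: (Gam _ _ _) (Gam _ _ _) (Gam _ _ _) (Gam _ _ _) => A B C D.
rewrite /c2; move: (rho _ _ _ _) (lnd _ _ _) => r l.
have sc (x y e : R) : 0 <= x -> x <= 4 -> `|y| <= e -> `|x * y| <= 4 * e.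
  by move=> x0 x4 ye; rewrite normrM (ger0_norm x0) ler_pM.
have sc1 (x y e : R) : 0 <= x -> x <= 2 -> `|y| <= e -> `|x * y| <= 2 * e.
  by move=> x0 x4 ye; rewrite normrM (ger0_norm x0) ler_pM.
have sc2 (x y e : R) : 0 <= x -> x <= 1 -> `|y| <= e -> `|x * y| <= 1 * e.
  by move=> x0 x4 ye; rewrite normrM (ger0_norm x0) ler_pM.
have [k2a k2b] : 0 <= 2 * kap /\ 2 * kap <= 2 by lra.
case/andP: kk => kk0 kk1.
move=> /(sc2 _ _ _ kk0 kk1) h1 /(sc1 _ _ _ k2a k2b) h2 /(sc1 _ _ _ k2a k2b) h3 h4.
move: h1 h2 h3 h4; rewrite !ler_norml => /andP[a1 a2] /andP[b1 b2] /andP[e1 e2] /andP[g1 g2].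
apply/andP; split; lra.
Qed.

Lemma f1_off i j : v1 R * gramv (tvec (@blk N') (cfun k 2 (2 + kap)) n) i j <=
  gramv (imgv f1 WX ++ (imgv f1 WA ++ [:: fun=> Num.sqrt c2])) i j.
Proof.
rewrite gram_noise; have := f1_close i j; rewrite ler_norml => /andP[h _].
have := tree_upper 2 (2 + kap) nN kN i j; rewrite -/V; lra.
Qed.

Lemma f1_diag i : v1 R * gramv (tvec (@blk N') (cfun k 2 (2 + kap)) n) i i <=
  gramv (imgv f1 WX ++ (imgv f1 WA ++ [:: fun=> Num.sqrt c2])) i i
   <= v1 R * gramv (tvec (@blk N') (cfun k 2 (2 + kap)) n) i i + 2 * c2.
Proof.
rewrite f1_off/= gram_noise tree_diag//; have := f1_close i i; rewrite ler_norml => /andP[_].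
have -> : rho R k i i = k%:R * ln 2.
  by rewrite /rho lnd_ii; apply/max_idPl; rewrite mulr_ge0 ?ln_ge0//; lra.
rewrite lnd_ii -/V; lra.
Qed.

Definition near_pair := {p : Pt * Pt | (2 ^ k <= 2 * dst p.1 p.2)%N && (dst p.1 p.2 <= 2 ^ k)%N}.

(** On the coarse levels the two points give weight 2, of which the segment mean removes [1 - kap];
    the remaining [1 + kap] is just above the critical 1. On the fine levels the two points are
    nearly independent: their variance [2 v1 k] is left out of the tree and handled by Jensen. *)
Definition f2 (p : near_pair) (v : Pt -> R) : R := v (val p).1 + v (val p).2 - (1 - kap) * sg k (val p).1 v.

Lemma lin_f2 p : lin (f2 p).
Proof.
apply: (@lin_ext _ _ (fun v => (v (val p).1 + v (val p).2) + (- (1 - kap)) * sg k (val p).1 v)).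
  by move=> v; rewrite /f2 mulNr.
by apply: lin_add; [apply: lin_add; exact: lin_ev|apply: lin_scale; exact: lin_sg].
Qed.

Lemma Gam_f2 p q : Gam W (f2 p) (f2 q) =
  (Gam W (ev (val p).1) (ev (val q).1) + Gam W (ev (val p).1) (ev (val q).2) +
   Gam W (ev (val p).2) (ev (val q).1) + Gam W (ev (val p).2) (ev (val q).2)) -
  (1 - kap) * (Gam W (sg k (val q).1) (ev (val p).1) + Gam W (sg k (val q).1) (ev (val p).2)) -
  (1 - kap) * (Gam W (sg k (val p).1) (ev (val q).1) + Gam W (sg k (val p).1) (ev (val q).2)) +
  (1 - kap) ^+ 2 * Gam W (sg k (val p).1) (sg k (val q).1).
Proof.
rewrite /Gam -!big_split/= !mulr_sumr -!sumrB -big_split/=; apply: eq_bigr => v _; rewrite /f2 /ev; ring.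
Qed.

Let bnd (x e : R) : `|x| <= e -> forall z, 0 <= z <= 1 -> - e <= z * x <= e.
Proof.
move=> xe z /andP[z0 z1]; have e0 := le_trans (normr_ge0 _) xe; move: xe; rewrite !ler_norml => /andP[h1 h2].
by apply/andP; split; nra.
Qed.

Lemma f2_off p q : v1 R * gramv (tvec (fun l (p : near_pair) => @blk N' l (val p).1) (cfun k 0 (1 + kap)) n) p q <=
  gramv (imgv f2 WX ++ (imgv f2 WA ++ [:: fun=> Num.sqrt c2])) p q.
Proof.
rewrite gram_noise Gam_f2; have /andP[k0 k1] := kap01; have cc := c10.
have -> : gramv (tvec (fun l (p : near_pair) => @blk N' l (val p).1) (cfun k 0 (1 + kap)) n) p q =
  gramv (tvec (@blk N') (cfun k 0 (1 + kap)) n) (val p).1 (val q).1 by rewrite !gramv_tvec.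
have := tree_upper 0 (1 + kap) nN kN (val p).1 (val q).1; rewrite expr0n /= mulr0 mul0r addr0 -/V.
case: p q => [[x y] /= /andP[_ pxy]] [[x' y'] /= /andP[_ qxy]].
have dxx (z : Pt) : (dst z z <= 2 ^ k)%N by rewrite dstE !subrr expn_gt0.
have p1 := cov_near_pp HC (dxx x) (dxx x'); have p2 := cov_near_pp HC (dxx x) qxy.
have p3 := cov_near_pp HC pxy (dxx x'); have p4 := cov_near_pp HC pxy qxy.
have z1 : 0 <= 1 - kap <= 1 by apply/andP; split; lra.
have z2 : 0 <= (1 - kap) ^+ 2 <= 1 by case/andP: z1 => ? ?; rewrite sqr_ge0 exprn_ile1.
have /andP[q1 _] := bnd (cov_ss kN HC x x') z2.
have /andP[_ q2] := bnd (cov_near kN HC x' (dxx x)) z1. have /andP[_ q3] := bnd (cov_near kN HC x' pxy) z1.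
have /andP[_ q4] := bnd (cov_near kN HC x (dxx x')) z1. have /andP[_ q5] := bnd (cov_near kN HC x qxy) z1.
rewrite (rhoC R k x' x) in q4; rewrite (rhoC R k x' x) in q5.
move: p1 p2 p3 p4 q1 q2 q3 q4 q5; rewrite -/V /c2.
move: (Gam _ _ _) => G1; move: (Gam _ _ _) => G2; move: (Gam _ _ _) => G3; move: (Gam _ _ _) => G4; move: (Gam _ _ _) => G5.
move: (Gam _ _ _) => G6; move: (Gam _ _ _) => G7; move: (Gam _ _ _) => G8; move: (Gam _ _ _) => G9.
move: (rho _ _ _ _) => r; move: c1 cc kap; clear => c cc z; move: V => V0 *; lra.
Qed.

Lemma f2_diag p : v1 R * gramv (tvec (fun l (p : near_pair) => @blk N' l (val p).1) (cfun k 0 (1 + kap)) n) p p <=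
  gramv (imgv f2 WX ++ (imgv f2 WA ++ [:: fun=> Num.sqrt c2])) p p
  <= v1 R * gramv (tvec (fun l (p : near_pair) => @blk N' l (val p).1) (cfun k 0 (1 + kap)) n) p p + (2 * c2 + 2 * v1 R * k%:R).
Proof.
rewrite f2_off/= gram_noise Gam_f2; have /andP[k0 k1] := kap01; have cc := c10.
have -> : gramv (tvec (fun l (p : near_pair) => @blk N' l (val p).1) (cfun k 0 (1 + kap)) n) p p =
  gramv (tvec (@blk N') (cfun k 0 (1 + kap)) n) (val p).1 (val p).1 by rewrite !gramv_tvec.
rewrite tree_diag// expr0n /= mulr0 mul0r addr0 -/V.
case: p => [[x y] /= /andP[pxy' pxy]].
have dxx (z : Pt) : (dst z z <= 2 ^ k)%N by rewrite dstE !subrr expn_gt0.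
have z1 : 0 <= 1 - kap <= 1 by apply/andP; split; lra.
have z2 : 0 <= (1 - kap) ^+ 2 <= 1 by case/andP: z1 => ? ?; rewrite sqr_ge0 exprn_ile1.
have /andP[_ q1] := bnd (cov_ss kN HC x x) z2.
have /andP[q2 _] := bnd (cov_near kN HC x (dxx x)) z1. have /andP[q3 _] := bnd (cov_near kN HC x pxy) z1.
have := HC x x; have := HC y y; have := HC x y; have := HC y x; rewrite !lnd_ii !ler_norml => /andP[_ p1] /andP[_ p2] /andP[_ p3] /andP[_ p4].
have rE : rho R k x x = k%:R * ln 2.
  by rewrite /rho lnd_ii; apply/max_idPl; rewrite mulr_ge0 ?ln_ge0//; lra.
have ld : k%:R * ln 2 <= lnd R x y + 1.
  rewrite -ln_pow2; apply: (@le_trans _ _ (ln (2 * (dst x y)%:R))).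
    by rewrite ler_ln ?posrE ?ltr0n ?expn_gt0 ?mulr_gt0 ?ltr0n ?dst_gt0// -natrM ler_nat.
  by rewrite lnM ?posrE ?ltr0n ?dst_gt0// addrC lerD2l; have := ln_le_sub1 (ltr0n _ 2 : 0 < 2 :> R); lra.
have ldC : lnd R y x = lnd R x y by rewrite /lnd dstC.
rewrite rE in q1 q2 q3; rewrite ldC in p1.
move: p1 p2 p3 p4 q1 q2 q3 ld; rewrite -/V /c2 /v1.
move: (Gam _ _ _) => G1; move: (Gam _ _ _) => G2; move: (Gam _ _ _) => G3; move: (Gam _ _ _) => G4; move: (Gam _ _ _) => G5.
move: (Gam _ _ _) => G6; move: (Gam _ _ _) => G7.
move: (lnd _ _ _) => r; move: (k%:R : R) (ln 2) c1 cc kap; clear => kk l2 c cc z; move: V => V0 *; lra.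
Qed.

End Comparisons.

Lemma kap_bounds (R : realType) (k : nat) (s : R) : (0 < k)%N -> 0 <= s -> 0 < (1 + s + 3 * ln k%:R)^-1 <= 1.
Proof.
move=> k0 s0; have D0 : 0 <= 3 * ln k%:R :> R by rewrite mulr_ge0// ln_ge0// ler1n.
have q : 0 < 1 + s + 3 * ln k%:R by lra.
by rewrite invr_gt0 q invf_le1//; lra.
Qed.

(** * Initial data for the coarse levels *)

Section EntryBounds.

Variables (R : realType) (m n : nat).

Hypothesis mok : micro_ok R n m.

Let es : meps R m <= 1 / 4. Proof. by case: mok. Qed.

Section Leaf.

Variables (I K : finType) (blk : nat -> I -> K) (c : nat -> R).

Hypothesis blk_step : forall l i j, blk l i = blk l j -> blk l.+1 i = blk l.+1 j.

Lemma one_sub_exp_le (x : R) : 1 - expR (- x) <= x.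
Proof. by have := expR_ge1Dx (- x); lra. Qed.

Lemma Ul0_le (v : R) b r : 0 <= v -> (forall i j, blk 0 i = blk 0 j -> i = j) ->
  Ul blk c m (fun=> v) 0 b r <= Num.min 1 (v * expR r).
Proof.
move=> v0 inj; rewrite le_min; have /andP[_ ->] := Ul_bounds blk c es 0 b r (fun=> v0).
rewrite /Ul /= /fb /lapl; apply: le_trans (one_sub_exp_le _) _; rewrite -mulr_suml /wb -mulr_sumr ler_wpM2r ?expR_ge0//.
rewrite -[leRHS]mulr1 ler_wpM2l//.
have [i /eqP ib|nb] := pickP (fun i => blk 0 i == b).
  by rewrite (bigD1 i)//= ib eqxx big1 ?addr0// => j ji; case: eqP => // jb; case/eqP: ji; apply: inj; rewrite jb.
by rewrite big1// => i _; rewrite nb.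
Qed.

(** Levels of weight 0 do not move the field, so the union bound over the points of a block loses
    nothing further. *)
Lemma Ul_linear (v : I -> R) k b r : (forall i, 0 <= v i) -> (forall l, (l < k)%N -> c l = 0) ->
  Ul blk c m v k b r <= expR r * \sum_i v i * (blk k i == b)%:R.
Proof.
move=> v0; elim: k b => [|k IH] b c0.
  by rewrite /Ul /= /fb /lapl; apply: le_trans (one_sub_exp_le _) _; rewrite -mulr_suml mulrC.
apply: (le_trans (Ul_step c blk_step es k b r v0)); rewrite c0//.
have P0 (g : R -> R) j x : iter j (Pc m 0) g x = g x.
  elim: j x => //= j IHj x; rewrite {1}/Pc !mul0r addr0 subr0 IHj; ring.
under eq_bigr do rewrite P0.
apply: (@le_trans _ _ (\sum_(g <- children blk k b) expR r * \sum_i v i * (blk k i == g)%:R)).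
  by apply: ler_sum => g _; apply: IH => l lk; apply: c0; exact: leqW.
rewrite -mulr_sumr ler_wpM2l ?expR_ge0// exchange_big/=; apply: ler_sum => i _.
rewrite -mulr_sumr ler_wpM2l// sum_indic ?undup_uniq//.
rewrite mem_undup; case: (boolP (_ \in _)) => // /mapP[j]; rewrite mem_filter => /andP[/eqP jb _] /blk_step ->.
by rewrite jb eqxx.
Qed.

End Leaf.

Section F1Entry.

Variables (I K : finType) (blk : nat -> I -> K).

Hypothesis blk_step : forall l i j, blk l i = blk l j -> blk l.+1 i = blk l.+1 j.

Hypothesis children4 : forall l b, (size (children blk l b) <= 4)%N.

Variables (k : nat) (s t C kap E : R).

Let D : R := 3 * ln k%:R.

Hypothesis k0 : (0 < k)%N.

Hypothesis s0 : 0 <= s.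

Hypothesis C1 : 1 <= C.

Hypothesis kapE : kap = (1 + s + D)^-1.

Hypothesis EE : E = v1 R * k%:R - 3 / 2 * ln k%:R + D.

Let D0 : 0 <= D. Proof. by rewrite mulr_ge0// ln_ge0// ler1n. Qed.

Let kp : 0 < kap <= 1. Proof. by rewrite kapE kap_bounds. Qed.

Definition g1 (y : R) : R := expR (- s) * Num.min 1 (C * expR (- (2 * y))).

(** The affine change of argument converts the distance [t - r / (2 + kap)], natural for the coarse
    weight, into the one natural for the fine weight 2. *)
Definition h1 (y : R) : R := iter k (Phi m) g1 (y + kap / 2 * (y - E)).

Lemma g1_bounds y : 0 <= g1 y <= 1.
Proof.
have C0 : 0 <= C by have := C1; lra.
rewrite /g1; apply/andP; split; first by rewrite mulr_ge0 ?expR_ge0// le_min ler01 mulr_ge0 ?expR_ge0.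
rewrite -[leRHS]mulr1 ler_pM ?expR_ge0//.
- by rewrite le_min ler01 mulr_ge0 ?expR_ge0.
- by rewrite -[leRHS]expR0 ler_expR oppr_le0.
- by rewrite ge_min lexx.
Qed.

Lemma h1_bounds y : 0 <= h1 y <= 1.
Proof.
rewrite /h1; move: (_ + _) => x; elim: k x => [|j IH] x /=; first exact: g1_bounds.
by apply: Phi_bounds => // z; case/andP: (IH z).
Qed.

Lemma h1_init : (k <= n)%N -> forall z, 0 <= z + (3 / 2 * ln k%:R + s) -> h1 (z + k%:R * mdrift R m) <=
  expR (- z) * (expR (- (3 / 2 * ln k%:R + s)) * (96 * (1 + pass_const R) * C * (1 + s) ^+ 3 * (1 + (z + (3 / 2 * ln k%:R + s))) * expR (- (kap / 2 * (z + (3 / 2 * ln k%:R + s)))))).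
Proof.
move=> kn z hz; have kk : (0 < k <= n)%N by rewrite k0.
apply: (@tilt_initial R m n mok g1 k s D kap C E kk s0 D0 C1 kapE EE g1_bounds) => // y.
- by rewrite /g1 ler_wpM2l ?expR_ge0// ge_min lexx orbT.
- by rewrite /g1 -[leRHS]mulr1 ler_wpM2l ?expR_ge0// ge_min lexx.
Qed.

Lemma F1_entry (A : finType) (q : A -> R) (v : A -> I -> R) :
  (forall a, 0 <= q a) -> \sum_a q a = 1 -> (forall a i, 0 <= v a i) ->
  (forall b r, UA blk (cfun k 2 (2 + kap)) m q v 0 b r <= expR (- s) * Num.min 1 (expR (- (2 * t + kap * (t - E))) * C * expR r)) ->
  forall b r, UA blk (cfun k 2 (2 + kap)) m q v k b r <= h1 (t - r / (2 + kap)).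
Proof.
move=> q0 q1 v0 entry b r; have /andP[kp0 _] := kp.
have kn0 : 2 + kap != 0 by rewrite gt_eqF//; lra.
have := @UA_pass_shift R I K blk (cfun k 2 (2 + kap)) m n (t + kap / 2 * (t - E)) blk_step children4 mok A q v 0 k 2 g1 q0 q1 v0 (ltr0n _ 2) _ _ _ b r.
rewrite add0n /h1.
have -> : t - r / (2 + kap) + kap / 2 * (t - r / (2 + kap) - E) = t + kap / 2 * (t - E) - r / 2 by field.
apply=> [l|y|b' r'].
- by rewrite /cfun => /andP[_ ->].
- by case/andP: (g1_bounds y).
apply: (le_trans (entry b' r')); rewrite /g1 ler_wpM2l ?expR_ge0//.
rewrite (_ : expR _ * C * expR r' = C * expR (- (2 * (t + kap / 2 * (t - E) - r' / 2))))//.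
by rewrite mulrAC -expRD mulrC; congr (_ * expR _); field.
Qed.

End F1Entry.

Section F2Entry.

Variables (N' k : nat) (s t C kap E : R).

Notation near := (near_pair N' k).

Definition blkp (l : nat) (p : near) : Pt N' := blk l (val p).1.

Let D : R := 3 * ln k%:R.

Hypothesis k0 : (0 < k)%N.

Hypothesis s0 : 0 <= s.

Hypothesis C1 : 1 <= C.

Hypothesis kapE : kap = (1 + s + D)^-1.

Hypothesis EE : E = v1 R * k%:R - 3 / 2 * ln k%:R + D.

Let D0 : 0 <= D. Proof. by rewrite mulr_ge0// ln_ge0// ler1n. Qed.

Lemma blkp_step l (p q : near) : blkp l p = blkp l q -> blkp l.+1 p = blkp l.+1 q.
Proof. exact: blk_step. Qed.

Lemma blkp_children l b : (size (children blkp l b) <= 4)%N.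
Proof.
apply: leq_trans (blk_children l b); apply: uniq_leq_size; first exact: undup_uniq.
move=> g; rewrite !mem_undup => /mapP[p]; rewrite mem_filter => /andP[pb _] ->.
by apply/mapP; exists (val p).1 => //; rewrite mem_filter mem_enum pb.
Qed.

(** A pair with its first point in a given block is determined by the residues of that point modulo
    [M = 2^k] and by its displacement: at most [M^2 (2M + 1)^2 <= 9 M^4] choices, and
    [M^4 = e^(v1 k)]. *)
Lemma count_near b : \sum_(p : near) (blkp k p == b)%:R <= 9 * expR (v1 R * k%:R) :> R.
Proof.
pose M := (2 ^ k)%N; have M0 : (0 < M)%N by rewrite expn_gt0.
pose T := ('I_M.-1.+1 * 'I_M.-1.+1 * ('I_M.*2.+1 * 'I_M.*2.+1))%type.
pose code (p : near) : T := ((inord ((val p).1.1 %% M), inord ((val p).1.2 %% M)),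
  (inord ((val p).2.1 + M - (val p).1.1), inord ((val p).2.2 + M - (val p).1.2))).
have cinj : {in [pred p | blkp k p == b] &, injective code}.
  move=> p q; rewrite !inE => /eqP pb /eqP qb [].
  have := blkP k (val p).1 (val q).1; rewrite -/(blkp k p) -/(blkp k q) pb qb => -[/(_ erefl)[e1 e2] _].
  have hp := valP p; have hq := valP q; move: hp hq; rewrite !dstE !geq_max => /and3P[_ _ /andP[p1 p2]] /and3P[_ _ /andP[q1 q2]].
  have mm a : (a %% M < M.-1.+1)%N by rewrite prednK// ltn_pmod.
  move=> /(congr1 val)/= + /(congr1 val)/= + /(congr1 val)/= + /(congr1 val)/=.
  have Q (a b' : nat) : (`|a%:Z - b'%:Z| <= M)%N -> (b' + M - a < M.*2.+1)%N by clear; lia.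
  rewrite !inordK ?mm ?Q//.
  have d1 := divn_eq (val p).1.1 M; have d2 := divn_eq (val q).1.1 M; have d3 := divn_eq (val p).1.2 M; have d4 := divn_eq (val q).1.2 M.
  rewrite e1 in d1; rewrite e2 in d3.
  move=> f1 f2 f3 f4; rewrite f1 -d2 in d1; rewrite f2 -d4 in d3.
  have Q2 (a b' a' b2 : nat) : a = a' -> (`|a%:Z - b'%:Z| <= M)%N -> (`|a'%:Z - b2%:Z| <= M)%N -> (b' + M - a = b2 + M - a')%N -> b' = b2 by clear; lia.
  have g1 := Q2 _ _ _ _ d1 p1 q1 f3; have g2 := Q2 _ _ _ _ d3 p2 q2 f4.
  apply/val_inj; case: (p) (q) d1 d3 g1 g2 => [[[a1 a2] [a3 a4]] ?] [[[b1 b2] [b3 b4]] ?] /= d1 d3 g1 g2.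
  by congr ((_, _), (_, _)); apply/val_inj.
have -> : \sum_(p : near) (blkp k p == b)%:R = #|[pred p | blkp k p == b]|%:R :> R.
  by rewrite -sum1_card natr_sum [RHS]big_mkcond/=; apply: eq_bigr => p _; rewrite inE; case: eqP.
rewrite -(card_in_image cinj); apply: (@le_trans _ _ #|{: T}|%:R); first by rewrite ler_nat max_card.
rewrite !card_prod !card_ord prednK//.
have -> : expR (v1 R * k%:R) = (M ^ 4)%:R.
  by rewrite natrX -{1}[M%:R]lnK ?posrE ?ltr0n// -expRM_natr /M ln_pow2 /v1; congr expR; ring.
by rewrite -natrM ler_nat; nia.
Qed.

Definition h2 (y : R) : R := Num.min 1 (9 * C * expR (- s) * expR (- ((1 - kap) * E) - (1 + kap) * y + 2 * (v1 R * k%:R))).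

Let kp : 0 < kap <= 1. Proof. by rewrite kapE kap_bounds. Qed.

Lemma h2_bounds y : 0 <= h2 y <= 1.
Proof. by have c := C1; rewrite /h2 le_min ler01 ge_min lexx /= andbT !mulr_ge0 ?expR_ge0//; lra. Qed.

(** All multiples of [v1 k] cancel: one comes from counting pairs, one from Jensen, against
    [1 - kap] from [E] and [1 + kap] from the drift. What is left of [E] is [3/2 ln k], which
    becomes the gain [k^(-3/2)], and [kap (s + D) <= 1] bounds the cost of the tilt. *)
Lemma h2_init : (k <= n)%N -> forall z, 0 <= z + (3 / 2 * ln k%:R + s) -> h2 (z + k%:R * mdrift R m) <=
  expR (- z) * (expR (- (3 / 2 * ln k%:R + s)) * (9 * C * expR 3 * (1 + (z + (3 / 2 * ln k%:R + s))) * expR (- (kap * (z + (3 / 2 * ln k%:R + s)))))).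
Proof.
move=> kn z hz; have /andP[kp0 kp1] := kp; have c := C1; have d0 := D0; have ss := s0.
set s2 := 3 / 2 * ln k%:R + s in hz *.
apply: (@le_trans _ _ (9 * C * expR 3 * expR (- z - s2 - kap * (z + s2)))); last first.
  have -> : - z - s2 - kap * (z + s2) = - z + (- s2 + - (kap * (z + s2))) by ring.
  rewrite (expRD (- z)) (expRD (- s2)); set a := expR (- z); set b' := expR (- s2); set e := expR (- (kap * _)).
  have -> : a * (b' * (9 * C * expR 3 * (1 + (z + s2)) * e)) = 9 * C * expR 3 * (a * (b' * e)) * (1 + (z + s2)) by ring.
  rewrite -[leLHS]mulr1 ler_wpM2l//; last by lra.
  by rewrite !mulr_ge0 ?expR_ge0//; lra.
rewrite /h2; apply: (@le_trans _ _ (9 * C * expR (- s) * expR (- ((1 - kap) * E) - (1 + kap) * (z + k%:R * mdrift R m) + 2 * (v1 R * k%:R)))).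
  by rewrite ge_min lexx orbT.
rewrite -(mulrA (9 * C)) -[leRHS](mulrA (9 * C)) ler_wpM2l//; first by lra.
rewrite -!expRD ler_expR EE /s2.
have kd : k%:R * mdrift R m >= v1 R * k%:R - 1.
  have [_ _ _ _] := mok; rewrite ler_norml => /andP[h _].
  have [hm|hm] := leP (v1 R) (mdrift R m).
    by have := ler_wpM2l (ler0n R k) hm; lra.
  have : (n%:R - k%:R) * (v1 R - mdrift R m) >= 0 by rewrite mulr_ge0 ?subr_ge0 ?ler_nat// ltW.
  by move: h; lra.
have kD : kap * (s + D) <= 1.
  by rewrite kapE mulrC ler_pdivrMr; lra.
have kd' : - ((1 + kap) * (k%:R * mdrift R m)) <= - ((1 + kap) * (v1 R * k%:R - 1)).
  by rewrite lerN2 ler_wpM2l//; lra.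
move: kd' kD d0; rewrite /D; move: (mdrift R m) (v1 R) (ln k%:R) => md vv l; move: (k%:R : R) => kk kd' kD d0; lra.
Qed.

Lemma F2_entry (A : finType) (q : A -> R) (v : A -> near -> R) :
  (forall a, 0 <= q a) -> \sum_a q a = 1 -> (forall a i, 0 <= v a i) ->
  (forall i, \sum_a q a * v a i <= expR (- s) * (expR (- (2 * t) + (1 - kap) * (t - E)) * (C * expR (v1 R * k%:R)))) ->
  forall b r, UA blkp (cfun k 0 (1 + kap)) m q v k b r <= h2 (t - r / (1 + kap)).
Proof.
have [w2 w2E] : exists w2, w2 = expR (- (2 * t) + (1 - kap) * (t - E)) * (C * expR (v1 R * k%:R)) by eexists.
rewrite -w2E => q0 q1 v0 hv b r; have /andP[kp0 kp1] := kp; have c := C1.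
have kp' : 1 + kap != 0 by rewrite gt_eqF//; lra.
rewrite /h2 le_min; have /andP[_ ->] := UA_bounds blkp (cfun k 0 (1 + kap)) es q0 q1 v0 k b r.
rewrite /UA; apply: (@le_trans _ _ (\sum_a q a * (expR r * \sum_i v a i * (blkp k i == b)%:R))).
  apply: ler_sum => a _; rewrite ler_wpM2l//; apply: Ul_linear => //; first exact: blkp_step.
  by move=> l lk; rewrite /cfun lk.
have -> : \sum_a q a * (expR r * \sum_i v a i * (blkp k i == b)%:R) =
   expR r * \sum_i (\sum_a q a * v a i) * (blkp k i == b)%:R.
  rewrite mulr_sumr (eq_bigr (fun a => \sum_i expR r * (q a * v a i * (blkp k i == b)%:R))); last first.
    by move=> a _; rewrite mulrCA !mulr_sumr; apply: eq_bigr => i _; ring.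
  by rewrite exchange_big/=; apply: eq_bigr => i _; rewrite mulr_suml mulr_sumr.
apply: (@le_trans _ _ (expR r * (expR (- s) * w2 * (9 * expR (v1 R * k%:R))))).
  rewrite ler_wpM2l ?expR_ge0//.
  apply: (@le_trans _ _ (expR (- s) * w2 * \sum_(i : near) (blkp k i == b)%:R)).
    by rewrite mulr_sumr; apply: ler_sum => i _; rewrite ler_wpM2r.
  rewrite ler_wpM2l ?count_near// w2E !mulr_ge0 ?expR_ge0//; lra.
rewrite w2E le_eqVlt; apply/orP; left; apply/eqP.
have -> : - ((1 - kap) * E) - (1 + kap) * (t - r / (1 + kap)) + 2 * (v1 R * k%:R) =
  r + (- (2 * t) + (1 - kap) * (t - E)) + v1 R * k%:R + v1 R * k%:R by field.
by rewrite !expRD; ring.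
Qed.

End F2Entry.

End EntryBounds.

(** * Expectations of the two functionals *)

Section FunctionalBounds.

Variables (R : realType) (N' n k : nat).

Context (d : measure_display) (Omega : measurableType d) (P : probability Omega R).

Variables (eta : Pt N' -> Omega -> R) (WX WA : seq (Pt N' -> R)) (c1 : R).

Hypothesis meta : forall i, measurable_fun setT (eta i).

Hypothesis chareta : forall a q, \int[P]_t cos (dotp a (fun i => eta i t) + q) = expR (- (qform WX a / 2)) * cos q.

Hypothesis lineta : forall a, P.-integrable setT (EFin \o (fun t => dotp a (fun i => eta i t) ^+ 2)) /\
  \int[P]_t (dotp a (fun i => eta i t) ^+ 2) = qform WX a.

Hypothesis nN : (N'.*2 < 2 ^ n)%N.

Hypothesis kN : (2 ^ k <= N'.+1)%N.

Hypothesis c10 : 0 <= c1.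

Hypothesis HC : forall i j, `|Gam (WX ++ WA) (ev i) (ev j) - (v1 R * n%:R - 4 * lnd R i j)| <= c1.

Variables (t : R).

Definition noise_factor : R := expR ((2 * c2 c1 + 1) / 2).

Lemma noise_factor_ge1 : 1 <= noise_factor.
Proof. by have h := c2_ge0 c10; rewrite /noise_factor -[leLHS]expR0 ler_expR; lra. Qed.

Definition kapk (s : R) : R := (1 + s + 3 * ln k%:R)^-1.

(** Typical maximum [v1 k - 3/2 ln k] of the field inside a block of size [2^k], plus an excess
    [3 ln k]. *)
Definition Ek : R := v1 R * k%:R - 3 / 2 * ln k%:R + 3 * ln k%:R.

(** [w1] and [w2] are normalised so that a pair above [t] has [w e^f >= 1] in the first functional
    if its segment mean is at least [t - Ek], and in the second otherwise. *)
Definition w1 (kap : R) : R := expR (- (2 * t + kap * (t - Ek))).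

Definition w2 (kap : R) : R := expR (- (2 * t) + (1 - kap) * (t - Ek)).

Definition tree_const : R := 96 * (1 + pass_const R) * noise_factor + 9 * noise_factor * expR 3.

Definition phi1 kap p kb := phi (@blk N') p kb (fun=> w1 kap) (img eta (f1 k kap)).

Definition phi2 kap p kb := phi (@blkp N' k) p kb (fun=> w2 kap) (img eta (f2 (k := k) kap)).

Let pass0 : 0 <= pass_const R.
Proof. by rewrite /pass_const mulr_ge0// ltW// lattice_const_gt0. Qed.

Lemma tree_const_ge0 : 0 <= tree_const.
Proof.
have h := noise_factor_ge1; have pp := pass0; have e3 := expR_ge0 (3 : R).
by rewrite /tree_const addr_ge0// !mulr_ge0//; lra.
Qed.

Lemma int_phi1_le kap p kb B : 0 <= kap <= 1 -> 0 <= p <= 1 ->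
  (forall m, micro_ok R n m -> forall b, UA (@blk N') (cfun k 2 (2 + kap)) m (thin p) (wJ (@blk N') kb (fun=> w1 kap * noise_factor)) n b 0 <= B) ->
  \int[P]_w phi1 kap p kb w <= 2 * B.
Proof.
move=> kap01 p01 hB.
have lf i : lin (f1 k kap i) by exact: lin_f1.
apply: (@int_phi R _ _ (@blk N') (cfun k 2 (2 + kap)) _ _ P p kb n (fun=> w1 kap) p01 (fun=> expR_ge0 _) (img eta (f1 k kap)) (imgv (f1 k kap) WX) (imgv (f1 k kap) WA ++ [:: fun=> Num.sqrt (c2 c1)]) (fun=> 2 * c2 c1) _ _ _ _ _ _ _ (ord0, ord0)).
- by move=> i; exact: img_meas.
- by move=> a q; exact: img_char.
- by move=> i; exact: img_sq.
- by move=> i; exact: img_var.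
- by move=> i j _; apply: f1_off.
- by move=> i; apply: f1_diag.
- by move=> i j; exact: blk_root.
- by move=> m mok; exact: hB.
Qed.

Lemma int_phi2_le kap p kb B : 0 <= kap <= 1 -> 0 <= p <= 1 -> 0 <= B ->
  (forall m, micro_ok R n m -> forall b, UA (@blkp N' k) (cfun k 0 (1 + kap)) m (thin p) (wJ (@blkp N' k) kb (fun=> w2 kap * expR (v1 R * k%:R) * noise_factor)) n b 0 <= B) ->
  \int[P]_w phi2 kap p kb w <= 2 * B.
Proof.
move=> kap01 p01 B0 hB.
have lf i : lin (f2 (k := k) kap i) by exact: lin_f2.
have [i0 _|no] := pickP (fun _ : near_pair N' k => true); last first.
  rewrite (_ : phi2 _ _ _ = fun=> 0); last first.
    apply/funext => w; rewrite /phi2 /phi big1// => J _; rewrite /lapl big1 ?oppr0 ?expR0 ?subrr ?mulr0// => i _.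
    by have := no i.
  by rewrite Rintegral_cst//= mul0r mulr_ge0.
apply: (@int_phi R _ _ (@blkp N' k) (cfun k 0 (1 + kap)) _ _ P p kb n (fun=> w2 kap) p01 (fun=> expR_ge0 _) (img eta (f2 (k := k) kap)) (imgv (f2 (k := k) kap) WX) (imgv (f2 (k := k) kap) WA ++ [:: fun=> Num.sqrt (c2 c1)]) (fun=> 2 * c2 c1 + 2 * v1 R * k%:R) _ _ _ _ _ _ _ i0).
- by move=> i; exact: img_meas.
- by move=> a q; exact: img_char.
- by move=> i; exact: img_sq.
- by move=> i; exact: img_var.
- by move=> i j _; apply: f2_off.
- by move=> i; apply: f2_diag.
- by move=> i j; exact: blk_root.
move=> m mok; have E : wn (fun=> w2 kap) (fun=> 2 * c2 c1 + 2 * v1 R * k%:R) = (fun=> w2 kap * expR (v1 R * k%:R) * noise_factor) :> (near_pair N' k -> R).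
  by apply/funext => i; rewrite /wn /noise_factor -[RHS]mulrA -expRD; congr (_ * expR _); field.
by rewrite E; exact: (hB m mok (blkp n i0)).
Qed.

Let T0 : R := t - n%:R * v1 R.

Let drift m : micro_ok R n m -> T0 - 1 <= t - n%:R * mdrift R m <= T0 + 1.
Proof.
by move=> [_ _ _ _]; rewrite ler_norml /T0 mulrBr => /andP[h1 h2]; apply/andP; split; lra.
Qed.

(** Thinning of single points enters through [s]. The sixth power collects [(1 + s)^3] and [kap^-3],
    and the two ballot factors [k^(-3/2)] and [(n - k)^(-3/2)] come from below and above level
    [k]. *)
Definition full_bound (s Y : R) : R := expR (1 - T0) * (pass_const R * (8 * tree_const * (1 + s + 3 * ln k%:R) ^+ 6) *
  expR (- (3 / 2 * ln k%:R + s)) * (1 + Y) / ((n - k)%:R * Num.sqrt (n - k)%:R)).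

(** Thinning of blocks of level [kb]: the second ballot factor ends at [kb], and [a] is the depth of
    the barrier between [kb] and the root. *)
Definition block_bound (p : R) kb (a B : R) : R := 4 * expR (- a) + expR (1 - T0) * (p * (pass_const R * (8 * tree_const * (1 + 0 + 3 * ln k%:R) ^+ 6) *
  expR (- (3 / 2 * ln k%:R + 0)) / ((kb - k)%:R * Num.sqrt (kb - k)%:R)) * (1 + B) * (1 + a)).

Lemma full_bound_ge0 s Y : (0 < k)%N -> 0 <= s -> 0 <= Y -> 0 <= full_bound s Y.
Proof.
move=> k0 s0 Y0; have tc := tree_const_ge0; have pp := pass0.
have i0 : 0 <= ((n - k)%:R * Num.sqrt (n - k)%:R)^-1 :> R by rewrite invr_ge0 mulr_ge0 ?sqrtr_ge0.
have l0 : 0 <= ln k%:R :> R by rewrite ln_ge0// ler1n.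
rewrite /full_bound; apply: mulr_ge0; first exact: expR_ge0.
apply: mulr_ge0 => //; apply: mulr_ge0; last by lra.
apply: mulr_ge0; last exact: expR_ge0.
apply: mulr_ge0 => //; apply: mulr_ge0; first exact: mulr_ge0.
by apply: exprn_ge0; lra.
Qed.

Lemma block_bound_ge0 p kb a B : (0 < k)%N -> 0 <= p -> 0 <= a -> 0 <= B -> 0 <= block_bound p kb a B.
Proof.
move=> k0 p0 a0 B0; have tc := tree_const_ge0; have pp := pass0.
have i0 : 0 <= ((kb - k)%:R * Num.sqrt (kb - k)%:R)^-1 :> R by rewrite invr_ge0 mulr_ge0 ?sqrtr_ge0.
have l0 : 0 <= ln k%:R :> R by rewrite ln_ge0// ler1n.
rewrite /block_bound; apply: addr_ge0; first by apply: mulr_ge0 => //; exact: expR_ge0.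
apply: mulr_ge0; first exact: expR_ge0.
apply: mulr_ge0; last by lra.
apply: mulr_ge0; last by lra.
apply: mulr_ge0 => //; apply: mulr_ge0 => //; apply: mulr_ge0; last exact: expR_ge0.
apply: mulr_ge0 => //; apply: mulr_ge0; first exact: mulr_ge0.
by apply: exprn_ge0; lra.
Qed.

Section Mu.

Variable s : R.

Hypothesis k0 : (0 < k)%N.

Hypothesis s0 : 0 <= s.

Let q : R := 1 + s + 3 * ln k%:R.

Let D0 : 0 <= 3 * ln k%:R :> R. Proof. by rewrite mulr_ge0// ln_ge0// ler1n. Qed.

Let q1 : 1 <= q. Proof. by have h := s0; have h' := D0; rewrite /q; lra. Qed.

Lemma mu1_le : 96 * (1 + pass_const R) * noise_factor * (1 + s) ^+ 3 * (kapk s / 2) ^- 3 <= 8 * tree_const * q ^+ 6.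
Proof.
have h := noise_factor_ge1; have pp := pass0; have e3 := expR_ge0 (3 : R); have hs := s0; have hq := q1.
rewrite /kapk -/q -exprVn invfM !invrK exprMn.
have -> : 96 * (1 + pass_const R) * noise_factor * (1 + s) ^+ 3 * (q ^+ 3 * 2 ^+ 3) = 8 * (96 * (1 + pass_const R) * noise_factor) * ((1 + s) ^+ 3 * q ^+ 3) by ring.
apply: ler_pM.
- by rewrite !mulr_ge0//; lra.
- by rewrite mulr_ge0// exprn_ge0//; lra.
- by rewrite ler_pM2l// /tree_const lerDl !mulr_ge0//; lra.
- rewrite (_ : 6%N = (3 + 3)%N)// exprD ler_wpM2r ?exprn_ge0//; first by lra.
  by rewrite lerXn2r ?nnegrE//; have h' := D0; rewrite /q; lra.
Qed.

Lemma mu2_le : 9 * noise_factor * expR 3 * (kapk s) ^- 3 <= 8 * tree_const * q ^+ 6.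
Proof.
have h := noise_factor_ge1; have pp := pass0; have e3 := expR_ge0 (3 : R); have hq := q1.
rewrite /kapk -/q -exprVn invrK.
apply: ler_pM.
- by rewrite !mulr_ge0//; lra.
- by rewrite exprn_ge0//; lra.
- have : 0 <= 96 * (1 + pass_const R) * noise_factor by rewrite !mulr_ge0//; lra.
  have : 0 <= 9 * noise_factor * expR 3 by rewrite !mulr_ge0//; lra.
  by rewrite /tree_const; lra.
- by apply: ler_weXn2l.
Qed.

Lemma A1_ge1 : 1 <= 96 * (1 + pass_const R) * noise_factor * (1 + s) ^+ 3.
Proof.
have h := noise_factor_ge1; have pp := pass0; have hs := s0.
have e : 1 <= (1 + s) ^+ 3 by rewrite exprn_ege1//; lra.
have f : 1 <= 96 * (1 + pass_const R) by lra.
by rewrite mulr_ege1// mulr_ege1.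
Qed.

Lemma A2_ge1 : 1 <= 9 * noise_factor * expR 3.
Proof.
have h := noise_factor_ge1; rewrite mulr_ege1//; first by lra.
by rewrite -[leLHS]expR0 ler_expR.
Qed.

Lemma full_mono m (A mu Y : R) : micro_ok R n m -> 0 <= A -> 0 < mu -> A * mu ^- 3 <= 8 * tree_const * q ^+ 6 -> 0 <= Y ->
  expR (- (t - n%:R * mdrift R m)) * (pass_const R * A * mu ^- 3 * expR (- (3 / 2 * ln k%:R + s)) * (1 + Y) / ((n - k)%:R * Num.sqrt (n - k)%:R))
   <= full_bound s Y.
Proof.
move=> mok A0 mu0 hA Y0; have pp := pass0; have /andP[d1 d2] := drift mok.
have i0 : 0 <= ((n - k)%:R * Num.sqrt (n - k)%:R)^-1 :> R by rewrite invr_ge0 mulr_ge0 ?sqrtr_ge0.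
have am : 0 <= A * mu ^- 3 by rewrite mulr_ge0// invr_ge0 exprn_ge0// ltW.
have y1 : 0 <= 1 + Y by lra.
have e0 := expR_ge0 (- (3 / 2 * ln k%:R + s)).
rewrite /full_bound -/q; apply: ler_pM; first exact: expR_ge0.
- by rewrite -(mulrA (pass_const R)); apply: mulr_ge0 => //; apply: mulr_ge0 => //; apply: mulr_ge0 => //; exact: mulr_ge0.
- by rewrite ler_expR; lra.
apply: ler_wpM2r => //; apply: ler_wpM2r => //; apply: ler_wpM2r => //.
by rewrite -mulrA; apply: ler_wpM2l.
Qed.

End Mu.

Lemma block_mono m (A mu p a B : R) kb : micro_ok R n m -> (0 < k)%N -> 0 <= A -> 0 < mu -> A * mu ^- 3 <= 8 * tree_const * (1 + 0 + 3 * ln k%:R) ^+ 6 -> 0 <= B ->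
  0 <= p -> 0 <= a ->
  4 * expR (- a) + expR (- (t - n%:R * mdrift R m)) * (p * (pass_const R * A * mu ^- 3 * expR (- (3 / 2 * ln k%:R + 0)) / ((kb - k)%:R * Num.sqrt (kb - k)%:R)) * (1 + B) * (1 + a))
   <= block_bound p kb a B.
Proof.
move=> mok k0 A0 mu0 hA B0 p0 a0; have pp := pass0; have /andP[d1 d2] := drift mok.
have i0 : 0 <= ((kb - k)%:R * Num.sqrt (kb - k)%:R)^-1 :> R by rewrite invr_ge0 mulr_ge0 ?sqrtr_ge0.
have am : 0 <= A * mu ^- 3 by rewrite mulr_ge0// invr_ge0 exprn_ge0// ltW.
have [y1 y2] : 0 <= 1 + B /\ 0 <= 1 + a by lra.
have e0 := expR_ge0 (- (3 / 2 * ln k%:R + 0 : R)).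
have Q0 : 0 <= pass_const R * A * mu ^- 3 * expR (- (3 / 2 * ln k%:R + 0)) / ((kb - k)%:R * Num.sqrt (kb - k)%:R).
  by rewrite -(mulrA (pass_const R)); apply: mulr_ge0 => //; apply: mulr_ge0 => //; exact: mulr_ge0.
rewrite /block_bound lerD2l; apply: ler_pM; first exact: expR_ge0.
- by apply: mulr_ge0 => //; apply: mulr_ge0 => //; exact: mulr_ge0.
- by rewrite ler_expR; lra.
apply: ler_wpM2r => //; apply: ler_wpM2r => //; apply: ler_wpM2l => //; apply: ler_wpM2r => //; apply: ler_wpM2r => //.
by rewrite -mulrA; apply: ler_wpM2l.
Qed.

Let kle : (k <= n)%N. Proof. exact: (leq_kn nN kN). Qed.

Let thin0 (J : finType) (K : finType) (bl : nat -> J -> K) (v : R) kb (S : {set K}) i : 0 <= v -> 0 <= wJ bl kb (fun=> v) S i.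
Proof. by move=> v0; exact: wJ_ge0. Qed.

Let nf0 : 0 <= noise_factor. Proof. by have h := noise_factor_ge1; lra. Qed.

Let W1 kap : 0 <= w1 kap * noise_factor. Proof. by rewrite mulr_ge0 ?expR_ge0. Qed.

Let W2 kap : 0 <= w2 kap * expR (v1 R * k%:R) * noise_factor. Proof. by rewrite !mulr_ge0 ?expR_ge0. Qed.

Let blkinj i j : @blk N' 0 i = blk 0 j -> i = j. Proof. exact: blk0_inj. Qed.

Lemma phi1_full s Y : (0 < k < n)%N -> 0 <= s -> 0 <= Y -> T0 + 1 + (3 / 2 * ln k%:R + s) + 3 / 2 * ln (n - k)%:R + 6 <= Y ->
  \int[P]_w phi1 (kapk s) (expR (- s)) 0 w <= 2 * full_bound s Y.
Proof.
case/andP=> k0 kn s0 Y0 hY; have /andP[kp0 kp1] := kap_bounds k0 s0.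
have p01 : 0 <= expR (- s) <= 1 by rewrite expR_ge0 -[leRHS]expR0 ler_expR oppr_le0.
apply: int_phi1_le => //; first by rewrite ltW.
move=> m mok b; have es : meps R m <= 1 / 4 by case: mok.
have /andP[d1 d2] := drift mok; have C1 := noise_factor_ge1.
have A1 := A1_ge1 s0.
apply: le_trans (full_mono mok (le_trans ler01 A1) (_ : 0 < kapk s / 2) (mu1_le k0 s0) Y0); last by rewrite divr_gt0.
apply: (@UA_root_full R _ _ (@blk N') (cfun k 2 (2 + kapk s)) m n 0 (expR (- s)) t (fun=> w1 (kapk s) * noise_factor) (@blk_step N') (@blk_children N') mok p01 (fun=> W1 _)
   (h1 m k s noise_factor (kapk s) Ek) k (2 + kapk s)) => //.
- by rewrite /kapk; lra.
- by move=> l /andP[kl _]; rewrite /cfun ltnNge kl.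
- by move=> y; exact: (h1_bounds mok).
- by apply/andP; split; rewrite /kapk; lra.
- by move=> z hz; apply: (h1_init mok).
- apply: (F1_entry mok (@blk_step N') (@blk_children N') k0 s0 C1) => //.
  + by move=> J; exact: thin_ge0.
  + exact: thin_sum.
  + by move=> J i; exact: thin0.
  + move=> b' r; rewrite UA_thin ler_wpM2l ?expR_ge0//; exact: (@Ul0_le R m n mok _ _ _ _ _ b' r (W1 _) blkinj).
- lra.
Qed.

Lemma phi2_full s Y : (0 < k < n)%N -> 0 <= s -> 0 <= Y -> T0 + 1 + (3 / 2 * ln k%:R + s) + 3 / 2 * ln (n - k)%:R + 6 <= Y ->
  \int[P]_w phi2 (kapk s) (expR (- s)) 0 w <= 2 * full_bound s Y.
Proof.
case/andP=> k0 kn s0 Y0 hY; have /andP[kp0 kp1] := kap_bounds k0 s0.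
have p01 : 0 <= expR (- s) <= 1 by rewrite expR_ge0 -[leRHS]expR0 ler_expR oppr_le0.
have FB := full_bound_ge0 k0 s0 Y0.
apply: int_phi2_le => //; first by rewrite ltW.
move=> m mok b; have es : meps R m <= 1 / 4 by case: mok.
have /andP[d1 d2] := drift mok; have C1 := noise_factor_ge1.
have A1 := A2_ge1.
apply: le_trans (full_mono mok (le_trans ler01 A1) (_ : 0 < kapk s) (mu2_le k0 s0) Y0) => //.
apply: (@UA_root_full R _ _ (@blkp N' k) (cfun k 0 (1 + kapk s)) m n 0 (expR (- s)) t (fun=> w2 (kapk s) * expR (v1 R * k%:R) * noise_factor) (@blkp_step N' k) (@blkp_children N' k) mok p01 (fun=> W2 _)
   (h2 k s noise_factor (kapk s) Ek) k (1 + kapk s)) => //.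
- by rewrite /kapk; lra.
- by move=> l /andP[kl _]; rewrite /cfun ltnNge kl.
- by move=> y; apply: h2_bounds.
- by rewrite kp0.
- by move=> z hz; apply: (h2_init mok).
- apply: (F2_entry mok k0 s0 C1) => //.
  + by move=> J; exact: thin_ge0.
  + exact: thin_sum.
  + by move=> J i; exact: thin0.
  + move=> i; rewrite /wJ (eq_bigr (fun J => w2 (kapk s) * expR (v1 R * k%:R) * noise_factor * (thin (expR (- s)) J * (blkp 0 i \in J)%:R))); last by move=> J _; ring.
    by rewrite -mulr_sumr thin_mem mulrC -/(w2 (kapk s)) le_eqVlt; apply/orP; left; apply/eqP; ring.
- lra.
Qed.

Lemma phi1_block p kb a B : (0 < k < kb)%N -> (kb <= n)%N -> 0 <= p <= 1 -> 0 <= a -> 0 <= B ->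
  T0 + 1 - a + 3 / 2 * ln k%:R + 3 / 2 * ln (kb - k)%:R + 6 <= B ->
  \int[P]_w phi1 (kapk 0) p kb w <= 2 * block_bound p kb a B.
Proof.
case/andP=> k0 kkb kbn p01 a0 B0 hB; have /andP[kp0 kp1] := kap_bounds k0 (lexx (0 : R)).
apply: int_phi1_le => //; first by rewrite ltW.
move=> m mok b; have es : meps R m <= 1 / 4 by case: mok.
have /andP[d1 d2] := drift mok; have C1 := noise_factor_ge1.
have A1 := A1_ge1 (lexx 0).
apply: le_trans (block_mono kb mok k0 (le_trans ler01 A1) (_ : 0 < kapk 0 / 2) (mu1_le k0 (lexx 0)) B0 (proj1 (andP p01)) a0); last by rewrite divr_gt0.
apply: (@UA_root_block R _ _ (@blk N') (cfun k 2 (2 + kapk 0)) m n kb p t (fun=> w1 (kapk 0) * noise_factor) (@blk_step N') (@blk_children N') mok p01 (fun=> W1 _)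
   (h1 m k 0 noise_factor (kapk 0) Ek) k (2 + kapk 0)) => //.
- by rewrite /kapk; lra.
- by move=> l /andP[kl _]; rewrite /cfun ltnNge kl.
- by move=> y; exact: (h1_bounds mok).
- by apply/andP; split; rewrite /kapk; lra.
- by move=> z hz; apply: (h1_init mok).
- by rewrite kkb.
- move=> b' r; rewrite Ul_UA; apply: (F1_entry mok (@blk_step N') (@blk_children N') k0 (lexx 0) C1) => //.
  + by rewrite big_const card_unit /= addr0.
  + by move=> b2 r2; rewrite -Ul_UA oppr0 expR0 mul1r; exact: (@Ul0_le R m n mok _ _ _ _ _ b2 r2 (W1 _) blkinj).
- lra.
Qed.

Lemma phi2_block p kb a B : (0 < k < kb)%N -> (kb <= n)%N -> 0 <= p <= 1 -> 0 <= a -> 0 <= B ->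
  T0 + 1 - a + 3 / 2 * ln k%:R + 3 / 2 * ln (kb - k)%:R + 6 <= B ->
  \int[P]_w phi2 (kapk 0) p kb w <= 2 * block_bound p kb a B.
Proof.
case/andP=> k0 kkb kbn p01 a0 B0 hB; have /andP[kp0 kp1] := kap_bounds k0 (lexx (0 : R)).
have FB := block_bound_ge0 kb k0 (proj1 (andP p01)) a0 B0.
apply: int_phi2_le => //; first by rewrite ltW.
move=> m mok b; have es : meps R m <= 1 / 4 by case: mok.
have /andP[d1 d2] := drift mok; have C1 := noise_factor_ge1.
have A1 := A2_ge1.
apply: le_trans (block_mono kb mok k0 (le_trans ler01 A1) (_ : 0 < kapk 0) (mu2_le k0 (lexx 0)) B0 (proj1 (andP p01)) a0) => //.
apply: (@UA_root_block R _ _ (@blkp N' k) (cfun k 0 (1 + kapk 0)) m n kb p t (fun=> w2 (kapk 0) * expR (v1 R * k%:R) * noise_factor) (@blkp_step N' k) (@blkp_children N' k) mok p01 (fun=> W2 _)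
   (h2 k 0 noise_factor (kapk 0) Ek) k (1 + kapk 0)) => //.
- by rewrite /kapk; lra.
- by move=> l /andP[kl _]; rewrite /cfun ltnNge kl.
- by move=> y; apply: h2_bounds.
- by rewrite kp0.
- by move=> z hz; apply: (h2_init mok).
- by rewrite kkb.
- move=> b' r; rewrite Ul_UA; apply: (F2_entry mok k0 (lexx 0) C1) => //.
  + by rewrite big_const card_unit /= addr0.
  + by move=> i; rewrite big_const card_unit /= addr0 oppr0 expR0 -/(w2 (kapk 0)) le_eqVlt; apply/orP; left; apply/eqP; ring.
- lra.
Qed.

(** Without a partner there is no scale [k]: the functional is built on twice the field alone, with
    the leaves as initial data. *)
Lemma phi0_block p kb a B : k = 0%N -> (0 < kb <= n)%N -> 0 <= p <= 1 -> 0 <= a -> 0 <= B ->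
  T0 + 1 - a + 3 / 2 * ln kb%:R + 6 <= B ->
  \int[P]_w phi1 0 p kb w <= 2 * (4 * expR (- a) + expR (1 - T0) * (p * (pass_const R * noise_factor / (kb%:R * Num.sqrt kb%:R)) * (1 + B) * (1 + a))).
Proof.
move=> k0 /andP[kb0 kbn] p01 a0 B0 hB.
apply: int_phi1_le => //; first by rewrite lexx ler01.
move=> m mok b; have es : meps R m <= 1 / 4 by case: mok.
have /andP[d1 d2] := drift mok; have C1 := noise_factor_ge1.
pose h y : R := Num.min 1 (noise_factor * expR (- (2 * y))).
have H : UA (@blk N') (cfun k 2 (2 + 0)) m (thin p) (wJ (@blk N') kb (fun=> w1 0 * noise_factor)) n b 0 <=
   4 * expR (- a) + expR (- (t - n%:R * mdrift R m)) * (p * (pass_const R * noise_factor * 1 ^- 3 * expR (- 0) / ((kb - 0)%:R * Num.sqrt (kb - 0)%:R)) * (1 + B) * (1 + a)).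
  apply: (@UA_root_block R _ _ (@blk N') (cfun k 2 (2 + 0)) m n kb p t (fun=> w1 0 * noise_factor) (@blk_step N') (@blk_children N') mok p01 (fun=> W1 _) h 0 2) => //.
  - by move=> l _; rewrite /cfun k0 ltn0 addr0.
  - by move=> y; rewrite le_min ler01 ge_min lexx /= andbT mulr_ge0 ?expR_ge0.
  - by rewrite ltr01 lexx.
  - move=> z; rewrite !addr0 mul0r addr0 oppr0 expR0 mul1r mul1r => z0.
    apply: (@le_trans _ _ (noise_factor * expR (- (2 * z)))); first by rewrite ge_min lexx orbT.
    rewrite (_ : - (2 * z) = - z + - z) ?expRD; last by ring.
    rewrite mulrCA ler_wpM2l ?expR_ge0// ler_wpM2r ?expR_ge0// -[leLHS]mulr1 ler_wpM2l//; lra.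
  - by rewrite kb0.
  - move=> b' r; apply: le_trans (@Ul0_le R m n mok _ _ _ (cfun k 2 (2 + 0)) _ b' r (W1 0) blkinj) _; rewrite /h le_min !ge_min lexx /=.
    apply/orP; right; rewrite /w1 mul0r addr0 le_eqVlt; apply/orP; left; apply/eqP.
    by rewrite mulrAC -expRD mulrC; congr (_ * expR _); field.
  - by rewrite subn0; lra.
apply: (le_trans H); rewrite lerD2l expr1n invr1 mulr1 oppr0 expR0 mulr1 subn0; apply: ler_wpM2r; last by rewrite ler_expR; lra.
have i0 : 0 <= (kb%:R * Num.sqrt kb%:R)^-1 :> R by rewrite invr_ge0 mulr_ge0 ?sqrtr_ge0.
have pp := proj1 (andP p01).
apply: mulr_ge0; last by lra.
apply: mulr_ge0; last by lra.
by apply: mulr_ge0 => //; apply: mulr_ge0 => //; apply: mulr_ge0.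
Qed.

End FunctionalBounds.

(** * Measurable predicates *)

Section MeasurablePredicates.

Context (d : measure_display) (Omega : measurableType d).

Definition mpred (Q : Omega -> Prop) := measurable [set w | Q w].

Lemma mpred_ext (Q Q' : Omega -> Prop) : (forall w, Q w <-> Q' w) -> mpred Q -> mpred Q'.
Proof. by move=> e; rewrite /mpred (_ : [set w | Q' w] = [set w | Q w])//; apply/seteqP; split => w /= /e. Qed.

Lemma mpred_and Q Q' : mpred Q -> mpred Q' -> mpred (fun w => Q w /\ Q' w).
Proof. exact: measurableI. Qed.

Lemma mpred_not Q : mpred Q -> mpred (fun w => ~ Q w).
Proof. exact: measurableC. Qed.

Lemma mpred_const (Q : Prop) : mpred (fun=> Q).
Proof.
by have [h|h] := pselect Q; [apply: (mpred_ext _ measurableT)|apply: (mpred_ext _ measurable0)].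
Qed.

Lemma mpred_imp Q Q' : mpred Q -> mpred Q' -> mpred (fun w => Q w -> Q' w).
Proof.
move=> m m'; apply: (mpred_ext _ (measurableU _ _ (mpred_not m) m')) => w /=; split; first by case.
by move=> h; have [q|q] := pselect (Q w); [right; exact: h|left].
Qed.

Lemma mpred_forall (U : countType) (Q : U -> Omega -> Prop) : (forall y, mpred (Q y)) -> mpred (fun w => forall y, Q y w).
Proof.
move=> mQ; pose F (n : nat) := [set w : Omega | if @choice.unpickle U n is Some y then Q y w else True].
have : measurable (\bigcap_n F n).
  by apply: bigcapT_measurable => n; rewrite /F; case: (choice.unpickle n) => [y|]; [exact: mQ|exact: measurableT].
apply: mpred_ext => w; split=> [h y|h n _]; first by have := h (choice.pickle y) I; rewrite /F /= choice.pickleK.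
by rewrite /F /=; case: (choice.unpickle n).
Qed.

Variable R : realType.

Lemma mpred_le (f g : Omega -> R) : measurable_fun setT f -> measurable_fun setT g -> mpred (fun w => f w <= g w).
Proof.
move=> mf mg; have := measurable_fun_ler mf mg => /(_ measurableT [set true] I).
by rewrite setTI; apply: mpred_ext => w /=.
Qed.

Lemma mpred_lt (f g : Omega -> R) : measurable_fun setT f -> measurable_fun setT g -> mpred (fun w => f w < g w).
Proof.
move=> mf mg; apply: (mpred_ext _ (mpred_not (mpred_le mg mf))) => w.
by rewrite ltNge; split => [/negP|/negP].
Qed.

Lemma mpred_eq (f g : Omega -> R) : measurable_fun setT f -> measurable_fun setT g -> mpred (fun w => f w = g w).
Proof.
move=> mf mg; apply: (mpred_ext _ (mpred_and (mpred_le mf mg) (mpred_le mg mf))) => w.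
by split=> [[h1 h2]|->]; [apply: le_anti; rewrite h1|].
Qed.

End MeasurablePredicates.

Lemma card_of_sum (N' : nat) (A : set Z2) : A `<=` VN N'.+1 ->
  card_of A = (\sum_(i : Pt N') `[< A (pos i) >])%N.
Proof.
move=> AV; have fA : finite_set A.
  apply: (@sub_finite_set _ _ [set` box N'.+1]); last exact: finite_seq.
  by move=> z /AV /VNP /inV_box.
have p : perm_eq (fset_set A) [seq pos i | i <- enum {: Pt N'} & `[< A (pos i) >]].
  apply: uniq_perm; [exact: fset_uniq|by rewrite (map_inj_uniq (@pos_inj N')) filter_uniq ?enum_uniq|].
  move=> z; rewrite in_fset_set//; apply/idP/mapP.
    rewrite inE => Az; have [i iz] := pos_surj ((VNP _ _).1 (AV _ Az)).
    by exists i => //; rewrite mem_filter mem_enum andbT; apply/asboolP; rewrite iz.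
  by move=> [i]; rewrite mem_filter => /andP[/asboolP Ai _] ->; rewrite inE.
by rewrite /card_of (perm_size p) size_map size_filter -sum1_count big_mkcond big_enum.
Qed.

(** * Measurability of the trap events and a Markov inequality *)

Section TrapEvents.

Variables (R : realType) (beta gamma : R) (N' : nat).

Let N := N'.+1.

Context (d : measure_display) (Omega : measurableType d) (P : probability Omega R).

Variable h : Z2 -> {RV P >-> R}.

Let phiw (w : Omega) : Z2 -> R := fun x => h x w.

Lemma tauhat_meas x : measurable_fun setT (fun w => tauhat beta gamma N (phiw w) x).
Proof.
rewrite /tauhat; apply: measurable_funM => //; apply: measurableT_comp => //.
by apply: measurable_funM.
Qed.

Lemma max_over_meas (A : set Z2) x : measurable_fun setT (fun w => max_over A (fun y => tauhat beta gamma N (phiw w) (x + y))).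
Proof.
rewrite /max_over; elim: (fset_set A : seq Z2) => [|y s IH].
  by under eq_fun do rewrite big_nil; exact: measurable_cst.
by under eq_fun do rewrite big_cons; apply: measurable_maxr => //; exact: tauhat_meas.
Qed.

Lemma mpred_T de x : mpred (fun w => T beta gamma N (phiw w) de x).
Proof.
apply: mpred_and; first exact: mpred_const.
apply: (mpred_ext _ (mpred_le (measurable_cst de) (tauhat_meas x))) => w.
by rewrite /= in_itv /= andbT.
Qed.

Lemma mpred_IT de x : mpred (fun w => IT beta gamma N (phiw w) de x).
Proof.
apply: mpred_and; first exact: mpred_T.
apply: mpred_forall => y; apply: mpred_imp; first exact: mpred_const.
by apply: mpred_not; exact: mpred_T.
Qed.

Lemma mpred_ITs de x : mpred (fun w => ITs beta gamma N (phiw w) de x).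
Proof. by apply: mpred_and; [exact: mpred_IT|apply: mpred_eq; [exact: tauhat_meas|exact: max_over_meas]]. Qed.

Lemma mpred_NTs de x : mpred (fun w => NTs beta gamma N (phiw w) de x).
Proof.
apply: mpred_and; first exact: mpred_ITs.
apply: (mpred_ext _ (mpred_and (mpred_le (measurable_cst de) (tauhat_meas x)) (mpred_le (tauhat_meas x) (measurable_cst de^-1)))) => w.
by split=> [[-> ->]|/andP].
Qed.

Lemma mpred_DTs de x : mpred (fun w => DTs beta gamma N (phiw w) de x).
Proof. by apply: mpred_and; [exact: mpred_ITs|apply: mpred_not; exact: mpred_NTs]. Qed.

Lemma mpred_WTs de r x : mpred (fun w => WTs beta gamma N (phiw w) de r x).
Proof. by apply: mpred_and; [exact: mpred_NTs|apply: mpred_le; [exact: measurable_cst|exact: max_over_meas]]. Qed.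

Lemma mpred_card (D : Omega -> set Z2) (c : R) : (forall w, D w `<=` VN N) -> (forall x, mpred (fun w => D w x)) ->
  mpred (fun w => c < (card_of (D w))%:R).
Proof.
move=> DV mD; apply: mpred_lt; first exact: measurable_cst.
rewrite (_ : (fun w => _) = (fun w => \sum_(i : Pt N') \1_[set w | D w (pos i)] w)).
  by apply: measurable_sum => i; apply: measurable_indic; exact: mD.
apply/funext => w; rewrite (card_of_sum (DV w)) natr_sum; apply: eq_bigr => i _.
by rewrite indicE; congr (nat_of_bool _)%:R; apply/asboolP/idP; rewrite inE.
Qed.

Lemma prob_le_integral (E : set Omega) (F : Omega -> R) (c : R) : measurable E -> 0 < c ->
  P.-integrable setT (EFin \o F) -> (forall w, 0 <= F w) -> (forall w, E w -> c <= F w) ->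
  (P E <= ((\int[P]_w F w) / c)%:E)%E.
Proof.
move=> mE c0 iF F0 hE.
have iE : P.-integrable setT (EFin \o (fun w => c * \1_E w)).
  apply: (@bounded_integrable _ _ _ _ _ c); first by apply: measurable_funM => //; exact: measurable_indic.
  by move=> w; rewrite normrM (gtr0_norm c0) -[leRHS]mulr1 ler_wpM2l ?(ltW c0)// indicE; case: (_ \in _); rewrite ?normr1 ?normr0.
have : \int[P]_w (c * \1_E w) <= \int[P]_w F w.
  apply: le_Rintegral => // w _; rewrite indicE; case: (boolP (w \in E)) => [/set_mem /hE|_]; first by rewrite mulr1.
  by rewrite mulr0.
rewrite RintegralZl//; last first.
  apply: (@bounded_integrable _ _ _ _ _ 1); first exact: measurable_indic.
  by move=> w; rewrite ger0_norm// indicE; case: (_ \in _).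
rewrite /Rintegral integral_indic// setIT => H.
have PE : (P E = (fine (P E))%:E)%E by rewrite fineK// fin_num_measure.
by rewrite PE lee_fin ler_pdivlMr// mulrC.
Qed.

End TrapEvents.

(** * From counted points to the functionals *)

Section Cover.

Variables (R : realType) (N' : nat) (d : measure_display) (Omega : measurableType d).

Variables (eta : Pt N' -> Omega -> R) (t s p eps : R) (kb : nat).

Hypothesis s0 : 0 <= s.

Hypothesis p01 : 0 <= p <= 1.

Lemma phi_ge0 (I K : finType) (bl : nat -> I -> K) (w : I -> R) (Z : I -> Omega -> R) o : (forall i, 0 <= w i) -> 0 <= phi bl p kb w Z o.
Proof.
move=> w0; apply: sumr_ge0 => J _; rewrite mulr_ge0 ?thin_ge0// subr_ge0.
by have /andP[_] := lapl_le1 (fun i => Z i o) (fun i => wJ_ge0 bl kb J i w0).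
Qed.

(** The segment mean is compared with [t - Ek]. If it is at least that, adding [kap] times it to
    twice the value of the first point helps; otherwise subtracting [1 - kap] times it from the sum
    of the two values helps. *)
Lemma pair_hits k (q : near_pair N' k) o : (0 < k)%N -> t <= eta (val q).1 o -> t <= eta (val q).2 o ->
  (blk kb (val q).1 \in hits (@blk N') kb (fun=> w1 k t (kapk k s)) (img eta (f1 k (kapk k s))) o) ||
  (blk kb (val q).1 \in hits (@blkp N' k) kb (fun=> w2 k t (kapk k s)) (img eta (f2 (k := k) (kapk k s))) o).
Proof.
move=> k0 t1 t2; have /andP[kp0 kp1] := kap_bounds k0 s0; rewrite -/(kapk k s) in kp0 kp1.
have [h|h] := leP (t - Ek R k) (sg k (val q).1 (fun i => eta i o)); apply/orP; [left|right]; rewrite inE; apply/existsP.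
  exists (val q).1; rewrite eqxx/= /w1 -expRD -[leLHS]expR0 ler_expR /img /f1.
  by have := ler_wpM2l (ltW kp0) h; lra.
exists q; rewrite eqxx/= /w2 -expRD -[leLHS]expR0 ler_expR /img /f2.
have k1 : 0 <= 1 - kapk k s by lra.
by have := ler_wpM2l k1 (ltW h); lra.
Qed.

Definition phis (ks : seq nat) o : R := \sum_(k <- ks) (phi1 k eta t (kapk k s) p kb o + phi2 k eta t (kapk k s) p kb o).

Lemma phis_ge0 ks o : 0 <= phis ks o.
Proof. by apply: sumr_ge0 => k _; rewrite addr_ge0 ?phi_ge0// => i; exact: expR_ge0. Qed.

Lemma phis_cover (SL : {set Pt N'}) (ks : seq nat) o : eps <= p * #|SL|%:R ->
  (forall b, b \in SL -> exists2 k, k \in ks & (0 < k)%N /\ exists q : near_pair N' k, [/\ blk kb (val q).1 = b, t <= eta (val q).1 o & t <= eta (val q).2 o]) ->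
  (1 - expR (- 1)) * (1 - expR (- eps)) <= phis ks o.
Proof.
move=> hS cov; pose H1 k := hits (@blk N') kb (fun=> w1 k t (kapk k s)) (img eta (f1 k (kapk k s))) o.
pose H2 k := hits (@blkp N' k) kb (fun=> w2 k t (kapk k s)) (img eta (f2 (k := k) (kapk k s))) o.
have e1 : 0 <= 1 - expR (- 1) :> R by rewrite subr_ge0 -[leRHS]expR0 ler_expR; lra.
apply: (@le_trans _ _ ((1 - expR (- 1)) * \sum_J thin p J * (meets J SL)%:R)).
  by rewrite ler_wpM2l// thin_hit; exact: thin_hit_large.
apply: (@le_trans _ _ (\sum_(k <- ks) ((1 - expR (- 1)) * (\sum_J thin p J * (meets J (H1 k))%:R) + (1 - expR (- 1)) * (\sum_J thin p J * (meets J (H2 k))%:R)))); last first.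
  by apply: ler_sum => k _; apply: lerD; apply: phi_hits => // i; exact: expR_ge0.
under [leRHS]eq_bigr do rewrite -mulrDr -big_split/=.
rewrite -mulr_sumr ler_wpM2l// exchange_big/=; apply: ler_sum => J _.
under [leRHS]eq_bigr do rewrite -mulrDr.
rewrite -mulr_sumr ler_wpM2l ?thin_ge0//.
have nn k : 0 <= (meets J (H1 k))%:R + (meets J (H2 k))%:R :> R by rewrite addr_ge0.
case: (boolP (meets J SL)) => [/existsP[b /andP[bJ /cov[k kks [k0 [q [qb t1 t2]]]]]]|_]; last by rewrite sumr_ge0.
rewrite (big_rem k)//=; apply: (@le_trans _ _ ((meets J (H1 k))%:R + (meets J (H2 k))%:R)); last by rewrite lerDl sumr_ge0.
have := pair_hits k0 t1 t2; rewrite qb => /orP[h|h].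
  have -> : meets J (H1 k) by apply/existsP; exists b; rewrite bJ.
  by rewrite lerDl.
have -> : meets J (H2 k) by apply/existsP; exists b; rewrite bJ.
by rewrite lerDr.
Qed.

End Cover.

Lemma Z2_addE (x y : Z2) : x + y = (x.1 + y.1, x.2 + y.2). Proof. by []. Qed.

(** * Traps as level sets, and their spatial separation *)

Section TrapGeometry.

Variables (R : realType) (beta gamma : R) (N' : nat) (phi : Z2 -> R).

Let N := N'.+1.

Hypothesis beta0 : 0 < beta.

Hypothesis N2 : (1 < N)%N.

(** The height that [alpha h] must reach for [tauhat >= de]. *)
Definition tlev (de : R) : R := alpha R / beta * (ln (that beta gamma N) + ln de).

Lemma alpha_gt0 : 0 < alpha R.
Proof. by rewrite /alpha sqrtr_gt0 mulr_gt0// pi_gt0. Qed.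

Lemma that_gt0 : 0 < that beta gamma N.
Proof. by rewrite /that mulr_gt0// powR_gt0// ?ltr0n// /logN ln_gt0// ltr1n. Qed.

Lemma tauhat_ge de x : 0 < de -> (de <= tauhat beta gamma N phi x) = (tlev de <= alpha R * phi x).
Proof.
move=> de0; have th := that_gt0; have a0 := alpha_gt0.
have E : de * that beta gamma N = expR (ln de + ln (that beta gamma N)) by rewrite expRD !lnK ?posrE.
rewrite /tauhat ler_pdivlMr// E ler_expR.
rewrite /tlev mulrAC ler_pdivrMr// -mulrA ler_pM2l// (mulrC (phi x)).
by rewrite addrC.
Qed.

Lemma T_pos de i : 0 < de -> T beta gamma N phi de (pos i) <-> tlev de <= alpha R * phi (@pos N' i).
Proof.
move=> de0; rewrite /T /TI /= in_itv /= andbT tauhat_ge//; split; first by case.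
by move=> h; split => //; apply/VNP; exact: pos_inV.
Qed.

Lemma BBE (r : R) (y : Z2) : BB r y = ((maxn `|y.1|%N `|y.2|%N)%:R <= r) :> Prop.
Proof.
rewrite /BB /=; have -> : (Num.max `|y.1| `|y.2| : int) = (maxn `|y.1|%N `|y.2|%N)%:Z => //.
by case: y => a b /=; case: leP => h; lia.
Qed.

Lemma BB_dist (r : R) (y : Z2) : 1 <= r -> BB r y <-> (dist y)%:R <= r.
Proof.
move=> r1; rewrite BBE /dist; set M := maxn `|y.1| _.
have [h|h] : (1 <= M)%N \/ M = 0%N by lia.
  by rewrite (maxn_idPr h).
by rewrite h /=; split => // _; lra.
Qed.

Lemma BB_finite (r : R) : finite_set (BB r).
Proof.
apply: (@sub_finite_set _ _ [set` box (Num.truncn r).+1]); last exact: finite_seq.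
move=> y; rewrite BBE => yr; apply: inV_box.
have : (maxn `|y.1|%N `|y.2|%N < (Num.truncn r).+1)%N by rewrite -(ltr_nat R) (le_lt_trans yr)// truncnS_gt.
by rewrite /inV gtn_max.
Qed.

Lemma bigmax_ge (s : seq Z2) (f : Z2 -> R) (de : R) : 0 < de -> de <= \big[Num.max/0]_(y <- s) f y -> exists2 y, y \in s & de <= f y.
Proof.
move=> de0; elim: s => [|y s IH]; first by rewrite big_nil; lra.
rewrite big_cons le_max => /orP[h|/IH[z zs hz]]; first by exists y; rewrite ?mem_head.
by exists z; rewrite ?inE ?zs ?orbT.
Qed.

Lemma le_bigmax_seq (s : seq Z2) (f : Z2 -> R) y : y \in s -> f y <= \big[Num.max/0]_(z <- s) f z.
Proof.
elim: s => // z s IH; rewrite inE big_cons le_max => /orP[/eqP ->|/IH ->]; by rewrite ?lexx ?orbT.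
Qed.

Let rr := rN gamma N.

Hypothesis rr1 : 1 <= rr.

Lemma dist_sub (i j : Pt N') : dist ((pos j).1 - (pos i).1, (pos j).2 - (pos i).2) = dst i j.
Proof. by rewrite dstC. Qed.

Lemma pos_sub (i j : Pt N') : pos i + ((pos j).1 - (pos i).1, (pos j).2 - (pos i).2) = pos j.
Proof. by rewrite Z2_addE /pos /=; congr (_, _); lia. Qed.

Lemma not_IT_pair de i : 0 < de -> rr <= N%:R / rr -> T beta gamma N phi de (pos i) -> ~ IT beta gamma N phi de (pos i) ->
  exists j : Pt N', [/\ rr < (dst i j)%:R, (dst i j)%:R <= N%:R / rr, tlev de <= alpha R * phi (pos i) & tlev de <= alpha R * phi (pos j)].
Proof.
move=> de0 rN' Ti nI.
have [y [[y1 y2] Ty]] : exists y, (BB (N%:R / rr) `\` BB rr) y /\ T beta gamma N phi de (pos i + y).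
  apply: contrapT => H; apply: nI; split => // y yB Ty; apply: H; by exists y.
have [j jy] : exists j : Pt N', pos j = pos i + y by apply: pos_surj; apply/VNP; case: Ty.
have E : y = ((pos j).1 - (pos i).1, (pos j).2 - (pos i).2).
  by rewrite jy Z2_addE /=; case: (y) => a b /=; rewrite addrAC subrr add0r addrAC subrr add0r.
have nr1 : 1 <= N%:R / rr := le_trans rr1 rN'.
exists j; split.
- by rewrite -dist_sub -E ltNge; apply/negP => /(BB_dist _ rr1).
- by rewrite -dist_sub -E; apply/(BB_dist _ nr1).
- exact/T_pos.
- by apply/T_pos => //; rewrite jy.
Qed.

(** The ball of the maximum may leave the box, where the field is 0; positivity of [tlev] forces the
    partner to lie inside. *)
Lemma WT_pair de r i : 0 < de -> 0 < tlev de -> 1 <= r -> WTs beta gamma N phi de r (pos i) -> (forall x, ~ VN N x -> phi x = 0) ->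
  exists j : Pt N', [/\ r < (dst i j)%:R, (dst i j)%:R <= rr, tlev de <= alpha R * phi (pos i) & tlev de <= alpha R * phi (pos j)].
Proof.
move=> de0 tl0 r1 [[[[Ti _] _] _]]; rewrite /max_over => /(bigmax_ge de0)[y]; rewrite in_fset_set; last first.
  by apply: (@sub_finite_set _ _ (BB rr)); [move=> z []|exact: BB_finite].
rewrite inE => -[y1 y2]; rewrite tauhat_ge// => Ty ph0.
have Vy : VN N (pos i + y).
  by apply: contrapT => nV; move: Ty; rewrite ph0// mulr0; lra.
have [j jy] : exists j : Pt N', pos j = pos i + y by apply: pos_surj; apply/VNP.
have E : y = ((pos j).1 - (pos i).1, (pos j).2 - (pos i).2).
  by rewrite jy Z2_addE /=; case: (y) => a b /=; rewrite addrAC subrr add0r addrAC subrr add0r.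
exists j; split.
- by rewrite -dist_sub -E ltNge; apply/negP => /(BB_dist _ r1).
- by rewrite -dist_sub -E; apply/(BB_dist _ rr1).
- exact/T_pos.
- by rewrite jy.
Qed.

(** At a distance between [r_N] and [N / r_N] isolation is violated; within [r_N] each point is the
    maximum of a ball containing the other one. *)
Lemma ITs_sep de (i j : Pt N') : 0 < de -> rr <= N%:R / rr -> i != j -> ITs beta gamma N phi de (pos i) -> ITs beta gamma N phi de (pos j) ->
  (dst i j)%:R <= N%:R / rr -> phi (pos i) = phi (pos j).
Proof.
move=> de0 rN' ij [[Ti Ii] Mi] [[Tj Ij] Mj] dij.
have nr1 : 1 <= N%:R / rr := le_trans rr1 rN'.
have [h|h] := leP (dst i j)%:R rr; last first.
  case: (Ii ((pos j).1 - (pos i).1, (pos j).2 - (pos i).2)); last by rewrite pos_sub.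
  split; first by apply/(BB_dist _ nr1); rewrite dist_sub.
  by move=> /(BB_dist _ rr1); rewrite dist_sub; lra.
have M (a b : Pt N') : (dst a b)%:R <= rr -> tauhat beta gamma N phi (pos a) = max_over (BB rr) (fun y => tauhat beta gamma N phi (pos a + y)) ->
   tauhat beta gamma N phi (pos b) <= tauhat beta gamma N phi (pos a).
  move=> ab ->; rewrite /max_over -{1}(pos_sub a b).
  apply: (le_bigmax_seq (fun y => tauhat beta gamma N phi (pos a + y))).
  rewrite in_fset_set; last exact: BB_finite.
  by rewrite inE; apply/(BB_dist _ rr1); rewrite dist_sub.
have h1 := M i j h Mi; have h2 := M j i (ltac:(by rewrite dstC)) Mj.
have /(mulIf (lt0r_neq0 (_ : 0 < (that beta gamma N)^-1))) : tauhat beta gamma N phi (pos i) = tauhat beta gamma N phi (pos j).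
  by apply: le_anti; rewrite h1 h2.
rewrite invr_gt0 that_gt0 => /(_ isT) /expR_inj /mulfI; apply; by rewrite gt_eqF.
Qed.

Lemma near_of (i j : Pt N') (lo hi : R) n : 1 <= lo -> lo < (dst i j)%:R -> (dst i j)%:R <= hi -> (N'.*2 < 2 ^ n)%N ->
  exists2 k, k \in [seq k <- iota 0 n.+1 | (lo < (2 ^ k)%:R) && ((2 ^ k)%:R <= 2 * hi)] & (0 < k)%N /\ exists q : near_pair N' k, val q = (i, j).
Proof.
move=> lo1 ld dh nN; have d1 : (1 < dst i j)%N by rewrite -(ltr_nat R); lra.
have /andP[u1 u2] := up_log_bounds (isT : 1 < 2)%N d1.
set k := up_log 2 (dst i j) in u1 u2.
have k0 : (0 < k)%N by rewrite lt0n; apply/eqP => e; move: u2; rewrite e; lia.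
have u3 : (2 ^ k < 2 * dst i j)%N by rewrite -(prednK k0) expnS ltn_pmul2l.
exists k; last first.
  split=> //; have pk : (2 ^ k <= 2 * dst (i, j).1 (i, j).2)%N && (dst (i, j).1 (i, j).2 <= 2 ^ k)%N by rewrite /= u2 ltnW.
  by exists (exist _ (i, j) pk).
rewrite mem_filter mem_iota /= add0n; apply/andP; split.
  apply/andP; split; first by apply: (lt_le_trans ld); rewrite ler_nat.
  apply: (@le_trans _ _ (2 * (dst i j)%:R)); last by rewrite ler_pM2l.
  by rewrite -natrM ler_nat ltnW.
rewrite ltnS; apply: up_log_min => //.
exact/blk_dst/blk_root.
Qed.

End TrapGeometry.

(** * The three probabilities at a fixed size of the box *)

Section FixedSize.

Variables (R : realType) (dS : measure_display) (OmegaS : measurableType dS).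

Variables (PS : Z2 -> probability OmegaS R) (S : nat -> OmegaS -> Z2).

Hypothesis hS : forall x, simple_random_walk (PS x) x S.

Variable N' : nat.

Let N := N'.+1.

Context (d : measure_display) (Omega : measurableType d) (P : probability Omega R).

Variable h : Z2 -> {RV P >-> R}.

Hypothesis hh : dgff PS S N h.

Variables (beta gamma eps : R).

Hypothesis beta0 : 0 < beta.

Hypothesis eps0 : 0 < eps.

Hypothesis N2 : (1 < N)%N.

Variable n : nat.

Hypothesis n_lo : (2 * N <= 2 ^ n)%N.

Hypothesis n_hi : (2 ^ n <= 4 * N)%N.

Definition eta := field h (@pos N').

Definition WX := pull (@pos N') (VX R N).

Definition WA := pull (@pos N') (VA R N).

(** The 8 pays for writing [n v1] in place of [4 ln N], which differ by at most [8 ln 2]. *)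
Definition cdist : R := cov_const R + 8.

Definition hit_const : R := (1 - expR (- 1)) * (1 - expR (- eps)).

Lemma hit_const_gt0 : 0 < hit_const.
Proof. by rewrite mulr_gt0// subr_gt0 -[ltRHS]expR0 ltr_expR oppr_lt0. Qed.

Lemma cdist_ge0 : 0 <= cdist.
Proof. by rewrite /cdist /cov_const /green_const; have := pi_ge0 R; lra. Qed.

Lemma nN : (N'.*2 < 2 ^ n)%N.
Proof. by have := n_lo; rewrite /N; lia. Qed.

Lemma n_ln : ln (N%:R : R) + ln 2 <= n%:R * ln 2 <= ln (N%:R : R) + 2 * ln 2.
Proof.
have NR : 0 < N%:R :> R by rewrite ltr0n.
rewrite -!ln_pow2; apply/andP; split.
  rewrite -lnM ?posrE// ler_ln ?posrE ?mulr_gt0 ?ltr0n ?expn_gt0// -natrM ler_nat mulnC; exact: n_lo.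
rewrite -lnM ?posrE ?ltr0n// ler_ln ?posrE ?mulr_gt0 ?ltr0n ?expn_gt0// -!natrM ler_nat.
by rewrite mulnC; exact: n_hi.
Qed.

Lemma ln2_bounds : 1 / 2 <= ln (2 : R) <= 1.
Proof. by have /andP[a b] := v1_bounds R; rewrite /v1 in a b; apply/andP; split; lra. Qed.

Lemma HC i j : `|Gam (WX ++ WA) (ev i) (ev j) - (v1 R * n%:R - 4 * lnd R i j)| <= cdist.
Proof.
have V := VC_bound hS (ltn0Sn _) hh (pos_inV i) (pos_inV j).
have -> : Gam (WX ++ WA) (ev i) (ev j) = \sum_(v <- VX R N ++ VA R N) v (pos i) * v (pos j).
  by rewrite /WX /WA /pull -map_cat /Gam big_map.
move: V; rewrite -/(dst i j) ln_div ?posrE ?ltr0n ?dst_gt0// -/(lnd R i j).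
have /andP[a b] := n_ln; have /andP[c e] := ln2_bounds.
rewrite /cdist /v1 !ler_norml => /andP[f g]; apply/andP; split; lra.
Qed.

Lemma meta i : measurable_fun setT (eta i).
Proof. exact: field_meas. Qed.

Let posV (i : Pt N') : inV N (pos i). Proof. exact: pos_inV. Qed.

Definition chareta := field_char hS hh posV.

Definition lineta := field_lin hS hh posV.

Let u : R := gamma * ln (logN R N).

Hypothesis u0 : 0 <= u.

Lemma kappaE : kappa gamma N = expR u.
Proof.
by rewrite /kappa /powR gt_eqF// /logN ln_gt0// ltr1n.
Qed.

Lemma exp_u01 : 0 <= expR (- u) <= 1.
Proof. by rewrite expR_ge0 -[leRHS]expR0 ler_expR oppr_le0. Qed.

Lemma event_count (D : set Z2) : D `<=` VN N -> eps * kappa gamma N < (card_of D)%:R ->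
  eps <= expR (- u) * #|[set i : Pt N' | `[< D (pos i) >]]%SET|%:R.
Proof.
move=> DV; rewrite (card_of_sum DV) kappaE => e1.
have -> : (#|[set i : Pt N' | `[< D (pos i) >]]%SET| = \sum_(i : Pt N') `[< D (pos i) >])%N.
  by rewrite -sum1_card big_mkcond/=; apply: eq_bigr => i _; rewrite inE; case: (`[< _ >]).
by rewrite mulrC -ler_pdivrMr ?expR_gt0// -expRN opprK ltW.
Qed.

Lemma phi_int (J : finType) (bl : nat -> J -> Pt N') (p : R) kb (w : J -> R) (f : J -> (Pt N' -> R) -> R) :
  0 <= p <= 1 -> (forall i, 0 <= w i) -> (forall j, lin (f j)) ->
  P.-integrable setT (EFin \o phi bl p kb w (img eta f)).
Proof.
move=> p01 w0 lf.
apply: (@bounded_integrable _ _ _ P _ 1).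
  rewrite /phi; apply: measurable_sum => J'; apply: measurable_funM => //; apply: measurable_funB => //.
  apply: measurable_lapl => j; exact: (img_meas meta lf).
move=> o; rewrite ger0_norm; last exact: phi_ge0.
rewrite /phi -[leRHS](thin_sum (Pt N') p); apply: ler_sum => J' _; rewrite ler_piMr ?thin_ge0//.
by have /andP[l0 _] := lapl_le1 (fun i => img eta f i o) (fun i => wJ_ge0 bl kb J' i w0); lra.
Qed.

Lemma phis_int t s p kb ks : 0 <= p <= 1 -> P.-integrable setT (EFin \o phis eta t s p kb ks) /\
  \int[P]_w phis eta t s p kb ks w = \sum_(k <- ks) (\int[P]_w phi1 k eta t (kapk k s) p kb w + \int[P]_w phi2 k eta t (kapk k s) p kb w).
Proof.
move=> p01; have i1 k : P.-integrable setT (EFin \o phi1 k eta t (kapk k s) p kb).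
  by apply: phi_int => // [i|j]; [exact: expR_ge0|exact: lin_f1].
have i2 k : P.-integrable setT (EFin \o phi2 k eta t (kapk k s) p kb).
  by apply: phi_int => // [i|j]; [exact: expR_ge0|exact: lin_f2].
have i12 k : P.-integrable setT (EFin \o (fun w => phi1 k eta t (kapk k s) p kb w + phi2 k eta t (kapk k s) p kb w)).
  exact: (integrableD measurableT (i1 k) (i2 k)).
have [h1 h2] := Rintegral_bigsum ks i12; split; first exact: h1.
by rewrite h2; apply: eq_bigr => k _; rewrite RintegralD.
Qed.

Lemma ties_null (E : set Omega) : measurable E ->
  exists E', [/\ measurable E', E' `<=` E, P E' = P E & forall w, E' w -> forall i j : Pt N', i != j -> h (pos i) w <> h (pos j) w].
Proof.
move=> mE; pose Q (q : Pt N' * Pt N') := if q.1 == q.2 then set0 else [set w | h (pos q.1) w = h (pos q.2) w].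
have mQ q : measurable (Q q).
  by rewrite /Q; case: ifP => _ //; apply: mpred_eq; exact: measurable_funPT.
have nQ q : P.-negligible (Q q).
  apply/negligibleP => //; rewrite /Q; case: eqP => [_|/eqP ne]; first exact: measure0.
  by apply: (no_tie hS (ltn0Sn _) hh) => //; rewrite (inj_eq (@pos_inj N')).
pose F (k : nat) : set Omega := if @choice.unpickle (Pt N' * Pt N')%type k is Some q then Q q else set0.
have mF k : measurable (F k) by rewrite /F; case: (choice.unpickle k).
have nB : P.-negligible (\bigcup_k F k).
  apply: negligible_bigcup => k; rewrite /F; case: (choice.unpickle k) => // ; exact: negligible_set0.
have mB : measurable (\bigcup_k F k) by apply: bigcupT_measurable.
exists (E `\` \bigcup_k F k); split.
- exact: measurableD.
- by move=> w [].
- have Z : P (E `&` \bigcup_k F k) = 0%E.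
    apply/eqP; rewrite -measure_le0 -((negligibleP P mB).1 nB); apply: le_measure; rewrite ?inE; [exact: measurableI|exact: mB|by move=> w []].
  by rewrite [RHS](measureDI P mE mB) [X in (_ + X)%E](_ : _ = 0%E) ?adde0.
- move=> w [_ nb] i j ij e; apply: nb; exists (choice.pickle (i, j)) => //.
  by rewrite /F choice.pickleK /Q /= (negbTE ij).
Qed.

Let l : R := ln (logN R N).

Hypothesis logN1 : 1 <= logN R N.

Let rr := rN gamma N.

Hypothesis rr2 : 2 <= rr.

Hypothesis rrN : rr <= N%:R / rr.

Lemma n_bounds : logN R N <= n%:R /\ ln n%:R <= l + 5.
Proof.
have /andP[a b] := n_ln; have /andP[c e] := ln2_bounds; have L := logN1; rewrite /logN in L.
have n0 : 0 < n%:R :> R.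
  by rewrite ltr0n lt0n; apply/eqP => z; move: a; rewrite z mul0r; lra.
split; first by rewrite /logN; nra.
have n6 : n%:R <= 6 * ln N%:R :> R by nra.
apply: (@le_trans _ _ (ln (6 * ln N%:R))); first by rewrite ler_ln ?posrE// mulr_gt0//; lra.
rewrite lnM ?posrE//; last by lra.
by rewrite addrC lerD2l; have := ln_le_sub1 (ltr0n _ 6 : 0 < 6 :> R); lra.
Qed.

Lemma n_gt0 : (0 < n)%N.
Proof. by have [a _] := n_bounds; have b := logN1; rewrite -(ltr0n R); lra. Qed.

Definition Ldelta (de : R) : R := alpha R / beta * ln de.

(** [alpha sqrt g = 2] makes the leading term of the threshold [4 ln N], and the logarithmic factor
    of [that] contributes [- 3/2 l - u]. Since [n v1] exceeds [4 ln N] by a number in [[0, 8]], the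
    error is centred at [-4]. *)
Lemma T0_bounds de : `|tlev beta gamma N' de - n%:R * v1 R - (- (3 / 2 * l) - u + Ldelta de) + 4| <= 4.
Proof.
have /andP[a b] := n_ln; have /andP[c e] := ln2_bounds; have L := logN1.
have l0 : 0 < logN R N by lra.
have NR : 0 < N%:R :> R by rewrite ltr0n.
have a0 := alpha_gt0 R; have p0 := pi_gt0 R.
have lt : ln (that beta gamma N) = 2 * Num.sqrt (gconst R) * beta * ln N%:R - (3 + 2 * gamma) / (2 * alpha R) * beta * l.
  by rewrite /that lnM ?posrE ?powR_gt0// !ln_powR mulNr.
have ag : alpha R * Num.sqrt (gconst R) = 2.
  rewrite /alpha /gconst -sqrtrM ?mulr_ge0 ?ltW//.
  have pn : pi != 0 :> R by rewrite gt_eqF.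
  rewrite mulrACA divff// mulr1 -expr2.
  by rewrite sqrtr_sqr ger0_norm.
have -> : tlev beta gamma N' de = 4 * ln N%:R - 3 / 2 * l - u + Ldelta de.
  rewrite /tlev mulrDr -/(Ldelta de) -/N lt; congr (_ + _).
  have -> : alpha R / beta * (2 * Num.sqrt (gconst R) * beta * ln N%:R - (3 + 2 * gamma) / (2 * alpha R) * beta * l) =
    2 * (alpha R * Num.sqrt (gconst R)) * ln N%:R - (3 + 2 * gamma) / 2 * l by field; rewrite !gt_eqF.
  by rewrite ag /u -/l; field.
rewrite /v1 ler_norml; apply/andP; split; lra.
Qed.

Definition Yk (k : nat) : R := 15 + 3 / 2 * ln k%:R.

Lemma T0_upper de : de <= 1 -> 0 < de -> tlev beta gamma N' de - n%:R * v1 R <= - (3 / 2 * l) - u.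
Proof.
move=> d1 d0; have := T0_bounds de; rewrite ler_norml => /andP[_ h1].
have q : 0 <= alpha R / beta by rewrite divr_ge0 // ltW // alpha_gt0.
have ld : ln de <= 0 by rewrite -[leRHS]ln1 ler_ln ?posrE.
have : Ldelta de <= 0 by exact: mulr_ge0_le0.
lra.
Qed.

Lemma ln_sub_le (k m : nat) : (m <= n)%N -> (k < m)%N -> ln (m - k)%:R <= l + 5.
Proof.
move=> mn km; have [_ h1] := n_bounds; apply: le_trans h1; rewrite ler_ln ?posrE ?ltr0n ?n_gt0 ?subn_gt0// ler_nat.
by apply: leq_trans (leq_subr _ _) mn.
Qed.

Definition ks2 : seq nat := [seq k <- iota 0 n.+1 | (rr < (2 ^ k)%:R) && ((2 ^ k)%:R <= 2 * (N%:R / rr))].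

Lemma ks2P k : k \in ks2 -> [/\ (0 < k < n)%N, (2 ^ k <= N'.+1)%N, rr < (2 ^ k)%:R & rr <= (2 ^ (n - k))%:R].
Proof.
rewrite mem_filter mem_iota add0n => /andP[/andP[h1 h2] /andP[_ kn]]; have r2 := rr2.
have r0 : 0 < rr by lra.
have k0 : (0 < k)%N by rewrite lt0n; apply/eqP => e; move: h1; rewrite e expn0; lra.
have kN : (2 ^ k <= N'.+1)%N.
  rewrite -(ler_nat R); apply: (le_trans h2); rewrite mulrA ler_pdivrMr// mulrC.
  by rewrite ler_wpM2l.
have kltn : (k < n)%N.
  by rewrite -(ltn_exp2l k n (isT : 1 < 2)%N) (leq_trans _ n_lo)// (leq_ltn_trans kN)// -[X in (X < _)%N]mul1n ltn_pmul2r.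
split => //; first by rewrite k0.
have E : (2 ^ (n - k))%:R * (2 ^ k)%:R = (2 ^ n)%:R :> R by rewrite -natrM -expnD subnK// ltnW.
have k20 : 0 < (2 ^ k)%:R :> R by rewrite ltr0n expn_gt0.
rewrite -(ler_pM2r k20) E; apply: (@le_trans _ _ (2 * N%:R)); last by rewrite -natrM ler_nat.
rewrite mulrC -ler_pdivlMr//; by rewrite -mulrA.
Qed.

(** Nothing separates the points of [T] outside [IT], so single points are thinned: the blocks are
    of level 0 and the thinning enters as [s = u]. *)
Lemma stmt2_fixed de : 0 < de < 1 ->
  (P [set w | (eps * kappa gamma N < (card_of (T beta gamma N (fun x => h x w) de `\` IT beta gamma N (fun x => h x w) de))%:R)%R]
   <= ((\sum_(k <- ks2) 4 * full_bound n k cdist (tlev beta gamma N' de) u (Yk k)) / hit_const)%:E)%E.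
Proof.
move=> /andP[de0 de1]; set t := tlev beta gamma N' de; have r2 := rr2.
set D := fun w => T beta gamma N (fun x => h x w) de `\` IT beta gamma N (fun x => h x w) de.
have DV w : D w `<=` VN N by move=> x [[]].
have mE : measurable [set w | eps * kappa gamma N < (card_of (D w))%:R].
  apply: (mpred_card _ DV) => x; apply: mpred_and; first exact: mpred_T.
  by apply: mpred_not; exact: mpred_IT.
have p01 := exp_u01; have [ip ie] := phis_int t u 0 ks2 p01.
apply: (le_trans (prob_le_integral mE hit_const_gt0 ip (fun w => phis_ge0 eta t u 0 p01 ks2 w) _)).
  move=> w /= /(event_count (DV w)) ec; rewrite /hit_const.
  have rr1 : 1 <= rr by lra.
  apply: (phis_cover (SL := imset (@blk N' 0) (mem [set i : Pt N' | `[< D w (pos i) >]]%SET)) u0 p01).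
    by rewrite card_in_imset// => x y _ _; exact: blk0_inj.
  move=> b /imsetP[i]; rewrite inE => /asboolP[Ti nI] ->.
  have [j [j1 j2 j3 j4]] := not_IT_pair beta0 N2 rr1 de0 rrN Ti nI.
  have [k kk [k0 [q qE]]] := near_of beta0 N2 rr1 rr1 j1 j2 nN.
  by exists k => //; split=> //; exists q; rewrite qE; split.
rewrite lee_fin ler_pM2r ?invr_gt0 ?hit_const_gt0// ie big_seq [leRHS]big_seq.
apply: ler_sum => k /ks2P[/andP[k0 kn] kN _ _].
have k0' : (0 < k < n)%N by rewrite k0.
have [n1 n2] := n_bounds; have l0 : 0 <= ln k%:R :> R by rewrite ln_ge0// ler1n.
have Y0 : 0 <= Yk k by rewrite /Yk; lra.
have hY : t - n%:R * v1 R + 1 + (3 / 2 * ln k%:R + u) + 3 / 2 * ln (n - k)%:R + 6 <= Yk k.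
  have := T0_upper (ltW de1) de0; have := ln_sub_le (leqnn n) kn; rewrite /Yk -/t; lra.
have h1 := phi1_full meta chareta lineta nN kN cdist_ge0 HC k0' u0 Y0 hY.
have h2 := phi2_full meta chareta lineta nN kN cdist_ge0 HC k0' u0 Y0 hY.
by apply: (le_trans (lerD h1 h2)); rewrite -mulrDl -natrD.
Qed.

Variable kb : nat.

Hypothesis kb_hi : ((2 ^ kb)%:R <= N%:R / rr).

Lemma rr_ge1 : 1 <= rr. Proof. by have r2 := rr2; lra. Qed.

(** Points of a block of level [kb] are within [N / r_N], so two isolated maxima there would tie.
    Counting such maxima is therefore the same as counting their blocks. *)
Lemma labels_sep (D : set Z2) (ph : Z2 -> R) de (i j : Pt N') : 0 < de -> (forall x, D x -> ITs beta gamma N ph de x) ->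
  (forall i j : Pt N', i != j -> ph (pos i) <> ph (pos j)) ->
  D (pos i) -> D (pos j) -> blk kb i = blk kb j -> i = j.
Proof.
move=> de0 DI nt Di Dj bij; apply/eqP; apply: contrapT => /negP ij; apply: (nt _ _ ij).
apply: (ITs_sep beta0 N2 rr_ge1 de0 rrN ij (DI _ Di) (DI _ Dj)).
by apply: le_trans kb_hi; rewrite ler_nat blk_dst.
Qed.

(** Blocks of level [kb] are thinned, which is legitimate because each contains at most one counted
    point. The barrier depth [2 ln k] makes its cost [4 k^-2] summable over the scales. *)
Lemma stmt3_fixed de r : 0 < de < 1 -> 1 <= r -> 0 < tlev beta gamma N' de ->
  let ks3 := [seq k <- iota 0 n.+1 | (r < (2 ^ k)%:R) && ((2 ^ k)%:R <= 2 * rr)] in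
  (forall k, k \in ks3 -> [/\ (0 < k)%N, (k < kb)%N, (kb <= n)%N & (2 ^ k <= N'.+1)%N]) ->
  (P [set w | (eps * kappa gamma N < (card_of (WTs beta gamma N (fun x => h x w) de r))%:R)%R]
   <= ((\sum_(k <- ks3) 4 * block_bound n k cdist (tlev beta gamma N' de) (expR (- u)) kb (2 * ln k%:R) (Yk k)) / hit_const)%:E)%E.
Proof.
move=> /andP[de0 de1] r1 tl0 ks3 hks; set t := tlev beta gamma N' de.
set D := fun w => WTs beta gamma N (fun x => h x w) de r.
have DI w x : D w x -> ITs beta gamma N (fun x => h x w) de x by move=> [[]].
have DV w : D w `<=` VN N by move=> x /DI[[[]]].
have mE : measurable [set w | eps * kappa gamma N < (card_of (D w))%:R].
  by apply: (mpred_card _ DV) => x; exact: mpred_WTs.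
have [E' [mE' sE' PE' nt]] := ties_null mE; rewrite -PE'.
have p01 := exp_u01; have [ip ie] := phis_int t 0 kb ks3 p01.
apply: (le_trans (prob_le_integral mE' hit_const_gt0 ip (fun w => phis_ge0 eta t 0 kb p01 ks3 w) _)).
  move=> w Ew; have /(event_count (DV w)) ec := sE' _ Ew; rewrite /hit_const.
  apply: (phis_cover (SL := imset (@blk N' kb) (mem [set i : Pt N' | `[< D w (pos i) >]]%SET)) (lexx 0) p01).
    rewrite card_in_imset// => x y; rewrite !inE => /asboolP Dx /asboolP Dy.
    by move=> bxy; exact: (labels_sep de0 (DI w) (nt w Ew) (asboolW Dx) (asboolW Dy) bxy).
  move=> b /imsetP[i]; rewrite inE => /asboolP Wi ->.
  have h0 x : ~ VN N x -> h x w = 0 by move=> nV; have [_ _ _ z] := hh; exact: z.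
  have [j [j1 j2 j3 j4]] := WT_pair beta0 N2 rr_ge1 de0 tl0 r1 Wi h0.
  have [k kk [k0 [q qE]]] := near_of beta0 N2 rr_ge1 r1 j1 j2 nN.
  by exists k => //; split=> //; exists q; rewrite qE; split.
rewrite lee_fin ler_pM2r ?invr_gt0 ?hit_const_gt0// ie big_seq [leRHS]big_seq.
apply: ler_sum => k /hks[k0 kkb kbn kN].
have k0' : (0 < k < kb)%N by rewrite k0.
have [n1 n2] := n_bounds; have l0 : 0 <= ln k%:R :> R by rewrite ln_ge0// ler1n.
have Y0 : 0 <= Yk k by rewrite /Yk; lra.
have a0 : 0 <= 2 * ln k%:R :> R by lra.
have hY : t - n%:R * v1 R + 1 - 2 * ln k%:R + 3 / 2 * ln k%:R + 3 / 2 * ln (kb - k)%:R + 6 <= Yk k.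
  have := T0_upper (ltW de1) de0; have := ln_sub_le kbn kkb; have := u0; rewrite /Yk -/t; lra.
have h1 := phi1_block meta chareta lineta nN kN cdist_ge0 HC k0' kbn p01 a0 Y0 hY.
have h2 := phi2_block meta chareta lineta nN kN cdist_ge0 HC k0' kbn p01 a0 Y0 hY.
by apply: (le_trans (lerD h1 h2)); rewrite -mulrDl -natrD.
Qed.

(** A deep trap lies in [T] for the threshold [1 / de], which is higher by [Ldelta de^-1]; the same
    number serves as barrier depth. *)
Lemma stmt1_fixed de : 0 < de < 1 -> (0 < kb <= n)%N ->
  (P [set w | (eps * kappa gamma N < (card_of (DTs beta gamma N (fun x => h x w) de))%:R)%R]
   <= ((2 * (4 * expR (- Ldelta de^-1) + expR (1 - (tlev beta gamma N' de^-1 - n%:R * v1 R)) *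
     (expR (- u) * (pass_const R * noise_factor cdist / (kb%:R * Num.sqrt kb%:R)) * (1 + 15) * (1 + Ldelta de^-1)))) / hit_const)%:E)%E.
Proof.
move=> /andP[de0 de1] kbn; set t := tlev beta gamma N' de^-1.
have d1 : 1 <= de^-1 by rewrite invf_ge1 ?ltW.
have dp : 0 < de^-1 by rewrite invr_gt0.
set D := fun w => DTs beta gamma N (fun x => h x w) de.
have DI w x : D w x -> ITs beta gamma N (fun x => h x w) de x by move=> [].
have DV w : D w `<=` VN N by move=> x /DI[[[]]].
have mE : measurable [set w | eps * kappa gamma N < (card_of (D w))%:R].
  by apply: (mpred_card _ DV) => x; exact: mpred_DTs.
have [E' [mE' sE' PE' nt]] := ties_null mE; rewrite -PE'.
have p01 := exp_u01.
have ip : P.-integrable setT (EFin \o phi1 0 eta t 0 (expR (- u)) kb).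
  by apply: phi_int => // [i|j]; [exact: expR_ge0|exact: lin_f1].
have ph0 w : 0 <= phi1 0 eta t 0 (expR (- u)) kb w by apply: phi_ge0 => // i; exact: expR_ge0.
apply: (le_trans (prob_le_integral mE' hit_const_gt0 ip ph0 _)).
  move=> w Ew; have /(event_count (DV w)) ec := sE' _ Ew.
  have e1 : 0 <= 1 - expR (- 1) :> R by rewrite subr_ge0 -[leRHS]expR0 ler_expR; lra.
  apply: le_trans (phi_hits (@blk N') kb p01 (fun=> expR_ge0 _) (img eta (f1 0 0)) w).
  rewrite /hit_const ler_wpM2l// thin_hit; apply: (thin_hit_large p01); apply: (le_trans ec).
  have [p0 _] := andP p01; rewrite ler_wpM2l// ler_nat.
  rewrite -(card_in_imset (f := @blk N' kb) (D := mem [set i : Pt N' | `[< D w (pos i) >]]%SET)); last first.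
    move=> x y; rewrite !inE => /asboolP Dx /asboolP Dy.
    by move=> bxy; exact: (labels_sep de0 (DI w) (nt w Ew) (asboolW Dx) (asboolW Dy) bxy).
  apply/subset_leq_card/fintype.subsetP => b /imsetP[i]; rewrite inE => /asboolP [Ii nN'] ->.
  rewrite inE; apply/existsP; exists i; rewrite eqxx /= /w1 -expRD -[leLHS]expR0 ler_expR /img /f1 !mul0r !addr0.
  have /(proj1 (@T_pos R beta gamma N' (fun x => h x w) beta0 N2 de^-1 i dp)) : T beta gamma N (fun x => h x w) de^-1 (pos i).
    split; first by case: Ii => [[[]]].
    rewrite /= in_itv /= andbT; case: (Ii) => [[[_ +] _] _]; rewrite /= in_itv /= andbT => ti.
    by apply: contrapT => /negP; rewrite -ltNge => /ltW hn; apply: nN'; split => //; rewrite ti.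
  by rewrite /t /eta /field; lra.
rewrite lee_fin ler_pM2r ?invr_gt0 ?hit_const_gt0//.
have L0 : 0 <= Ldelta de^-1.
  have q : 0 <= alpha R / beta by rewrite divr_ge0 // ltW // alpha_gt0.
  by apply: mulr_ge0 => //; exact: ln_ge0.
have k0N : (2 ^ 0 <= N'.+1)%N by [].
apply: (phi0_block meta chareta lineta nN k0N cdist_ge0 HC) => //.
have := T0_bounds de^-1; rewrite ler_norml => /andP[_ h1].
case/andP: kbn => kb0 kbn; have := ln_sub_le kbn kb0; rewrite subn0; have := u0; rewrite /t; lra.
Qed.

End FixedSize.

Lemma sum_sub_le (R : realType) (s s' : seq nat) (F : nat -> R) : uniq s -> uniq s' -> {subset s <= s'} -> (forall k, 0 <= F k) ->
  \sum_(k <- s) F k <= \sum_(k <- s') F k.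
Proof.
elim: s s' => [|k s IH] s' /=; first by move=> _ _ _ F0; rewrite big_nil sumr_ge0.
move=> /andP[ks us] us' sub F0; have ks' : k \in s' by apply: sub; rewrite mem_head.
rewrite big_cons [leRHS](big_rem k)//= lerD2l; apply: IH => //; first exact: rem_uniq.
move=> j js; rewrite mem_rem_uniq// inE sub ?inE ?js ?orbT// andbT.
by apply: contraNneq ks => <-.
Qed.

(** * Summation over the scales *)

Section NumericBounds.

Variables (R : realType) (c1 : R).

Hypothesis c10 : 0 <= c1.

Let tc := tree_const c1.

Let tc0 : 0 <= tc. Proof. exact: (tree_const_ge0 c10). Qed.

Let pc := pass_const R.

Let pc0 : 0 <= pc. Proof. by rewrite /pc /pass_const mulr_ge0// ltW// lattice_const_gt0. Qed.

Lemma inv32E (m : nat) : (0 < m)%N -> (m%:R * Num.sqrt m%:R)^-1 = expR (- (3 / 2 * ln m%:R)) :> R.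
Proof. by move=> m0; rewrite t32E// ltr0n. Qed.

(** Up to logarithms the term is [e^(3 y / 2)], where [e^y = n / (k (n - k)) = 1/k + 1/(n - k)]. One
    factor [e^y] is kept for a harmonic sum; the remaining [e^(y/2)] is at most [sqrt (2 / X)] and
    provides the smallness. *)
Lemma full_le (n k : nat) (t u L Q X : R) : (0 < k < n)%N -> 0 <= u ->
  - (t - n%:R * v1 R) <= 3 / 2 * ln n%:R + u - L + 8 -> 1 + u + 3 * ln k%:R <= Q -> 0 < X -> X <= k%:R -> X <= (n - k)%:R ->
  full_bound n k c1 t u (Yk R k) <=
   (128 * expR (9 - L) * pc * tc) * Q ^+ 7 * expR ((ln 2 - ln X) / 2) * (k%:R^-1 + (n - k)%:R^-1).
Proof.
move=> /andP[k0 kn] u0 hT hQ X0 Xk Xn.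
have kR : 0 < k%:R :> R by rewrite ltr0n.
have mR : 0 < (n - k)%:R :> R by rewrite ltr0n subn_gt0.
have nR : 0 < n%:R :> R by rewrite ltr0n (leq_trans _ kn).
have l0 : 0 <= ln k%:R :> R by rewrite ln_ge0// ler1n.
have q1 : 1 <= 1 + u + 3 * ln k%:R by lra.
have nE : n%:R = k%:R + (n - k)%:R :> R by rewrite -natrD subnKC// ltnW.
rewrite /full_bound /Yk inv32E ?subn_gt0//.
set y := ln n%:R - ln k%:R - ln (n - k)%:R : R.
have ey : expR y = k%:R^-1 + (n - k)%:R^-1.
  rewrite /y !expRD !expRN !lnK ?posrE// nE; field.
  by rewrite !gt_eqF.
have yX : y <= ln 2 - ln X.
  rewrite -ler_expR ey expRD expRN !lnK ?posrE//.
  have i1 : k%:R^-1 <= X^-1 by rewrite lef_pV2.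
  have i2 : (n - k)%:R^-1 <= X^-1 by rewrite lef_pV2.
  lra.
have qQ : (1 + u + 3 * ln k%:R) ^+ 6 * (1 + (15 + 3 / 2 * ln k%:R)) <= 16 * Q ^+ 7.
  rewrite [Q ^+ 7]exprSr mulrCA; apply: ler_pM.
  - by rewrite exprn_ge0//; lra.
  - by lra.
  - by rewrite lerXn2r ?nnegrE//; lra.
  - by lra.
have E : expR (1 - (t - n%:R * v1 R)) * expR (- (3 / 2 * ln k%:R + u)) * expR (- (3 / 2 * ln (n - k)%:R)) <= expR (9 - L) * (expR y * expR ((ln 2 - ln X) / 2)).
  by rewrite -!expRD ler_expR /y; move: yX; rewrite /y => yX; lra.
rewrite -ey.
have := ler_pM (mulr_ge0 (mulr_ge0 (expR_ge0 _) (expR_ge0 _)) (expR_ge0 _)) _ E qQ.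
have Q0 : 0 <= (1 + u + 3 * ln k%:R) ^+ 6 * (1 + (15 + 3 / 2 * ln k%:R)) by rewrite mulr_ge0 ?exprn_ge0//; lra.
move=> /(_ Q0) H.
have := ler_wpM2l (mulr_ge0 pc0 (mulr_ge0 (ler0n R 8) tc0)) H.
set e1 := expR (1 - _); set e2 := expR (- (_ + u)); set e3 := expR (- _); set e4 := expR (9 - L); set e5 := expR y; set e6 := expR (_ / 2).
rewrite -/tc -/pc; move: ((1 + u + 3 * ln k%:R) ^+ 6) (1 + (15 + _)) (Q ^+ 7) => a b c.
move: e1 e2 e3 e4 e5 e6 pc tc; clear => e1 e2 e3 e4 e5 e6 pc tc H.
apply: le_trans (_ : pc * (8 * tc) * (e1 * e2 * e3 * (a * b)) <= _).
  by rewrite le_eqVlt; apply/orP; left; apply/eqP; ring.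
by apply: (le_trans H); rewrite le_eqVlt; apply/orP; left; apply/eqP; ring.
Qed.

Lemma sum_full_le (n : nat) (ks : seq nat) (t u L Q X : R) : uniq ks -> (0 < n)%N -> 0 <= u ->
  - (t - n%:R * v1 R) <= 3 / 2 * ln n%:R + u - L + 8 -> 1 + u + 3 * ln n%:R <= Q -> 0 < X ->
  (forall k, k \in ks -> [/\ (0 < k < n)%N, X <= k%:R & X <= (n - k)%:R]) ->
  \sum_(k <- ks) 4 * full_bound n k c1 t u (Yk R k) <= (1024 * expR (9 - L) * pc * tc) * Q ^+ 8 * expR ((ln 2 - ln X) / 2).
Proof.
move=> uk n0 u0 hT hQ X0 hk.
have ln0 : 0 <= ln n%:R :> R by rewrite ln_ge0// ler1n.
set K := (128 * expR (9 - L) * pc * tc) * Q ^+ 7 * expR ((ln 2 - ln X) / 2).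
have K0 : 0 <= K.
  have Q0 : 0 <= Q by lra.
  rewrite /K; apply: mulr_ge0; last exact: expR_ge0.
  apply: mulr_ge0; last exact: exprn_ge0.
  by apply: mulr_ge0 => //; apply: mulr_ge0 => //; apply: mulr_ge0 => //; exact: expR_ge0.
pose g (k : nat) : R := k%:R^-1 + (n - k)%:R^-1.
have g0 k : 0 <= g k by rewrite addr_ge0// invr_ge0.
apply: (@le_trans _ _ (\sum_(k <- ks) 4 * (K * g k))).
  rewrite big_seq [leRHS]big_seq; apply: ler_sum => k /hk[k0n Xk Xn]; rewrite ler_pM2l//.
  apply: full_le => //; apply: le_trans hQ; rewrite lerD2l ler_pM2l// ler_ln ?posrE ?ltr0n//; last by case/andP: k0n.
  by rewrite ler_nat; case/andP: k0n => _ /ltnW.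
rewrite -mulr_sumr -mulr_sumr.
have H : \sum_(k <- ks) g k <= 2 * Q.
  apply: (@le_trans _ _ (\sum_(1 <= k < n) g k)).
    apply: sum_sub_le => //; first exact: iota_uniq.
    by move=> k /hk[]; rewrite mem_index_iota.
  rewrite /g big_split/= [X in _ + X](_ : _ = \sum_(1 <= k < n) (k%:R : R)^-1); last first.
    by rewrite big_nat_rev/=; apply: eq_big_nat => k /andP[k1 k2]; congr (_%:R^-1); move: k1 k2; clear; lia.
  have n1 : (0 < 1 <= n)%N by [].
  have /andP[_] := harmonic_bounds R n1; rewrite ln1 invr1.
  have : 0 <= (n%:R : R)^-1 by rewrite invr_ge0.
  by move: (\sum_(1 <= _ < _) _) => S; lra.
have := ler_wpM2l (mulr_ge0 (ler0n _ 4) K0) H; rewrite -mulrA => h'; apply: (le_trans h').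
rewrite /K le_eqVlt; apply/orP; left; apply/eqP; ring.
Qed.

Lemma pow_log_le (y : R) : 0 <= y -> (1 + 3 * y) ^+ 8 <= 96 ^+ 8 * expR (y / 4).
Proof.
move=> y0; have -> : expR (y / 4) = expR (y / 32) ^+ 8 by rewrite -expRM_natr; congr expR; field.
rewrite -exprMn lerXn2r ?nnegrE ?mulr_ge0 ?expR_ge0//; first by lra.
have := expR_ge1Dx (y / 32); lra.
Qed.

(** [n <= 8 (kb - k)] makes the factor above level [k] cancel [n^(3/2)]. Eight powers of [ln k] are
    absorbed by [k^(1/4)], so [k^(-5/4)] remains of [k^(-3/2)]; the barrier term [k^-2] is
    smaller. *)
Lemma block_le (n k kb : nat) (t u L : R) : (0 < k < kb)%N -> (kb <= n)%N -> (n <= 8 * (kb - k))%N -> 0 <= u ->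
  - (t - n%:R * v1 R) <= 3 / 2 * ln n%:R + u - L + 8 ->
  block_bound n k c1 t (expR (- u)) kb (2 * ln k%:R) (Yk R k) <=
   (4 + 128 * 96 ^+ 8 * expR (20 - L) * pc * tc) * expR (- (5 / 4 * ln k%:R)).
Proof.
move=> /andP[k0 kkb] kbn n8 u0 hT.
have kR : 0 < k%:R :> R by rewrite ltr0n.
have mR : 0 < (kb - k)%:R :> R by rewrite ltr0n subn_gt0.
have nR : 0 < n%:R :> R by rewrite ltr0n (leq_trans _ kbn)// (leq_trans _ kkb).
have l0 : 0 <= ln k%:R :> R by rewrite ln_ge0// ler1n.
have ln8 : ln n%:R <= ln (kb - k)%:R + 7 :> R.
  apply: (@le_trans _ _ (ln (8 * (kb - k)%:R))); first by rewrite ler_ln ?posrE ?mulr_gt0// -natrM ler_nat.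
  by rewrite lnM ?posrE// addrC lerD2l; have := ln_le_sub1 (ltr0n _ 8 : 0 < 8 :> R); lra.
rewrite /block_bound /Yk inv32E ?subn_gt0// !addr0 [leRHS]mulrDl; apply: lerD.
  by rewrite ler_pM2l// ler_expR; lra.
have qQ : (1 + 3 * ln k%:R) ^+ 6 * (1 + (15 + 3 / 2 * ln k%:R)) * (1 + 2 * ln k%:R) <= 16 * (96 ^+ 8 * expR (ln k%:R / 4)) :> R.
  apply: (@le_trans _ _ (16 * (1 + 3 * ln k%:R) ^+ 8)); last by rewrite ler_pM2l// pow_log_le.
  have -> : 16 * (1 + 3 * ln k%:R) ^+ 8 = (1 + 3 * ln k%:R) ^+ 6 * (16 * (1 + 3 * ln k%:R)) * (1 + 3 * ln k%:R) :> R by ring.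
  have e6 : 0 <= (1 + 3 * ln k%:R) ^+ 6 :> R by rewrite exprn_ge0//; lra.
  apply: ler_pM; [by apply: mulr_ge0 => //; lra|lra| |lra].
  by apply: ler_wpM2l => //; lra.
have E : expR (1 - (t - n%:R * v1 R)) * expR (- u) * expR (- (3 / 2 * ln k%:R)) * expR (- (3 / 2 * ln (kb - k)%:R)) <= expR (20 - L) * expR (- (3 / 2 * ln k%:R)).
  by rewrite -!expRD ler_expR; lra.
have Q0 : 0 <= (1 + 3 * ln k%:R) ^+ 6 * (1 + (15 + 3 / 2 * ln k%:R)) * (1 + 2 * ln k%:R) :> R.
  by apply: mulr_ge0; [apply: mulr_ge0; [rewrite exprn_ge0//; lra|lra]|lra].
have H := ler_pM (mulr_ge0 (mulr_ge0 (mulr_ge0 (expR_ge0 _) (expR_ge0 _)) (expR_ge0 _)) (expR_ge0 _)) Q0 E qQ.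
have := ler_wpM2l (mulr_ge0 pc0 (mulr_ge0 (ler0n R 8) tc0)) H.
have -> : expR (- (5 / 4 * ln k%:R)) = expR (- (3 / 2 * ln k%:R)) * expR (ln k%:R / 4) :> R by rewrite -expRD; congr expR; field.
rewrite -/tc -/pc; move: (96 ^+ 8) => c96; clear E H qQ Q0.
set e1 := expR (1 - _); set e2 := expR (- u); set e3 := expR (- (3 / 2 * ln k%:R)); set e4 := expR (20 - L); set e5 := expR (_ / 4); set e6 := expR (- _).
move: ((1 + 3 * ln k%:R) ^+ 6) (1 + (15 + _)) (1 + 2 * _) => a b c.
move: e1 e2 e3 e4 e5 e6 pc tc; clear => e1 e2 e3 e4 e5 e6 pc tc H.
apply: le_trans (_ : pc * (8 * tc) * (e1 * e2 * e3 * e6 * (a * b * c)) <= _).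
  by rewrite le_eqVlt; apply/orP; left; apply/eqP; ring.
by apply: (le_trans H); rewrite le_eqVlt; apply/orP; left; apply/eqP; ring.
Qed.

(** Telescoping with the majorant [24 k^(-1/8)], whose increments dominate [k^(-9/8)]. *)
Lemma sum_pow_le (n : nat) : \sum_(1 <= k < n.+1) expR (- (9 / 8 * ln k%:R)) <= 25 - 24 * expR (- (1 / 8 * ln n.+1%:R)) :> R.
Proof.
elim: n => [|n IH]; first by rewrite big_geq// ln1 mulr0 oppr0 expR0; lra.
rewrite big_nat_recr//=; set m := n.+1 in IH *.
have mR : 0 < m%:R :> R by rewrite ltr0n.
have m1 : 1 <= m%:R :> R by rewrite ler1n.
have m1R : 0 < m.+1%:R :> R by rewrite ltr0n.
have mE : m.+1%:R = m%:R + 1 :> R by rewrite natr1.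
have a : ln m%:R + m.+1%:R^-1 <= ln m.+1%:R :> R.
  have : ln m%:R - ln m.+1%:R <= m%:R / m.+1%:R - 1 :> R.
    by rewrite -ln_div ?posrE//; apply: ln_le_sub1; rewrite divr_gt0.
  have -> : m%:R / m.+1%:R - 1 = - (m.+1%:R^-1) :> R by rewrite mE; field; rewrite gt_eqF// -mE.
  by move: (ln m%:R) (ln m.+1%:R) (m.+1%:R^-1) => p q z; lra.
apply: le_trans (lerD IH (lexx _)) _.
set e := expR (- (1 / 8 * ln m%:R)); have e0 : 0 <= e by exact: expR_ge0.
have e1 : expR (- (9 / 8 * ln m%:R)) = e * m%:R^-1.
  by rewrite -{2}[m%:R]lnK ?posrE// -expRN -expRD; congr expR; field.
pose y : R := (8 * m.+1%:R)^-1; have y0 : 0 < y by rewrite invr_gt0 mulr_gt0.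
have e2 : expR (- (1 / 8 * ln m.+1%:R)) <= e * (1 + y)^-1.
  apply: (@le_trans _ _ (e * expR (- y))).
    by rewrite -expRD ler_expR /y invfM; move: a; move: (ln _) (ln _) (_^-1) => p q r; lra.
  by rewrite ler_wpM2l// expRN lef_pV2 ?posrE ?expR_gt0 ?expR_ge1Dx//; lra.
have key : m%:R^-1 + 24 * (1 + y)^-1 <= 24.
  rewrite /y mE; move: (m%:R : R) m1 => x x1; have x0 : 0 < x by lra.
  have y0' : (1 + (8 * (x + 1))^-1)^-1 = 1 - (8 * x + 9)^-1.
    by field; rewrite !gt_eqF//; lra.
  have : 24^-1 * x^-1 <= (8 * x + 9)^-1 by rewrite -invfM lef_pV2 ?posrE; lra.
  by rewrite y0'; move: (x^-1) ((8 * x + 9)^-1) => p q; lra.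
rewrite e1.
have := ler_wpM2l e0 key; move: e2; rewrite mulrDr; move: (expR (- (1 / 8 * ln m.+1%:R))) => z.
move: (m%:R^-1) ((1 + y)^-1) => p q; rewrite mulrCA; move: (e * q) (e * p) => eq ep; lra.
Qed.

(** Of [k^(-5/4)] the part [k^(-1/8)] gives smallness in the least scale [K], and [k^(-9/8)] is
    summable. *)
Lemma sum_block_le (n kb : nat) (ks : seq nat) (t u L K : R) : uniq ks -> 0 <= u -> 0 < K ->
  - (t - n%:R * v1 R) <= 3 / 2 * ln n%:R + u - L + 8 -> (kb <= n)%N ->
  (forall k, k \in ks -> [/\ (0 < k < kb)%N, (n <= 8 * (kb - k))%N & K <= k%:R]) ->
  \sum_(k <- ks) 4 * block_bound n k c1 t (expR (- u)) kb (2 * ln k%:R) (Yk R k) <=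
   100 * (4 + 128 * 96 ^+ 8 * expR (20 - L) * pc * tc) * expR (- (1 / 8 * ln K)).
Proof.
move=> uk u0 K0 hT kbn hk; set C := 4 + _; have C0 : 0 <= C.
  have c96 : 0 <= 96 ^+ 8 :> R by exact: exprn_ge0.
  exact: addr_ge0 (ler0n _ 4) (mulr_ge0 (mulr_ge0 (mulr_ge0 (mulr_ge0 (ler0n _ 128) c96) (expR_ge0 _)) pc0) tc0).
set E := expR (- (1 / 8 * ln K)).
apply: (@le_trans _ _ (\sum_(k <- ks) 4 * C * E * expR (- (9 / 8 * ln k%:R)))).
  rewrite big_seq [leRHS]big_seq; apply: ler_sum => k /hk[k0b n8 Kk].
  rewrite -!mulrA ler_pM2l//; apply: (le_trans (block_le k0b kbn n8 u0 hT)); rewrite -/C ler_wpM2l//.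
  rewrite /E -expRD ler_expR.
  have : ln K <= ln k%:R by rewrite ler_ln ?posrE//; apply: lt_le_trans Kk.
  lra.
rewrite -mulr_sumr; have E0 : 0 <= E by exact: expR_ge0.
have H : \sum_(k <- ks) expR (- (9 / 8 * ln k%:R)) <= 25 :> R.
  apply: (@le_trans _ _ (\sum_(1 <= k < kb.+1) expR (- (9 / 8 * ln k%:R)))).
    apply: sum_sub_le => //; first exact: iota_uniq.
    by move=> k /hk[/andP[h1 h2] _ _]; rewrite mem_index_iota h1 ltnS ltnW.
  apply: (le_trans (sum_pow_le kb)).
  by have := expR_ge0 (- (1 / 8 * ln kb.+1%:R) : R); lra.
have := ler_wpM2l (mulr_ge0 (mulr_ge0 (ler0n _ 4) C0) E0) H => h'; apply: (le_trans h').
by rewrite le_eqVlt; apply/orP; left; apply/eqP; ring.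
Qed.

End NumericBounds.

(** * Limits, superior limits and iterated logarithms *)

Lemma small_cvge (R : realType) (U : Type) (F : set_system U) (FF : Filter F) (f : U -> \bar R) :
  (forall x, 0 <= f x)%E -> (forall e : R, 0 < e -> \forall x \near F, (f x <= e%:E)%E) ->
  f x @[x --> F] --> 0%E.
Proof.
move=> f0 fe A /= hA; have : nbhs (0 : R) (fun r : R => A r%:E) by exact: hA.
move=> /nbhs_ballP[e /= e0 eA].
have := fe _ (divr_gt0 e0 (ltr0n R 2)); apply: filterS => x; move: (f0 x).
rewrite /preimage/=; case: (f x) => [r| |]//; rewrite !lee_fin => r0 re; apply: (eA r).
by rewrite /ball/= sub0r normrN ger0_norm//; lra.
Qed.

Lemma limn_esup_le (R : realType) (f : nat -> \bar R) (C : \bar R) :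
  (\forall N \near \oo, (f N <= C)%E) -> (limn_esup f <= C)%E.
Proof.
case=> m _ hm; rewrite limn_esup_lim (cvg_lim _ (@cvg_esups_inf _ f))//.
apply: (@le_trans _ _ (esups f m)); first by apply: ereal_inf_lbound; exists m.
by apply: ge_ereal_sup => _ [k /= mk <-]; exact: hm.
Qed.

Lemma limn_esup_ge0 (R : realType) (f : nat -> \bar R) : (forall N, 0 <= f N)%E -> (0 <= limn_esup f)%E.
Proof.
move=> f0; rewrite limn_esup_lim (cvg_lim _ (@cvg_esups_inf _ f))//.
apply: le_ereal_inf_tmp => _ [m _ <-]; apply: (le_trans (f0 m)).
by apply: ereal_sup_ubound; exists m => /=.
Qed.

Lemma lnln_infty (R : realType) (A : R) : \forall N \near \oo, A <= ln (logN R N).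
Proof.
have := nbhs_infty_ger (expR (expR A) : R); apply: filterS => N hN.
have N0 : 0 < N%:R :> R by apply: lt_le_trans hN; exact: expR_gt0.
have L : expR A <= logN R N by rewrite /logN -[leLHS]expRK ler_ln ?posrE ?expR_gt0.
by rewrite -[leLHS]expRK ler_ln ?posrE ?expR_gt0//; apply: lt_le_trans L; exact: expR_gt0.
Qed.

(** [ln x <= x - 1] at [x = l / (2 p)] gives [p ln l <= l/2 + p ln (2 p)]. With [l = ln ln N] it
    says that [ln r_N] is at most [ln N / 64] for large [N]. *)
Lemma powR_le_expR (R : realType) (p C : R) : 1 <= p ->
  exists A : R, forall l, A <= l -> [/\ 1 <= l, C <= l & 64 * l `^ p <= expR l].
Proof.
move=> p1; exists (Num.max 1 (Num.max C (2 * (p * ln (2 * p) + 64)))) => l.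
rewrite !ge_max => /and3P[l1 Cl hl]; split => //.
have l0 : 0 < l by lra.
have p0 : 0 < p by lra.
rewrite /powR (gt_eqF l0).
have e64 : 64 <= expR 64 :> R by have := expR_ge1Dx (64 : R); lra.
apply: (@le_trans _ _ (expR 64 * expR (p * ln l))); first by rewrite ler_wpM2r ?expR_ge0.
rewrite -expRD ler_expR.
have : ln (l / (2 * p)) <= l / (2 * p) - 1 by apply: ln_le_sub1; rewrite divr_gt0 ?mulr_gt0.
rewrite ln_div ?posrE ?mulr_gt0// => h.
have : p * (ln l - ln (2 * p)) <= p * (l / (2 * p) - 1) by rewrite ler_wpM2l// ltW.
have -> : p * (l / (2 * p) - 1) = l / 2 - p by field; rewrite gt_eqF.
rewrite mulrBr; move: (p * ln l) (p * ln (2 * p)) hl p0 => a b; clear; lra.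
Qed.

(** * Choice of the number of levels and of the block size *)

Section Scales.

Variables (R : realType) (gamma : R) (N' : nat).

Let N := N'.+1.

Let l : R := ln (logN R N).

Let p : R := 100 * (2 + gamma).

Let rho : R := l `^ p.

Hypotheses (gamma0 : 0 < gamma) (l1 : 1 <= l) (rho64 : 64 * rho <= expR l).

(** [ln] is 0 on nonpositive numbers, so [l >= 1] excludes a nonpositive [logN]. *)
Lemma logNE : logN R N = expR l.
Proof.
rewrite lnK// posrE ltNge; apply/negP => L; have := l1; rewrite /l ln0//; lra.
Qed.

Lemma rNE : rN gamma N = expR rho. Proof. by []. Qed.

Lemma rho_ge : l <= rho.
Proof. by rewrite -[leLHS]powRr1 ?ler_powR// /p; have := l1; have := gamma0; lra. Qed.

Lemma rho_ge1 : 1 <= rho. Proof. exact: le_trans rho_ge. Qed.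

Lemma logN_ge : 64 <= logN R N.
Proof. by rewrite logNE; have := rho64; have := rho_ge1; lra. Qed.

Lemma logN_ge1 : 1 <= logN R N. Proof. have := logN_ge; lra. Qed.

Lemma NE : N%:R = expR (logN R N) :> R.
Proof. by rewrite /logN lnK// posrE ltr0n. Qed.

Lemma N_ge3 : (3 <= N)%N.
Proof.
rewrite -(ler_nat R) NE; have := expR_ge1Dx (logN R N); have := logN_ge.
by move=> a b; lra.
Qed.

Lemma N_gt1 : (1 < N)%N. Proof. exact: ltnW N_ge3. Qed.

Lemma rN_ge2 : 2 <= rN gamma N.
Proof. by rewrite rNE; have := expR_ge1Dx rho; have := rho_ge1; lra. Qed.

Lemma rN_small : rN gamma N <= N%:R / rN gamma N.
Proof.
by rewrite rNE NE -expRN -expRD ler_expR logNE; have := rho64; have := rho_ge1; lra.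
Qed.

Lemma u_ge0 : 0 <= gamma * l.
Proof. by rewrite mulr_ge0//; have := gamma0; have := l1; lra. Qed.

(** [n] is the least exponent with [2 N <= 2^n], so one block of level [n] contains the box; [kb] is
    the largest with [2^kb <= N / r_N]. As [ln r_N <= ln N / 64], the scales up to [2 r_N] are far
    below [kb], which is itself comparable with [n]. *)
Lemma scale_exists : exists n kb : nat, [/\ (2 * N <= 2 ^ n)%N, (2 ^ n <= 4 * N)%N,
  (2 ^ kb)%:R <= N%:R / rN gamma N, (0 < kb <= n)%N &
  (n <= 8 * kb)%N /\ forall k, (2 ^ k)%:R <= 2 * rN gamma N -> [/\ (k < kb)%N, (n <= 8 * (kb - k))%N & (2 ^ k <= N)%N]].
Proof.
have A1 (a b c e f : R) : c - e <= a + f -> b <= e + f -> 1 <= e -> 64 * e <= c -> f <= 1 -> b + f <= a by lra.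
have A2 (a b b' c e f : R) : c - e <= a + f -> b <= e + f -> 64 * e <= c -> 64 <= c -> f <= 1 -> b' <= c + 2 * f -> b' <= 8 * (a - b) by lra.
have A3 (a b c e f : R) : a <= c - e -> c + f <= b -> 1 <= e -> 1 / 2 <= f -> a <= b by lra.
have A4 (f : R) : 1 / 2 <= f -> 0 < f by lra.
have A5 (e f : R) : 1 <= e -> 1 / 2 <= f -> 0 <= e + f by lra.
have /andP[g1 g2] := ln2_bounds R; have g0 := A4 _ g1.
have := logN_ge; have := rho64; have := rho_ge1; rewrite -logNE => r1 r64 L64.
have n1 : (1 < 2 * N)%N := leq_mul (leqnn 2) (ltn0Sn N').
have /andP[na nb] := up_log_bounds (isT : (1 < 2)%N) n1.
set n := up_log 2 _ in na nb.
have n0 : (0 < n)%N by rewrite lt0n; apply: contraTneq nb => ->; rewrite expn0 -ltnNge.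
have n_lo := nb.
have n_hi : (2 ^ n <= 4 * N)%N by rewrite -(prednK n0) expnS -[4%N]/(2 * 2)%N -mulnA leq_mul2l ltnW.
have N0 : 0 < N%:R :> R by rewrite ltr0n.
have X0 : 1 <= N%:R / rN gamma N by apply: le_trans rN_small; have := rN_ge2; lra.
have Xlt := truncn_itv (le_trans ler01 X0); set X := N%:R / rN gamma N in X0 Xlt.
have m0 : (0 < Num.truncn X)%N by rewrite truncn_gt0.
have /andP[ka kb'] := trunc_log_bounds (isT : (1 < 2)%N) m0.
set kb := trunc_log 2 _ in ka kb'; exists n, kb.
move: Xlt => /andP[Xa Xb].
have Xp : X \in Num.pos by rewrite posrE (lt_le_trans ltr01 X0).
have pp k : (2 ^ k)%:R \in @Num.pos R by rewrite posrE ltr0n expn_gt0.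
have kX : (2 ^ kb)%:R <= X by apply: le_trans Xa; rewrite ler_nat.
have Xk : X < (2 ^ kb.+1)%:R by apply: (lt_le_trans Xb); rewrite ler_nat.
have lX : ln X = logN R N - rho by rewrite /X rNE NE -expRN -expRD expRK.
have kb_hi : kb%:R * ln 2 <= logN R N - rho :> R.
  by rewrite -lX -ln_pow2 (ler_ln (pp _) Xp).
have kb_lo : logN R N - rho <= kb%:R * ln 2 + ln 2 :> R.
  have -> : kb%:R * ln 2 + ln 2 = kb.+1%:R * ln 2 :> R by rewrite -natr1; ring.
  by rewrite -lX -ln_pow2 (ler_ln Xp (pp _)) ltW.
have /andP[n_l n_h] := n_ln R n_lo n_hi; rewrite -/N -/(logN R N) in n_l n_h.
have fromln (a b : nat) : a%:R * ln 2 <= b%:R * ln 2 :> R -> (a <= b)%N by rewrite ler_pM2r// ler_nat.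
have n8 (k : nat) : k%:R * ln 2 <= rho + ln 2 :> R -> (k < kb)%N /\ (n <= 8 * (kb - k))%N.
  move=> hk; have kkb : (k < kb)%N.
    apply: fromln; rewrite -natr1 mulrDl mul1r; exact: A1 kb_lo hk r1 r64 g2.
  split => //; apply: fromln; rewrite natrM natrB ?(ltnW kkb)// -mulrA mulrBl.
  exact: A2 kb_lo hk r64 L64 g2 n_h.
have [kb0 n8kb] : (0 < kb)%N /\ (n <= 8 * kb)%N.
  by have := n8 0%N; rewrite mul0r subn0; apply; exact: A5 r1 g1.
split => //.
  rewrite kb0/=; apply: fromln; exact: A3 kb_hi n_l r1 g1.
split=> // k hk; have [|k1 k2] := n8 k.
  rewrite -ln_pow2 addrC; have -> : ln 2 + rho = ln (2 * rN gamma N) :> R by rewrite rNE lnM ?posrE ?expR_gt0// expRK.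
  by rewrite (ler_ln (pp k))// posrE rNE mulr_gt0 ?expR_gt0.
split => //; rewrite -(ler_nat R); apply: (le_trans hk).
have r2 := rN_ge2; have rp : 0 < rN gamma N by exact: lt_le_trans r2.
by move: rN_small; rewrite (ler_pdivlMr _ _ rp) => b; apply: le_trans b; rewrite ler_wpM2r// ltW.
Qed.

End Scales.

Lemma pow2_exp_gt0 (N' n : nat) : (2 * N'.+1 <= 2 ^ n)%N -> (0 < n)%N.
Proof. by case: n => //; rewrite expn0; lia. Qed.

(** Excludes [N = 0]: by the default values of [ln] the iterated logarithm is 0 there, hence not at
    least 1. *)
Lemma lnln0 (R : realType) : ln (logN R 0) = 0.
Proof. by rewrite /logN (_ : ln 0%:R = 0) ?ln0. Qed.

Lemma expR_small (R : realType) (C e : R) : 0 <= C -> 0 < e ->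
  exists2 Y : R, 0 <= Y & forall y, Y <= y -> C * expR (- y) <= e.
Proof.
move=> C0 e0; exists (C / e); first by rewrite divr_ge0// ltW.
move=> y; rewrite ler_pdivrMr// => Cy; rewrite expRN ler_pdivrMr ?expR_gt0// mulrC.
by apply: (le_trans Cy); rewrite ler_wpM2r ?ltW//; have := expR_ge1Dx y; lra.
Qed.

Lemma le_of_expR_pow2 (R : realType) (x : R) (k : nat) : expR x <= (2 ^ k)%:R -> x <= k%:R.
Proof.
move=> h; have : x <= ln (2 ^ k)%:R by rewrite -[leLHS]expRK ler_ln ?posrE ?expR_gt0 ?ltr0n ?expn_gt0.
rewrite ln_pow2 => h'; apply: (le_trans h'); rewrite ler_piMr//.
by have /andP[] := ln2_bounds R.
Qed.

(** * Smallness of the three probabilities for large boxes *)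

Section FieldLimits.

Variables (R : realType)
  (dS : measure_display) (OmegaS : measurableType dS)
  (PS : Z2 -> probability OmegaS R) (S : nat -> OmegaS -> Z2)
  (hS : forall x : Z2, simple_random_walk (PS x) x S)
  (d : nat -> measure_display)
  (Omega : forall N : nat, measurableType (d N))
  (P : forall N : nat, probability (Omega N) R)
  (h : forall N : nat, Z2 -> {RV (P N) >-> R})
  (hh : forall N : nat, (3 <= N)%N -> dgff PS S N (h N))
  (beta gamma epsilon : R)
  (hbeta : 0 < beta) (hgamma0 : 0 < gamma) (hgamma1 : gamma < 1)
  (hepsilon : 0 < epsilon).

Let p : R := 100 * (2 + gamma).

Let p1 : 1 <= p. Proof. by rewrite /p; have := hgamma0; lra. Qed.

Let hc := hit_const epsilon.

Let hc0 : 0 < hc. Proof. exact: hit_const_gt0. Qed.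

Let pc := pass_const R.

Let pc0 : 0 <= pc. Proof. by rewrite /pc /pass_const mulr_ge0// ltW// lattice_const_gt0. Qed.

Let tc := tree_const (cdist R).

Let tc0 : 0 <= tc. Proof. exact: (tree_const_ge0 (cdist_ge0 R)). Qed.

Lemma tlev_lower (N' n : nat) (de : R) : (2 * N'.+1 <= 2 ^ n)%N -> (2 ^ n <= 4 * N'.+1)%N -> 1 <= logN R N'.+1 ->
  - (tlev beta gamma N' de - n%:R * v1 R) <= 3 / 2 * ln n%:R + gamma * ln (logN R N'.+1) - Ldelta beta de + 8.
Proof.
move=> nlo nhi L1; have [nb _] := n_bounds nlo nhi L1.
have : ln (logN R N'.+1) <= ln n%:R.
  have L0 := lt_le_trans ltr01 L1.
  by rewrite ler_ln ?posrE// (lt_le_trans L0).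
have := T0_bounds gamma hbeta nlo nhi L1 de; rewrite ler_norml => /andP[a _] b.
have A1 (x y z w g : R) : - 4 <= x - (- (3 / 2 * y) - g + w) + 4 -> y <= z -> - x <= 3 / 2 * z + g - w + 8 by lra.
exact: A1 a b.
Qed.

Lemma stmt2_eventually (de e : R) : 0 < de < 1 -> 0 < e -> exists A, forall N, A <= ln (logN R N) ->
  (P N [set w | (epsilon * kappa gamma N <
          (card_of (T beta gamma N (fun x => h N x w) de `\` IT beta gamma N (fun x => h N x w) de))%:R)%R] <= e%:E)%E.
Proof.
move=> de01 e0; set L := Ldelta beta de.
pose D := 1024 * expR (9 - L) * pc * tc.
have D0 : 0 <= D by exact: mulr_ge0 (mulr_ge0 (mulr_ge0 (ler0n _ 1024) (expR_ge0 _)) pc0) tc0.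
have c20 : 0 <= 20 ^+ 8 :> R by exact: exprn_ge0.
have C0 : 0 <= D * 20 ^+ 8 * expR 1 / hc by exact: divr_ge0 (mulr_ge0 (mulr_ge0 D0 c20) (expR_ge0 _)) (ltW hc0).
have [Y Y0 hY] := expR_small C0 e0.
have [A hA] := powR_le_expR (expR Y) p1; exists A => -[|N'] hN.
  by have [] := hA _ hN; rewrite lnln0 ler10.
set l := ln (logN R N'.+1) in hN *; have [l1 Yl r64] := hA _ hN.
have l0 : 0 < l := lt_le_trans ltr01 l1.
have L1 : 1 <= logN R N'.+1 := logN_ge1 hgamma0 l1 r64.
have N1 := N_gt1 hgamma0 l1 r64.
have u0 := u_ge0 hgamma0 l1.
have rr2 := rN_ge2 hgamma0 l1.
have rrN := rN_small hgamma0 l1 r64.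
have [n [_ [nlo nhi _ _ _]]] := scale_exists hgamma0 l1 r64.
have hN' := hh (N_ge3 hgamma0 l1 r64).
apply: le_trans (stmt2_fixed hS hN' hbeta hepsilon N1 nlo nhi u0 L1 rr2 rrN de01) _.
have rho1 := rho_ge1 hgamma0 l1; rewrite -/p in rho1.
have n0 := pow2_exp_gt0 nlo.
rewrite lee_fin ler_pdivrMr//.
(* [Q = 20 l] because [1 + u + 3 ln n <= 16 + 4 l]; [X = l^p] is [ln r_N], a lower bound for [k] and
   [n - k] at all scales between [r_N] and [N / r_N]. *)
apply: (@le_trans _ _ (D * (20 * l) ^+ 8 * expR ((ln 2 - ln (l `^ p)) / 2))).
  apply: (@sum_full_le R (cdist R) (cdist_ge0 R)) => //.
  - by rewrite filter_uniq// iota_uniq.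
  - exact: tlev_lower.
  - have [_ hn] := n_bounds nlo nhi L1; rewrite -/l in hn *.
    have : gamma * l <= 1 * l by apply: ler_wpM2r; [exact: ltW|exact: ltW].
    by move: hn l1; move: (ln n%:R) (gamma * l) => a b; lra.
  - exact: lt_le_trans rho1.
  - move=> k kk; have [k0n _ rk rnk] := ks2P nlo rr2 kk.
    by split => //; apply: le_of_expR_pow2; [exact: ltW rk|exact: rnk].
have hl : Y <= ln l by rewrite -[leLHS]expRK ler_ln ?posrE ?expR_gt0.
have := hY _ hl; rewrite mulrAC ler_pdivrMr// => H; apply: le_trans H.
(* The exponent 100 in [r_N] is used here: [p >= 200], so [l^(-p/2)] beats the eighth power of the
   logarithms. *)
have E : l ^+ 8 * expR ((ln 2 - ln (l `^ p)) / 2) <= expR 1 * expR (- ln l).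
  have -> : l ^+ 8 = expR (8 * ln l) by rewrite mulrC expRM_natr lnK.
  rewrite -!expRD ler_expR ln_powR.
  have lnl : 0 <= ln l by rewrite ln_ge0.
  have : 200 * ln l <= p * ln l by rewrite ler_wpM2r// /p; have := hgamma0; lra.
  have /andP[_] := ln2_bounds R.
  by move: lnl; move: (ln 2) (ln l) (p * ln l) => a b c; lra.
by have := ler_wpM2l (mulr_ge0 D0 c20) E; rewrite exprMn !mulrA.
Qed.

Lemma stmt3_eventually (de e : R) : 0 < de < 1 -> 0 < e -> exists M : R, forall r, M <= r ->
  exists A, forall N, A <= ln (logN R N) ->
  (P N [set w | (epsilon * kappa gamma N <
          (card_of (WTs beta gamma N (fun x => h N x w) de r))%:R)%R] <= e%:E)%E.
Proof.
have A1 (nv g el rh t l m L : R) : - 4 <= t - nv - (- (3 / 2 * l) - g + L) + 4 -> el <= m -> l <= rh -> g <= 1 * l ->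
    m * 2 <= nv -> - l <= L -> 64 * rh <= el -> 1 <= l -> 0 < t by lra.
move=> de01 e0; set L := Ldelta beta de.
pose D := 100 * (4 + 128 * 96 ^+ 8 * expR (20 - L) * pc * tc).
have c96 : 0 <= 96 ^+ 8 :> R by exact: exprn_ge0.
have D0 : 0 <= D.
  exact: mulr_ge0 (ler0n _ 100) (addr_ge0 (ler0n _ 4) (mulr_ge0 (mulr_ge0 (mulr_ge0 (mulr_ge0 (ler0n _ 128) c96) (expR_ge0 _)) pc0) tc0)).
have [Y Y0 hY] := expR_small (divr_ge0 D0 (ltW hc0)) e0.
(* Scales with [2^k > r] satisfy [k >= ln r], and the sum over them is of order [(ln r)^(-1/8)];
   this [r] makes it at most [e^(-Y)]. *)
exists (expR (expR (8 * Y))) => r rM.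
have r0 : 0 < r by apply: lt_le_trans rM; exact: expR_gt0.
have rK : expR (8 * Y) <= ln r by rewrite -[leLHS]expRK ler_ln ?posrE ?expR_gt0.
have K0 : 0 < ln r by apply: lt_le_trans rK; exact: expR_gt0.
have rY : Y <= 1 / 8 * ln (ln r).
  have : 8 * Y <= ln (ln r) by rewrite -[leLHS]expRK ler_ln ?posrE ?expR_gt0.
  by move: (ln (ln r)) => z; lra.
have r1 : 1 <= r by rewrite leNgt; apply/negP => r1; have := ln_lt0 (x := r); rewrite r0 r1 => /(_ isT); lra.
have [A hA] := powR_le_expR `|L| p1; exists A => -[|N'] hN.
  by have [] := hA _ hN; rewrite lnln0 ler10.
set l := ln (logN R N'.+1) in hN *; have [l1 Ll r64] := hA _ hN.
have l0 : 0 < l := lt_le_trans ltr01 l1.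
have L1 : 1 <= logN R N'.+1 := logN_ge1 hgamma0 l1 r64.
have N1 := N_gt1 hgamma0 l1 r64.
have u0 := u_ge0 hgamma0 l1.
have rr2 := rN_ge2 hgamma0 l1.
have rrN := rN_small hgamma0 l1 r64.
have [n [kb [nlo nhi kbhi kbn [n8 kP]]]] := scale_exists hgamma0 l1 r64.
have hN' := hh (N_ge3 hgamma0 l1 r64).
have kbn' : (kb <= n)%N by case/andP: kbn.
have t0 : 0 < tlev beta gamma N' de.
  have := T0_bounds gamma hbeta nlo nhi L1 de; rewrite ler_norml -/l -/L => /andP[a _].
  have [nL _] := n_bounds nlo nhi L1; rewrite (logNE l1) -/l in nL.
  have rl := rho_ge hgamma0 l1; rewrite -/l -/p in rl.
  have gl : gamma * l <= 1 * l by apply: ler_wpM2r; [exact: ltW|exact: ltW].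
  have nv : n%:R * 2 <= n%:R * v1 R by rewrite ler_wpM2l//; have /andP[] := v1_bounds R.
  move: Ll; rewrite ler_norml => /andP[Ll _].
  exact: A1 a nL rl gl nv Ll r64 l1.
have k3 k : k \in [seq k <- iota 0 n.+1 | r < (2 ^ k)%:R & (2 ^ k)%:R <= 2 * rN gamma N'.+1] ->
    [/\ (0 < k < kb)%N, (n <= 8 * (kb - k))%N, ln r <= k%:R & (2 ^ k <= N'.+1)%N].
  rewrite mem_filter => /andP[/andP[rk /kP[k1 k2 k3]] _]; split => //.
    by rewrite k1 andbT lt0n; apply: contraTneq rk => ->; rewrite expn0 -leNgt.
  by apply: le_of_expR_pow2; rewrite lnK ?posrE// ltW.
have h3 := stmt3_fixed hS hN' hbeta hepsilon N1 nlo nhi u0 L1 rr2 rrN kbhi de01 r1 t0.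
apply: le_trans (h3 _) _.
  by move=> k /k3[/andP[k0 kk] _ _ kN]; split.
rewrite lee_fin ler_pdivrMr//.
apply: (@le_trans _ _ (D * expR (- (1 / 8 * ln (ln r))))).
  apply: (@sum_block_le R (cdist R) (cdist_ge0 R)) => //.
  - by rewrite filter_uniq// iota_uniq.
  - exact: tlev_lower.
  - by move=> k /k3[].
by have := hY _ rY; rewrite mulrAC ler_pdivrMr.
Qed.

Lemma stmt1_eventually (e : R) : 0 < e -> exists2 M : R, 0 < M & forall de, 0 < de < M ->
  exists A, forall N, A <= ln (logN R N) ->
  (P N [set w | (epsilon * kappa gamma N <
          (card_of (DTs beta gamma N (fun x => h N x w) de))%:R)%R] <= e%:E)%E.
Proof.
have A1 (a b g x L : R) : a <= b + 7 -> - x <= 3 / 2 * a + g - L + 8 -> 1 - x + - g + - (3 / 2 * b) <= 20 + - L by lra.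
move=> e0; have nf0 : 0 <= noise_factor (cdist R) by exact: expR_ge0.
pose D := 4 * (4 + 16 * (expR 20 * (pc * noise_factor (cdist R)))).
have D0 : 0 <= D.
  exact: mulr_ge0 (ler0n _ 4) (addr_ge0 (ler0n _ 4) (mulr_ge0 (ler0n _ 16) (mulr_ge0 (expR_ge0 _) (mulr_ge0 pc0 nf0)))).
have [Y Y0 hY] := expR_small (divr_ge0 D0 (ltW hc0)) e0.
have ab : 0 < alpha R / beta by rewrite divr_gt0// alpha_gt0.
(* Makes [L = Ldelta de^-1] at least [2 Y]; half of [L] is spent on absorbing the factor [1 + L] in
   front of [e^(-L)]. *)
exists (expR (- (2 * Y / (alpha R / beta)))); first exact: expR_gt0.
move=> de /andP[de0 deM].
have M1 : expR (- (2 * Y / (alpha R / beta))) <= 1 :> R.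
  by rewrite -[leRHS]expR0 ler_expR oppr_le0; exact: divr_ge0 (mulr_ge0 (ler0n _ 2) Y0) (ltW ab).
have de01 : 0 < de < 1 by rewrite de0 (lt_le_trans deM M1).
set L := Ldelta beta de^-1.
have LY : Y <= L / 2.
  rewrite /L /Ldelta lnV ?posrE//.
  have : ln de <= - (2 * Y / (alpha R / beta)) by rewrite -[leRHS]expRK ler_ln ?posrE ?expR_gt0// ltW.
  rewrite lerNr => h1; have := ler_wpM2l (ltW ab) h1.
  by rewrite mulrCA mulfV ?gt_eqF// mulr1; lra.
have L0 : 0 <= L by lra.
have [A hA] := powR_le_expR (0 : R) p1; exists A => -[|N'] hN.
  by have [] := hA _ hN; rewrite lnln0 ler10.
set l := ln (logN R N'.+1) in hN *; have [l1 _ r64] := hA _ hN.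
have L1 : 1 <= logN R N'.+1 := logN_ge1 hgamma0 l1 r64.
have N1 := N_gt1 hgamma0 l1 r64.
have u0 := u_ge0 hgamma0 l1.
have rr2 := rN_ge2 hgamma0 l1.
have rrN := rN_small hgamma0 l1 r64.
have [n [kb [nlo nhi kbhi kbn [n8 _]]]] := scale_exists hgamma0 l1 r64.
have hN' := hh (N_ge3 hgamma0 l1 r64).
apply: le_trans (stmt1_fixed hS hN' hbeta hepsilon N1 nlo nhi u0 L1 rr2 rrN kbhi de01 kbn) _.
rewrite lee_fin ler_pdivrMr// -/l -/L -/pc.
have {}kbn : (0 < kb)%N by case/andP: kbn.
rewrite inv32E//.
have ln8 : ln n%:R <= ln kb%:R + 7 :> R.
  have n0 := pow2_exp_gt0 nlo.
  apply: (@le_trans _ _ (ln (8 * kb%:R))).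
    by rewrite ler_ln ?posrE ?mulr_gt0 ?ltr0n// -natrM ler_nat.
  by rewrite lnM ?posrE ?ltr0n// addrC lerD2l; have := ln_le_sub1 (ltr0n _ 8 : 0 < 8 :> R); lra.
have E : expR (1 - (tlev beta gamma N' de^-1 - n%:R * v1 R)) * expR (- (gamma * l)) * expR (- (3 / 2 * ln kb%:R)) <= expR 20 * expR (- L).
  rewrite -!expRD ler_expR; have := tlev_lower de^-1 nlo nhi L1; rewrite -/l -/L.
  exact: A1 ln8.
have LE : (1 + L) * expR (- L) <= 2 * expR (- (L / 2)).
  have -> : expR (- L) = expR (- (L / 2)) * expR (- (L / 2)) by rewrite -expRD; congr expR; field.
  rewrite mulrA ler_wpM2r ?expR_ge0// expRN ler_pdivrMr ?expR_gt0//.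
  by have := expR_ge1Dx (L / 2); lra.
have L1p : 0 <= 1 + L by lra.
have H1 := ler_wpM2l (mulr_ge0 (mulr_ge0 (ler0n R 16) (mulr_ge0 pc0 nf0)) L1p) E.
have H2 : expR (- L) <= (1 + L) * expR (- L) by rewrite ler_peMl ?expR_ge0//; lra.
have H := hY _ LY; rewrite mulrAC ler_pdivrMr// in H; apply: le_trans H.
have D4 : 0 <= D / 2 by rewrite divr_ge0.
have H3 : D / 2 * ((1 + L) * expR (- L)) <= D * expR (- (L / 2)).
  by apply: le_trans (ler_wpM2l D4 LE) _; rewrite mulrA divfK ?pnatr_eq0.
apply: le_trans H3; rewrite /D.
have -> : (1 + 15 : R) = 16 by ring.
set nf := noise_factor _ in nf0 H1 *.
move: H1 H2; set e1 := expR (1 - _); set e2 := expR (- (gamma * l)); set e3 := expR (- (3 / 2 * _)); set e4 := expR (- L); set e20 := expR 20.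
move=> H1 H2; set z := pc * nf in H1 *; set y := 1 + L in H1 H2 *.
have -> : e1 * (e2 * (z * e3) * 16 * y) = 16 * z * y * (e1 * e2 * e3) by ring.
have -> : 4 * (4 + 16 * (e20 * z)) / 2 * (y * e4) = 2 * (4 * (y * e4) + 16 * z * y * (e20 * e4)) by field.
by rewrite ler_pM2l// lerD// ler_pM2l.
Qed.

End FieldLimits.

(** * The three limits *)

Theorem theorem1p2 (R : realType)
  (dS : measure_display) (OmegaS : measurableType dS)
  (PS : Z2 -> probability OmegaS R) (S : nat -> OmegaS -> Z2)
  (hS : forall x : Z2, simple_random_walk (PS x) x S)
  (d : nat -> measure_display)
  (Omega : forall N : nat, measurableType (d N))
  (P : forall N : nat, probability (Omega N) R)
  (h : forall N : nat, Z2 -> {RV (P N) >-> R})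
  (hh : forall N : nat, (3 <= N)%N -> dgff PS S N (h N))
  (beta gamma epsilon : R)
  (hbeta : 0 < beta) (hgamma0 : 0 < gamma) (hgamma1 : gamma < 1)
  (hepsilon : 0 < epsilon) :
  [/\ limn_esup (fun N : nat =>
        P N [set w | epsilon * kappa gamma N <
          (card_of (DTs beta gamma N (fun x => h N x w) delta))%:R])
        @[delta --> (0 : R)^'+] --> 0%E,
      forall delta : R, 0 < delta < 1 ->
        P N [set w | epsilon * kappa gamma N <
          (card_of (T beta gamma N (fun x => h N x w) delta `\`
                    IT beta gamma N (fun x => h N x w) delta))%:R]
        @[N --> \oo] --> 0%E
    & forall delta : R, 0 < delta < 1 ->
        limn_esup (fun N : nat =>
          P N [set w | epsilon * kappa gamma N <
            (card_of (WTs beta gamma N (fun x => h N x w) delta r))%:R])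
        @[r --> +oo] --> 0%E].
Proof.
split.
- apply: small_cvge => [de|e e0]; first by apply: limn_esup_ge0 => N; exact: measure_ge0.
  have [M M0 hM] := stmt1_eventually hS hh hbeta hgamma0 hepsilon e0.
  near=> de; have [|A hA] := hM de.
    by apply/andP; split; [near: de; exact: nbhs_right_gt|near: de; exact: nbhs_right_lt].
  by apply: limn_esup_le; apply: filterS (lnln_infty A) => N; exact: hA.
- move=> de de01; apply: small_cvge => [N|e e0]; first exact: measure_ge0.
  have [A hA] := stmt2_eventually hS hh hbeta hgamma0 hgamma1 hepsilon de01 e0.
  by apply: filterS (lnln_infty A) => N; exact: hA.
- move=> de de01; apply: small_cvge => [r|e e0]; first by apply: limn_esup_ge0 => N; exact: measure_ge0.
  have [M hM] := stmt3_eventually hS hh hbeta hgamma0 hgamma1 hepsilon de01 e0.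
  near=> r; have [|A hA] := hM r; first by near: r; apply: nbhs_pinfty_ge; exact: num_real.
  by apply: limn_esup_le; apply: filterS (lnln_infty A) => N; exact: hA.
Unshelve. all: by end_near.
Qed.
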